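(* Let $G=\mathrm{PGL}_2$, let $C$ be a special nilpotent extension of length $2$ of a smooth proper curve $\overline C$ over a finite field $k$ of characteristic $\ne2$, and let $K\subset G(\mathbb A)$ be an open compact subgroup with image $\overline K\subset G(\overline{\mathbb A})$. One has a direct sum decomposition preserved by the Hecke algebra $\mathcal H_K$, $$V(C,K)=V(\overline C,\overline K)\oplus V(C,K)_n\oplus V^1(C,K),$$ where $V^1(C,K)\subset V(C,K)$ is the space of strongly cuspidal functions and $V(C,K)_n=\bigoplus_{\alpha\ne0}\widetilde{\mathcal S}_{\eta_0,\chi_\alpha}^K$, $\alpha$ running over nonzero elements of $\omega_{\overline C}(\overline F)$.
   Context: $C$ is a scheme of finite type with reduced scheme $\overline C$ whose nilradical $L=\mathcal N$ satisfies $\mathcal N^2=0$ and is a line bundle on $\overline C$. $F$ is the stalk of $\mathcal O_C$ at the general point, $\overline F=k(\overline C)$; for a closed point $p$, $\mathcal O_p$ is the completed local ring of $C$ at $p$, $F_p$ its total ring of fractions; $\mathbb A$ is the restricted product of the $F_p$ with respect to the $\mathcal O_p$; $\overline{\mathbb A}$ is the adele ring of $\overline C$, the quotient of $\mathbb A$ by its nilradical $\mathcal N\mathbb A$; $\mathcal N_F$ is the nilradical of $F$. For a line bundle $M$ on $\overline C$, $M(\overline{\mathbb A})$ and $M(\overline F)$ denote adelic and rational sections. Let $U\subset G$ be the unipotent upper triangular subgroup, $U(\mathcal N\mathbb A)=\ker(U(\mathbb A)\to U(\overline{\mathbb A}))$, $U(\mathcal N_F)=\ker(U(F)\to U(\overline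 F))$. $V(C,K)$ is the space of cuspidal functions on $\mathrm{Bun}_{\mathrm{PGL}_2}(C,K)=G(F)\backslash G(\mathbb A)/K$, i.e. functions $f$ with $\int_{U(F)\backslash U(\mathbb A)}f(ug)du=0$ for all $g$; $V^1(C,K)$ is the subspace of $f$ with $\int_{U(\mathcal N_F)\backslash U(\mathcal N\mathbb A)}f(ug)du=0$ for all $g$. $V(\overline C,\overline K)$ is the space of cuspidal functions on $G(\overline F)\backslash G(\overline{\mathbb A})/\overline K$, viewed in $V(C,K)$ by pull-back. $\mathcal H_K$ is the convolution algebra of compactly supported $K$-biinvariant measures on $G(\mathbb A)$, acting by $(h*f)(g)=\int f(gx)dh(x)$. Let $N_{\mathbb A}=\ker(G(\mathbb A)\to G(\overline{\mathbb A}))\simeq\mathfrak g\otimes L(\overline{\mathbb A})$. Fix a nontrivial character $\psi$ of $k$ and let $\psi_{\overline C}(\beta)=\psi(\sum_p\mathrm{Res}_p\beta)$ on $\omega_{\overline C}(\overline{\mathbb A})/\omega_{\overline C}(\overline F)$ (residues traced down to $k$). $\mathfrak g^\vee\simeq\mathfrak g$ by the Killing form. Let $\eta_0=\begin{pmatrix}0&\alpha_0\\0&0\end{pmatrix}\in\mathfrak g\otimes L^{-1}\omega_{\overline C}(\overline F)$ with a fixed nonzero $\alpha_0$, $\psi_{\eta_0}(u)=\psi_{\overline C}(\langle\eta_0,u\rangle)$ for $u\in N_{\mathbb A}$; the stabilizer of $\eta_0$ in $G(\mathbb A)$ is $\mathrm{St}_{\eta_0}=N_{\mathbb A}U(\mathbb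 A)$. For $\alpha\in\omega_{\overline C}(\overline F)$, $\chi_\alpha(x)=\psi_{\overline C}(x\alpha)$ on $U(\overline{\mathbb A})/U(\overline F)=\overline{\mathbb A}/\overline F$. $\widetilde{\mathcal S}_{\eta_0,\chi_\alpha}$ is the space of smooth functions $f$ on $G(\mathbb A)$ with $f(nug)=\psi_{\eta_0}(n)\chi_\alpha(\overline u)f(g)$ for $n\in N_{\mathbb A}$, $u\in U(\mathbb A)$, with support compact modulo left shifts by $\mathrm{St}_{\eta_0}$, with $G(\mathbb A)$ acting by right translation; it is embedded in functions on $G(F)\backslash G(\mathbb A)$ by $f\mapsto\sum_{\gamma\in(\mathrm{St}_{\eta_0}\cap G(F))\backslash G(F)}f(\gamma g)$. *)

(* Defs.v *)
From HB Require Import structures.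
From mathcomp Require Import all_boot all_order all_algebra all_fingroup.
From mathcomp Require Import generic_quotient complex.
From mathcomp Require Import all_classical all_reals topology.

Set Implicit Arguments.
Unset Strict Implicit.
Unset Printing Implicit Defensive.

Import GRing.Theory.

Local Open Scope classical_set_scope.
Local Open Scope quotient_scope.
Local Open Scope ring_scope.

Section Sets.
Variable R : comNzRingType.

Definition is_subring (A : set R) : Prop :=
  [/\ A 1, forall x y, A x -> A y -> A (x - y)
    & forall x y, A x -> A y -> A (x * y)].

Definition subring_gen (s : seq R) : set R :=
  [set x | forall B, is_subring B -> (forall y, y \in s -> B y) -> B x].

Definition is_invertible (x : R) : Prop := exists y, x * y = 1.

(* The maximal ideal of a local ring [O], i.e. its set of non-units. *)
Definition maxid (O : set R) : set R :=
  [set x | O x /\ ~ exists y, O y /\ x * y = 1].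

Definition idealM (I J : set R) : set R :=
  [set z | exists2 s : seq (R * R),
     (forall u, u \in s -> I u.1 /\ J u.2) & z = \sum_(u <- s) u.1 * u.2].

Fixpoint maxid_pow (O : set R) (n : nat) : set R :=
  if n is n'.+1 then idealM (maxid O) (maxid_pow O n') else O.

End Sets.

(* [O] is a local subring of [F], with maximal ideal [m]. The predicate says
   that [Oh] is the [m]-adic completion of [O] and that [Fh] is the total ring
   of fractions of [Oh], the map [j : F -> Fh] inducing [O -> Oh]. *)
Record is_completion (F Fh : comNzRingType) (O : set F) (j : {rmorphism F -> Fh})
    (Oh : set Fh) : Prop := IsCompletion {
  compl_subring : is_subring Oh;
  compl_map : forall x, O x -> Oh (j x);
  compl_inj : forall n x, O x ->
    idealM (j @` maxid_pow O n) Oh (j x) -> maxid_pow O n x;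
  compl_dense : forall n x, Oh x ->
    exists2 y, O y & idealM (j @` maxid_pow O n) Oh (x - j y);
  compl_separated : forall x,
    (forall n, idealM (j @` maxid_pow O n) Oh x) -> x = 0;
  compl_complete : forall u : nat -> Fh, (forall n, Oh (u n)) ->
    (forall n, idealM (j @` maxid_pow O n) Oh (u n.+1 - u n)) ->
    exists2 x, Oh x & forall n, idealM (j @` maxid_pow O n) Oh (x - u n);
  compl_regular : forall s, Oh s -> (forall a, Oh a -> s * a = 0 -> a = 0) ->
    is_invertible s;
  compl_frac : forall x, exists a s,
    [/\ Oh a, Oh s, is_invertible s & x * s = a] }.

Record completions (I : Type) (F : comNzRingType) (O : I -> set F) := Completions {
  cring : I -> comNzRingType;
  cint : forall i, set (cring i);
  cmap : forall i, {rmorphism F -> cring i};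
  completionsP : forall i, is_completion (O i) (cmap i) (@cint i) }.

Arguments cring {I F O} M i : rename.
Arguments cint {I F O} M i : rename.
Arguments cmap {I F O} M i : rename.

Section Adele.
Context {I : Type} {F : comNzRingType} {O : I -> set F}.
Variable M : completions O.

Record adele := Adele {
  aval : forall i, cring M i;
  _ : finite_set [set i | ~ cint M i (aval i)] }.

Implicit Types x y z : adele.

Lemma aval_inj x y : (forall i, aval x i = aval y i) -> x = y.
Proof.
case: x y => [x Px] [y Py] /= xy.
have {}xy : x = y by apply: functional_extensionality_dep.
by subst y; rewrite (Prop_irrelevance Px Py).
Qed.

Lemma avalP x : finite_set [set i | ~ cint M i (aval x i)].
Proof. by case: x. Qed.

Let csub i (a b : cring M i) : cint M i a -> cint M i b -> cint M i (a - b).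
Proof. by have [_ + _] := compl_subring (completionsP M i); apply. Qed.

Let c1 i : cint M i 1.
Proof. by have [] := compl_subring (completionsP M i). Qed.

Let c0 i : cint M i 0.
Proof. by rewrite -(subrr 1); apply: csub. Qed.

Let copp i (a : cring M i) : cint M i a -> cint M i (- a).
Proof. by move=> ca; rewrite -[- a]add0r; apply: csub. Qed.

Let cadd i (a b : cring M i) : cint M i a -> cint M i b -> cint M i (a + b).
Proof. by move=> ca cb; rewrite -[b]opprK; apply/csub/copp. Qed.

Let cmul i (a b : cring M i) : cint M i a -> cint M i b -> cint M i (a * b).
Proof. by have [_ _ +] := compl_subring (completionsP M i); apply. Qed.

Let fin_int (a : forall i, cring M i) :
  (forall i, cint M i (a i)) -> finite_set [set i | ~ cint M i (a i)].
Proof.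
by move=> ca; apply: (sub_finite_set _ (@finite_set0 I)) => i /=; apply.
Qed.

Let fin_int2 x y (a : forall i, cring M i) :
  (forall i, cint M i (aval x i) -> cint M i (aval y i) -> cint M i (a i)) ->
  finite_set [set i | ~ cint M i (a i)].
Proof.
move=> ca; apply: (@sub_finite_set _ _
  ([set i | ~ cint M i (aval x i)] `|` [set i | ~ cint M i (aval y i)])).
  move=> i /= nca; have [cx|] := pselect (cint M i (aval x i)); last by left.
  by right => cy; apply/nca/ca.
by rewrite finite_setU; split; apply: avalP.
Qed.

Definition adele0 := Adele (fin_int c0).
Definition adele1 := Adele (fin_int c1).
Definition adeleD x y :=
  Adele (@fin_int2 x y (fun i => aval x i + aval y i) (fun i => @cadd i _ _)).
Definition adeleN x :=
  Adele (@fin_int2 x x (fun i => - aval x i) (fun i c _ => copp c)).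
Definition adeleM x y :=
  Adele (@fin_int2 x y (fun i => aval x i * aval y i) (fun i => @cmul i _ _)).

HB.instance Definition _ := gen_eqMixin adele.
HB.instance Definition _ := gen_choiceMixin adele.

Fact adele_addA : associative adeleD.
Proof. by move=> x y z; apply: aval_inj => i /=; rewrite addrA. Qed.
Fact adele_addC : commutative adeleD.
Proof. by move=> x y; apply: aval_inj => i /=; rewrite addrC. Qed.
Fact adele_add0 : left_id adele0 adeleD.
Proof. by move=> x; apply: aval_inj => i /=; rewrite add0r. Qed.
Fact adele_addN : left_inverse adele0 adeleN adeleD.
Proof. by move=> x; apply: aval_inj => i /=; rewrite addNr. Qed.
HB.instance Definition _ :=
  GRing.isZmodule.Build adele adele_addA adele_addC adele_add0 adele_addN.

Fact adele_mulA : associative adeleM.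
Proof. by move=> x y z; apply: aval_inj => i /=; rewrite mulrA. Qed.
Fact adele_mulC : commutative adeleM.
Proof. by move=> x y; apply: aval_inj => i /=; rewrite mulrC. Qed.
Fact adele_mul1 : left_id adele1 adeleM.
Proof. by move=> x; apply: aval_inj => i /=; rewrite mul1r. Qed.
Fact adele_mulD : left_distributive adeleM adeleD.
Proof. by move=> x y z; apply: aval_inj => i /=; rewrite mulrDl. Qed.
HB.instance Definition _ := GRing.Zmodule_isComPzRing.Build adele
  adele_mulA adele_mulC adele_mul1 adele_mulD.

HB.instance Definition _ := isPointed.Build adele 0.

Definition diagonal (x : F) (a : adele) : Prop :=
  forall i, aval a i = cmap M i x.

Definition principal : set adele := [set a | exists x : F, diagonal x a].

(* Exponents [n] with finite support index the basic neighbourhoods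
   [prod_i m_i^(n i)] of 0. *)
Definition congr0 (n : I -> nat) (a : adele) : Prop :=
  forall i, maxid_pow (cint M i) (n i) (aval a i).

Definition fin_supp (n : I -> nat) : Prop := finite_set [set i | n i != 0%N].

Definition adele_basis : set (set adele) :=
  [set U | exists a n, fin_supp n /\ U = [set b | congr0 n (b - a)]].

HB.instance Definition _ :=
  isSubBaseTopological.Build adele adele_basis id.

End Adele.

(* Elements of GL_2(R) are stored together with their inverse. On the rings
   considered here (local rings, adeles) PGL_2(R) = GL_2(R) / R^*. *)
Section PGL2.
Variable R : comPzRingType.

Definition gl2_pred (m : 'M[R]_2 * 'M[R]_2) : bool :=
  (m.1 *m m.2 == 1%:M) && (m.2 *m m.1 == 1%:M).

Definition GL2 := {m : 'M[R]_2 * 'M[R]_2 | gl2_pred m}.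

HB.instance Definition _ := Choice.on GL2.

Definition gmx (g : GL2) : 'M[R]_2 := (val g).1.
Definition gmxV (g : GL2) : 'M[R]_2 := (val g).2.

Lemma gmxK (g : GL2) : gmx g *m gmxV g = 1%:M.
Proof. by case/andP: (valP g) => /eqP. Qed.
Lemma gmxVK (g : GL2) : gmxV g *m gmx g = 1%:M.
Proof. by case/andP: (valP g) => _ /eqP. Qed.

Fact gl2_mulP (g h : GL2) : gl2_pred (gmx g *m gmx h, gmxV h *m gmxV g).
Proof.
rewrite /gl2_pred /= !mulmxA -(mulmxA (gmx g)) gmxK mulmx1 gmxK eqxx /=.
by rewrite -(mulmxA (gmxV h)) gmxVK mulmx1 gmxVK.
Qed.
Fact gl2_oneP : gl2_pred (1%:M, 1%:M).
Proof. by rewrite /gl2_pred /= mulmx1 eqxx. Qed.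
Fact gl2_invP (g : GL2) : gl2_pred (gmxV g, gmx g).
Proof. by rewrite /gl2_pred /= gmxK gmxVK eqxx. Qed.

Definition gl2_mul (g h : GL2) : GL2 := Sub _ (gl2_mulP g h).
Definition gl2_one : GL2 := Sub _ gl2_oneP.
Definition gl2_inv (g : GL2) : GL2 := Sub _ (gl2_invP g).

Definition proportional (g h : GL2) : bool :=
  `[< exists c d : R, c * d = 1 /\ gmx g = c *: gmx h >].

Fact proportional_equiv : equiv_class_of proportional.
Proof.
have sym g h : proportional g h -> proportional h g.
  move=> /asboolP[c [d [cd gh]]]; apply/asboolP; exists d, c.
  by rewrite gh mulrC cd scalerA mulrC cd scale1r.
split=> [g|g h|h g k].
- by apply/asboolP; exists 1, 1; rewrite mulr1 scale1r.
- by apply/idP/idP; apply: sym.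
- move=> /asboolP[c [d [cd gh]]] /asboolP[c' [d' [cd' hk]]].
  apply/asboolP; exists (c * c'), (d * d').
  by rewrite mulrACA cd cd' mulr1 -scalerA -hk.
Qed.
Canonical proportional_equivRel := EquivRelPack proportional_equiv.

Definition PGL2 : Type := {eq_quot proportional}.
HB.instance Definition _ := Choice.on PGL2.
HB.instance Definition _ := EqQuotient.on PGL2.

Definition pi_pgl (g : GL2) : PGL2 := \pi_PGL2 g.

Lemma pi_pglP (g h : GL2) : pi_pgl g = pi_pgl h <->
  exists c d : R, c * d = 1 /\ gmx g = c *: gmx h.
Proof.
rewrite /pi_pgl; split => [/eqmodP|gh]; first by move=> /= /asboolP.
by apply/eqmodP => /=; apply/asboolP.
Qed.

Lemma pi_pgl_repr (x : PGL2) : pi_pgl (repr x) = x.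
Proof. exact: reprK. Qed.

Definition pgl_mul (x y : PGL2) : PGL2 := pi_pgl (gl2_mul (repr x) (repr y)).
Definition pgl_one : PGL2 := pi_pgl gl2_one.
Definition pgl_inv (x : PGL2) : PGL2 := pi_pgl (gl2_inv (repr x)).

Lemma pi_pgl_mul (g h : GL2) : pi_pgl (gl2_mul g h) = pgl_mul (pi_pgl g) (pi_pgl h).
Proof.
apply/pi_pglP.
have /pi_pglP[c [d [cd e]]] := esym (pi_pgl_repr (pi_pgl g)).
have /pi_pglP[c' [d' [cd' e']]] := esym (pi_pgl_repr (pi_pgl h)).
exists (c * c'), (d * d'); rewrite mulrACA cd cd' mulr1; split=> //.
by rewrite /gmx /= -!/(gmx _) e e' -scalemxAl -scalemxAr scalerA.
Qed.

Fact pgl_mulA : associative pgl_mul.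
Proof.
move=> x y z; rewrite -(pi_pgl_repr x) -(pi_pgl_repr y) -(pi_pgl_repr z).
rewrite -!pi_pgl_mul; congr pi_pgl; apply: val_inj => /=.
by rewrite /gmx /gmxV /= !mulmxA.
Qed.
Fact pgl_mul1 : left_id pgl_one pgl_mul.
Proof.
move=> x; rewrite -(pi_pgl_repr x) -pi_pgl_mul; congr pi_pgl.
by apply: val_inj => /=; rewrite /gmx /gmxV /= mul1mx mulmx1; case: (val _).
Qed.
Fact pgl_mulx1 : right_id pgl_one pgl_mul.
Proof.
move=> x; rewrite -(pi_pgl_repr x) -pi_pgl_mul; congr pi_pgl.
by apply: val_inj => /=; rewrite /gmx /gmxV /= mul1mx mulmx1; case: (val _).
Qed.
Fact pgl_mulV : left_inverse pgl_one pgl_inv pgl_mul.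
Proof.
move=> x; rewrite -[X in pgl_mul _ X](pi_pgl_repr x) -pi_pgl_mul.
congr pi_pgl; apply: val_inj => /=.
by rewrite /gmx /gmxV /= -!/(gmx _) -!/(gmxV _) gmxVK.
Qed.
Fact pgl_mulxV : right_inverse pgl_one pgl_inv pgl_mul.
Proof.
move=> x; rewrite -[X in pgl_mul X _](pi_pgl_repr x) -pi_pgl_mul.
congr pi_pgl; apply: val_inj => /=.
by rewrite /gmx /gmxV /= -!/(gmx _) -!/(gmxV _) gmxK.
Qed.
HB.instance Definition _ := isGroup.Build PGL2
  pgl_mulA pgl_mul1 pgl_mulx1 pgl_mulV pgl_mulxV.

(* The class of a matrix; 1 if the matrix is not invertible. *)
Definition pgl (A : 'M[R]_2) : PGL2 :=
  if pselect (exists B, gl2_pred (A, B)) is left e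
  then pi_pgl (Sub _ (projT2 (cid e))) else 1%g.

Definition unip (x : R) : PGL2 := pgl (1%:M + x *: delta_mx ord0 ord_max).

End PGL2.

Fact gl2_mapP (R S : comPzRingType) (f : {rmorphism R -> S}) (g : GL2 R) :
  gl2_pred (map_mx f (gmx g), map_mx f (gmxV g)).
Proof. by rewrite /gl2_pred /= -!map_mxM gmxK gmxVK map_mx1 eqxx. Qed.

Definition pgl_map (R S : comPzRingType) (f : {rmorphism R -> S}) (x : PGL2 R) :
  PGL2 S := pi_pgl (Sub _ (gl2_mapP f (repr x))).

Definition is_subgroup (G : groupType) (K : set G) : Prop :=
  K 1%g /\ forall x y, K x -> K y -> K (x * y^-1)%g.

Section AdelicGroup.
Context {I : Type} {F : comNzRingType} {O : I -> set F}.
Variable M : completions O.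

Definition PGL2A : Type := PGL2 (adele M).
HB.instance Definition _ := Group.on PGL2A.
HB.instance Definition _ := isPointed.Build PGL2A 1%g.

Definition congr_subgroup (n : I -> nat) : set PGL2A :=
  [set x | exists2 g, x = pi_pgl g & forall i j,
     congr0 n ((gmx g - 1%:M) i j) /\ congr0 n ((gmxV g - 1%:M) i j)].

Definition PGL2A_basis : set (set PGL2A) :=
  [set U | exists g n, fin_supp n /\
     U = [set h : PGL2A | congr_subgroup n (g^-1 * h)%g]].

HB.instance Definition _ :=
  isSubBaseTopological.Build PGL2A PGL2A_basis id.

Definition PGL2_rat : set PGL2A :=
  [set x | exists (A : 'M[F]_2) (B : 'M[adele M]_2),
     [/\ (exists A', A *m A' = 1%:M), (forall i j, diagonal (A i j) (B i j))
       & x = pgl B]].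

Variable C : pzRingType.

(* The functions on [H / L], for [L] a subgroup of the adeles contained in the
   subgroup [H], that are locally constant on [H]. *)
Definition test_fun (H L : set (adele M)) (phi : adele M -> C) : Prop :=
  (forall l x, L l -> H x -> phi (l + x) = phi x) /\
  (forall x, H x -> \forall y \near x, H y -> phi y = phi x).

(* Integration against the Haar probability measure of the compact group
   [H / L], as an invariant linear functional on locally constant functions. *)
Record is_haar (H L : set (adele M)) (J : (adele M -> C) -> C) : Prop := IsHaar {
  haar_ext : forall phi1 phi2, test_fun H L phi1 -> test_fun H L phi2 ->
    (forall x, H x -> phi1 x = phi2 x) -> J phi1 = J phi2;
  haar_lin : forall c phi1 phi2, test_fun H L phi1 -> test_fun H L phi2 ->
    J (fun x => c * phi1 x + phi2 x) = c * J phi1 + J phi2;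
  haar_inv : forall h phi, H h -> test_fun H L phi ->
    J (fun x => phi (h + x)) = J phi;
  haar_one : J (fun=> 1) = 1 }.

Definition haar_int (H L : set (adele M)) : (adele M -> C) -> C :=
  xget (fun=> 0) [set J | is_haar H L J].

Definition Bun_fun (K : set PGL2A) : set (PGL2A -> C) :=
  [set f | (forall x g, PGL2_rat x -> f (x * g)%g = f g) /\
           (forall g k, K k -> f (g * k)%g = f g)].

Definition cuspidal (K : set PGL2A) : set (PGL2A -> C) :=
  [set f | Bun_fun K f /\
     forall g, haar_int setT (@principal _ _ _ M)
                 (fun u => f (unip u * g)%g) = 0].

Definition locally_constant (phi : PGL2A -> C) : Prop :=
  forall x, \forall y \near x, phi y = phi x.

Definition smooth (f : PGL2A -> C) : Prop :=
  exists K : set PGL2A, [/\ is_subgroup K, open K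
    & forall g k, K k -> f (g * k)%g = f g].

(* The compactly supported [K]-biinvariant measures on the totally
   disconnected group [PGL2A], as linear functionals [phi |-> \int phi dh] on
   locally constant functions. *)
Record hecke (K : set PGL2A) (h : (PGL2A -> C) -> C) : Prop := Hecke {
  hecke_lin : forall c phi1 phi2,
    locally_constant phi1 -> locally_constant phi2 ->
    h (fun x => c * phi1 x + phi2 x) = c * h phi1 + h phi2;
  hecke_supp : exists2 S : set PGL2A, compact S &
    forall phi, locally_constant phi -> (forall x, S x -> phi x = 0) -> h phi = 0;
  hecke_left : forall k phi, K k -> locally_constant phi ->
    h (fun x => phi (k * x)%g) = h phi;
  hecke_right : forall k phi, K k -> locally_constant phi ->
    h (fun x => phi (x * k)%g) = h phi }.

Definition hecke_act (h : (PGL2A -> C) -> C) (f : PGL2A -> C) : PGL2A -> C :=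
  fun g => h (fun x => f (g * x)%g).

End AdelicGroup.

Section Curve.
Variables (k : finFieldType) (E : fieldType) (iota : {rmorphism k -> E}).

(* [E] is finite over [k(t)] for some [t] transcendental over [k]. *)
Definition is_function_field : Prop :=
  exists t : E, (forall P : {poly k}, (map_poly iota P).[t] = 0 -> P = 0) /\
  exists (n : nat) (b : 'I_n -> E), forall x, exists (Q : {poly k})
    (P : 'I_n -> {poly k}), Q != 0 /\
    x * (map_poly iota Q).[t] = \sum_i (map_poly iota (P i)).[t] * b i.

Record is_valuation_ring (A : set E) : Prop := IsValuationRing {
  vr_const : forall a, A (iota a);
  vr_subring : is_subring A;
  vr_total : forall x, A x \/ A x^-1;
  vr_proper : A <> setT }.

(* The closed points of the smooth proper curve with function field [E], given
   by their local rings. *)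
Record place := Place {
  place_ring : set E;
  place_ringP : is_valuation_ring place_ring }.

HB.instance Definition _ := gen_eqMixin place.
HB.instance Definition _ := gen_choiceMixin place.

(* A scheme of finite type over Z whose reduction is the smooth proper curve with
   function field [E], with nilradical of square zero and a line bundle on the
   reduction. As its nilradical is torsion free, such a scheme is determined by
   its stalk [sF] at the general point together with its local rings
   [sO p], included in [sF], at the closed points; [sred] is the reduction. *)
Record special_extension := SpecialExtension {
  sF : comNzRingType;
  sred : {rmorphism sF -> E};
  sO : place -> set sF;
  sred_surj : forall x, exists y, sred y = x;
  snil_sq0 : forall x y, sred x = 0 -> sred y = 0 -> x * y = 0;
  (* the nilradical is a line bundle: at the general point, *)
  snil_gen : exists n, [/\ sred n = 0, n != 0
    & forall x, sred x = 0 -> exists a, x = a * n];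
  (* and at the closed points *)
  snil_loc : forall p, exists n, [/\ sred n = 0, n != 0, sO p n
    & forall x, sred x = 0 -> sO p x -> exists2 a, sO p a & x = a * n];
  sO_subring : forall p, is_subring (sO p);
  sO_red : forall p, sred @` sO p = place_ring p;
  (* every closed point has an affine open neighbourhood, the spectrum of a
     finitely generated ring [A], of which the [sO q] are localizations *)
  sO_chart : forall p, exists (s : seq sF) (Z : set place),
    [/\ finite_set Z, ~ Z p & forall q, ~ Z q -> sO q =
      [set x | exists a b, [/\ subring_gen s a, subring_gen s b, sred b != 0,
         place_ring q (sred b) /\ place_ring q (sred b)^-1 & x * b = a]]] }.

Arguments sred {_}.

(* By [ared_map] and [ared_int], [ared_loc p] is the map induced by [sred] on
   the total rings of fractions of the completed local rings. *)
Record adelic_data (X : special_extension) := AdelicData {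
  aM : completions (@sO X);
  aMbar : completions place_ring;
  ared_loc : forall p, {rmorphism cring aM p -> cring aMbar p};
  ared_int : forall p x, cint aM p x -> cint aMbar p (ared_loc p x);
  ared_map : forall p x, ared_loc p (cmap aM p x) = cmap aMbar p (sred x) }.

Section Reduction.
Context {X : special_extension}.
Variable D : adelic_data X.

Fact ared_subproof (x : adele (aM D)) :
  finite_set [set p | ~ cint (aMbar D) p (ared_loc D p (aval x p))].
Proof.
apply: sub_finite_set (avalP x) => p /=.
by apply: contra_not; apply: ared_int.
Qed.

Definition ared (x : adele (aM D)) : adele (aMbar D) := Adele (ared_subproof x).

Fact ared_is_zmod_morphism : zmod_morphism ared.
Proof. by move=> x y; apply: aval_inj => p /=; rewrite rmorphB. Qed.
Fact ared_is_monoid_morphism : monoid_morphism ared.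
Proof.
split=> [|x y]; apply: aval_inj => p /=; first by rewrite rmorph1.
by rewrite rmorphM.
Qed.
HB.instance Definition _ := GRing.isZmodMorphism.Build _ _ ared
  ared_is_zmod_morphism.
HB.instance Definition _ := GRing.isMonoidMorphism.Build _ _ ared
  ared_is_monoid_morphism.

Definition gred (g : PGL2A (aM D)) : PGL2A (aMbar D) := pgl_map ared g.

Definition nilA : set (adele (aM D)) := [set x | ared x = 0].
Definition nilF : set (adele (aM D)) := nilA `&` @principal _ _ _ (aM D).

Definition NA : set (PGL2A (aM D)) := [set g | gred g = 1%g].

Definition UA : set (PGL2A (aM D)) := range (@unip (adele (aM D))).

Definition St : set (PGL2A (aM D)) :=
  [set g | exists n u, [/\ NA n, UA u & g = (n * u)%g]].

End Reduction.

Definition is_derivation (V : lmodType E) (d : E -> V) : Prop :=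
  [/\ forall x y, d (x + y) = d x + d y,
      forall x y, d (x * y) = x *: d y + y *: d x
    & forall a, d (iota a) = 0].

(* [(Om, d)] is the module of Kaehler differentials of [E] over [k]. *)
Definition is_kaehler (Om : lmodType E) (d : E -> Om) : Prop :=
  is_derivation d /\
  forall (V : lmodType E) (e : E -> V), is_derivation e ->
    exists l : {linear Om -> V}, (forall x, l (d x) = e x) /\
      forall l' : {linear Om -> V}, (forall x, l' (d x) = e x) -> l' =1 l.

Definition is_uniformizer (p : place) (t : E) : Prop :=
  forall x, maxid (place_ring p) x <-> exists2 y, place_ring p y & x = t * y.

Section Residue.
Variable Mbar : completions place_ring.

(* The coefficient field of the completion at [p]: the elements algebraic over
   the finite field [k]; it maps isomorphically to the residue field. *)
Definition coef_field (p : place) : set (cring Mbar p) :=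
  [set a | exists2 m : nat, (0 < m)%N & a ^+ (#|k| ^ m) = a].

Definition is_residue_degree (p : place) (m : nat) : Prop :=
  [/\ (0 < m)%N, forall a, @coef_field p a -> a ^+ (#|k| ^ m) = a
    & forall m', (0 < m')%N ->
        (forall a, @coef_field p a -> a ^+ (#|k| ^ m') = a) -> (m <= m')%N].

Variables (Om : lmodType E) (d : E -> Om).

(* [r] is the trace to [k] of the residue at [p] of the form [x * alpha]: if
   [alpha = h dt] and [x * h] has polar part [\sum_i a_i t^-(i+1)], the
   residue is [a_0], and its trace is the sum of its Frobenius conjugates. *)
Definition is_residue (p : place) (x : cring Mbar p) (alpha : Om) (r : k) : Prop :=
  exists (t h : E) (m n : nat) (a : nat -> cring Mbar p),
    [/\ is_uniformizer p t, alpha = h *: d t, is_residue_degree p m,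
        (forall i, @coef_field p (a i)) /\
        cint Mbar p (x * cmap Mbar p h
          - \sum_(i < n.+1) a i * cmap Mbar p t^-1 ^+ i.+1)
      & cmap Mbar p (iota r) = \sum_(j < m) a 0%N ^+ (#|k| ^ j)].

Definition residue (p : place) (x : cring Mbar p) (alpha : Om) : k :=
  xget 0 [set r | is_residue x alpha r].

Variables (C : pzRingType) (psi : k -> C).

(* [psi_Cbar (x alpha)]; for fixed [alpha] this is [chi_alpha x]. *)
Definition psi_curve (x : adele Mbar) (alpha : Om) : C :=
  psi (\sum_(p \in [set: place]) residue (aval x p) alpha).

End Residue.

Section Summands.
Context {X : special_extension}.
Variables (D : adelic_data X) (Om : lmodType E) (d : E -> Om).
Variables (C : pzRingType) (psi : k -> C) (alpha0 : sF X -> Om).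

(* [alpha0], of which only the values on the nilradical of [sF X] matter, is
   a rational section of L^-1 omega, that is an [E]-linear map to [Om]. *)
Definition is_Linv_omega : Prop :=
  (forall x y, sred x = 0 -> sred y = 0 -> alpha0 (x + y) = alpha0 x + alpha0 y) /\
  (forall a x, sred x = 0 -> alpha0 (a * x) = sred a *: alpha0 x).

(* [psi_eta0 n] for [n] the class of [1 + Y], with [Y] nilpotent. The Killing
   form of sl_2 being 4 tr(AB), one has [<eta0, Y> = 4 alpha0 Y_21], with
   [Y_21 = x l], for [x] an adele and [l] a rational section of L. *)
Definition psi_eta0 (n : PGL2A (aM D)) : C :=
  xget 1 [set c | exists (Y : 'M[adele (aM D)]_2) (x y : adele (aM D)) (l : sF X),
    [/\ forall i j, nilA (Y i j), n = pgl (1%:M + Y), sred l = 0,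
        diagonal l y /\ Y ord_max ord0 = x * y
      & c = psi_curve d psi (4%:R * ared x) (alpha0 l)]].

Definition St_equivariant (alpha : Om) (f : PGL2A (aM D) -> C) : Prop :=
  forall n u g, NA n ->
    f (n * unip u * g)%g = psi_eta0 n * psi_curve d psi (ared u) alpha * f g.

Definition Stilde (alpha : Om) : set (PGL2A (aM D) -> C) :=
  [set f | [/\ smooth f, St_equivariant alpha f
    & exists2 W : set (PGL2A (aM D)), compact W & forall g, f g != 0 ->
        exists s w, [/\ St s, W w & g = (s * w)%g]]].

Definition Stilde_inv (K : set (PGL2A (aM D))) (alpha : Om) :
    set (PGL2A (aM D) -> C) :=
  [set f | Stilde alpha f /\ forall g x, K x -> f (g * x)%g = f g].

(* (St \cap G(F)) \ G(F) *)
Definition St_cosets : set (set (PGL2A (aM D))) :=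
  [set Y | exists2 x, PGL2_rat x &
     Y = [set (s * x)%g | s in @St X D `&` @PGL2_rat _ _ _ (aM D)]].

Definition embed (f : PGL2A (aM D) -> C) : PGL2A (aM D) -> C :=
  fun g => \sum_(Y \in St_cosets) f (xget 1%g Y * g)%g.

Definition V (K : set (PGL2A (aM D))) : set (PGL2A (aM D) -> C) := cuspidal K.

Definition Vbar (K : set (PGL2A (aM D))) : set (PGL2A (aM D) -> C) :=
  [set f | exists2 fb : PGL2A (aMbar D) -> C, cuspidal (@gred X D @` K) fb
       & f = fb \o @gred X D].

Definition V1 (K : set (PGL2A (aM D))) : set (PGL2A (aM D) -> C) :=
  [set f | V K f /\
     forall g, haar_int (@nilA X D) (@nilF X D) (fun u => f (unip u * g)%g) = 0].

Definition Stilde_family (K : set (PGL2A (aM D))) (s : seq Om)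
    (phi : Om -> PGL2A (aM D) -> C) : Prop :=
  [/\ uniq s, 0 \notin s & forall alpha, alpha \in s -> Stilde_inv K alpha (phi alpha)].

Definition Vn (K : set (PGL2A (aM D))) : set (PGL2A (aM D) -> C) :=
  [set f | exists s phi, Stilde_family K s phi /\
     f = \sum_(alpha <- s) embed (phi alpha)].

End Summands.

End Curve.

Arguments sred {k E iota X} : rename.

Definition direct_sum3 (T : Type) (C : pzRingType) (W W0 W1 W2 : set (T -> C)) :
    Prop :=
  (forall f, W f <-> exists f0 f1 f2,
     [/\ W0 f0, W1 f1, W2 f2 & f = f0 + f1 + f2]) /\
  (forall f0 f1 f2 f0' f1' f2', W0 f0 -> W1 f1 -> W2 f2 ->
     W0 f0' -> W1 f1' -> W2 f2' -> f0 + f1 + f2 = f0' + f1' + f2' ->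
     [/\ f0 = f0', f1 = f1' & f2 = f2']).

Definition nontrivial_character (k : finFieldType) (C : pzRingType) (psi : k -> C) :=
  [/\ psi 0 = 1, forall x y, psi (x + y) = psi x * psi y & exists x, psi x != 1].

(* Main.v *)
(* By residue duality (Tate's residues, Weil's differentials) a function on
 G(F)\G(A) expands along N_A = g (x) L(Abar) into coefficients indexed by the
 matrices Q over Fbar. The coefficient at 0 is a function on G(Abar). The nilpotent
 nonzero Q are G(F)-conjugate to eta_0; the coefficient at eta_0 expands along
 U(Abar)/U(Fbar) into the chi_alpha: alpha = 0 is excluded by cuspidality, and
 alpha <> 0 yields the summands of V_n. What is left is strongly cuspidal. *)
From HB Require Import structures.
From mathcomp Require Import all_boot all_order all_algebra all_fingroup all_solvable all_field complex.
From mathcomp Require Import all_classical all_reals topology.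
From mathcomp Require Import ring lra zify.
Require Import Defs.

Set Implicit Arguments.
Unset Strict Implicit.
Unset Printing Implicit Defensive.
Import Order.TTheory GRing.Theory Num.Theory.
Local Open Scope classical_set_scope.
Local Open Scope ring_scope.

(** Integrals are [xget] choices among invariant functionals, so their values must first be pinned
    down: a locally constant function on a compact quotient has a finite average of translates that
    is constant, and every invariant functional must take that value. Residues are [xget] choices as
    well; Tate's trace of a commutator shows that they are well defined and sum to zero. Duality
    (the elements of E give enough characters of the adeles modulo E) comes from counting
    functionals over the finite field k, in place of Riemann-Roch. On the nonreduced curve the
    obstacle is that one generic generator of the nilradical must generate it integrally at almost
    all places; finite type of a chart gives this, and multiplication by the generator identifies
    N_A with matrices over the reduced adeles modulo scalars. Characteristic not 2 enters above all
    where an upper unipotent u conjugates a lower nilpotent matrix with entry b: the diagonal term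
    2bu lets cuspidality kill the coefficients at triangular, non-nilpotent Q. The harmonic analysis
    is carried out for an abstract group satisfying a few relations, so that no adelic matrix is
    unfolded there. *)

Local Notation o0 := ord0.
Local Notation o1 := ord_max.
Local Notation gl2 := gl2_pred.
Local Notation csub := congr_subgroup.
Local Notation pring := place_ring.
Local Notation dl01 := (delta_mx o0 o1).

(** * Traces of finite-rank operators on spaces of any dimension *)

Section FiniteRankTrace.
Variables (k : fieldType) (V : lmodType k).
Implicit Types (S T : V -> V).

Definition lfun (f : V -> k) := forall a x y, f (a *: x + y) = a * f x + f y.
Definition lop T := forall a x y, T (a *: x + y) = a *: T x + T y.
Lemma lfunD f (lf : lfun f) x y : f (x + y) = f x + f y.
by have := lf 1 x y; rewrite scale1r mul1r. Qed.
Lemma lfun0 f (lf : lfun f) : f 0 = 0.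
by apply: (addrI (f 0)); rewrite -(lfunD lf) !addr0. Qed.
Lemma lfunZ f (lf : lfun f) a x : f (a *: x) = a * f x.
by have := lf a x 0; rewrite !addr0 (lfun0 lf) addr0. Qed.
Lemma lfunN f (lf : lfun f) x : f (- x) = - f x.
by rewrite -scaleN1r (lfunZ lf) mulN1r. Qed.
Lemma lfunB f (lf : lfun f) x y : f (x - y) = f x - f y.
by rewrite (lfunD lf) (lfunN lf). Qed.
Lemma lfun_sum f (lf : lfun f) I (r : seq I) P (F : I -> V) :
 f (\sum_(i <- r | P i) F i) = \sum_(i <- r | P i) f (F i).
exact: (big_morph f (lfunD lf) (lfun0 lf)). Qed.
Lemma lopD T (lT : lop T) x y : T (x + y) = T x + T y.
by have := lT 1 x y; rewrite !scale1r. Qed.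
Lemma lop0 T (lT : lop T) : T 0 = 0.
by apply: (addrI (T 0)); rewrite -(lopD lT) !addr0. Qed.
Lemma lopZ T (lT : lop T) a x : T (a *: x) = a *: T x.
by have := lT a x 0; rewrite !addr0 (lop0 lT) addr0. Qed.
Lemma lopN T (lT : lop T) x : T (- x) = - T x.
by rewrite -scaleN1r (lopZ lT) scaleN1r. Qed.
Lemma lopB T (lT : lop T) x y : T (x - y) = T x - T y.
by rewrite (lopD lT) (lopN lT). Qed.
Lemma lop_sum T (lT : lop T) I (r : seq I) P (F : I -> V) :
 T (\sum_(i <- r | P i) F i) = \sum_(i <- r | P i) T (F i).
exact: (big_morph T (lopD lT) (lop0 lT)). Qed.
Lemma lop_comp S T : lop S -> lop T -> lop (S \o T).
by move=> lS lT a x y /=; rewrite lT lS. Qed.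
Lemma lop_sub S T : lop S -> lop T -> lop (fun x => S x - T x).
by move=> lS lT a x y; rewrite lT lS opprD scalerBr addrACA.
Qed.
Lemma lfun_comp f T : lfun f -> lop T -> lfun (f \o T).
by move=> lf lT a x y /=; rewrite lT lf. Qed.

(** Induction on the number of terms, without bases: if [phi o0] is nonzero at some [x0], the
    relation at [x0] expresses [v o0] through the other vectors, and absorbing [phi o0] into the
    other functionals gives a shorter null sum with the same trace. This is what makes the trace
    independent of the presentation. *)
Lemma trace_zero n (phi : 'I_n -> V -> k) (v : 'I_n -> V) :
 (forall i, lfun (phi i)) -> (forall x, \sum_i phi i x *: v i = 0) ->
 \sum_i phi i (v i) = 0.
elim: n phi v => [|n IH] phi v lphi z; first by rewrite big_ord0.
have {}z x : phi o0 x *: v o0 +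
  \sum_(i < n) phi (lift o0 i) x *: v (lift o0 i) = 0.
 by rewrite -[RHS](z x) big_ord_recl.
rewrite big_ord_recl.
have [[x0 nz]|phi0] := pselect (exists x, phi o0 x != 0); last first.
 have {}phi0 x : phi o0 x = 0.
  by apply/eqP; apply: contra_notT phi0 => ?; exists x.
 rewrite phi0 add0r; apply: (IH (fun i => phi (lift o0 i))) => // x.
 by have := z x; rewrite phi0 scale0r add0r.
pose c i := phi (lift o0 i) x0 / phi o0 x0.
have v0 : v o0 = - \sum_(i < n) c i *: v (lift o0 i).
 have /eqP := z x0; rewrite addr_eq0 => /eqP e.
 rewrite -[LHS]scale1r -(mulVf nz) -scalerA e scalerN scaler_sumr.
 congr (- _); apply: eq_bigr => i _; by rewrite scalerA mulrC.
have := IH (fun i x => phi (lift o0 i) x - c i * phi o0 x)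
 (fun i => v (lift o0 i)).
have -> : \sum_i (phi (lift o0 i) (v (lift o0 i)) -
   c i * phi o0 (v (lift o0 i))) =
  phi o0 (v o0) + \sum_i phi (lift o0 i) (v (lift o0 i)).
 rewrite sumrB addrC; congr (_ + _); rewrite {1}v0.
 rewrite (lfunN (lphi _)) (lfun_sum (lphi _)); congr (- _).
 by apply: eq_bigr => i _; rewrite (lfunZ (lphi _)).
apply=> [i a x y|x].
 by rewrite !lphi; ring.
transitivity (\sum_(i < n) phi (lift o0 i) x *: v (lift o0 i)
  + phi o0 x *: v o0); last by rewrite addrC.
rewrite v0 scalerN scaler_sumr -sumrN -big_split /=.
by apply: eq_bigr => i _ /=; rewrite scalerA mulrC -scalerBl.
Qed.

(* [T] is the finite sum of the rank one operators [phi i (-) *: v i], and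
  [c] is its trace. *)
Definition trop T (c : k) := exists (I : finType) (phi : I -> V -> k) (v : I -> V),
 [/\ forall i, lfun (phi i), forall x, T x = \sum_i phi i x *: v i
  & c = \sum_i phi i (v i)].

Lemma trop_ext S T c : S =1 T -> trop S c -> trop T c.
by move=> ST [I [p [v [lp e ->]]]]; exists I, p, v; split=> // x; rewrite -ST. Qed.

Lemma tropB S T c d : trop S c -> trop T d -> trop (fun x => S x - T x) (c - d).
move=> [I [p [v [lp e ->]]]] [J [q [w [lq e' ->]]]].
exists (I + J)%type, (fun ij => match ij with inl i => p i | inr j => q j end),
 (fun ij => match ij with inl i => v i | inr j => - w j end); split.
- by case.
- move=> x; rewrite big_sumType /= e e' -sumrN; congr (_ + _).
 by apply: eq_bigr => j _; rewrite scalerN.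
- rewrite big_sumType /= -sumrN; congr (_ + _).
 by apply: eq_bigr => j _; rewrite (lfunN (lq _)).
Qed.

Lemma trop0 : trop (fun=> 0) 0.
by exists void, (fun _ _ => 0), (fun=> 0); split=> [[]|x|]; rewrite big_pred0 // => -[].
Qed.

Lemma trop_uniq T c d : trop T c -> trop T d -> c = d.
move=> tc td; have [I [p [v [lp e z]]]] := tropB tc td.
apply/eqP; rewrite -subr_eq0 z; apply/eqP.
rewrite (reindex (@enum_val I predT)) /=; last by apply: onW_bij; apply: enum_val_bij.
apply: (@trace_zero #|I| (fun i => p (enum_val i)) (fun i => v (enum_val i))) => // x.
rewrite -[RHS](subrr (T x)) e (reindex (@enum_val I predT)) //=.
by apply: onW_bij; apply: enum_val_bij.
Qed.

Lemma tropD S T c d : trop S c -> trop T d -> trop (fun x => S x + T x) (c + d).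
move=> tS tT; have t := tropB trop0 tT.
apply: (@trop_ext (fun x => S x - (0 - T x))); last by rewrite -[d]opprK -[- d]add0r; apply: tropB.
by move=> x; rewrite sub0r opprK.
Qed.

Lemma tropZ T c a : trop T c -> trop (fun x => a *: T x) (a * c).
move=> [I [p [v [lp e ->]]]].
exists I, (fun i x => a * p i x), v; split=> //.
- by move=> i b x y; rewrite lp mulrDr !mulrA (mulrC a).
- by move=> x; rewrite e scaler_sumr; apply: eq_bigr => i _; rewrite scalerA.
- by rewrite mulr_sumr.
Qed.

(** One scalar serves both orders: if [S] is presented by functionals [p i] and vectors [v i],
    either composite has trace the sum of the [p i (T (v i))]. *)
Lemma trop_comp S T c : trop S c -> lop T ->
 exists d, trop (S \o T) d /\ trop (T \o S) d.
move=> [I [p [v [lp e _]]]] lT; exists (\sum_i p i (T (v i))); split.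
 exists I, (fun i => p i \o T), v; split=> // [i|x]; first exact: lfun_comp.
 by rewrite /= e.
exists I, p, (fun i => T (v i)); split=> // x.
by rewrite /= e (lop_sum lT); apply: eq_bigr => i _; rewrite (lopZ lT).
Qed.

Definition finrank T := exists c, trop T c.
Lemma finrankB S T : finrank S -> finrank T -> finrank (fun x => S x - T x).
by move=> [c tc] [d td]; exists (c - d); apply: tropB. Qed.
Lemma finrankD S T : finrank S -> finrank T -> finrank (fun x => S x + T x).
by move=> [c tc] [d td]; exists (c + d); apply: tropD. Qed.
Lemma finrank_compl S T : finrank S -> lop T -> finrank (S \o T).
by move=> [c tc] /(trop_comp tc)[d [? _]]; exists d. Qed.
Lemma finrank_compr S T : finrank S -> lop T -> finrank (T \o S).
by move=> [c tc] /(trop_comp tc)[d [_ ?]]; exists d. Qed.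
Lemma finrank_ext S T : S =1 T -> finrank S -> finrank T.
by move=> ST [c /(trop_ext ST)]; exists c. Qed.

Definition opcomm S T := fun x => S (T x) - T (S x).
Lemma trop_comm0 S T : finrank S -> lop T -> trop (opcomm S T) 0.
move=> [c tc] /(trop_comp tc)[d [t1 t2]].
by rewrite -(subrr d); apply: tropB t1 t2.
Qed.

(** Changing one factor by a finite-rank operator changes the commutator by a commutator with a
    finite-rank operator, whose trace is 0 by [trop_comm0]. *)
Lemma opcomm_perturb S S' T T' c :
 lop S -> lop S' -> lop T -> lop T' ->
 finrank (fun x => S' x - S x) -> finrank (fun x => T' x - T x) ->
 trop (opcomm S T) c -> trop (opcomm S' T') c.
move=> lS lS' lT lT' fS fT tc.
have t1 := trop_comm0 fS lT.
have t2 := trop_comm0 fT lS'.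
apply: (@trop_ext (fun x => (opcomm S T x + opcomm (fun x => S' x - S x) T x)
  - opcomm (fun x => T' x - T x) S' x)).
 have l1 A B C D : (C - A) - (D - B) = (C - D) - (A - B) :> V.
  by rewrite !opprD !opprK addrACA.
 move=> x; rewrite /opcomm (lopB lT) (lopB lS') l1 (addrC (S (T x) - T (S x))) subrK l1 opprB.
 rewrite (opprB (T _)) addrACA (addrC (S' (T x))) subrK (addrAC (T (S' x))).
 by rewrite subrr sub0r.
by rewrite -[c]addr0 -[c + 0]subr0; apply: tropB t2; apply: tropD.
Qed.
End FiniteRankTrace.

(** * Tate's abstract residue *)

Section Tate.
Variables (k : fieldType) (V : lmodType k).
Implicit Types (f g pi : V -> V).

(** The compression of [f] to the image of a projector [pi]. In the applications, compressions of
    commuting operators commute only up to finite rank, and the residue is the trace of this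
    defect. *)
Definition compr pi f := fun x => pi (f (pi x)).
Lemma lop_compr pi f : lop pi -> lop f -> lop (compr pi f).
by move=> lp lf a x y; rewrite /compr lp lf lp. Qed.

(** As [pi'] fixes the image of [pi], the inner [pi' \o pi] collapses when the mixed compressions
    [pi \o f \o pi'] are composed; these differ from [compr pi' f] by finite rank, so the trace of
    the commutator is kept. *)
Lemma tate_change pi pi' f g c : lop pi -> lop pi' -> lop f -> lop g ->
 (forall x, pi' (pi x) = pi x) ->
 finrank (fun x => pi (f (pi' x)) - compr pi' f x) ->
 finrank (fun x => pi (g (pi' x)) - compr pi' g x) ->
 trop (opcomm (compr pi' f) (compr pi' g)) c ->
 trop (fun x => pi (f (pi (g (pi' x)))) - pi (g (pi (f (pi' x))))) c.
move=> lp lp' lf lg pp ff fg tc.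
have lS h : lop h -> lop (fun x => pi (h (pi' x))).
 by move=> lh a x y; rewrite lp' lh lp.
have := opcomm_perturb (lop_compr lp' lf) (lS _ lf) (lop_compr lp' lg) (lS _ lg)
 ff fg tc.
by apply: trop_ext => x; rewrite /opcomm !pp.
Qed.

(* The residue theorem: [pi] is the projection along a linsub stable by [f]
  and [g]. *)
Lemma tate_vanish pi pi' f g c : lop pi -> lop pi' -> lop f -> lop g ->
 (forall x, f (g x) = g (f x)) ->
 (forall x, pi' (pi x) = pi x) ->
 (forall x, pi (f (pi x)) = pi (f x)) -> (forall x, pi (g (pi x)) = pi (g x)) ->
 finrank (fun x => pi (f (pi' x)) - compr pi' f x) ->
 finrank (fun x => pi (g (pi' x)) - compr pi' g x) ->
 trop (opcomm (compr pi' f) (compr pi' g)) c -> c = 0.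
move=> lp lp' lf lg fgC pp pf pg ff fg tc.
apply: trop_uniq (tate_change lp lp' lf lg pp ff fg tc) _.
(* Stability of the kernel of [pi] lets the inner [pi] be dropped; the commutator is then
   identically zero because [f] and [g] commute. *)
by apply: trop_ext (trop0 V) => x; rewrite pf pg fgC subrr.
Qed.

(** Here [pi] and [pi'] project onto the same subspace. The mixed commutator of [tate_change] is the
    [pi]-commutator composed with [pi'], and cyclicity of the trace moves [pi'] to the left, where
    it acts as the identity. *)
Lemma tate_indep pi pi' f g c c' : lop pi -> lop pi' -> lop f -> lop g ->
 (forall x, pi' (pi x) = pi x) -> (forall x, pi (pi' x) = pi' x) ->
 finrank (fun x => pi (f (pi' x)) - compr pi' f x) ->
 finrank (fun x => pi (g (pi' x)) - compr pi' g x) ->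
 trop (opcomm (compr pi' f) (compr pi' g)) c ->
 trop (opcomm (compr pi f) (compr pi g)) c' -> c = c'.
move=> lp lp' lf lg pp pp' ff fg tc tc'.
have t1 := tate_change lp lp' lf lg pp ff fg tc.
have [d [t2 t3]] := trop_comp tc' lp'.
have -> : c' = d.
 apply: trop_uniq tc' _; apply: trop_ext t3 => x /=.
 by rewrite /opcomm /compr (lopB lp') !pp.
apply: trop_uniq t1 _; apply: trop_ext t2 => x /=.
have ipp y : pi (pi y) = pi y by rewrite -[in LHS](pp y) pp' pp.
by rewrite /opcomm /compr !pp' !ipp.
Qed.
End Tate.

(** * Separating functionals and finite spans *)

Section Subspaces.
Variables (k : fieldType) (V : lmodType k).

Definition linsub (S : set V) := S 0 /\ forall a u v, S u -> S v -> S (a *: u + v).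
(** A subspace maximal among those containing [S] and avoiding [x] is a hyperplane complementary to
    [x]; [f] reads off the multiple of [x] modulo it. *)
Lemma separating_fun (S : set V) x : linsub S -> ~ S x ->
 exists f, [/\ lfun f, forall s, S s -> f s = 0 & f x = 1].
move=> subS nSx.
(* The sets [A] enter only through their union with [S], so that the empty chain, whose union is
   empty, also satisfies [P]. *)
pose P (A : set V) := linsub (S `|` A) /\ ~ (S `|` A) x.
have [F FP totF|A [[[M0 Mlin] nMx] Amax]] := @Zorn_bigcup _ P.
 have [[A0 FA0]|F0] := pselect (exists A, F A); last first.
  suff -> : \bigcup_(X in F) X = set0 by rewrite /P setU0.
  by apply/seteqP; split=> // y [A FA]; case: F0; exists A.
 have inF y : (S `|` \bigcup_(X in F) X) y -> exists2 A, F A & (S `|` A) y.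
  move=> [Sy|[A FA Ay]]; first by exists A0 => //; left.
  by exists A => //; right.
 have Fin A y : F A -> (S `|` A) y -> (S `|` \bigcup_(X in F) X) y.
  by move=> FA [Sy|Ay]; [left|right; exists A].
 split; last by move=> /inF[A FA]; exact: (FP _ FA).2.
 split=> [|a u v /inF[A FA Au] /inF[B FB Bv]]; first by left; case: subS.
 have [AB|BA] := totF _ _ FA FB.
  apply: (Fin B _ FB); apply: (FP _ FB).1.2 => //.
  by case: Au => [|/AB]; [left|right].
 apply: (Fin A _ FA); apply: (FP _ FA).1.2 => //.
 by case: Bv => [|/BA]; [left|right].
set M := S `|` A in M0 Mlin nMx.
have MZ a u : M u -> M (a *: u) by move=> Mu; rewrite -[_ *: _]addr0; apply: Mlin.
have MD u v : M u -> M v -> M (u + v) by rewrite -{2}[u]scale1r; apply: Mlin.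
(* Otherwise adjoining [v] to [M] would give a larger subspace still avoiding [x]: from
   [x = a *: v + m] with [a] nonzero, [v - a^-1 *: x] would lie in [M]. *)
have ex v : exists c, M (v - c *: x).
 apply: contrapT => nex.
 pose N : set V := [set y | exists a m, M m /\ y = a *: v + m].
 have MN : M `<=` N by move=> m Mm; exists 0, m; rewrite scale0r add0r.
 have Nv : N v by exists 1, 0; rewrite scale1r addr0.
 apply: (Amax N).
  split; first by move=> y Ay; apply: MN; right.
  move=> /(_ _ Nv) Av; apply: nex; exists 0; rewrite scale0r subr0; by right.
 have -> : P N = (linsub N /\ ~ N x).
  by rewrite /P; have -> : S `|` N = N by apply/setUidPr => y Sy; apply: MN; left.
 split.
  split=> [|a _ _ [b [m [Mm ->]]] [c [n [Mn ->]]]]; first exact: MN.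
  exists (a * b + c), (a *: m + n); split; first exact: Mlin.
  by rewrite scalerDr scalerA scalerDl addrACA.
 move=> [a [m [Mm xE]]]; have [a0|anz] := eqVneq a 0.
  by apply: nMx; rewrite xE a0 scale0r add0r.
 apply: nex; exists a^-1; rewrite {1}xE scalerDr scalerA mulVf // scale1r.
 by rewrite opprD addNKr -scaleN1r; apply/MZ/MZ.
pose f v := projT1 (cid (ex v)).
have fP v : M (v - f v *: x) by rewrite /f; case: cid.
have funi v c : M (v - c *: x) -> f v = c.
 move=> Mc; apply/eqP; rewrite -subr_eq0; apply: contra_notT nMx => nz.
 rewrite -[x]scale1r -(mulVf nz) -scalerA; apply: (MZ).
 have -> : (f v - c) *: x = (v - c *: x) - (v - f v *: x).
  by rewrite scalerBl opprB [RHS]addrC addrA subrK.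
 by apply: (MD) => //; rewrite -scaleN1r; apply: (MZ).
exists f; split.
- move=> a u v; apply: funi.
 have -> : a *: u + v - (a * f u + f v) *: x = a *: (u - f u *: x) + (v - f v *: x).
  by rewrite scalerBr scalerA scalerDl opprD addrACA.
 exact: Mlin.
- by move=> s Ss; apply: funi; rewrite scale0r subr0; left.
- by apply: funi; rewrite scale1r subrr.
Qed.

Fixpoint lspan (s : seq V) : set V :=
 if s is v :: s' then [set x | exists a, lspan s' (x - a *: v)] else [set 0].

Lemma lspan_linsub s : linsub (lspan s).
elim: s => [|v s [s0 sl]]; first by split=> // a u w /= -> ->; rewrite scaler0 addr0.
split=> [|a u w [b sb] [c sc]]; first by exists 0; rewrite scale0r subr0.
exists (a * b + c).
have -> : a *: u + w - (a * b + c) *: v = a *: (u - b *: v) + (w - c *: v).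
 by rewrite scalerBr scalerA scalerDl opprD addrACA.
exact: sl.
Qed.

Lemma mem_lspan s v : v \in s -> lspan s v.
elim: s => // u s IH; move=> /predU1P[->|/IH us].
 by exists 1; rewrite scale1r subrr; case: (lspan_linsub s).
by exists 0; rewrite scale0r subr0.
Qed.

Lemma lspan_sub s (S : set V) : linsub S -> (forall v, v \in s -> S v) ->
 lspan s `<=` S.
move=> [S0 Sl]; elim: s => [|v s IH] sS x /=; first by move=> ->.
move=> [a ax]; rewrite -[x](subrK (a *: v)) addrC; apply: Sl.
 by apply: sS; rewrite mem_head.
by apply: IH => // w ws; apply: sS; rewrite in_cons ws orbT.
Qed.

(** A new vector [v] is handled by adding to [P] the rank-one operator with vector [v - P v] and a
    functional that is 1 at [v] and 0 on the old span. *)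
Lemma lspan_projection s : exists P, [/\ lop P, finrank P,
 forall x, lspan s (P x) & forall x, lspan s x -> P x = x].
elim: s => [|v s [P [lP fP sP Ps]]].
 exists (fun=> 0); split=> [a x y||//|x ->//]; first by rewrite scaler0 addr0.
 by exists 0; apply: trop0.
have [sv|nsv] := pselect (lspan s v).
 have sub : lspan (v :: s) `<=` lspan s.
  apply: lspan_sub (lspan_linsub s) _ => w; rewrite in_cons => /orP[/eqP->//|].
  exact: mem_lspan.
 exists P; split=> // x; last by move=> /sub/Ps.
 by exists 0; rewrite scale0r subr0.
have [f [lf fs fv]] := separating_fun (lspan_linsub s) nsv.
have fr : finrank (fun x => f x *: (v - P v)).
 exists (f (v - P v)); exists unit, (fun=> f), (fun=> v - P v).
 by split=> // [x|]; rewrite (big_pred1 tt) // => -[].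
exists (fun x => P x + f x *: (v - P v)); split.
- by move=> a x y; rewrite lP lf scalerDl -scalerA (scalerDr a) addrACA.
- exact: finrankD.
- move=> x; exists (f x).
 rewrite scalerBr addrCA addrC addrK -scaleNr addrC.
 by apply: (lspan_linsub s).2.
- move=> x [a sx]; have := Ps _ sx; rewrite (lopB lP) (lopZ lP) => e.
 have -> : f x = a.
  have := fs _ sx; rewrite -scaleNr addrC lf fv mulr1 addrC => /eqP.
  by rewrite subr_eq0 => /eqP.
 rewrite scalerBr -[P x](subrK (a *: P v)) e.
 by rewrite -addrA [a *: P v + _]addrC subrK subrK.
Qed.
End Subspaces.

Lemma small_rank_kernel (k : fieldType) (N M : nat) (A : 'M[k]_(N, M)) :
 (M < N)%N -> exists2 c : 'rV[k]_N, c != 0 & c *m A = 0.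
move=> MN; have /rowV0Pn[c /sub_kermxP cA c0] : kermx A != 0.
 by rewrite -mxrank_eq0 mxrank_ker subn_eq0 -ltnNge (leq_ltn_trans (rank_leq_col A)).
by exists c.
Qed.

(** * Finite index, expressed by coverings with cosets *)

Section Covers.
Variable T : zmodType.
Implicit Types (S U : set T) (s : seq T).

Definition sgp U := U 0 /\ forall x y, U x -> U y -> U (x - y).
Lemma sgpN U x : sgp U -> U x -> U (- x).
by move=> [U0 UB] Ux; rewrite -sub0r; apply: UB. Qed.
Lemma sgpD U x y : sgp U -> U x -> U y -> U (x + y).
by move=> sU Ux Uy; rewrite -[y]opprK; apply: sU.2 => //; apply: sgpN. Qed.
Lemma sgpC U x y : sgp U -> U (x - y) -> U (y - x).
by move=> sU Uxy; rewrite -opprB; apply: sgpN. Qed.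

Definition sumset U U' : set T := [set z | exists x y, [/\ U x, U' y & z = x + y]].
Lemma sgp_sumset U U' : sgp U -> sgp U' -> sgp (sumset U U').
move=> sU sU'; split; first by exists 0, 0; rewrite addr0; split=> //; [apply: sU.1|apply: sU'.1].
move=> _ _ [x [y [Ux Uy ->]]] [x' [y' [Ux' Uy' ->]]].
exists (x - x'), (y - y'); rewrite opprD addrACA.
by split=> //; [apply: sU.2|apply: sU'.2].
Qed.

(** Finite index without forming a quotient: [S] need not be a subgroup, and [U] need not lie in
    [S]. *)
Definition covers s S U := forall x, S x -> exists2 y, y \in s & U (x - y).
Definition indep s U := uniq s /\ forall x y, x \in s -> y \in s -> U (x - y) -> x = y.
(** Pigeonhole on cosets: independent elements choose different representatives in [s']. *)
Lemma indep_le_cover s s' S U : sgp U -> indep s U ->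
 (forall x, x \in s -> S x) -> covers s' S U -> (size s <= size s')%N.
move=> sU [us si] sS cs'.
pose f x := xget 0 [set y | y \in s' /\ U (x - y)].
have fP x : x \in s -> f x \in s' /\ U (x - f x).
 by move=> /sS/cs'[y ys' Uy]; exact: (@xgetI _ 0 [set y | y \in s' /\ U (x - y)] y).
rewrite -(size_map f); apply: uniq_leq_size.
 rewrite map_inj_in_uniq // => x y xs ys fxy; apply: si => //.
 have [_ Ux] := fP _ xs; have [_ Uy] := fP _ ys.
 have -> : x - y = (x - f x) - (y - f y) by rewrite fxy opprB addrA subrK.
 exact: sU.2.
by move=> _ /mapP[x xs ->]; case: (fP _ xs).
Qed.

Lemma prune s U : sgp U -> exists s', [/\ {subset s' <= s}, indep s' U
 & forall x, x \in s -> exists2 y, y \in s' & U (x - y)].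
move=> sU; elim: s => [|x s [s' [ss' [us' is'] cs']]]; first by exists [::].
have [[y ys' Uxy]|nx] := pselect (exists2 y, y \in s' & U (x - y)).
 exists s'; split=> //.
  by move=> z /ss'; rewrite in_cons orbC => ->.
 by move=> z; move=> /predU1P[->|/cs' //]; exists y.
exists (x :: s'); split.
- by move=> z; rewrite !in_cons => /orP[->//|/ss' ->]; rewrite orbT.
- split.
  rewrite /= us' andbT; apply/negP => xs'; apply: nx; exists x => //.
  by rewrite subrr; apply: sU.1.
 move=> y z; rewrite !in_cons => /orP[/eqP ->|ys'] /orP[/eqP ->|zs'] //.
 + by move=> Uz; case: nx; exists z.
 + by move=> Uy; case: nx; exists y => //; apply: sgpC.
 + exact: is'.
- move=> z; move=> /predU1P[->|/cs'[y ys' Uy]].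
  by exists x; rewrite ?mem_head // subrr; apply: sU.1.
 by exists y => //; rewrite in_cons ys' orbT.
Qed.

(** A representative whose coset meets [S] is exchanged for a point of [S] in that coset, and the
    others are dropped; hence the list does not grow. *)
Lemma cover_in s S U : sgp U -> covers s S U ->
 exists s', [/\ forall x, x \in s' -> S x, (size s' <= size s)%N & covers s' S U].
move=> sU; elim: s S => [|y s IH] S cs.
 by exists [::]; split=> // x /cs[].
pose S' : set T := [set x | S x /\ ~ U (x - y)].
have [|s' [s'S sz cs']] := IH S'.
 move=> x [Sx nUx]; have [z] := cs x Sx; move=> /predU1P[->//|zs Uz].
 by exists z.
have [[x [Sx Ux]]|nx] := pselect (exists x, S x /\ U (x - y)); last first.
 exists s'; split; first by move=> x /s'S[].
  exact: leq_trans sz _.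
 move=> x Sx; apply: cs'; split=> // Ux; by apply: nx; exists x.
exists (x :: s'); split=> //.
 by move=> z; move=> /predU1P[->//|/s'S[]].
move=> z Sz; have [Uz|nUz] := pselect (U (z - y)).
 exists x; rewrite ?mem_head //.
 have -> : z - x = (z - y) - (x - y) by rewrite opprB addrA subrK.
 exact: sU.2.
have [|w ws' Uw] := cs' z; first by split.
by exists w => //; rewrite in_cons ws' orbT.
Qed.

Lemma transversal s S U : sgp U -> covers s S U ->
 exists s', [/\ forall x, x \in s' -> S x, (size s' <= size s)%N, indep s' U & covers s' S U].
move=> sU /(cover_in sU)[s1 [s1S sz1 cs1]].
have [s2 [s21 [us2 is2] cs2]] := prune s1 sU; exists s2; split=> //.
- by move=> x /s21/s1S.
- by apply: leq_trans sz1; apply: uniq_leq_size.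
- move=> x /cs1[y ys1 Uxy]; have [z zs2 Uyz] := cs2 y ys1; exists z => //.
 by rewrite -[x](subrK y) -addrA; apply: sgpD.
Qed.
End Covers.

(** * Means of functions on abelian groups *)

Section Means.
Variable C : numFieldType.

(* [c] is the mean of [phi] over [H]: some finite average of translates of
  [phi] is the constant [c]. *)
Definition meanon (T : zmodType) (H : set T) (phi : T -> C) (c : C) :=
 exists s : seq T, [/\ s != [::], forall a, a \in s -> H a
  & forall x, H x -> \sum_(a <- s) phi (a + x) = (size s)%:R * c].

Section OneGroup.
Variables (T : zmodType) (H : set T).
Hypothesis sH : sgp H.
Implicit Types (phi : T -> C).

Lemma mean_ext phi phi' c : (forall x, H x -> phi x = phi' x) ->
 meanon H phi c -> meanon H phi' c.
move=> e [s [s0 sH' sc]]; exists s; split=> // x Hx; rewrite -(sc x Hx).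
by apply: eq_big_seq => a /sH' Ha; rewrite e //; apply: sgpD.
Qed.

Lemma mean_cst c : meanon H (fun=> c) c.
exists [:: 0]; split=> //; first by move=> a; rewrite inE => /eqP ->; apply: sH.1.
by move=> x _; rewrite big_seq1 mul1r.
Qed.

Let addseq (s t : seq T) := [seq a + b | a <- s, b <- t].

(** Averaging once more over further translates keeps a constant average; sumsets of lists are the
    device that makes several averages simultaneous. *)
Lemma addseq_l s t phi c : (forall a, a \in t -> H a) ->
 (forall x, H x -> \sum_(a <- s) phi (a + x) = (size s)%:R * c) ->
 forall x, H x -> \sum_(a <- addseq s t) phi (a + x) = (size (addseq s t))%:R * c.
move=> tH sc x Hx; rewrite /addseq big_allpairs_dep /= size_allpairs exchange_big /=.
rewrite (eq_big_seq (fun=> (size s)%:R * c)) => [|b bt].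
 by rewrite big_const_seq count_predT iter_addr_0 -[_ *+ size t]mulr_natl mulrA mulnC natrM.
rewrite -(sc (b + x)); last by apply: sgpD => //; apply: tH.
by apply: eq_bigr => a _; rewrite addrA.
Qed.

Lemma addseq_r s t phi c : (forall a, a \in s -> H a) ->
 (forall x, H x -> \sum_(a <- t) phi (a + x) = (size t)%:R * c) ->
 forall x, H x -> \sum_(a <- addseq s t) phi (a + x) = (size (addseq s t))%:R * c.
move=> tH sc x Hx; rewrite /addseq big_allpairs_dep /= size_allpairs.
rewrite (eq_big_seq (fun=> (size t)%:R * c)) => [|b bt].
 by rewrite big_const_seq count_predT iter_addr_0 -[_ *+ size s]mulr_natl mulrA natrM.
rewrite -(sc (b + x)); last by apply: sgpD => //; apply: tH.
by apply: eq_bigr => a _; rewrite addrA (addrC a).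
Qed.

Lemma addseqP s t : s != [::] -> t != [::] -> (forall a, a \in s -> H a) ->
 (forall a, a \in t -> H a) ->
 addseq s t != [::] /\ forall a, a \in addseq s t -> H a.
move=> s0 t0 sH' tH; split.
 by rewrite -size_eq0 size_allpairs muln_eq0 negb_or !size_eq0 s0.
by move=> a /allpairsP[[x y] /= [xs yt ->]]; apply: sgpD => //; [apply: sH'|apply: tH].
Qed.

Lemma natr_neq0 (s : seq T) : s != [::] -> (size s)%:R != 0 :> C.
by rewrite -size_eq0 pnatr_eq0. Qed.

(** The average over the sumset of the two lists can be evaluated through either list, which yields
    both constants; the lengths are invertible in characteristic 0. *)
Lemma mean_uniq phi c d : meanon H phi c -> meanon H phi d -> c = d.
move=> [s [s0 s1 sc]] [t [t0 t1 td]].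
have [st0 _] := addseqP s0 t0 s1 t1.
apply: (mulfI (natr_neq0 st0)).
by rewrite -(addseq_l t1 sc sH.1) -(addseq_r s1 td sH.1).
Qed.

Lemma mean_common (I : eqType) (r : seq I) (phi : I -> T -> C) (c : I -> C) :
 (forall i, i \in r -> meanon H (phi i) (c i)) ->
 exists s : seq T, [/\ s != [::], forall a, a \in s -> H a
  & forall i, i \in r -> forall x, H x ->
    \sum_(a <- s) phi i (a + x) = (size s)%:R * c i].
elim: r => [|i r IH] mr.
 by exists [:: 0]; split=> // a; rewrite inE => /eqP ->; apply: sH.1.
have [|s [s0 sH' sc]] := IH; first by move=> j jr; apply: mr; rewrite in_cons jr orbT.
have [t [t0 tH tc]] := mr i (mem_head _ _).
exists (addseq s t); have [? ?] := addseqP s0 t0 sH' tH; split=> // j.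
move=> /predU1P[->|jr] x Hx; first exact: addseq_r.
by apply: addseq_l => //; apply: sc.
Qed.

Lemma mean_lin a phi phi' c c' : meanon H phi c -> meanon H phi' c' ->
 meanon H (fun x => a * phi x + phi' x) (a * c + c').
move=> [s [s0 s1 sc]] [t [t0 t1 td]].
have [st0 st1] := addseqP s0 t0 s1 t1.
exists (addseq s t); split=> // x Hx.
rewrite big_split /= -mulr_sumr (addseq_l t1 sc Hx) (addseq_r s1 td Hx).
by rewrite mulrDr mulrCA.
Qed.

Lemma meanonZ a phi c : meanon H phi c -> meanon H (fun x => a * phi x) (a * c).
move=> m; have := mean_lin a m (mean_cst 0); rewrite addr0.
by apply: mean_ext => x _; rewrite addr0.
Qed.

Lemma meanonD phi phi' c c' : meanon H phi c -> meanon H phi' c' ->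
 meanon H (fun x => phi x + phi' x) (c + c').
move=> m m'; have := mean_lin 1 m m'; rewrite mul1r.
by apply: mean_ext => x _; rewrite mul1r.
Qed.

Lemma mean_sum I (r : seq I) (P : pred I) (phi : I -> T -> C) (c : I -> C) :
 (forall i, P i -> meanon H (phi i) (c i)) ->
 meanon H (fun x => \sum_(i <- r | P i) phi i x) (\sum_(i <- r | P i) c i).
move=> mP; elim: r => [|i r IH].
 by rewrite big_nil; apply: mean_ext (mean_cst 0) => x _; rewrite big_nil.
rewrite big_cons; case: ifPn => Pi; last first.
 by apply: mean_ext IH => x _; rewrite big_cons (negPf Pi).
apply: mean_ext (meanonD (mP i Pi) IH) => x _.
by rewrite big_cons Pi.
Qed.

Lemma mean_shift phi c h : H h -> meanon H phi c ->
 meanon H (fun x => phi (h + x)) c.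
move=> Hh [s [s0 s1 sc]]; exists s; split=> // x Hx.
rewrite -(sc (h + x)); last exact: sgpD.
by apply: eq_bigr => a _; rewrite addrCA.
Qed.

(** Translation by [x] permutes the cosets of [U]; [f] is this permutation on representatives,
    injective and hence surjective on the finite list. *)
Lemma sum_transversal (t : seq T) U phi : sgp U -> U `<=` H ->
 (forall a, a \in t -> H a) -> indep t U -> covers t H U ->
 (forall u x, U u -> H x -> phi (u + x) = phi x) ->
 forall x, H x -> \sum_(a <- t) phi (a + x) = \sum_(a <- t) phi a.
move=> sU UH tH [ut it] ct per x Hx.
pose f a := xget 0 [set y | y \in t /\ U (a + x - y)].
have fP a : a \in t -> f a \in t /\ U (a + x - f a).
 move=> /tH Ha; have [y yt Uy] := ct (a + x) (sgpD sH Ha Hx).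
 exact: (@xgetI _ 0 [set y | y \in t /\ U (a + x - y)] y).
have -> : \sum_(a <- t) phi (a + x) = \sum_(a <- map f t) phi a.
 rewrite big_map; apply: eq_big_seq => a /fP[/tH Hfa Ua].
 by rewrite -[a + x](subrK (f a)) per.
have sub : {subset map f t <= t} by move=> _ /mapP[a /fP[? _] ->].
have uf : uniq (map f t).
 rewrite map_inj_in_uniq // => a b at_ bt fab; apply: it => //.
 have [_ Ua] := fP a at_; have [_ Ub] := fP b bt.
 have -> : a - b = (a + x - f a) - (b + x - f b).
  by rewrite fab opprB addrA subrK opprD addrACA subrr addr0.
 exact: sU.2.
apply: perm_big; apply: uniq_perm => //.
by have [_ e] := uniq_min_size uf sub (eq_leq (esym (size_map f t))).
Qed.

Lemma mean_periodic (s : seq T) U phi : sgp U -> U `<=` H -> covers s H U ->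
 (forall u x, U u -> H x -> phi (u + x) = phi x) -> exists c, meanon H phi c.
move=> sU UH cs per; have [t [tH _ it ct]] := transversal sU cs.
have t0 : t != [::].
 by have [y yt _] := ct 0 sH.1; apply: contraTneq yt => ->.
exists ((size t)%:R^-1 * \sum_(a <- t) phi a), t; split=> // x Hx.
rewrite mulVKf ?natr_neq0 //.
exact: sum_transversal it ct per x Hx.
Qed.
End OneGroup.

Section Morphisms.
Variables (T T' : zmodType) (H : set T) (H' : set T') (sigma : T -> T').
Hypotheses (sigmaD : forall x y, H x -> H y -> sigma (x + y) = sigma x + sigma y)
 (sigmaH : forall x, H x -> H' (sigma x))
 (sigma_surj : forall y, H' y -> exists2 x, H x & sigma x = y).

(** Averaging lists are pushed forward by [sigma] and pulled back by choosing preimages, so a mean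
    may be computed on either side of a surjection. *)
Lemma mean_morph phi c : meanon H (phi \o sigma) c <-> meanon H' phi c.
split=> [[s [s0 sH sc]]|[s [s0 sH sc]]].
 exists (map sigma s); split; first by case: (s) s0.
  by move=> _ /mapP[a /sH Ha ->]; apply: sigmaH.
 move=> _ /sigma_surj[x Hx <-]; rewrite size_map -(sc x Hx) big_map.
 by apply: eq_big_seq => a /sH Ha /=; rewrite sigmaD.
pose lift y := xget 0 [set x | H x /\ sigma x = y].
have liftP y : H' y -> H (lift y) /\ sigma (lift y) = y.
 by move=> /sigma_surj[x Hx <-]; exact: (@xgetI _ 0 [set z | H z /\ sigma z = sigma x] x).
exists (map lift s); split; first by case: (s) s0.
 by move=> _ /mapP[a /sH/liftP[] + _ ->].
move=> x Hx; rewrite size_map -(sc (sigma x)) ?big_map; last exact: sigmaH.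
by apply: eq_big_seq => a /sH/liftP[Ha e] /=; rewrite sigmaD // e.
Qed.
End Morphisms.

(* Fubini: averaging first along the image of [j] *)
Lemma mean_fubini (T T1 : zmodType) (j : T1 -> T) (phi m : T -> C) c :
 meanon setT phi c ->
 (forall x, meanon setT (fun b => phi (j b + x)) (m x)) -> meanon setT m c.
have sT (U : zmodType) : sgp [set: U] by [].
move=> [s [s0 _ sc]] mm; exists s; split=> // x _.
(* A single list [t] averages all the finitely many functions [b |-> phi (j b + (a + x))] with [a]
   in [s], so that the two finite sums can be exchanged. *)
have [|t [t0 _ tc]] := @mean_common _ _ (sT T1) _ s
 (fun a b => phi (j b + (a + x))) (fun a => m (a + x)); first by move=> a _; apply: mm.
have tz := natr_neq0 t0.
apply: (mulfI tz); rewrite mulr_sumr.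
rewrite (eq_big_seq (fun a => \sum_(b <- t) phi (j b + (a + x)))); last first.
 by move=> a as_; rewrite -(tc a as_ 0) //; apply: eq_bigr => b _; rewrite addr0.
rewrite exchange_big /= (eq_bigr (fun=> (size s)%:R * c)); last first.
 by move=> b _; rewrite -(sc (j b + x)) //; apply: eq_bigr => a _; rewrite addrCA.
by rewrite big_const_seq count_predT iter_addr_0 -[_ *+ size t]mulr_natl.
Qed.
End Means.

Lemma small_rank_relation (k : fieldType) (I J : finType) (A : I -> J -> k) :
 (#|J| < #|I|)%N -> exists2 c : I -> k, exists i, c i != 0 &
  forall j, \sum_i c i * A i j = 0.
move=> JI; have [c c0 cA] := small_rank_kernel
 (\matrix_(i, j) A (enum_val i) (enum_val j) : 'M[k]_(#|I|, #|J|)) JI.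
exists (fun i => c o0 (enum_rank i)).
 have /rV0Pn[i ci] := c0; exists (enum_val i); by rewrite enum_valK.
move=> j; have /rowP/(_ (enum_rank j)) := cA; rewrite !mxE => e.
rewrite -[RHS]e (reindex (@enum_val I predT)) /=; last by apply: onW_bij; apply: enum_val_bij.
by apply: eq_bigr => i _; rewrite mxE enum_valK enum_rankK.
Qed.

(** * Operators with finite image, and projectors *)

Section FiniteImage.
Variables (k : fieldType) (V : lmodType k).

Lemma finrank_image (T : V -> V) (r : seq V) : lop T -> (forall x, T x \in r) -> finrank T.
move=> lT Tr; have [P [lP fP sP Ps]] := lspan_projection r.
apply: (finrank_ext (S := P \o T)) => [x /=|]; first by rewrite Ps //; apply: mem_lspan.
exact: finrank_compl.
Qed.

(** With [P] a projector onto the span of the image of [U], the trace of [T \o U = T \o P \o U] is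
    by cyclicity that of [U \o T \o P], and this operator vanishes because [U \o T \o U] does. *)
Lemma trop_nilpotent (T U : V -> V) (r : seq V) : lop T -> lop U -> (forall x, U x \in r) ->
 (forall x, U (T (U x)) = 0) -> trop (T \o U) 0.
move=> lT lU Ur UTU; pose r' := [seq v <- r | `[< exists x, v = U x >]].
have [P [lP fP sP Ps]] := lspan_projection r'.
have [c tc] := finrank_compr fP lT; have [d [t1 t2]] := trop_comp tc lU.
have PU x : P (U x) = U x.
 by apply/Ps/mem_lspan; rewrite mem_filter Ur andbT; apply/asboolP; exists x.
have d0 : d = 0.
 apply: trop_uniq t2 _; apply: trop_ext (trop0 V) => x /=; apply/esym.
 have sub : linsub [set v | U (T v) = 0].
  split=> [|a u v /= hu hv]; first by rewrite /= (lop0 lT) (lop0 lU).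
  by rewrite /= lT lU hu hv scaler0 addr0.
 apply: (lspan_sub sub _ (sP x)) => v; rewrite mem_filter => /andP[/asboolP[y ->] _].
 exact: UTU.
by rewrite -d0; apply: trop_ext t1 => x /=; rewrite PU.
Qed.

Lemma complement_projector (L N : set V) : linsub L -> linsub N ->
 (forall x, L x -> N x -> x = 0) -> (forall x, exists2 y, N y & L (x - y)) ->
 exists pi, [/\ lop pi, forall x, L (pi x), forall x, L x -> pi x = x,
  forall x, N x -> pi x = 0 & forall x, N (x - pi x)].
move=> [L0 Ll] [N0 Nl] LN dec.
have /choice[f hf] : forall x, exists y, N y /\ L (x - y).
 by move=> x; have [y] := dec x; exists y.
have LB u v : L u -> L v -> L (u - v).
 by move=> Lu Lv; rewrite addrC -scaleN1r; apply: Ll.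
have NB u v : N u -> N v -> N (u - v).
 by move=> Lu Lv; rewrite addrC -scaleN1r; apply: Nl.
have un x y : N y -> L (x - y) -> f x = y.
 move=> Ny Ly; have [Nf Lf] := hf x; apply/subr0_eq/LN; last exact: NB.
 by have := LB _ _ Ly Lf; rewrite opprB addrC addrA subrK.
exists (fun x => x - f x); split.
- move=> a x y; have [Nx Lx] := hf x; have [Ny Ly] := hf y.
 have e : a *: x + y - (a *: f x + f y) = a *: (x - f x) + (y - f y).
  by rewrite scalerBr opprD addrACA.
 by rewrite (un _ (a *: f x + f y)) //; [exact: Nl|rewrite e; apply: Ll].
- by move=> x; case: (hf x).
- by move=> x Lx; rewrite (un x 0) ?subr0.
- by move=> x Nx; rewrite (un x x) ?subrr.
- by move=> x; rewrite subKr; case: (hf x).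
Qed.
End FiniteImage.

Section RankOne.
Variables (E : fieldType) (V W : lmodType E) (l : {linear V -> E^o}) (w : W).
(** Packaged as a linear map so that the uniqueness clause in the universal property of Kaehler
    differentials can compare it with the identity. *)
Definition rank_one : V -> W := fun x => l x *: w.
Fact rank_one_linear : linear rank_one.
by move=> a x y; rewrite /rank_one linearP scalerDl scalerA. Qed.
HB.instance Definition _ := GRing.isLinear.Build E V W _ rank_one rank_one_linear.
End RankOne.

Section Subrings.
Variables (R : comNzRingType) (A : set R).
Hypothesis h : is_subring A.

Lemma sr1 : A 1. by case: h. Qed.
Lemma srB x y : A x -> A y -> A (x - y). by case: h => _ + _; apply. Qed.
Lemma srM x y : A x -> A y -> A (x * y). by case: h => _ _; apply. Qed.
Lemma sr0 : A 0. by rewrite -(subrr 1); apply: srB sr1 sr1. Qed.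
Lemma srN x : A x -> A (- x). by move=> Ax; rewrite -sub0r; apply: srB sr0 Ax. Qed.
Lemma srD x y : A x -> A y -> A (x + y).
by move=> Ax Ay; rewrite -[y]opprK; apply/srB/srN. Qed.
Lemma srX x n : A x -> A (x ^+ n).
by move=> Ax; elim: n => [|n IH]; rewrite ?expr0 ?exprS; [exact: sr1|exact: srM]. Qed.
Lemma sr_sum I (r : seq I) (P : pred I) (F : I -> R) :
 (forall i, P i -> A (F i)) -> A (\sum_(i <- r | P i) F i).
by apply: big_ind; [exact: sr0|exact: srD]. Qed.
End Subrings.

Section Ideals.
Variable R : comNzRingType.
Implicit Types (I J O : set R).

Lemma idealM_sgp I J : (forall x, J x -> J (- x)) -> sgp (idealM I J).
move=> JN; split; first by exists [::]; rewrite ?big_nil.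
move=> _ _ [s sP ->] [s' sP' ->].
exists (s ++ [seq (u.1, - u.2) | u <- s']); last first.
 rewrite big_cat big_map /= -sumrN; congr (_ + _).
 by apply: eq_bigr => u _; rewrite mulrN.
move=> u; rewrite mem_cat => /orP[/sP //|/mapP[v /sP'[Iv Jv] ->]] /=.
by split=> //; exact: JN.
Qed.

Lemma maxid_pow_sgp O n : is_subring O -> sgp (maxid_pow O n).
move=> [O1 OB _]; elim: n => [|n IH] /=.
 by split=> //; rewrite /= -(subrr 1); exact: OB.
by apply: idealM_sgp => x; exact: sgpN IH.
Qed.
End Ideals.

Lemma finI_from_ind (J : choiceType) T (D : set J) (b : J -> set T) (P : set T -> Prop) U :
 P setT -> (forall A B, P A -> P B -> P (A `&` B)) -> (forall i, D i -> P (b i)) ->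
 finI_from D b U -> P U.
move=> PT PI Pb [A sA <-]; rewrite bigcap_fset big_seq; apply: (big_ind P) => // i iA.
by apply: Pb; have := sA i iA; rewrite inE.
Qed.

(** * Topology of the adeles and evaluation of Haar integrals *)

Section SubbaseNbhs.
Variables (I : choiceType) (F : comNzRingType) (O : I -> set F).
Variable M : completions O.

Lemma congr0_sgp n : sgp (congr0 (M := M) n).
have h i : sgp (maxid_pow (cint M i) (n i)).
 exact: maxid_pow_sgp (compl_subring (completionsP M i)).
by split=> [i|x y hx hy i]; [exact: (h i).1|exact: (h i).2].
Qed.

Lemma fin_supp0 : fin_supp (fun _ : I => 0%N).
by apply: (sub_finite_set _ (@finite_set0 I)) => i /=. Qed.

Lemma fin_supp_max (n m : I -> nat) : fin_supp n -> fin_supp m -> fin_supp (fun i => maxn (n i) (m i)).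
move=> fn fm; apply: (@sub_finite_set _ _ ([set i | n i != 0%N] `|` [set i | m i != 0%N])).
 by move=> i /=; have [->|n0] := eqVneq (n i) 0%N; [rewrite max0n; right|left].
by rewrite finite_setU.
Qed.

Lemma maxid_pow_le (R : comNzRingType) (A : set R) m n : is_subring A -> (m <= n)%N ->
 maxid_pow A n `<=` maxid_pow A m.
move=> sA; have [A1 AB AM] := sA.
have sub l : maxid_pow A l `<=` A.
 elim: l => [//|l IH] _ [s sP ->]; have [A0 _] := maxid_pow_sgp 0 sA.
 elim: s sP => [|u s IHs] sP; first by rewrite big_nil.
 rewrite big_cons; apply: (sgpD (maxid_pow_sgp 0 sA)).
  by have [[Au _] /IH] := sP u (mem_head _ _); apply: AM.
 by apply: IHs => v vs; apply: sP; rewrite in_cons vs orbT.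
elim: m n => [|m IH] n mn; first exact: (sub n).
case: n mn => // n mn.
move=> _ [s sP ->]; exists s => // u /sP[h1 h2]; split=> //; exact: IH h2.
Qed.

Lemma congr0_le (n m : I -> nat) : (forall i, (n i <= m i)%N) -> congr0 (M := M) m `<=` congr0 n.
move=> nm a ha i; apply: maxid_pow_le (nm i) _ (ha i).
exact: compl_subring (completionsP M i).
Qed.

(** Subbasic sets are cosets of subgroups, so each may be recentred at any of its points, and finite
    intersections are absorbed by maxima of exponents. *)
Lemma nbhs_adele (x : adele M) (N : set (adele M)) :
 nbhs x N <-> exists n, fin_supp n /\ forall y, congr0 n (y - x) -> N y.
split; last first.
 move=> [n [fn hn]]; rewrite nbhsE; exists [set b | congr0 n (b - x)]; last by move=> y /hn.
 split; last by rewrite /= subrr; exact: (congr0_sgp n).1.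
 exists [set [set b | congr0 n (b - x)]]; last by rewrite bigcup_set1.
 by move=> _ ->; apply: (@finI_from1 _ _ _ id); exists x, n.
rewrite nbhsE => -[B [[D DB <-] [U DU Ux]] BN].
have sA := DB U DU.
suff [n [fn hn]] : exists n, fin_supp n /\ forall y, congr0 n (y - x) -> U y.
 by exists n; split=> // y /hn Uy; apply: BN; exists U.
move: Ux; move: sA.
apply: (@finI_from_ind _ _ _ _ (fun V => V x -> exists n, fin_supp n /\ forall y, congr0 n (y - x) -> V y)).
- by exists (fun=> 0%N); split=> //; exact: fin_supp0.
- move=> V W hV hW [/hV[n [fn hn]] /hW[m [fm hm]]].
 exists (fun i => maxn (n i) (m i)); split; first exact: fin_supp_max.
 move=> y hy; split; [apply: hn|apply: hm]; apply: congr0_le hy => i; [exact: leq_maxl|exact: leq_maxr].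
- move=> V [a [n [fn ->]]] /= Vx; exists n; split=> // y hy.
 by rewrite -[y](subrK x) -addrA; apply: (sgpD (congr0_sgp n)).
Qed.

Section Haar.
Variable C : numFieldType.

Lemma test_funP (H L : set (adele M)) (phi : adele M -> C) : test_fun H L phi <->
 (forall l x, L l -> H x -> phi (l + x) = phi x) /\
 (forall x, H x -> exists n, fin_supp n /\ forall y, H y -> congr0 n (y - x) -> phi y = phi x).
split=> -[h1 h2]; split=> // x Hx.
 by have /nbhs_adele[n [fn hn]] := h2 x Hx; exists n; split=> // y Hy /hn; apply.
have [n [fn hn]] := h2 x Hx.
by apply/nbhs_adele; exists n; split=> // y hy Hy; apply: hn.
Qed.

Section Group.
Variables (H L : set (adele M)).
Hypothesis sH : sgp H.
Hypothesis LH : L `<=` H.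

Lemma test_fun_lin c (phi1 phi2 : adele M -> C) : test_fun H L phi1 -> test_fun H L phi2 ->
 test_fun H L (fun x => c * phi1 x + phi2 x).
move=> /test_funP[a1 b1] /test_funP[a2 b2]; apply/test_funP; split=> [l x Ll Hx|x Hx].
 by rewrite a1 // a2.
have [n [fn hn]] := b1 x Hx; have [m [fm hm]] := b2 x Hx.
exists (fun i => maxn (n i) (m i)); split; first exact: fin_supp_max.
move=> y Hy hy; rewrite hn ?hm //; apply: congr0_le hy => i; [exact: leq_maxr|exact: leq_maxl].
Qed.

Lemma test_fun_translate h (phi : adele M -> C) : H h -> test_fun H L phi ->
 test_fun H L (fun x => phi (h + x)).
move=> Hh /test_funP[a b]; apply/test_funP; split=> [l x Ll Hx|x Hx].
 by rewrite addrCA; apply: a => //; apply: (sgpD sH).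
have [n [fn hn]] := b _ (sgpD sH Hh Hx); exists n; split=> // y Hy hy.
by apply: hn; [exact: (sgpD sH Hh Hy)|rewrite opprD addrACA subrr add0r].
Qed.

Lemma test_fun_cst (c : C) : test_fun H L (fun=> c).
by apply/test_funP; split=> // x _; exists (fun=> 0%N); split=> //; exact: fin_supp0. Qed.

Hypothesis mean : forall phi : adele M -> C, test_fun H L phi -> exists c, meanon H phi c.

Lemma haar_exists : exists J, is_haar H L J (C := C).
pose J (phi : adele M -> C) := xget 0 [set c | meanon H phi c].
have JE phi c : meanon H phi c -> J phi = c.
 move=> hc; apply: (mean_uniq sH) (hc).
 exact: (@xgetI _ 0 [set c | meanon H phi c] c).
exists J; split.
- move=> phi1 phi2 t1 t2 e; have [c hc] := mean t2.
 by rewrite (JE _ _ hc); apply: JE; apply: mean_ext hc => // x Hx; rewrite e.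
- move=> c phi1 phi2 /mean[c1 h1] /mean[c2 h2].
 by rewrite (JE _ _ h1) (JE _ _ h2); apply: JE; apply: mean_lin.
- move=> h phi Hh /mean[c hc]; rewrite (JE _ _ hc); apply: JE; exact: mean_shift.
- by apply: JE; apply: mean_cst.
Qed.

(** The functional chosen by [xget] is known only through its axioms, but some average of translates
    of [phi] is a constant, and on constants the normalisation determines every such functional. *)
Lemma haar_intE (phi : adele M -> C) c : test_fun H L phi -> meanon H phi c ->
 haar_int H L phi = c.
move=> tp [s [s0 sH' sc]]; have [J0 hJ0] := haar_exists.
have hJ : is_haar H L (haar_int H L (C := C)) by apply: (@xgetI _ (fun=> 0) [set J | is_haar H L J] J0).
have key (r : seq (adele M)) : (forall a, a \in r -> H a) ->
  test_fun H L (fun x => \sum_(a <- r) phi (a + x)) /\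
  haar_int H L (fun x => \sum_(a <- r) phi (a + x)) = (size r)%:R * haar_int H L phi.
 elim: r => [|a r IH] rH.
  have e0 : (fun x : adele M => \sum_(a <- [::]) phi (a + x)) = (fun=> 0 : C).
   by apply/funext => x; rewrite big_nil.
  rewrite e0 mul0r; split; first exact: test_fun_cst.
  have := haar_lin hJ (-1) (test_fun_cst 1) (test_fun_cst 1).
  move=> h; have {}h : haar_int H L (fun=> -1 * 1 + 1 : C) = 0 by rewrite h; ring.
  by rewrite -[RHS]h; congr haar_int; apply/funext => x; rewrite mulN1r addNr.
 have [|t e] := IH; first by move=> b br; apply: rH; rewrite in_cons br orbT.
 have ta := test_fun_translate (rH a (mem_head _ _)) tp.
 have eq1 : (fun x => \sum_(b <- a :: r) phi (b + x)) =
   (fun x => 1 * phi (a + x) + \sum_(b <- r) phi (b + x)).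
  by apply/funext => x; rewrite big_cons mul1r.
 rewrite eq1; split; first exact: test_fun_lin.
 rewrite (haar_lin hJ 1 ta t) e (haar_inv hJ (rH a (mem_head _ _)) tp) mul1r /=.
 by rewrite -[in RHS]addn1 natrD mulrDl mul1r addrC.
have [ts es] := key s sH'; apply: (mulfI (natr_neq0 C s0)); rewrite -es.
(* The constant is written as [(size s * c - 1) * 1 + 1] to fit the shape of [haar_lin]; [haar_one]
   then evaluates it. *)
have := haar_lin hJ ((size s)%:R * c - 1) (test_fun_cst 1) (test_fun_cst 1).
rewrite (haar_one hJ) mulr1 subrK => <-.
by apply: (haar_ext hJ) ts (test_fun_cst _) _ => x Hx; exact: sc.
Qed.
End Group.

Section Compactness.
(** An abstract filtration of each completed local ring. It is instantiated by the valuation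
    filtration on the reduced curve and by the powers of a lifted uniformizer on the nonreduced
    one. *)
Variable Sp : forall i, nat -> set (cring M i).
Arguments Sp : clear implicits.
Hypothesis S_sgp : forall i n, sgp (Sp i n).
Hypothesis S_dec : forall i m n, (m <= n)%N -> Sp i n `<=` Sp i m.
Hypothesis S_int : forall i, Sp i 0%N `<=` cint M i.
Hypothesis S_max : forall i n, Sp i n `<=` maxid_pow (cint M i) n.
Hypothesis S_cover : forall i n, exists s, covers s (cint M i) (Sp i n).
Hypothesis S_complete : forall i (u : nat -> cring M i), (forall n, cint M i (u n)) ->
 (forall n, Sp i n (u n.+1 - u n)) -> exists2 x, cint M i x & forall n, Sp i n (x - u n).

Definition Slat (n : I -> nat) : set (adele M) := [set a | forall i, Sp i (n i) (aval a i)].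
Definition integral_adele : set (adele M) := [set a | forall i, cint M i (aval a i)].
Lemma ultra_cover (T : Type) (J : Type) (G : set_system J) (s : seq T) (P : T -> set J) A :
 UltraFilter G -> G A -> (forall j, A j -> exists2 y, List.In y s & P y j) -> exists y, G (P y).
move=> UG; elim: s A => [|y s IH] A GA h.
 by have /filter_ex[j /h[]] := GA.
have [GP|GP] := in_ultra_setVsetC (P y) UG; first by exists y.
apply: (IH (A `&` ~` P y)) => [|j [Aj nP]]; first exact: filterI.
by have [z [<- //|zs] Pz] := h j Aj; exists z.
Qed.

(** Compactness of the integral adeles by ultrafilters: if every level had a counterexample, these
    would converge along an ultrafilter on levels to an integral adele, and local constancy there
    would contradict the nearby counterexamples. *)
Lemma uniform_level (phi : adele M -> C) :
 (forall x, integral_adele x -> exists n, fin_supp n /\ forall y, congr0 n (y - x) -> phi y = phi x) ->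
 exists n, fin_supp n /\ forall x u, integral_adele x -> Slat n u -> phi (u + x) = phi x.
move=> loc; apply: contrapT => nex.
have /choice[XU hXU] : forall n : I -> nat, exists xu : adele M * adele M, fin_supp n ->
  [/\ integral_adele xu.1, Slat n xu.2 & phi (xu.2 + xu.1) <> phi xu.1].
 move=> n; have [fn|nfn] := pselect (fin_supp n); last by exists (0, 0).
 apply: contrapT => nxu; apply: nex; exists n; split=> // x u ix Su.
 by apply: contrapT => ne; apply: nxu; exists (x, u).
pose X n := (XU n).1; pose B (n0 : I -> nat) : set (I -> nat) :=
 [set m | fin_supp m /\ forall i, (n0 i <= m i)%N].
(* Levels are directed under pointwise maximum; an ultrafilter containing all the upper sets [B n0]
   then selects limits place by place. *)
have pF : ProperFilter (filter_from (@fin_supp I) B).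
 apply: filter_from_proper => [|n fn]; last by exists n.
 apply: filter_from_filter; first by exists (fun=> 0%N); exact: fin_supp0.
 move=> n m fn fm; exists (fun i => maxn (n i) (m i)); first exact: fin_supp_max.
 by move=> l [fl hl]; split; split=> // i; have := hl i; rewrite geq_max => /andP[].
have [G [UG FG]] := ultraFilterLemma pF.
have GB n : fin_supp n -> G (B n) by move=> fn; apply: FG; exists n.
have Xint m : fin_supp m -> integral_adele (X m) by move=> /hXU[].
pose Y i l : set (cring M i) := [set y | G [set m | Sp i l (aval (X m) i - y)]].
have exY i l : exists y, Y i l y.
 have [s cs] := S_cover i l.
 apply: (@ultra_cover _ _ G s (fun y => [set m | Sp i l (aval (X m) i - y)]) (B (fun=> 0%N))).
  exact/GB/fin_supp0.
 move=> m [fm _]; have [y ys hy] := cs _ (Xint m fm i); exists y => //.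
 by elim: s ys {cs} => // z s IH; move=> /predU1P[->|/IH]; [left|right].
pose y i l := xget 0 (Y i l).
have hy i l : G [set m | Sp i l (aval (X m) i - y i l)].
 by have [y0 hy0] := exY i l; apply: (@xgetI _ 0 (Y i l) y0 hy0).
have yint i l : cint M i (y i l).
 have [m [[fm _] hm]] := filter_ex (filterI (GB _ fin_supp0) (hy i l)).
 have [_ cB _] := compl_subring (completionsP M i).
 rewrite -[y i l](subKr (aval (X m) i)); apply: cB; first exact: Xint.
 exact/S_int/(S_dec (leq0n l)).
have ydiff i l : Sp i l (y i l.+1 - y i l).
 have [m [h1 h2]] := filter_ex (filterI (hy i l) (hy i l.+1)).
 have := (S_sgp i l).2 _ _ h1 (S_dec (leqnSn l) h2).
 by rewrite opprB addrC addrA subrK.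
(* The limit exists at each place by completeness, and integrality of all its components is what
   makes the family an adele. *)
have [A hA] : exists A : adele M, integral_adele A /\ forall i l, Sp i l (aval A i - y i l).
 pose Z i : set (cring M i) := [set x | cint M i x /\ forall n, Sp i n (x - y i n)].
 have hZ i : Z i (xget 0 (Z i)).
  have [x h1 h2] := S_complete (yint i) (ydiff i).
  exact: (@xgetI _ 0 (Z i) x).
 have fin : finite_set [set i | ~ cint M i (xget 0 (Z i))].
  by apply: (sub_finite_set _ (@finite_set0 I)) => i /=; apply; case: (hZ i).
 by exists (Adele fin); split=> [i|i l]; case: (hZ i).
have [iA hAy] := hA; have [n0 [fn0 hn0]] := loc A iA.
have [s hs] : exists s : seq I, forall i, n0 i != 0%N -> i \in s.
 have /finite_seqP[s hs] := fn0; exists s => i ni.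
 by have : [set` s] i by rewrite -hs.
have GS : G [set m | forall i, i \in s -> Sp i (n0 i) (aval (X m) i - aval A i)].
 elim: s {hs} => [|i s IH]; first by apply: filterS filterT => m _ i; rewrite in_nil.
 apply: filterS (filterI (hy i (n0 i)) IH) => m [h1 h2] i'; move=> /predU1P[->|/h2 //].
 have := (S_sgp i (n0 i)).2 _ _ h1 (hAy i (n0 i)).
 by rewrite opprB addrA subrK.
have [m [[fm mn] hm]] := filter_ex (filterI (GB _ fn0) GS).
have [iX SU ne] := hXU m fm; apply: ne.
have cXA : congr0 n0 (X m - A).
 move=> i /=; have [n0i|n0i] := eqVneq (n0 i) 0%N.
  rewrite n0i; have [_ cB _] := compl_subring (completionsP M i).
  by apply: cB; [exact: iX|exact: iA].
 exact/S_max/hm/hs.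
rewrite (hn0 _ cXA) -(hn0 _ (_ : congr0 n0 ((XU m).2 + X m - A))) // -addrA.
apply: (sgpD (congr0_sgp n0)) cXA => i.
exact/S_max/(S_dec (mn i))/SU.
Qed.

Hypothesis S_glob : forall n, fin_supp n -> exists s, covers s setT (sumset (@principal _ _ _ M) (Slat n)).

Lemma Slat_sgp n : sgp (Slat n).
by split=> [i|x y hx hy i]; [exact: (S_sgp i _).1|exact: (S_sgp i _).2]. Qed.

Lemma principal_sgp : sgp (@principal _ _ _ M).
split; first by exists 0 => i; rewrite rmorph0.
by move=> x y [a ha] [b hb]; exists (a - b) => i; rewrite rmorphB /= ha hb.
Qed.

(** Modulo principal adeles, finitely many translates of the integral adeles cover everything, and
    [uniform_level] applies to each translate. *)
Lemma test_fun_uniform (phi : adele M -> C) : test_fun setT (@principal _ _ _ M) phi ->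
 exists n, fin_supp n /\ forall u x, sumset (@principal _ _ _ M) (Slat n) u -> phi (u + x) = phi x.
move=> /test_funP[per loc]; have [s cs] := S_glob fin_supp0.
have [n [fn hn]] : exists n, fin_supp n /\ forall y, y \in s -> forall x u, integral_adele x ->
  Slat n u -> phi (y + (u + x)) = phi (y + x).
 elim: s {cs} => [|y s [n [fn hn]]]; first by exists (fun=> 0%N); split=> //; exact: fin_supp0.
 have [|m [fm hm]] := @uniform_level (fun x => phi (y + x)).
  move=> x _; have [m [fm hm]] := loc (y + x) Logic.I; exists m; split=> // z hz; apply: hm => //.
  by rewrite opprD addrACA subrr add0r.
 exists (fun i => maxn (n i) (m i)); split; first exact: fin_supp_max.
 move=> z; move=> /predU1P[->|zs] x u ix Su.
  by apply: hm => // i; apply: S_dec (Su i); exact: leq_maxr.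
 by apply: hn => // i; apply: S_dec (Su i); exact: leq_maxl.
have inv u x : Slat n u -> phi (u + x) = phi x.
 move=> Su; have [y ys [e [o [pe So E]]]] := cs x Logic.I.
 have -> : x = e + (y + o) by rewrite addrCA addrC -E subrK.
 rewrite (addrCA u e) (per e) // (per e) // (addrCA u y) hn // => i; exact/S_int/So.
exists n; split=> // _ x [e [v [pe Sv ->]]]; rewrite -addrA per //; exact: inv.
Qed.

Lemma test_fun_mean (phi : adele M -> C) : test_fun setT (@principal _ _ _ M) phi ->
 exists c, meanon setT phi c.
move=> tp; have [n [fn hn]] := test_fun_uniform tp; have [s cs] := S_glob fn.
apply: (@mean_periodic _ _ _ _ s (sumset (@principal _ _ _ M) (Slat n))) => //.
 exact: sgp_sumset principal_sgp (Slat_sgp n).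
by move=> u x Su _; exact: hn.
Qed.
End Compactness.
End Haar.
End SubbaseNbhs.

(** * Two by two matrices, PGL_2 and square-zero extensions *)

Section Matrices2.
Variable R : comPzRingType.
Implicit Types (A B : 'M[R]_2).

Definition mx2 (a b c d : R) : 'M[R]_2 :=
 \matrix_(i, j) if i == o0 then if j == o0 then a else b else if j == o0 then c else d.

Lemma ord2 (i : 'I_2) : i = o0 \/ i = o1.
by case: i => [[|[|//]] h]; [left|right]; apply: val_inj. Qed.

Lemma mx2P A B : A o0 o0 = B o0 o0 -> A o0 o1 = B o0 o1 ->
 A o1 o0 = B o1 o0 -> A o1 o1 = B o1 o1 -> A = B.
by move=> *; apply/matrixP => i j; case: (ord2 i) => ->; case: (ord2 j) => ->. Qed.

Lemma mul2E A B i j : (A *m B) i j = A i o0 * B o0 j + A i o1 * B o1 j.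
by rewrite mxE big_ord_recl big_ord1; congr (_ * _ + _ * _); congr (fun_of_matrix _ _ _); apply: val_inj. Qed.

Lemma mx2E A : A = mx2 (A o0 o0) (A o0 o1) (A o1 o0) (A o1 o1).
by apply: mx2P; rewrite mxE. Qed.

Lemma mul_mx2 a b c d a' b' c' d' : mx2 a b c d *m mx2 a' b' c' d' =
 mx2 (a * a' + b * c') (a * b' + b * d') (c * a' + d * c') (c * b' + d * d').
by apply: mx2P; rewrite mul2E !mxE. Qed.

Lemma scalar_mx2 a : a%:M = mx2 a 0 0 a.
by apply: mx2P; rewrite !mxE ?mulr1n ?mulr0n. Qed.

Lemma add_mx2 a b c d a' b' c' d' : mx2 a b c d + mx2 a' b' c' d' = mx2 (a + a') (b + b') (c + c') (d + d').
by apply: mx2P; rewrite !mxE. Qed.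

Lemma scale_mx2 s a b c d : s *: mx2 a b c d = mx2 (s * a) (s * b) (s * c) (s * d).
by apply: mx2P; rewrite !mxE. Qed.

Lemma mx2_inj a b c d a' b' c' d' : mx2 a b c d = mx2 a' b' c' d' -> [/\ a = a', b = b', c = c' & d = d'].
move=> /matrixP e; have e1 := e o0 o0; have e2 := e o0 o1.
by have e3 := e o1 o0; have e4 := e o1 o1; rewrite !mxE /= in e1 e2 e3 e4.
Qed.

Lemma gl2P A B : A *m B = 1%:M -> gl2 (A, B).
by move=> AB; rewrite /gl2 /= AB (mulmx1C AB) eqxx. Qed.

Lemma gl2_1 A B : gl2 (A, B) -> A *m B = 1%:M. by case/andP => /eqP. Qed.
Lemma gl2C A B : gl2 (A, B) -> gl2 (B, A).
by rewrite /gl2 /= andbC. Qed.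

Lemma gl2M A A' B B' : gl2 (A, A') -> gl2 (B, B') -> gl2 (A *m B, B' *m A').
move=> /gl2_1 a /gl2_1 b; apply: gl2P.
by rewrite mulmxA -(mulmxA A) b mulmx1.
Qed.

Lemma pgl_pi A B (h : gl2 (A, B)) : pgl A = pi_pgl (Sub (A, B) h).
rewrite /pgl; case: pselect => [e|[]]; last by exists B.
by apply/pi_pglP; exists 1, 1; rewrite mulr1 scale1r.
Qed.

Lemma pgl_ex (g : PGL2 R) : exists A A', gl2 (A, A') /\ g = pgl A.
rewrite -(pi_pgl_repr g); case: (generic_quotient.repr g) => [[A A'] h]; exists A, A'; split=> //.
by rewrite (pgl_pi h).
Qed.

Lemma pgl_eq A A' B B' : gl2 (A, A') -> gl2 (B, B') ->
 pgl A = pgl B <-> exists c d : R, c * d = 1 /\ A = c *: B.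
by move=> h h'; rewrite (pgl_pi h) (pgl_pi h'); apply: pi_pglP. Qed.

Lemma pglM A A' B B' : gl2 (A, A') -> gl2 (B, B') -> pgl (A *m B) = (pgl A * pgl B)%g.
move=> h h'; rewrite (pgl_pi h) (pgl_pi h') -[RHS]pi_pgl_mul (pgl_pi (gl2M h h')).
by congr pi_pgl; apply: val_inj.
Qed.

Lemma pgl1 : pgl (1%:M : 'M[R]_2) = 1%g.
by rewrite (pgl_pi (gl2_oneP R)). Qed.

Lemma pglV A A' : gl2 (A, A') -> (pgl A)^-1%g = pgl A'.
move=> h; rewrite -[pgl A']mul1g -(mulVg (pgl A)) -mulgA -(pglM h (gl2C h)) (gl2_1 h) pgl1.
by rewrite mulg1.
Qed.

Lemma pgl_scale A A' c d : gl2 (A, A') -> c * d = 1 -> pgl (c *: A) = pgl A.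
move=> h cd; have h' : gl2 (c *: A, d *: A').
 by apply: gl2P; rewrite -scalemxAl -scalemxAr scalerA cd scale1r; exact: gl2_1.
by apply/(pgl_eq h' h); exists c, d.
Qed.

Lemma unipE (x : R) : unip x = pgl (mx2 1 x 0 1).
by congr pgl; apply: mx2P; rewrite !mxE /=; ring. Qed.

Lemma unip_pred (x : R) : gl2 (mx2 1 x 0 1, mx2 1 (- x) 0 1).
by apply: gl2P; rewrite mul_mx2 scalar_mx2; congr mx2; ring. Qed.

Lemma unipD (x y : R) : unip (x + y) = (unip x * unip y)%g.
by rewrite !unipE -(pglM (unip_pred x) (unip_pred y)) mul_mx2 !mul1r !mul0r !mulr0 !mulr1 !addr0 !add0r addrC.
Qed.

Lemma unip0 : unip (0 : R) = 1%g.
by rewrite unipE -pgl1 scalar_mx2. Qed.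

Definition dgl (a : R) : PGL2 R := pgl (mx2 a 0 0 1).
Lemma dgl_pred (a b : R) : a * b = 1 -> gl2 (mx2 a 0 0 1, mx2 b 0 0 1).
by move=> ab; apply: gl2P; rewrite mul_mx2 scalar_mx2 ab; congr mx2; ring. Qed.

Lemma dgl_unip (a b x : R) : a * b = 1 -> (dgl a * unip x = unip (a * x) * dgl a)%g.
move=> ab; rewrite /dgl !unipE -(pglM (dgl_pred ab) (unip_pred x)) -(pglM (unip_pred _) (dgl_pred ab)).
by rewrite !mul_mx2 !mul1r !mul0r !mulr0 !mulr1 !addr0 !add0r.
Qed.
End Matrices2.

Lemma gl2_map (R S : comPzRingType) (f : {rmorphism R -> S}) (A A' : 'M[R]_2) :
 gl2 (A, A') -> gl2 (map_mx f A, map_mx f A').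
by move=> /gl2_1 h; apply: gl2P; rewrite -map_mxM h map_mx1. Qed.

Lemma map_mx_mx2 (R S : comPzRingType) (f : R -> S) a b c d :
 map_mx f (mx2 a b c d) = mx2 (f a) (f b) (f c) (f d).
by apply: mx2P; rewrite !mxE. Qed.

Section PglMap.
Variables (R S : comPzRingType) (f : {rmorphism R -> S}).

Lemma pgl_mapE (A A' : 'M[R]_2) : gl2 (A, A') -> pgl_map f (pgl A) = pgl (map_mx f A).
move=> h; rewrite (pgl_pi (gl2_map f h)); apply/pi_pglP.
have [c [d [cd e]]] : exists c d : R, c * d = 1 /\ gmx (generic_quotient.repr (pgl A)) = c *: A.
 have [c [d [cd e]]] := (pi_pglP _ _).1 (etrans (pi_pgl_repr (pgl A)) (pgl_pi h)); by exists c, d.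
exists (f c), (f d); rewrite -rmorphM cd rmorph1; split=> //.
by rewrite /gmx /= -/(gmx _) e map_mxZ.
Qed.

Lemma pgl_mapM (g h : PGL2 R) : pgl_map f (g * h)%g = (pgl_map f g * pgl_map f h)%g.
have [A [A' [hA ->]]] := pgl_ex g; have [B [B' [hB ->]]] := pgl_ex h.
rewrite -(pglM hA hB) (pgl_mapE (gl2M hA hB)) map_mxM.
by rewrite (pglM (gl2_map f hA) (gl2_map f hB)) (pgl_mapE hA) (pgl_mapE hB).
Qed.

Lemma pgl_map1 : pgl_map f 1%g = 1%g.
by rewrite -pgl1 (pgl_mapE (gl2_oneP R)) map_mx1 pgl1. Qed.

Lemma pgl_mapV (g : PGL2 R) : pgl_map f g^-1%g = (pgl_map f g)^-1%g.
by rewrite -[LHS]mulg1 -(mulgV (pgl_map f g)) mulgA -pgl_mapM mulVg pgl_map1 mul1g. Qed.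

Lemma pgl_map_unip x : pgl_map f (unip x) = unip (f x).
by rewrite !unipE (pgl_mapE (unip_pred x)) map_mx_mx2 rmorph0 rmorph1. Qed.
End PglMap.

Section SquareZero.
Variables (R S : comPzRingType) (f : {rmorphism R -> S}).
Hypothesis f_surj : forall y, exists x, f x = y.
Hypothesis f_sq0 : forall x y, f x = 0 -> f y = 0 -> x * y = 0.

Lemma nil_mx_mul0 (N N' : 'M[R]_2) : map_mx f N = 0 -> map_mx f N' = 0 -> N *m N' = 0.
move=> h h'; have e i j : f (N i j) = 0 by have /matrixP/(_ i j) := h; rewrite !mxE.
have e' i j : f (N' i j) = 0 by have /matrixP/(_ i j) := h'; rewrite !mxE.
by apply: mx2P; rewrite mul2E !mxE !f_sq0 // addr0.
Qed.

Lemma nil_mx_pred (N : 'M[R]_2) : map_mx f N = 0 -> gl2 (1%:M + N, 1%:M - N).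
move=> h; apply: gl2P; rewrite mulmxDl mul1mx mulmxBr mulmx1 (nil_mx_mul0 h h) subr0.
by rewrite subrK.
Qed.

(** Lifts of a matrix and of its inverse multiply to [1 + N] with [N] of square zero; the factor
    [1 - N] corrects the inverse. *)
Lemma gl2_lift (B B' : 'M[S]_2) : gl2 (B, B') ->
 exists A A', [/\ gl2 (A, A'), map_mx f A = B & map_mx f A' = B'].
move=> /gl2_1 BB.
have lft (Y : 'M[S]_2) : exists Z, map_mx f Z = Y.
 have /choice[g hg] := f_surj; exists (map_mx g Y); apply/matrixP => i j; rewrite !mxE; exact: hg.
have [A eA] := lft B; have [A0 eA0] := lft B'.
have nN : map_mx f (A *m A0 - 1%:M) = 0 by rewrite map_mxB map_mxM map_mx1 eA eA0 BB subrr.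
exists A, (A0 *m (1%:M - (A *m A0 - 1%:M))); split=> //.
 apply: gl2P; rewrite mulmxA -{1}[A *m A0](subrK 1%:M) addrC; exact: gl2_1 (nil_mx_pred nN).
by rewrite map_mxM map_mxB nN map_mx1 subr0 mulmx1.
Qed.

Lemma unit_lift x y : f x * y = 1 -> exists2 z, x * z = 1 & f z = y.
move=> xy; have [z0 ez] := f_surj y; have n : f (x * z0 - 1) = 0 by rewrite rmorphB rmorphM ez xy rmorph1 subrr.
exists (z0 * (1 - (x * z0 - 1))); last by rewrite rmorphM rmorphB n rmorph1 subr0 mulr1.
have := f_sq0 n n; move=> e; have -> : x * (z0 * (1 - (x * z0 - 1))) = 1 - (x * z0 - 1) * (x * z0 - 1) by ring.
by rewrite e subr0.
Qed.

(** A representative of a kernel element reduces to a scalar matrix; dividing by a lift of this unit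
    leaves [1 + N]. *)
Lemma pgl_map_ker g : pgl_map f g = 1%g -> exists2 N, map_mx f N = 0 & g = pgl (1%:M + N).
have [A [A' [h ->]]] := pgl_ex g; rewrite (pgl_mapE f h) -pgl1 => /(pgl_eq (gl2_map f h) (gl2_oneP S))[c [d [cd e]]].
have [c' ec] := f_surj c; have cd' : f c' * d = 1 by rewrite ec.
have [d' c'd' ed'] := unit_lift cd'.
have eN : map_mx f (d' *: A - 1%:M) = 0.
 by rewrite map_mxB map_mxZ ed' e scalerA mulrC cd scale1r map_mx1 subrr.
exists (d' *: A - 1%:M) => //; rewrite addrC subrK; apply/esym/(pgl_scale h).
by rewrite mulrC; exact: c'd'.
Qed.

Lemma pgl_map_surj y : exists x, pgl_map f x = y.
have [B [B' [h ->]]] := pgl_ex y; have [A [A' [hA <- _]]] := gl2_lift h.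
by exists (pgl A); rewrite (pgl_mapE f hA).
Qed.
End SquareZero.

Lemma maxid_powM (R : comNzRingType) (O : set R) n x y : is_subring O ->
 maxid_pow O n x -> O y -> maxid_pow O n (x * y).
move=> [O1 OB OM]; elim: n x => [|n IH] x; first by move=> hx hy; exact: OM.
move=> [s sP ->] Oy; exists [seq (u.1, u.2 * y) | u <- s].
 by move=> _ /mapP[u /sP[h1 h2] ->]; split=> //=; exact: IH.
by rewrite big_map mulr_suml; apply: eq_bigr => u _; rewrite mulrA.
Qed.

(** * Congruence subgroups and the topology of PGL_2 of the adeles *)

Section Congruence.
Variables (I : choiceType) (F : comNzRingType) (O : I -> set F).
Variable M : completions O.
Notation A := (adele M).
Notation G := (PGL2A M).
Implicit Types (n m : I -> nat) (g x y : G).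

Lemma congr0_mul n (a b : A) : congr0 n a -> congr0 (fun=> 0%N) b -> congr0 n (a * b).
by move=> ha hb i; apply: maxid_powM; [exact: compl_subring (completionsP M i)|exact: ha|exact: hb]. Qed.

Lemma congr0_int n (a : A) : congr0 n a -> congr0 (fun=> 0%N) a.
by apply: congr0_le. Qed.

Lemma congrP n x : csub n x <-> exists Y Y' : 'M[A]_2,
 [/\ gl2 (1%:M + Y, 1%:M + Y'), forall i j, congr0 n (Y i j) /\ congr0 n (Y' i j) & x = pgl (1%:M + Y)].
split=> [[[[B B'] h] -> hB]|[Y [Y' [h hY ->]]]].
 exists (B - 1%:M), (B' - 1%:M); split; first by rewrite !(addrC 1%:M) !subrK.
  by move=> i j; exact: hB.
 by rewrite addrC subrK (pgl_pi h).
exists (Sub _ h); first exact: pgl_pi.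
move=> i j; have := hY i j; rewrite /gmx /gmxV /=.
by rewrite ![1%:M + _]addrC !addrK.
Qed.

Lemma congr_mx n (Y Y' : 'M[A]_2) : (forall i j, congr0 n (Y i j)) -> (forall i j, congr0 n (Y' i j)) ->
 forall i j, congr0 n ((Y + Y' + Y *m Y') i j).
move=> hY hY' i j; have sg := congr0_sgp M n; rewrite mxE mxE mul2E.
apply: (sgpD sg); apply: (sgpD sg) => //; apply: congr0_mul => //; exact: congr0_int (hY' _ _).
Qed.

Lemma congrM n x y : csub n x -> csub n y -> csub n (x * y)%g.
move=> /congrP[Y [Y' [h hY ->]]] /congrP[Z [Z' [h' hZ ->]]].
have e (P Q : 'M[A]_2) : (1%:M + P) *m (1%:M + Q) = 1%:M + (P + Q + P *m Q).
 by rewrite mulmxDl mul1mx mulmxDr mulmx1 addrA [in RHS]addrA [in RHS]addrA -!addrA; congr (_ + _); rewrite addrCA.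
apply/congrP; exists (Y + Z + Y *m Z), (Z' + Y' + Z' *m Y'); split.
- by have := gl2M h h'; rewrite !e.
- by move=> i j; split; apply: congr_mx => i' j'; have [] := hY i' j'; have [] := hZ i' j'.
- by rewrite -(pglM h h') e.
Qed.

Lemma congrV n x : csub n x -> csub n x^-1%g.
move=> /congrP[Y [Y' [h hY ->]]]; apply/congrP; exists Y', Y; split.
- exact: gl2C.
- by move=> i j; have [] := hY i j.
- exact: pglV h.
Qed.

Lemma congr_subgroup1 n : csub n (1%g : G).
apply/congrP; exists 0, 0; rewrite addr0 pgl1; split=> //; first exact: gl2_oneP.
by move=> i j; rewrite mxE; split; exact: (congr0_sgp M n).1.
Qed.

Lemma congr_le n m x : (forall i, (n i <= m i)%N) -> csub m x -> csub n x.
move=> nm /congrP[Y [Y' [h hY ->]]]; apply/congrP; exists Y, Y'; split=> // i j.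
by have [h1 h2] := hY i j; split; apply: congr0_le nm _ _.
Qed.

Lemma nbhs_pgl g (N : set G) :
 nbhs g N <-> exists n, fin_supp n /\ forall k, csub n k -> N (g * k)%g.
split; last first.
 move=> [n [fn hn]]; rewrite nbhsE; exists [set h : G | csub n (g^-1 * h)%g].
  split; last by rewrite /= mulVg; exact: congr_subgroup1.
  exists [set [set h : G | csub n (g^-1 * h)%g]]; last by rewrite bigcup_set1.
  by move=> _ ->; apply: (@finI_from1 _ _ _ id); exists g, n.
 by move=> y /hn; rewrite mulKVg.
rewrite nbhsE => -[B [[D DB <-] [U DU Ux]] BN].
have sA := DB U DU.
suff [n [fn hn]] : exists n, fin_supp n /\ forall k, csub n k -> U (g * k)%g.
 by exists n; split=> // y /hn Uy; apply: BN; exists U.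
move: Ux; move: sA.
apply: (@finI_from_ind _ _ _ _ (fun V => V g -> exists n, fin_supp n /\ forall k, csub n k -> V (g * k)%g)).
- by exists (fun=> 0%N); split=> //; exact: fin_supp0.
- move=> V W hV hW [/hV[n [fn hn]] /hW[m [fm hm]]].
 exists (fun i => maxn (n i) (m i)); split; first exact: fin_supp_max.
 move=> y hy; split; [apply: hn|apply: hm]; apply: congr_le hy => i; [exact: leq_maxl|exact: leq_maxr].
- move=> V [a [n [fn ->]]] /= Vx; exists n; split=> // y hy.
 by rewrite mulgA; apply: congrM.
Qed.

Lemma open_coset (K : set G) g : is_subgroup K -> open K -> open [set (g * k)%g | k in K].
move=> [K1 KK] oK; rewrite openE => _ [k Kk <-].
have /nbhs_pgl[n [fn hn]] : nbhs k K by exact: open_nbhs_nbhs.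
by apply/nbhs_pgl; exists n; split=> // y /hn Ky; exists (k * y)%g => //; rewrite mulgA.
Qed.

Lemma compact_coset (K : set G) g : compact K -> compact [set (g * k)%g | k in K].
apply: continuous_compact; apply: continuous_subspaceT => x N /nbhs_pgl[n [fn hn]].
by apply/nbhs_pgl; exists n; split=> // y hy /=; rewrite mulgA; apply: hn.
Qed.

Lemma inv_subgroup (K : set G) x : is_subgroup K -> K x -> K x^-1%g.
by move=> [K1 KK] Kx; rewrite -[x^-1%g]mul1g; apply: KK. Qed.

Lemma mul_subgroup (K : set G) x y : is_subgroup K -> K x -> K y -> K (x * y)%g.
by move=> sK Kx Ky; rewrite -[y]invgK; apply: sK.2 => //; exact: inv_subgroup. Qed.

Lemma inv_locally_constant (C : pzRingType) (K : set G) (f : G -> C) : is_subgroup K -> open K ->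
 (forall g k, K k -> f (g * k)%g = f g) -> locally_constant f.
move=> [K1 KK] oK hf x; have /nbhs_pgl[n [fn hn]] : nbhs (1%g : G) K by exact: open_nbhs_nbhs.
by apply/nbhs_pgl; exists n; split=> // k /hn; rewrite mul1g; exact: hf.
Qed.

Lemma compact_cosets (K S : set G) : is_subgroup K -> open K -> compact S ->
 exists s : seq G, forall x, S x -> exists2 y, y \in s & K (y^-1 * x)%g.
move=> sK oK; rewrite compact_cover => cS.
have [|x Sx|D _ hD] := cS G S (fun y => [set (y * k)%g | k in K]).
- by move=> y _; exact: open_coset.
- by exists x => //; exists 1%g; rewrite ?mulg1 //; case: sK.
exists (finmap.enum_fset D) => x Sx; have [y Dy [k Kk <-]] := hD x Sx.
by exists y => //; rewrite mulKg.
Qed.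
End Congruence.

Section LocalPowers.
Variables (R : comNzRingType) (O : set R) (t n : R).
Hypotheses (sO : is_subring O) (Ot : O t) (On : O n) (n2 : n * n = 0).

(** The maximal ideal is generated by [t] and [n], and [n * n = 0], so every product of [l + 1] of
    its elements contains at least [l] factors [t]. The lost power is the later shift between powers
    of the maximal ideal and powers of [t]. *)
Lemma local_pow : (forall x, maxid O x -> exists a b, [/\ O a, O b & x = t * a + n * b]) ->
 forall l x, maxid_pow O l.+1 x -> exists a b, [/\ O a, O b & x = t ^+ l * (t * a + n * b)].
have [O1 OB OM] := sO; have O0 : O 0 by rewrite -(subrr 1); apply: OB.
have OD x y : O x -> O y -> O (x + y).
 by move=> Ox Oy; rewrite -[y]opprK; apply: (OB) => //; rewrite -sub0r; apply: (OB).
move=> hm; have sum l (s : seq (R * R)) : (forall u, u \in s -> exists a b,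
  [/\ O a, O b & u.1 * u.2 = t ^+ l * (t * a + n * b)]) ->
  exists a b, [/\ O a, O b & \sum_(u <- s) u.1 * u.2 = t ^+ l * (t * a + n * b)].
 elim: s => [|u s IH] h; first by exists 0, 0; rewrite big_nil !mulr0 addr0 mulr0.
 have [|a [b [Oa Ob e]]] := IH; first by move=> v vs; apply: h; rewrite in_cons vs orbT.
 have [a' [b' [Oa' Ob' e']]] := h u (mem_head _ _).
 exists (a' + a), (b' + b); split; [exact: OD|exact: OD|by rewrite big_cons e e'; ring].
elim=> [|l IH] _ [s sP ->]; apply: sum => u /sP[mu Ou].
 have [a [b [Oa Ob ->]]] := hm _ mu; exists (a * u.2), (b * u.2).
 by split; [exact: OM|exact: OM|ring].
have [a [b [Oa Ob e]]] := hm _ mu; have [a' [b' [Oa' Ob' e']]] := IH _ Ou.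
exists (a * a'), (a * b' + b * a'); split.
- exact: OM.
- by apply: OD; apply: OM.
- rewrite e e' exprS.
 have -> : (t * a + n * b) * (t ^+ l * (t * a' + n * b')) =
  t * t ^+ l * (t * (a * a') + n * (a * b' + b * a')) + t ^+ l * (n * n) * b * b' by ring.
 by rewrite n2; ring.
Qed.

Lemma pow_maxid l y : maxid O t -> O y -> maxid_pow O l (t ^+ l * y).
have [O1 OB OM] := sO; move=> mt Oy.
elim: l => [|l IH]; first by rewrite mul1r.
exists [:: (t, t ^+ l * y)]; last by rewrite big_seq1 /= exprS mulrA.
by move=> u; rewrite inE => /eqP ->.
Qed.
End LocalPowers.

(** Only finitely many coordinates are free, those where some bound is nonzero; the induction frees
    them one at a time with [upd]. *)
Lemma finite_between (I : choiceType) (L U : I -> int) :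
 finite_set [set p | L p <> 0] -> finite_set [set p | U p <> 0] ->
 finite_set [set d : I -> int | forall p, L p <= d p <= U p].
move=> /finite_seqP[r1 h1] /finite_seqP[r2 h2].
have out p : p \notin r1 ++ r2 -> L p = 0 /\ U p = 0.
 rewrite mem_cat negb_or => /andP[n1 n2]; split; apply: contrapT => hp.
  by have : [set p | L p <> 0] p by []; rewrite h1 /=; exact/negP.
 by have : [set p | U p <> 0] p by []; rewrite h2 /=; exact/negP.
apply: (@sub_finite_set _ _ [set d : I -> int | (forall p, p \in r1 ++ r2 -> L p <= d p <= U p) /\
  (forall p, p \notin r1 ++ r2 -> d p = 0)]).
 move=> d hd; split=> [p _|p np]; first exact: hd.
 by have := hd p; have [-> ->] := out p np; lia.
elim: (r1 ++ r2) => {out} [|q r IH].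
 by apply: (sub_finite_set _ (finite_set1 (fun _ : I => 0 : int))) => d [_ h]; apply/funext => p; exact: h.
have [qr|qr] := boolP (q \in r).
 apply: sub_finite_set IH => d [h3 h4]; split=> p hp; [apply: h3|apply: h4]; rewrite in_cons; first by rewrite hp orbT.
 by rewrite negb_or hp andbT; apply: contraNneq hp => ->.
pose upd (v : int) (d : I -> int) p := if p == q then v else d p.
have fi : finite_set [set v : int | L q <= v <= U q].
 apply: (sub_finite_set _ (finite_image (fun n : nat => L q + n%:Z) (finite_II `|U q - L q|.+1))) => v /= /andP[h3 h4].
 by exists `|v - L q|%N => /=; lia.
apply: (sub_finite_set _ (finite_image2 upd fi IH)) => d [h3 h4].
exists (d q); first by apply: h3; rewrite mem_head.
exists (upd 0 d); last by apply/funext => p; rewrite /upd; case: eqP => [->|].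
split=> p hp; rewrite /upd; case: eqVneq => [pq|pq] //.
- by rewrite pq (negPf qr) in hp.
- by apply: h3; rewrite in_cons hp orbT.
- by apply: h4; rewrite in_cons negb_or pq.
Qed.

(* If the [phi (-) b] are periodic under a common subgroup of finite index, one
  finite average computes all their means. *)
Lemma mean_swap (C : numFieldType) (T1 T2 : zmodType) (phi : T1 -> T2 -> C) (m : T1 -> C) (U : set T1) s :
 sgp U -> covers s setT U -> (forall y x b, U y -> phi (y + x) b = phi x b) ->
 (forall b, meanon setT (phi^~ b) 0) -> (forall x, meanon setT (phi x) (m x)) -> meanon setT m 0.
have sT (T : zmodType) : sgp [set: T] by [].
move=> sU cs per h1 h2; have [t [_ _ it ct]] := transversal sU cs.
have t0 : t != [::] by have [y yt _] := ct 0 Logic.I; apply: contraTneq yt => ->.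
have key b x : \sum_(a <- t) phi (a + x) b = 0.
 have st := @sum_transversal C T1 setT (sT T1) t U (phi^~ b) sU (fun _ _ => Logic.I) (fun _ _ => Logic.I) it ct
  (fun u x Uu _ => per u x b Uu).
 rewrite (st x Logic.I).
 have hm : meanon setT (phi^~ b) ((size t)%:R^-1 * \sum_(a <- t) phi a b).
  exists t; split=> // y _; rewrite (st y Logic.I) mulVKf //; exact: natr_neq0.
 have := mean_uniq (sT T1) hm (h1 b) => /eqP; rewrite mulf_eq0 invr_eq0 => /orP[|/eqP //].
 by rewrite (negPf (natr_neq0 C t0)).
exists t; split=> // x _; rewrite mulr0.
have hs : meanon setT (fun b => \sum_(a <- t) phi (a + x) b) (\sum_(a <- t) m (a + x)).
 exact: (@mean_sum C T2 setT (sT T2) _ t xpredT (fun a b => phi (a + x) b)).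
apply: (mean_uniq (sT T2) hs); apply: (mean_ext (sT T2) _ (mean_cst (sT T2) 0)) => b _.
by rewrite key.
Qed.

#[local] Opaque pgl unip pgl_mul pgl_inv.

(** * Hecke operators as finite sums of translations *)

Section HeckeOperators.
Variables (I : choiceType) (F : comNzRingType) (O : I -> set F).
Variable M : completions O.
Notation G := (PGL2A M).
Variables (C : numFieldType) (K : set G) (h : (G -> C) -> C).
Hypotheses (sK : is_subgroup K) (oK : open K) (hh : hecke K h).
Implicit Types (phi : G -> C) (s : seq G).

Definition right_inv phi := forall x y, K y -> phi (x * y)%g = phi x.
Let first s (x : G) := find (fun y => `[<K (y^-1 * x)%g>]) s.
(** [find] takes the first matching coset, so for [i] below the length of [s] these are disjoint
    indicators even if cosets repeat in the list, and they sum to 1 on the covered set. *)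
Definition at_coset s i : G -> C := fun x => (first s x == i)%:R.

Let lc phi : right_inv phi -> locally_constant phi.
exact: inv_locally_constant. Qed.

Let first_inv s x y : K y -> first s (x * y)%g = first s x.
move=> Ky; apply: eq_find => z; apply: asbool_equiv_eq.
have e : (z^-1 * (x * y) = z^-1 * x * y)%g := mulgA _ _ _.
split=> [|hz]; last by rewrite e; exact: mul_subgroup.
rewrite e => hz; have := mul_subgroup sK hz (inv_subgroup sK Ky).
by rewrite (mulgK y (z^-1 * x)%g).
Qed.

Lemma at_coset_inv s i : right_inv (at_coset s i).
by move=> x y Ky; rewrite /at_coset first_inv. Qed.

Let lin c phi phi' : right_inv phi -> right_inv phi' ->
 h (fun x => c * phi x + phi' x) = c * h phi + h phi'.
by move=> /lc a /lc b; exact: hecke_lin hh _ _ _ a b. Qed.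

Let h0 : h (fun=> 0) = 0.
by have [S _ hS] := hecke_supp hh; apply: hS => // x; near=> y. Unshelve. all: by end_near. Qed.

Lemma hecke_sum n (c : 'I_n -> C) (phi : 'I_n -> G -> C) : (forall i, right_inv (phi i)) ->
 h (fun x => \sum_i c i * phi i x) = \sum_i c i * h (phi i).
elim: n c phi => [|n IH] c phi rp.
 rewrite big_ord0; have -> : (fun x => \sum_(i < 0) c i * phi i x) = (fun=> 0) by apply/funext => x; rewrite big_ord0.
 exact: h0.
have -> : (fun x => \sum_(i < n.+1) c i * phi i x) = (fun x => c o0 * phi o0 x + \sum_(i < n) c (lift o0 i) * phi (lift o0 i) x).
 by apply/funext => x; rewrite big_ord_recl.
rewrite big_ord_recl lin; last first.
- by move=> x y Ky; apply: eq_bigr => i _; rewrite rp.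
- exact: rp.
by rewrite IH // => i; exact: rp.
Qed.

(** The compact support meets finitely many cosets of [K], and a right-invariant function is
    constant on each; [h] thus becomes a finite combination of point evaluations. *)
Lemma hecke_finite : exists s, forall phi, right_inv phi ->
 h phi = \sum_(i < size s) h (at_coset s i) * phi (tnth (in_tuple s) i).
have [S cS hS] := hecke_supp hh; have [s hs] := compact_cosets sK oK cS; exists s => phi rp.
pose sphi x := \sum_(i < size s) phi (tnth (in_tuple s) i) * at_coset s i x.
have rs : right_inv sphi by move=> x y Ky; apply: eq_bigr => i _; rewrite at_coset_inv.
have d0 : h (fun x => -1 * sphi x + phi x) = 0.
 apply: hS; first by apply: lc => x y Ky; rewrite rs // rp.
 move=> x Sx; have [y ys Ky] := hs x Sx.
 have hx : has (fun y => `[<K (y^-1 * x)%g>]) s by apply/hasP; exists y => //; exact/asboolP.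
 have lt : (first s x < size s)%N by rewrite -has_find.
 pose i0 := Ordinal lt.
 rewrite /sphi (bigD1 i0) //= big1 => [|i ii]; last first.
  rewrite /at_coset; case: eqP => [e|_]; last by rewrite mulr0.
  by case/eqP: ii; apply: val_inj; rewrite /= e.
 rewrite /at_coset eqxx mulr1 addr0 (tnth_nth y) /=.
 have /asboolP Kx := nth_find y hx.
 have e : (nth y s (first s x) * ((nth y s (first s x))^-1 * x) = x)%g := mulKVg _ _.
 rewrite -{2}e rp; last exact: Kx.
 by rewrite mulN1r addNr.
move: d0; rewrite lin // mulN1r => /eqP; rewrite addrC subr_eq0 => /eqP ->.
rewrite /sphi hecke_sum; last by move=> i; exact: at_coset_inv.
by apply: eq_bigr => i _; rewrite mulrC.
Qed.

Lemma hecke_act_finite : exists s, forall f, right_inv f -> forall g,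
 hecke_act h f g = \sum_(i < size s) h (at_coset s i) * f (g * tnth (in_tuple s) i)%g.
have [s hs] := hecke_finite; exists s => f rf g; apply: (hs (fun x => f (g * x)%g)) => x y Ky.
by apply: etrans (rf _ _ Ky); apply: congr1; exact: mulgA.
Qed.

(** Right translation of the result by [K] becomes left translation of the integration variable,
    whence the use of [hecke_left]. *)
Lemma hecke_act_inv f : right_inv f -> right_inv (hecke_act h f).
move=> rf g y Ky; apply: etrans (hecke_left hh Ky _).
 by rewrite /hecke_act; apply: congr1; apply/funext => x; apply: congr1; exact: esym (mulgA _ _ _).
apply: lc => x z Kz; apply: etrans (rf _ _ Kz); apply: congr1; exact: mulgA.
Qed.
End HeckeOperators.

#[local] Transparent pgl unip pgl_mul pgl_inv.

(** * Algebraic dependence over polynomial rings *)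

Section FunctionField.
Variables (k : finFieldType) (E : fieldType) (iota : {rmorphism k -> E}).
Notation place := (place iota).

Definition ev (x : E) (P : {poly k}) : E := (map_poly iota P).[x].
Lemma evD x P Q : ev x (P + Q) = ev x P + ev x Q.
by rewrite /ev rmorphD hornerD. Qed.
Lemma evM x P Q : ev x (P * Q) = ev x P * ev x Q.
by rewrite /ev rmorphM hornerM. Qed.
Lemma evC x a : ev x a%:P = iota a.
by rewrite /ev map_polyC hornerC. Qed.
Lemma ev0 x : ev x 0 = 0. by rewrite /ev rmorph0 horner0. Qed.
Lemma ev1 x : ev x 1 = 1. by rewrite /ev rmorph1 hornerC. Qed.
Lemma evX x : ev x 'X = x. by rewrite /ev map_polyX hornerX. Qed.
Lemma evN x P : ev x (- P) = - ev x P.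
by rewrite /ev rmorphN hornerN. Qed.
Lemma evXn x P n : ev x (P ^+ n) = ev x P ^+ n.
by elim: n => [|n IH]; rewrite ?ev1 // !exprS evM IH. Qed.
Lemma ev_sum x I (r : seq I) P (F : I -> {poly k}) :
 ev x (\sum_(i <- r | P i) F i) = \sum_(i <- r | P i) ev x (F i).
exact: (big_morph _ (evD x) (ev0 x)). Qed.
Lemma ev_poly x n (c : nat -> k) : ev x (\poly_(i < n) c i) = \sum_(i < n) iota (c i) * x ^+ i.
rewrite poly_def ev_sum; apply: eq_bigr => i _.
by rewrite -mul_polyC evM evC evXn evX.
Qed.

(** For transcendental [x] this says that [N] exceeds the degree of E over k(x), with no fraction
    field formed. For algebraic [x] and positive [N], a polynomial killing [x] gives it at once. *)
Definition dep_bound (x : E) (N : nat) := forall y : 'I_N -> E,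
 exists c : 'I_N -> {poly k}, (exists i, c i != 0) /\ \sum_i ev x (c i) * y i = 0.

Section Coordinates.
Variables (t : E) (n : nat) (b : 'I_n -> E).
Hypothesis t_tr : forall P, ev t P = 0 -> P = 0.
Hypothesis b_gen : forall x, exists (Q : {poly k}) (P : 'I_n -> {poly k}),
 Q != 0 /\ x * ev t Q = \sum_i ev t (P i) * b i.

Lemma common_denominator (I : finType) (z : I -> E) :
 exists (D : {poly k}) (P : I -> 'I_n -> {poly k}) (e : nat),
 [/\ D != 0, forall i, z i * ev t D = \sum_l ev t (P i l) * b l
  & forall i l, (size (P i l) <= e)%N].
have /choice[Q hQ] : forall i, exists Q : {poly k}, Q != 0 /\
  exists P : 'I_n -> {poly k}, z i * ev t Q = \sum_l ev t (P l) * b l.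
 by move=> i; have [Q [P [? ?]]] := b_gen (z i); exists Q; split=> //; exists P.
have /choice[P hP] i := (hQ i).2.
pose D := \prod_i Q i; pose D' i := \prod_(j | j != i) Q j.
exists D, (fun i l => P i l * D' i), (\max_i \max_l size (P i l * D' i)%R)%N.
split.
- by rewrite prodf_seq_neq0; apply/allP => i _; rewrite (hQ i).1.
- move=> i; rewrite /D (bigD1 i) //= evM mulrA hP mulr_suml.
 by apply: eq_bigr => l _; rewrite evM mulrAC.
- move=> i l; apply: leq_trans (leq_bigmax i).
 exact: (@leq_bigmax _ (fun l => size (P i l * D' i)%R)).
Qed.

Lemma size_sum_leq I (r : seq I) (P : pred I) (F : I -> {poly k}) m :
 (forall i, P i -> (size (F i) <= m)%N) -> (size (\sum_(i <- r | P i) F i)%R <= m)%N.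
move=> h; apply: (big_ind (fun p : {poly k} => (size p <= m)%N)) => [|p q sp sq|//].
 by rewrite size_poly0.
by apply: leq_trans (size_polyD _ _) _; rewrite geq_max sp.
Qed.

(** Counting of unknowns as in Siegel's lemma: in coordinates over k[t] the element [x ^+ a * y m]
    has degrees growing linearly in [a], with a slope bounded by a [c] that does not depend on [y].
    So more than [n * c] elements satisfy a relation whose coefficients have degree below a large
    [L]. *)
Lemma dep_bound_exists x : exists N, dep_bound x N.
have [dx [X [ex [dx0 Xx sX]]]] := common_denominator (fun _ : unit => x).
have [d0 [B [e0 [d00 Bb sB]]]] := common_denominator (fun ij : 'I_n * 'I_n => b ij.1 * b ij.2).
pose c1 := size (dx * d0); pose c := (ex + e0 + c1)%N.
exists (n * c).+1 => y.
have [dy [Y [ey [dy0 Yy sY]]]] := common_denominator y.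
pose d := dx * d0.
have coord m a : exists P : 'I_n -> {poly k}, x ^+ a * y m * ev t (dy * d ^+ a)
  = \sum_l ev t (P l) * b l /\ forall l, (size (P l) <= ey + a * (ex + e0))%N.
 elim: a => [|a [P [eP sP]]].
  exists (Y m); split; first by rewrite expr0 mulr1 mul1r.
  by move=> l; rewrite mul0n addn0.
 exists (fun l => \sum_i \sum_j X tt i * P j * B (i, j) l); split; last first.
  move=> l; apply: size_sum_leq => i _; apply: size_sum_leq => j _.
  apply: leq_trans (size_polyMleq _ _) _.
  have := size_polyMleq (X tt i) (P j); have := sX tt i; have := sB (i, j) l.
  have := sP j; rewrite mulSn; lia.
 transitivity ((x * ev t dx) * (x ^+ a * y m * ev t (dy * d ^+ a)) * ev t d0).
  by rewrite exprS [d ^+ a.+1]exprS !evM; ring.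
 rewrite (Xx tt) eP.
 transitivity (\sum_i \sum_j ev t (X tt i) * ev t (P j) * (b i * b j * ev t d0)).
  rewrite big_distrlr mulr_suml; apply: eq_bigr => i _; rewrite mulr_suml.
  by apply: eq_bigr => j _ /=; ring.
 under eq_bigr => i _ do under eq_bigr => j _ do rewrite (Bb (i, j)) mulr_sumr.
 under [RHS]eq_bigr => l _ do rewrite ev_sum mulr_suml.
 rewrite [RHS]exchange_big; apply: eq_bigr => i _ /=.
 under [RHS]eq_bigr => l _ do rewrite ev_sum mulr_suml.
 rewrite [RHS]exchange_big; apply: eq_bigr => j _ /=.
 by apply: eq_bigr => l _; rewrite !evM mulrA.
(* There are [(n * c + 1) * L] unknown coefficients and [n * (ey + L * c)] equations;
   [L = n * ey + 1] is the first value for which unknowns outnumber equations. *)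
pose L := (n * ey).+1.
have /choice[Q hQ] : forall ma : 'I_(n * c).+1 * 'I_L, exists Q : 'I_n -> {poly k},
  x ^+ ma.2 * y ma.1 * ev t (dy * d ^+ L) = \sum_l ev t (Q l) * b l /\
  forall l, (size (Q l) <= ey + L * c)%N.
 move=> [m a] /=; have [P [eP sP]] := coord m a.
 exists (fun l => P l * d ^+ (L - a)); split.
  transitivity (x ^+ a * y m * ev t (dy * d ^+ a) * ev t (d ^+ (L - a))).
   by rewrite -[RHS]mulrA -evM -[in RHS](mulrA dy) -exprD subnKC // ltnW.
  by rewrite eP mulr_suml; apply: eq_bigr => l _; rewrite evM mulrAC.
 move=> l; apply: leq_trans (size_polyMleq _ _) _.
 have aL := ltn_ord a; have := sP l; have := size_poly_exp_leq d (L - a).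
 rewrite -/c1 /c; set s1 := size (d ^+ _); set s2 := size (P l) => h1 h2.
 have h3 : (c1.-1 * (L - a) <= c1 * (L - a))%N by rewrite leq_mul2r leq_pred orbT.
 have -> : (L * (ex + e0 + c1) = a * (ex + e0) + (L - a) * (ex + e0) + L * c1)%N.
  by rewrite -mulnDl subnKC ?mulnDr // ltnW.
 have h4 : (c1 * (L - a) <= L * c1)%N by rewrite mulnC leq_mul2r leq_subr orbT.
 have h5 : (s1 <= (L * c1).+1)%N by apply: leq_trans h1 _; apply: leq_trans h3 h4.
 move: h2 h5; move: (a * (ex + e0))%N ((L - a) * (ex + e0))%N (L * c1)%N => A1 B1 C1.
 lia.
have [|cc [[m0 a0] cc0] cc1] := @small_rank_relation k ('I_(n * c).+1 * 'I_L)%type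
  ('I_n * 'I_(ey + L * c))%type (fun ma le => (Q ma le.1)`_(le.2)).
 rewrite !card_prod !card_ord mulnDr mulSn mulnA (mulnAC n L) -addSn -/L.
 by rewrite leq_add2l.
have Q0 l : \sum_ma (cc ma)%:P * Q ma l = 0.
 apply/polyP => e; rewrite coef0 coef_sum.
 have [eb|eb] := ltnP e (ey + L * c).
  by rewrite -[RHS](cc1 (l, Ordinal eb)); apply: eq_bigr => ma _; rewrite coefCM.
 apply: big1 => ma _; rewrite coefCM nth_default ?mulr0 //.
 exact: leq_trans ((hQ ma).2 l) eb.
exists (fun m => \sum_(a < L) (cc (m, a))%:P * 'X^a); split.
 exists m0; apply: contra_neq cc0 => /(congr1 (fun p : {poly k} => p`_a0)).
 rewrite coef0 coef_sum (bigD1 a0) //= coefCM coefXn eqxx mulr1 big1 ?addr0 // => a aa0.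
 by rewrite coefCM coefXn eq_sym (inj_eq val_inj) (negPf aa0) mulr0.
have nz : ev t (dy * d ^+ L) != 0.
 apply/eqP => /t_tr/eqP; apply/negP.
 by rewrite mulf_neq0 // expf_neq0 // mulf_neq0.
apply: (mulIf nz); rewrite mul0r mulr_suml.
transitivity (\sum_m \sum_a ev t (cc (m, a))%:P * (x ^+ a * y m * ev t (dy * d ^+ L))).
 apply: eq_bigr => m _; rewrite ev_sum !mulr_suml; apply: eq_bigr => a _.
 by rewrite (evM x) (evXn x 'X a) evX !evC; ring.
rewrite pair_bigA /=.
transitivity (\sum_ma \sum_l ev t ((cc ma)%:P * Q ma l) * b l).
 apply: eq_bigr => -[m a] _ /=; rewrite (hQ (m, a)).1 mulr_sumr.
 by apply: eq_bigr => l _; rewrite evM mulrA.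
rewrite exchange_big big1 // => l _.
by rewrite -mulr_suml -ev_sum Q0 ev0 mul0r.
Qed.
End Coordinates.

Lemma ev_C_mod x P : exists q, ev x P = iota P.[0] + x * ev x q.
have /factor_theorem[q e] : root (P - P.[0]%:P) 0 by rewrite /root !hornerE subrr.
exists q; rewrite -[P in LHS](subrK P.[0]%:P) evD evC e subr0 evM evX mulrC addrC.
by [].
Qed.

(** Common factors X are divided out, the size of one nonzero coefficient serving as measure;
    afterwards the relation remains nontrivial modulo [x]. *)
Lemma dep_primitive x N (y : 'I_N -> E) (c : 'I_N -> {poly k}) : x != 0 ->
 (exists i, c i != 0) -> \sum_i ev x (c i) * y i = 0 ->
 exists c' : 'I_N -> {poly k},
  (exists i, (c' i).[0] != 0) /\ \sum_i ev x (c' i) * y i = 0.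
move=> x0 [i0]; move: {2}(size _) (leqnn (size (c i0))) => n.
elim: n c => [|n IH] c.
 by rewrite leqn0 size_poly_eq0 => ->.
move=> sc ci0 cz; have [[i ci]|nc] := pselect (exists i, (c i).[0] != 0).
 by exists c; split=> //; exists i.
have cX i : c i = (c i %/ 'X) * 'X.
 rewrite divpK // -['X]subr0 -[0 in X in _ - X]/(0%:P) dvdp_XsubCl.
 by apply/negPn/negP => ci; apply: nc; exists i.
apply: (IH (fun i => c i %/ 'X)).
- move: sc ci0; rewrite {1 2}(cX i0); have [->|q0] := eqVneq (c i0 %/ 'X) 0.
  by rewrite size_poly0.
 by rewrite size_mulX.
- by move: ci0; rewrite {1}(cX i0); apply: contra_neq => ->; rewrite mul0r.
- apply: (mulfI x0); rewrite mulr0 mulr_sumr -[RHS]cz; apply: eq_bigr => i _.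
 by rewrite {2}(cX i) evM evX; ring.
Qed.

Definition transc x := forall P, ev x P = 0 -> P = 0.

Hypothesis ff : is_function_field iota.

Lemma dep_boundP x : exists N, dep_bound x N.
by have [t [tt [n [b hb]]]] := ff; apply: (dep_bound_exists tt hb). Qed.

Lemma tr_exists : exists t, transc t.
by have [t [tt _]] := ff; exists t. Qed.

(** The constant terms are what survives at a place where [x] vanishes; discreteness of valuations,
    finiteness of residue fields and finiteness of zeros all come from evaluating such a
    relation. *)
Lemma dependent x : x != 0 -> exists N, forall y : nat -> E,
 exists c : nat -> {poly k},
  (exists2 j, (j < N)%N & (c j).[0] != 0) /\ \sum_(i < N) ev x (c i) * y i = 0.
move=> x0; have [N hN] := dep_boundP x; exists N => y.
have [c [c0 cy]] := hN (fun i : 'I_N => y i).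
have [c' [[i c'0] c'y]] := dep_primitive x0 c0 cy.
exists (fun j => if insub j is Some o then c' o else 0); split.
 by exists i => //; rewrite valK.
by rewrite -[RHS]c'y; apply: eq_bigr => j _; rewrite valK.
Qed.

(** * Places as discrete valuations with finite residue field *)

Section Place.
Variable p : place.
Notation O := (pring p).

Let vr : is_valuation_ring iota O := place_ringP p.

Lemma prc a : O (iota a). exact: vr_const vr a. Qed.
Definition pr1 := sr1 (vr_subring vr).
Definition prB := srB (vr_subring vr).
Definition prM := srM (vr_subring vr).
Definition pr0 := sr0 (vr_subring vr).
Definition prN := srN (vr_subring vr).
Definition prD := srD (vr_subring vr).
Definition prX := srX (vr_subring vr).
Definition pr_sum := sr_sum (vr_subring vr).
Lemma prV x : ~ O x -> O x^-1. by case: (vr_total vr x). Qed.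
Lemma pr_ev x P : O x -> O (ev x P).
move=> Ox; rewrite -[P]coefK ev_poly; apply: pr_sum => i _.
by apply: prM; [apply: prc|apply: prX].
Qed.

Lemma maxidE x : maxid O x <-> x = 0 \/ ~ O x^-1.
split=> [[Ox nx]|[->|nx]].
- have [->|x0] := eqVneq x 0; [by left|right=> Oxv; apply: nx].
 by exists x^-1; rewrite mulfV.
- by split; [exact: pr0|move=> [y [_ /eqP]]; rewrite mul0r eq_sym oner_eq0].
- split; first by rewrite -[x]invrK; apply: prV.
 move=> [y [Oy xy]]; apply: nx; have <- // : y = x^-1.
 by apply: (mulfI (x := x)); [apply: contra_eq_neq xy => ->; rewrite mul0r eq_sym oner_eq0 | rewrite xy mulfV //; apply: contra_eq_neq xy => ->; rewrite mul0r eq_sym oner_eq0].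
Qed.

Lemma max_pr x : maxid O x -> O x. by case. Qed.
Lemma max0 : maxid O 0. by apply/maxidE; left. Qed.
Lemma maxM a x : O a -> maxid O x -> maxid O (a * x).
move=> Oa [Ox nx]; split; first exact: prM.
by move=> [y [Oy e]]; apply: nx; exists (a * y); split; [exact: prM|rewrite mulrCA mulrA].
Qed.
Lemma max1 : ~ maxid O 1.
by move=> /maxidE[/eqP|]; rewrite ?oner_eq0 // invr1; apply; exact: pr1. Qed.
Lemma maxD x y : maxid O x -> maxid O y -> maxid O (x + y).
have aux a b : maxid O a -> maxid O b -> O (a / b) -> b != 0 -> maxid O (a + b).
 move=> ma mb Oab b0; have -> : a + b = (a / b + 1) * b by rewrite mulrDl mul1r divfK.
 by apply: maxM mb; apply: prD pr1.
move=> mx my; have [->|x0] := eqVneq x 0; first by rewrite add0r.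
have [->|y0] := eqVneq y 0; first by rewrite addr0.
have [Oxy|/prV] := pselect (O (x / y)); first exact: aux.
by rewrite invf_div addrC => ?; apply: aux.
Qed.
Lemma maxN x : maxid O x -> maxid O (- x).
by move=> mx; rewrite -mulN1r; apply: maxM mx; apply/prN/pr1. Qed.
Lemma max_sum I (r : seq I) (P : pred I) (F : I -> E) :
 (forall i, P i -> maxid O (F i)) -> maxid O (\sum_(i <- r | P i) F i).
by apply: big_ind; [exact: max0 | exact: maxD]. Qed.
Lemma max_const a : maxid O (iota a) -> a = 0.
move=> ma; apply/eqP; apply: contra_notT max1 => a0.
by rewrite -(rmorph1 iota) -(mulVf a0) rmorphM; apply: maxM ma; apply: prc.
Qed.

Lemma ev_max x P : maxid O x -> maxid O (ev x P) -> P.[0] = 0.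
move=> mx mP; have [q e] := ev_C_mod x P; apply: max_const.
have -> : iota P.[0] = ev x P - ev x q * x by rewrite e mulrC addrK.
by apply: maxD => //; apply/maxN/maxM => //; apply/pr_ev/max_pr.
Qed.

Lemma max_transc x : maxid O x -> x != 0 -> transc x.
move=> mx x0 P Px; apply/eqP; apply: contra_eqT Px => P0; apply/eqP => Px.
have [||c [[i ci] /eqP]] := @dep_primitive x 1 (fun=> 1) (fun=> P) x0.
- by exists o0.
- by rewrite big_ord1 Px mul0r.
rewrite big_ord1 mulr1 => /eqP ce; move: ci; rewrite (ord1 i) => /eqP; apply.
by apply: (@ev_max x) => //; rewrite ce; exact: max0.
Qed.

(** Discreteness of the valuation. In a relation between the [y i] over k[x], let [j] be the last
    index whose coefficient has nonzero constant term. Divided by [y j], an earlier term lies in the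
    maximal ideal, and a later one is a multiple of [(x / y j) * y i], so it does too. The
    coefficient of index [j] would then vanish at the place, against [ev_max]. *)
Lemma chain_bound x : maxid O x -> x != 0 -> exists N : nat, forall y : nat -> E,
 y 0%N = x -> (forall i, (i < N)%N -> y i != 0 /\ maxid O (y i)) ->
 (forall i, (i.+1 < N)%N -> maxid O (y i / y i.+1)) -> False.
move=> mx x0; have [N hN] := dependent x0; exists N => y y0 ym yc.
have [c [[j1 j1N cj1] cy]] := hN y.
have exj : exists j, (j < N)%N && ((c j).[0] != 0) by exists j1; rewrite j1N.
have ubj j : (j < N)%N && ((c j).[0] != 0) -> (j <= N)%N by case/andP => /ltnW.
have [j /andP[jN cj] jmax] := ex_maxnP exj ubj.
have lt i l : (l < N)%N -> (i < l)%N -> maxid O (y i / y l).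
 elim: l => // l IH lN; rewrite ltnS leq_eqVlt => /orP[/eqP ->|il]; first exact: yc.
 have -> : y i / y l.+1 = (y l / y l.+1) * (y i / y l).
  have := (ym l (ltnW lN)).1; set a := y i; set b := y l => b0.
  by field; rewrite b0 (ym _ lN).1.
 by apply: maxM; [apply/max_pr/yc|apply: IH => //; apply: ltnW].
have [yj0 _] := ym j jN.
suff : maxid O (ev x (c j)) by move=> /(ev_max mx)/eqP; apply/negP.
have e : \sum_(i < N) ev x (c i) * (y i / y j) = 0.
 by under eq_bigr => i _ do rewrite mulrA; rewrite -mulr_suml cy mul0r.
move: e; rewrite (bigD1 (Ordinal jN)) //= divff // mulr1 => /eqP.
rewrite addr_eq0 => /eqP ->; apply/maxN/max_sum => i ij.
have Ox := max_pr mx.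
have [lij|lji|eij] := ltngtP i j; last by rewrite -val_eqE /= eij eqxx in ij.
 by apply: maxM; [apply: pr_ev|apply: lt].
have [q ->] := ev_C_mod x (c i).
have -> : (c i).[0] = 0.
 by apply/eqP; apply: contraTT lji => ci; rewrite -leqNgt; apply: jmax; rewrite ltn_ord.
rewrite rmorph0 add0r -mulrA mulrCA; apply: maxM; first exact: pr_ev.
rewrite mulrCA mulrC; apply: maxM; last exact: (ym i (ltn_ord i)).2.
case: j {cj jmax lji ij exj ubj} jN yj0 => [|j] jN yj0.
 by rewrite y0 mulfV //; exact: pr1.
by rewrite -y0; apply/max_pr/lt.
Qed.

Lemma maxid_neq0 : exists2 x, maxid O x & x != 0.
have [x nx] : exists x, ~ O x.
 apply: contrapT => nex; apply: (vr_proper vr); apply/seteqP; split=> // x _.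
 by apply: contrapT => nx; apply: nex; exists x.
exists x^-1; first by apply/maxidE; right; rewrite invrK.
by rewrite invr_eq0; apply: contra_notN nx => /eqP ->; exact: pr0.
Qed.

(** If no element generated the maximal ideal, each nonzero one would be a proper multiple of
    another inside it, giving chains of unbounded length. *)
Lemma uniformizer_exists : exists t, is_uniformizer p t.
apply: contrapT => nex.
have /choice[f hf] : forall t, exists y, maxid O t -> t != 0 ->
  [/\ maxid O y, y != 0 & maxid O (t / y)].
 move=> t; have [[mt t0]|nt] := pselect (maxid O t /\ t != 0); last first.
  by exists 0 => mt t0; case: nt.
 apply: contrapT => ny; apply: nex; exists t => x; split; last first.
  by move=> [y Oy ->]; rewrite mulrC; apply: maxM.
 move=> mx; exists (x / t); last by rewrite mulrC divfK.
 have [->|x0] := eqVneq x 0; first by rewrite mul0r; exact: pr0.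
 apply: contrapT => nO; apply: ny; exists x => _ _; split=> //.
 by apply/maxidE; right; rewrite invf_div.
have [x mx x0] := maxid_neq0; have [N hN] := chain_bound mx x0.
have it i : maxid O (iter i f x) /\ iter i f x != 0.
 by elim: i => [//|i [m1 m2]] /=; have [] := hf _ m1 m2.
apply: (hN (fun i => iter i f x)) => // [i _|i _]; first by have [] := it i.
by have [m1 m2] := it i; have [] := hf _ m1 m2.
Qed.

Definition unif : E := xget 0 [set t | is_uniformizer p t].
Lemma unifP : is_uniformizer p unif.
by have [t tu] := uniformizer_exists; apply: (@xgetI _ 0 [set t | is_uniformizer p t] t). Qed.

Lemma unif_max t : is_uniformizer p t -> maxid O t.
by move=> tu; apply/tu; exists 1; rewrite ?mulr1 //; exact: pr1. Qed.

Lemma unif_neq0 t : is_uniformizer p t -> t != 0.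
move=> tu; have [x mx x0] := maxid_neq0; apply: contraNneq x0 => t0.
by have [y _ ->] := (tu x).1 mx; rewrite t0 mul0r.
Qed.

Let unif0 : unif != 0. exact: unif_neq0 unifP. Qed.
Lemma unif_exp n : O (unif ^ n) <-> (0 <= n :> int).
split; last by case: n => // n _; apply/prX/max_pr/unif_max/unifP.
case: n => // n; rewrite NegzE => On; case: (@max1).
have -> : 1 = unif ^ n * unif ^ (- n.+1%:Z) * unif :> E.
 by rewrite mulrAC -exprSzr ?unitfE // -expfzDr // subrr.
apply: maxM; last exact/unif_max/unifP.
by apply: prM On; apply/prX/max_pr/unif_max/unifP.
Qed.

(** Order at least [n], in a form that includes 0 and does not presuppose [ord]. *)
Definition vge (n : int) (x : E) := O (x * unif ^ (- n)).
Lemma vge0n x : vge 0 x <-> O x. by rewrite /vge oppr0 expr0z mulr1. Qed.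
Lemma vge_0 n : vge n 0. by rewrite /vge mul0r; exact: pr0. Qed.
Lemma vgeB n x y : vge n x -> vge n y -> vge n (x - y).
by rewrite /vge mulrBl; exact: prB. Qed.
Lemma vgeD n x y : vge n x -> vge n y -> vge n (x + y).
by rewrite /vge mulrDl; exact: prD. Qed.
Lemma vgeN n x : vge n x -> vge n (- x).
by rewrite /vge mulNr; exact: prN. Qed.
Lemma vge_sum n I (r : seq I) (P : pred I) (F : I -> E) :
 (forall i, P i -> vge n (F i)) -> vge n (\sum_(i <- r | P i) F i).
by apply: big_ind; [exact: vge_0 | exact: vgeD]. Qed.
Lemma vgeM m n x y : vge m x -> vge n y -> vge (m + n) (x * y).
by move=> vx vy; rewrite /vge opprD expfzDr // mulrACA; apply: prM. Qed.
Lemma vge_le m n x : m <= n -> vge n x -> vge m x.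
move=> mn vx; rewrite /vge; have -> : - m = - n + (n - m) by rewrite addrA addNr add0r.
by rewrite expfzDr // mulrA; apply: prM vx _; apply/unif_exp; rewrite subr_ge0.
Qed.
Lemma vge_unif n : vge n (unif ^ n).
by rewrite /vge -expfzDr // subrr; exact: pr1. Qed.
Lemma maxid_vge x : maxid O x <-> vge 1 x.
rewrite /vge; split=> [/unifP[y Oy ->]|Ox]; first by rewrite mulrC mulKf.
by apply/unifP; exists (x * unif ^ (- 1)) => //; rewrite mulrC divfK.
Qed.

Let ord_ex x : x != 0 -> exists n : int, vge n x /\ O (x^-1 * unif ^ n).
have main z : z != 0 -> O z -> exists n : nat, vge n z /\ O (z^-1 * unif ^ n).
 move=> z0 Oz.
 have exn : exists n : nat, ~ vge n.+1 z.
  apply: contrapT => nex.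
  have vz n : vge n.+1 z by apply: contrapT => nv; apply: nex; exists n.
  have mz : maxid O z by apply/maxid_vge/(vz 0%N).
  have [N hN] := chain_bound mz z0.
  (* The forbidden chain is [z], then the powers of the uniformizer with exponents [N - 1] down to
     1; it would exist if [z] were divisible by all powers. *)
  apply: (hN (fun i => if i is 0%N then z else unif ^ (N - i)%N)) => //.
   case=> [//|i] iN; split; first exact: expfz_neq0.
   by apply/maxid_vge; apply: (@vge_le 1 (N - i.+1)%N); [lia|exact: vge_unif].
  case=> [|i] iN; apply/maxid_vge.
   rewrite invr_expz; apply: (@vge_le 1 (N%:Z + (- (N - 1)%N%:Z))); first lia.
   apply: vgeM; last exact: vge_unif.
   by have := vz N.-1; rewrite prednK // ltnW.
  rewrite invr_expz -expfzDr //; apply: (@vge_le 1 ((N - i.+1)%N%:Z - (N - i.+2)%N%:Z)).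
   lia.
  exact: vge_unif.
 have exn' : exists n : nat, `[< ~ vge n.+1 z >] by have [n hn] := exn; exists n; apply/asboolP.
 have [n /asboolP nv nmin] := ex_minnP exn'; exists n.
 have vn : vge n z.
  case: n nv nmin => [|n] nv nmin; first exact/vge0n.
  by apply: contrapT => /asboolP/nmin; rewrite ltnn.
 split=> //; apply: contrapT => nO; apply: nv.
 have : maxid O (z * unif ^ (- n%:Z)).
  by apply/maxidE; right; rewrite invfM invr_expz opprK.
 by move=> /maxid_vge; rewrite /vge -mulrA -expfzDr // -opprD addrC -intS.
move=> x0; have [Ox|nOx] := pselect (O x); first by have [n] := main x x0 Ox; exists n.
have [|n [v1 v2]] := main x^-1 _ (prV nOx); first by rewrite invr_eq0.
by exists (- n%:Z); rewrite /vge opprK; rewrite invrK in v2.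
Qed.

Definition ord (x : E) : int := xget 0 [set n | vge n x /\ O (x^-1 * unif ^ n)].
Lemma ordP x : x != 0 -> vge (ord x) x /\ O (x^-1 * unif ^ (ord x)).
by move=> /ord_ex[n hn]; apply: (@xgetI _ 0 [set n | vge n x /\ O (x^-1 * unif ^ n)] n). Qed.

Lemma vge_ord n x : x != 0 -> vge n x <-> n <= ord x.
move=> x0; have [v1 v2] := ordP x0; split=> [vn|le]; last exact: vge_le v1.
rewrite -subr_ge0; apply/unif_exp; rewrite addrC expfzDr // -[_ ^ _ * _]mul1r -(mulfV x0).
by rewrite mulrACA; apply: prM.
Qed.

Lemma ord_uniq n x : x != 0 -> vge n x -> O (x^-1 * unif ^ n) -> ord x = n.
move=> x0 vn On; apply/le_anti/andP; split; last exact/vge_ord.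
have [v1 v2] := ordP x0; rewrite -subr_ge0; apply/unif_exp.
by rewrite addrC expfzDr // -[_ ^ _ * _]mul1r -(mulfV x0) mulrACA; apply: prM.
Qed.

Lemma ordM x y : x != 0 -> y != 0 -> ord (x * y) = ord x + ord y.
move=> x0 y0; have [v1 v2] := ordP x0; have [w1 w2] := ordP y0.
apply: ord_uniq; rewrite ?mulf_neq0 //; first exact: vgeM.
by rewrite invfM expfzDr // mulrACA; apply: prM.
Qed.
Lemma ordV x : x != 0 -> ord x^-1 = - ord x.
move=> x0; have [v1 v2] := ordP x0; apply: ord_uniq; rewrite ?invr_eq0 //.
 by rewrite /vge opprK.
by rewrite invrK.
Qed.
Lemma ord_one : ord 1 = 0.
by apply: ord_uniq; rewrite ?oner_eq0 // ?invr1 ?mul1r ?expr0z; [apply/vge0n/pr1|exact: pr1]. Qed.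
Lemma ordX x n : x != 0 -> ord (x ^+ n) = ord x *+ n.
move=> x0; elim: n => [|n IH]; first by rewrite ord_one.
by rewrite exprS ordM ?expf_neq0 // IH mulrS.
Qed.
Lemma pr_ord x : x != 0 -> O x <-> 0 <= ord x.
by move=> x0; rewrite -vge_ord // vge0n. Qed.

Lemma ord_add_lt x y : x != 0 -> y != 0 -> ord x < ord y ->
 x + y != 0 /\ ord (x + y) = ord x.
move=> x0 y0 lt.
have nv : ~ vge (ord x + 1) (x + y).
 move=> v; have : vge (ord x + 1) ((x + y) - y).
  by apply: vgeB => //; apply/vge_ord => //; lia.
 by rewrite addrK => /vge_ord -/(_ x0); lia.
have nz : x + y != 0 by apply: contra_notN nv => /eqP ->; exact: vge_0.
split=> //; apply/le_anti/andP; split.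
 by rewrite leNgt; apply: contra_notN nv => h; apply/vge_ord => //; lia.
by apply/vge_ord => //; apply: vgeD; apply/vge_ord => //; apply: ltW.
Qed.

Lemma vge_exists x : exists n : nat, vge (- n%:Z) x.
have [->|x0] := eqVneq x 0; first by exists 0%N; exact: vge_0.
by exists `|ord x|%N; apply/vge_ord => //; lia.
Qed.

Fixpoint kcomb (u : seq E) : seq E :=
 if u is v :: u' then [seq iota a * v + w | a <- enum k, w <- kcomb u'] else [:: 0].

Lemma kcombP u (a : nat -> k) : \sum_(i < size u) iota (a i) * u`_i \in kcomb u.
elim: u a => [|v u IH] a; first by rewrite big_ord0 mem_head.
rewrite big_ord_recl; apply/allpairsP; exists (a 0%N, \sum_(i < size u) iota (a i.+1) * u`_i).
by split=> //; [rewrite mem_enum|exact: (IH (fun i => a i.+1))].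
Qed.

Lemma kcombZ u b w : w \in kcomb u -> iota b * w \in kcomb u.
elim: u w => [|v u IH] w; first by rewrite !inE => /eqP ->; rewrite mulr0.
move=> /allpairsP[[a w'] /= [_ w'u ->]]; apply/allpairsP; exists (b * a, iota b * w').
by rewrite mem_enum IH // rmorphM mulrDr mulrA.
Qed.

Lemma kcomb_pr u w : (forall v, v \in u -> O v) -> w \in kcomb u -> O w.
elim: u w => [|v u IH] w Ou; first by rewrite inE => /eqP ->; exact: pr0.
move=> /allpairsP[[a w'] /= [_ w'u ->]]; apply: prD.
 by apply: prM; [exact: prc|apply: Ou; rewrite mem_head].
by apply: IH => // z zu; apply: Ou; rewrite in_cons zu orbT.
Qed.

Fixpoint kindep (u : seq E) : Prop :=
 if u is v :: u' then (forall w, w \in kcomb u' -> ~ maxid O (v - w)) /\ kindep u'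
 else True.

Lemma kindepP u (a : nat -> k) : kindep u ->
 maxid O (\sum_(i < size u) iota (a i) * u`_i) -> forall i, (i < size u)%N -> a i = 0.
elim: u a => [//|v u IH] a [ku iu]; rewrite big_ord_recl /= => m.
have a0 : a 0%N = 0.
 apply/eqP; apply: contrapT => /negP a0.
 apply: (ku (iota (- (a 0%N)^-1) * \sum_(i < size u) iota (a i.+1) * u`_i)).
  exact/kcombZ/(kcombP u (fun i => a i.+1)).
 have := maxM (prc (a 0%N)^-1) m; rewrite mulrDr mulrA -rmorphM mulVf // rmorph1 mul1r.
 by rewrite rmorphN mulNr opprK.
case=> [//|i] iu'; apply: (IH (fun i => a i.+1)) => //.
by move: m; rewrite a0 rmorph0 mul0r add0r.
Qed.

(** [N] integral elements independent over k modulo the maximal ideal would contradict a relation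
    over k[unif] read at the place. If no finite list of k-combinations represented the residue
    field, such independent lists could be extended forever. *)
Lemma residue_cover : exists s : seq E, (forall y, y \in s -> O y) /\
 forall x, O x -> exists2 y, y \in s & maxid O (x - y).
have mt := unif_max unifP; have [N hN] := dependent unif0.
apply: contrapT => nex.
have bigu r : exists u, [/\ size u = r, forall v, v \in u -> O v & kindep u].
 elim: r => [|r [u [su Ou iu]]]; first by exists [::].
 have [y [Oy ny]] : exists y, O y /\ forall w, w \in kcomb u -> ~ maxid O (y - w).
  apply: contrapT => nny; apply: nex; exists (kcomb u); split.
   by move=> y; apply: kcomb_pr.
  move=> x Ox; apply: contrapT => nx; apply: nny; exists x; split=> // w wu mw.
  by apply: nx; exists w.
 exists (y :: u); split=> [/=|v|//]; first by rewrite su.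
 by move=> /predU1P[->//|/Ou].
have [u [su Ou iu]] := bigu N.
have [c [[j jN cj] cu]] := hN (fun i => u`_i).
suff : maxid O (\sum_(i < size u) iota (c i).[0] * u`_i).
 by move=> /(kindepP (a := fun i => (c i).[0]) iu)/(_ j); rewrite su => /(_ jN)/eqP; apply/negP.
rewrite su.
have -> : \sum_(i < N) iota (c i).[0] * u`_i =
  - \sum_(i < N) (ev unif (c i) - iota (c i).[0]) * u`_i.
 under [in RHS]eq_bigr => i _ do rewrite mulrBl.
 by rewrite sumrB cu sub0r opprK.
apply/maxN/max_sum => i _; have [q ->] := ev_C_mod unif (c i).
rewrite addrC addKr -mulrA mulrC; apply: (maxM _ mt); apply: prM.
 exact/pr_ev/max_pr.
by apply: Ou; apply: mem_nth; rewrite su.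
Qed.
End Place.

(** * Approximation at several places, finiteness of zeros, existence of poles *)

Lemma place_eq (p q : place) : pring p = pring q -> p = q.
case: p q => [A HA] [B HB] /= e; move: HA; rewrite e => HA.
by rewrite (Prop_irrelevance HA HB).
Qed.

(** A discrete valuation ring is maximal among proper subrings: were [pring p] inside [pring q], an
    element [y] of [pring q] with a pole at [p] would, through its powers, put every [z] into
    [pring q]. *)
Lemma place_sep (p q : place) : p <> q -> exists x, pring p x /\ ~ pring q x.
move=> pq; apply: contrapT => nex.
have sub x : pring p x -> pring q x.
 by move=> px; apply: contrapT => nq; apply: nex; exists x.
have [y [qy npy]] : exists y, pring q y /\ ~ pring p y.
 apply: contrapT => nex'; apply: pq; apply: place_eq; apply/seteqP; split=> // x qx.
 by apply: contrapT => np; apply: nex'; exists x.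
have y0 : y != 0 by apply: contra_notN npy => /eqP ->; exact: pr0.
have oy : ord p y < 0 by rewrite ltNge; apply: contra_notN npy => h; apply/(pr_ord _ y0).
apply: (vr_proper (place_ringP q)); apply/seteqP; split=> // z _.
have [->|z0] := eqVneq z 0; first exact: pr0.
pose n := `|ord p z|%N; have yn0 : y ^+ n != 0 by rewrite expf_neq0.
have -> : z = (z / y ^+ n) * y ^+ n by rewrite divfK.
apply: prM; last exact: prX.
apply/sub/pr_ord; first by rewrite mulf_neq0 // invr_eq0.
rewrite ordM ?invr_eq0 // ordV // ordX //.
have : n%:Z <= - (ord p y *+ n) by rewrite -mulNrn -mulr_natr natz; apply: ler_peMl; lia.
lia.
Qed.

Lemma seq_bound (T : eqType) (s : seq T) (P : T -> nat -> Prop) :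
 (forall x, x \in s -> exists n, P x n) ->
 (forall x n m, (n <= m)%N -> P x n -> P x m) ->
 exists n, forall x, x \in s -> P x n.
move=> ex mono; elim: s ex => [|x s IH] ex; first by exists 0%N.
have [|n hn] := IH; first by move=> y ys; apply: ex; rewrite in_cons ys orbT.
have [m hm] := ex x (mem_head _ _); exists (maxn n m) => y.
move=> /predU1P[->|/hn Py].
 by apply: mono hm; exact: leq_maxr.
by apply: mono Py; exact: leq_maxl.
Qed.

Lemma vgeX (p : place) n x m : vge p n x -> vge p (n *+ m) (x ^+ m).
move=> v; elim: m => [|m IH]; first exact/vge0n/pr1.
by rewrite exprS mulrS; apply: vgeM.
Qed.

Lemma npr_ord (p : place) x : ~ pring p x -> x != 0 /\ ord p x < 0.
move=> np; have x0 : x != 0 by apply: contra_notN np => /eqP ->; exact: pr0.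
by split=> //; rewrite ltNge; apply: contra_notN np => h; apply/(pr_ord _ x0).
Qed.

Lemma separate_places (p : place) (s : seq place) : p \notin s ->
 exists u, maxid (pring p) u /\ forall q, q \in s -> ~ pring q u.
elim: s => [|q s IH].
 by move=> _; exists (unif p); split=> //; apply/unif_max/unifP.
rewrite in_cons negb_or => /andP[pq /IH[u [mu us]]].
have [z [mz nz]] : exists z, maxid (pring p) z /\ ~ pring q z.
 have [a [pa nqa]] := place_sep (elimN eqP pq).
 have [|b [qb npb]] := @place_sep q p; first by move=> e; rewrite e eqxx in pq.
 have [b0 ob] := npr_ord npb; have [a0 oa] := npr_ord nqa.
 have oab : ord q (a / b) < 0.
  rewrite ordM ?invr_eq0 // ordV //; have := (pr_ord q b0).1 qb; lia.
 exists (a / b); split; last first.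
  by move=> /pr_ord; rewrite mulf_neq0 ?invr_eq0 // => /(_ isT); lia.
 apply/maxid_vge/vge_ord; first by rewrite mulf_neq0 ?invr_eq0.
 rewrite ordM ?invr_eq0 // ordV //; have := (pr_ord p a0).1 pa; lia.
have [z0 oz] := npr_ord nz.
have [nqu|qu] := pselect (~ pring q u).
 by exists u; split=> // r; move=> /predU1P[->|/us].
have {}qu : pring q u by apply: contrapT.
(* The exponent exceeds all orders of [u] at the places already separated, so [z ^+ n.+1] never has
   the same order as [u] there and no cancellation occurs. *)
have [n hn] : exists n, forall r, r \in s -> (`|ord r u| < n)%N.
 by apply: seq_bound => [r _|r n m nm /leq_trans]; [exists `|ord r u|.+1|apply].
have zn0 : z ^+ n.+1 != 0 by rewrite expf_neq0.
exists (u + z ^+ n.+1); split.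
 by apply: maxD => //; rewrite exprS mulrC; apply: maxM => //; apply/prX/max_pr.
move=> r; move=> /predU1P[->|rs].
 move=> /prB/(_ qu); rewrite addrC addKr => /pr_ord -/(_ zn0); rewrite ordX //; lia.
have [u0 ou] := npr_ord (us r rs); have := hn r rs => h.
have [c|c|c] := ltgtP (ord r u) (ord r (z ^+ n.+1)).
- have [nz0 e] := ord_add_lt u0 zn0 c.
 by move=> /pr_ord -/(_ nz0); rewrite e; lia.
- have [nz0 e] := ord_add_lt zn0 u0 c; rewrite addrC in nz0 e *.
 by move=> /pr_ord -/(_ nz0); rewrite e; lia.
- move: c; rewrite ordX // -mulr_natr natz => c; exfalso.
 have := oz; case: (ltrgtP (ord r z) 0) => oz0 _.
 + have : ord r z * n.+1%:Z <= - n.+1%:Z by rewrite -[leRHS]mulN1r; apply: ler_wpM2r; lia.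
  by rewrite -c; lia.
 + have : n.+1%:Z <= ord r z * n.+1%:Z by apply: ler_peMl; lia.
  by rewrite -c; lia.
 + by rewrite oz0 mul0r in c; lia.
Qed.

(** [(1 + u ^+ N.+1)^-1] is close to 1 where [u] vanishes and close to 0 where [u] has a pole. *)
Lemma approx_idempotent (p : place) (s : seq place) (N : nat) : p \notin s ->
 exists w, vge p N (w - 1) /\ forall q, q \in s -> vge q N w.
move=> /separate_places[u [mu us]]; exists (1 + u ^+ N.+1)^-1; split.
 have mN : maxid (pring p) (u ^+ N.+1).
  by rewrite exprS mulrC; apply: maxM => //; apply/prX/max_pr.
 have nm : ~ maxid (pring p) (1 + u ^+ N.+1).
  by move=> /maxD/(_ (maxN mN)); rewrite addrK; apply: max1.
 have nz : 1 + u ^+ N.+1 != 0 by apply: contra_notN nm => /eqP ->; exact: max0.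
 have Ow : pring p (1 + u ^+ N.+1)^-1.
  by apply: contrapT => nO; apply: nm; apply/maxidE; right.
 have -> : (1 + u ^+ N.+1)^-1 - 1 = - (u ^+ N.+1 * (1 + u ^+ N.+1)^-1) by field.
 apply/vgeN; apply: (@vge_le _ N (1 *+ N.+1 + 0)); first by rewrite addr0; lia.
 by apply: vgeM; [exact/vgeX/maxid_vge|exact/vge0n].
move=> q /us/npr_ord[u0 ou].
have uN0 : u ^+ N.+1 != 0 by rewrite expf_neq0.
have oq1 : ord q (u ^+ N.+1) <= - N.+1%:Z.
 by rewrite ordX // -mulr_natr natz -[leRHS]mulN1r; apply: ler_wpM2r; lia.
have [|nz e] := ord_add_lt uN0 (oner_neq0 E) (p := q); first by rewrite ord_one; lia.
rewrite addrC; apply/vge_ord; first by rewrite invr_eq0.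
by rewrite ordV // e; lia.
Qed.

Lemma weak_approx (s : seq place) (x : place -> E) (N : nat) :
 uniq s -> exists e, forall q, q \in s -> vge q N (e - x q).
move=> us.
have [M hM] : exists M, forall pq, pq \in [seq (p, q) | p <- s, q <- s] ->
  vge pq.2 (- M%:Z) (x pq.1).
 apply: seq_bound => [pq _|pq n m nm]; first exact: vge_exists.
 by apply: vge_le; lia.
have /choice[w hw] : forall q, exists w, q \in s -> vge q (M + N)%N (w - 1) /\
  forall r, r \in rem q s -> vge r (M + N)%N w.
 move=> q; have [|w hw] := @approx_idempotent q (rem q s) (M + N)%N.
  by rewrite mem_rem_uniq // inE eqxx.
 by exists w.
exists (\sum_(q <- s) x q * w q) => q qs; rewrite (bigD1_seq q) //= addrAC.
have -> : N%:Z = - M%:Z + (M + N)%N by lia.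
apply: vgeD.
 rewrite -[X in _ - X]mulr1 -mulrBr; apply: vgeM; last exact: (hw q qs).1.
 by apply: (hM (q, q)); apply/allpairsP; exists (q, q).
rewrite big_seq_cond; apply: vge_sum => r /andP[rs rq]; apply: vgeM.
 by apply: (hM (r, q)); apply/allpairsP; exists (r, q).
by apply: (hw r rs).2; rewrite mem_rem_uniq // inE qs andbT eq_sym.
Qed.

Lemma finite_by_bound (T : choiceType) (A : set T) N :
 (forall s : seq T, uniq s -> (forall x, x \in s -> A x) -> (size s < N)%N) -> finite_set A.
move=> bnd; apply: contrapT => inf.
have big n : exists s : seq T, [/\ uniq s, forall x, x \in s -> A x & size s = n].
 elim: n => [|n [s [us sA sn]]]; first by exists [::].
 have [x [Ax xs]] : exists x, A x /\ x \notin s.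
  apply: contrapT => nex; apply: inf; apply: (@sub_finite_set _ _ [set` s]); last exact: finite_seq.
  by move=> x Ax /=; apply: contrapT => /negP xs; apply: nex; exists x.
 exists (x :: s); split=> /=; rewrite ?xs ?sn // => y.
 by move=> /predU1P[->//|/sA].
by have [s [us sA sn]] := big N; have := bnd s us sA; rewrite sn ltnn.
Qed.

(** The [N] of [dependent] bounds the number of zeros: functions [y i] close to 1 at the [i]-th zero
    and to 0 at the others cannot satisfy a relation whose coefficient [c j] has nonzero constant
    term, as evaluation at the [j]-th zero shows. *)
Lemma finite_zeros x : x != 0 -> finite_set [set p : place | maxid (pring p) x].
move=> x0; have [N hN] := dependent x0; apply: (@finite_by_bound _ _ N) => s us sm.
rewrite ltnNge; apply/negP => Ns.
have [p0 _] : exists p0, p0 \in s.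
 have [c [[j jN _] _]] := hN (fun=> 0).
 by case: (s) Ns => [|p0 s' _]; [rewrite leqn0 => /eqP N0; rewrite N0 in jN|exists p0; rewrite mem_head].
have /choice[y hy] : forall i, exists y, forall q, q \in s -> vge q 1%N (y - (q == nth p0 s i)%:R).
 by move=> i; apply: (weak_approx (fun q => (q == nth p0 s i)%:R)).
have [c [[j jN cj] cy]] := hN y; pose p := nth p0 s j.
have ps : p \in s by rewrite mem_nth // (leq_trans jN).
have mx := sm p ps; have Ox := max_pr mx.
suff : maxid (pring p) (ev x (c j)) by move=> /(ev_max mx)/eqP; apply/negP.
move: cy; rewrite (bigD1 (Ordinal jN)) //= => /eqP; rewrite addr_eq0 => /eqP e.
have -> : ev x (c j) = - (ev x (c j) * (y j - 1)) -
  \sum_(i < N | i != Ordinal jN) ev x (c i) * y i.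
 by rewrite -e mulrBr mulr1 opprB subrK.
apply: maxD; apply/maxN.
 apply: maxM; first exact: pr_ev.
 by apply/maxid_vge; have := hy j p ps; rewrite /p eqxx.
apply: max_sum => i ij; apply: maxM; first exact: pr_ev.
apply/maxid_vge; have := hy i p ps; rewrite /p nth_uniq ?(leq_trans _ Ns) //.
by rewrite eq_sym (_ : (i == j :> nat) = false) ?subr0 //; apply/negbTE.
Qed.

Lemma finite_poles x : finite_set [set p : place | ~ pring p x].
have [->|x0] := eqVneq x 0.
 by apply: (sub_finite_set _ (@finite_set0 _)) => p /=; apply; exact: pr0.
have := @finite_zeros x^-1; rewrite invr_eq0 => /(_ x0).
by apply: sub_finite_set => p /= np; apply/maxidE; right; rewrite invrK.
Qed.

Lemma transcendental_inv x : x != 0 -> transc x -> transc x^-1.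
move=> x0 tx P; rewrite -[P in ev _ P]coefK ev_poly => e.
have := tx (\poly_(i < size P) P`_(size P - i.+1)).
rewrite ev_poly (reindex_inj rev_ord_inj) /= => h.
apply/eqP; rewrite -lead_coef_eq0; apply/eqP.
have [->|P0] := eqVneq P 0; first by rewrite lead_coef0.
have sP : (0 < size P)%N by rewrite size_poly_gt0.
have /polyP/(_ 0%N) : \poly_(i < size P) P`_(size P - i.+1) = 0.
 apply: h; transitivity (x ^+ (size P).-1 * \sum_(i < size P) iota P`_i * x^-1 ^+ i).
  rewrite mulr_sumr; apply: eq_bigr => i _.
  have ip := ltn_ord i.
  have aux n (l : nat) : (l < n)%N -> (n - (n - l.+1).+1 = l)%N by lia.
  have aux' n (l : nat) : (l < n)%N -> (n.-1 = (n - l.+1) + l)%N by lia.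
  rewrite (aux _ _ ip) (aux' _ _ ip).
  by rewrite exprD exprVn mulrACA mulfV ?expf_neq0 // mulr1 mulrC.
 by rewrite e mulr0.
by rewrite coef_poly sP coef0 lead_coefE subn1.
Qed.

(* Chevalley: a subring maximal among those containing [x^-1] but not [x] is a
  valuation ring. *)
Lemma pole_exists x : transc x -> exists p : place, ~ pring p x.
move=> tx.
have x0 : x != 0.
 by apply/eqP => x0; have := tx 'X; rewrite evX => /(_ x0)/eqP; rewrite polyX_eq0.
pose y := x^-1; have xy : y * x = 1 by rewrite mulVf.
have ty : transc y by apply: transcendental_inv.
pose B : set E := [set z | exists P, z = ev y P].
pose Q (A : set E) := [/\ is_subring A, forall a, A (iota a), A y & ~ A x].
have QB : Q B.
 split.
 - split; first by exists 1; rewrite ev1.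
   by move=> _ _ [P ->] [P' ->]; exists (P - P'); rewrite evD evN.
  by move=> _ _ [P ->] [P' ->]; exists (P * P'); rewrite evM.
 - by move=> a; exists a%:P; rewrite evC.
 - by exists 'X; rewrite evX.
 - move=> [P xP]; have := ty ('X * P - 1); rewrite evD evM evX evN ev1 -xP xy subrr => /(_ erefl).
  by move=> /(congr1 (fun p : {poly k} => p.[0]))/eqP; rewrite hornerD hornerN hornerM hornerX mul0r !hornerC sub0r oppr_eq0 oner_eq0.
have [F FP totF|A [QA Amax]] := @Zorn_bigcup _ (fun A => Q (B `|` A)).
 have [[A0 FA0]|F0] := pselect (exists A, F A); last first.
  suff -> : \bigcup_(X in F) X = set0 by rewrite setU0.
  by apply/seteqP; split=> // z [A FA]; case: F0; exists A.
 have inF z : (B `|` \bigcup_(X in F) X) z -> exists2 A, F A & (B `|` A) z.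
  move=> [Sy|[A FA Ay]]; first by exists A0 => //; left.
  by exists A => //; right.
 have Fin A z : F A -> (B `|` A) z -> (B `|` \bigcup_(X in F) X) z.
  by move=> FA [Sy|Ay]; [left|right; exists A].
 have com u v : (B `|` \bigcup_(X in F) X) u -> (B `|` \bigcup_(X in F) X) v ->
   exists A, [/\ F A, (B `|` A) u & (B `|` A) v].
  move=> /inF[A1 FA1 Au] /inF[A2 FA2 Av]; have [AB|AB] := totF _ _ FA1 FA2.
   by exists A2; split=> //; case: Au => [|/AB]; [left|right].
  by exists A1; split=> //; case: Av => [|/AB]; [left|right].
 have [[B1 _ _] B2 B3 B4] := QB; split; [split|..].
 - by left.
 - move=> u v hu hv; have [A1 [FA1 Au Av]] := com u v hu hv.
  by apply: (Fin A1 _ FA1); have [[_ + _] _ _ _] := FP _ FA1; apply.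
 - move=> u v hu hv; have [A1 [FA1 Au Av]] := com u v hu hv.
  by apply: (Fin A1 _ FA1); have [[_ _ +] _ _ _] := FP _ FA1; apply.
 - by move=> a; left.
 - by left.
 - by move=> /inF[A1 FA1]; have [] := FP _ FA1.
set M := B `|` A in QA.
have maxM' M' : M `<=` M' -> is_subring M' -> (exists z, M' z /\ ~ M z) -> M' x.
 move=> MM' sM' [z [M'z nMz]]; apply: contrapT => nx; apply: (Amax M').
  by split=> [u Au|/(_ _ M'z) Az]; [apply: MM'; right|apply: nMz; right].
 have -> : B `|` M' = M' by apply/setUidPr => u Bu; apply: MM'; left.
 by split=> //; [move=> a|]; apply: MM'; have [] := QA.
have [[M1 MB MM] Mk My Mx] := QA.
have M0 : M 0 by rewrite -(subrr 1); apply: MB.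
have MN u : M u -> M (- u) by move=> Mu; rewrite -sub0r; apply: MB.
have MD u v : M u -> M v -> M (u + v) by move=> Mu Mv; rewrite -[v]opprK; apply: MB => //; apply: MN.
have MX u n : M u -> M (u ^+ n) by move=> Mu; elim: n => // n IH; rewrite exprS; apply: MM.
(* Inverting [w = 1 - a * y] does not produce [x], since [x * w ^+ n] differs from [x] by an element
   of [M]; by maximality [w] is already invertible in [M]. *)
have unitM a : M a -> M (1 - a * y)^-1.
 move=> Ma; set w := 1 - a * y; have Mw : M w by apply: MB => //; apply: MM.
 apply: contrapT => nMw.
 have w0 : w != 0 by apply: contra_notN nMw => /eqP ->; rewrite invr0.
 have : [set z | exists n, M (z * w ^+ n)] x.
  apply: maxM'; first by move=> z Mz; exists 0%N; rewrite mulr1.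
   split; first by exists 0%N; rewrite mulr1.
    move=> u v [n Mn] [m Mm]; exists (n + m)%N; rewrite mulrBl.
    by apply: MB; [rewrite exprD mulrA|rewrite addnC exprD mulrA]; apply: MM => //; apply: MX.
   by move=> u v [n Mn] [m Mm]; exists (n + m)%N; rewrite exprD mulrACA; apply: MM.
  by exists w^-1; split=> //; exists 1%N; rewrite expr1 mulVf.
 move=> [n Mn]; apply: Mx.
 have : exists2 m, M m & x * w ^+ n = x + m.
  elim: n {Mn} => [|n [m Mm e]]; first by exists 0; rewrite // addr0 mulr1.
  exists (m * w - a); first by apply: MB => //; apply: MM.
  rewrite exprSr mulrA e mulrDl {1}/w mulrBr mulr1 mulrCA (mulrC x) xy mulr1.
  by rewrite -!addrA; congr (_ + _); rewrite addrC.
 by move=> [m Mm e]; rewrite -[x](addrK m) -e; apply: MB.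
(* For [z] outside [M], maximality puts [x] into [M[z]]. If neither [z] nor its inverse lies in [M],
   the shortest expressions of [x] in the two shorten each other through [red]. *)
pose Rep z n := exists2 a : nat -> E, forall i, M (a i) & x = \sum_(i < n) a i * z ^+ i.
have red z n m : z != 0 -> Rep z n.+1 -> Rep z^-1 m -> (m <= n.+1)%N -> Rep z n.
 move=> z0 [a Ma ea] [b0 Mb0 eb0] mn.
 pose b i := if (i < m)%N then b0 i else 0.
 have Mb i : M (b i) by rewrite /b; case: ifP.
 have {}eb0 : x = \sum_(i < n.+1) b i * z^-1 ^+ i.
  rewrite eb0 (big_ord_widen n.+1 (fun i => b0 i * z^-1 ^+ i)) // big_mkcond /=.
  by apply: eq_bigr => i _; rewrite /b; case: ifP => // _; rewrite mul0r.
 set c := (1 - b 0%N * y)^-1; have Mc : M c := unitM _ (Mb 0%N).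
 have c0 : 1 - b 0%N * y != 0.
  apply: contra_notN Mx => /eqP/subr0_eq e.
  by rewrite -[x]mul1r e -mulrA xy mulr1.
 have e1 : 1 = \sum_(i < n) c * b i.+1 * y * z^-1 ^+ i.+1.
  apply: (mulfI c0); rewrite mulr1 mulr_sumr.
  rewrite -[1 in LHS]xy {1}eb0 big_ord_recl expr0 mulr1 mulrDr [y * _]mulrC addrC addKr.
  rewrite mulr_sumr; apply: eq_bigr => i _ /=.
  by rewrite /bump /= add1n !mulrA mulfV // mul1r (mulrC y).
 exists (fun l => a l + a n * (c * b (n - l)%N * y)).
  by move=> l; exact: MD (Ma l) (MM _ _ (Ma n) (MM _ _ (MM _ _ Mc (Mb _)) My)).
 rewrite {1}ea big_ord_recr /=.
 under [RHS]eq_bigr => l _ do rewrite mulrDl.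
 rewrite big_split /=; congr (_ + _).
 rewrite -[LHS]mulr1 e1 mulr_sumr (reindex_inj rev_ord_inj) /=.
 apply: eq_bigr => l _; have ln := ltn_ord l.
 have -> : ((n - l.+1).+1 = n - l)%N by lia.
 have en : (n = (n - l) + l)%N by lia.
 rewrite {2}en exprD exprVn.
 have zn : z ^+ (n - l) != 0 by rewrite expf_neq0.
 by field.
have rep_ex z : ~ M z -> exists n, Rep z n.
 move=> nMz.
 have : [set w | exists P : {poly E}, (forall i, M P`_i) /\ w = P.[z]] x.
  apply: maxM'.
  - move=> w Mw; exists w%:P; split; last by rewrite hornerC.
   by move=> i; rewrite coefC; case: ifP.
  - split.
   + by exists 1; split; [move=> i; rewrite coef1; case: eqP|rewrite hornerC].
   + move=> _ _ [P [MP ->]] [P' [MP' ->]]; exists (P - P'); split; last by rewrite hornerD hornerN.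
    by move=> i; rewrite coefB; apply: MB.
   + move=> _ _ [P [MP ->]] [P' [MP' ->]]; exists (P * P'); split; last by rewrite hornerM.
    by move=> i; rewrite coefM; apply: (big_ind M) => // j _; apply: MM.
  - exists z; split=> //; exists 'X; split; last by rewrite hornerX.
   by move=> i; rewrite coefX; case: eqP.
 move=> [P [MP e]]; exists (size P); exists (fun i => P`_i) => //.
 by rewrite e horner_coef.
have rep0 z : ~ Rep z 0%N by move=> [a _]; rewrite big_ord0 => /eqP; rewrite (negPf x0).
have vrM : is_valuation_ring iota M.
 split=> // [z|MT]; last by apply: Mx; rewrite MT.
 apply: contrapT => /not_orP[nz nzv].
 have z0 : z != 0 by apply: contra_notN nz => /eqP ->.
 have h u : ~ M u -> exists n, [/\ Rep u n.+1 & ~ Rep u n].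
  move=> /rep_ex[n]; elim: n => [/rep0//|n IH] r.
  by have [/IH//|nr] := pselect (Rep u n); exists n.
 have [n [rn nn]] := h z nz; have [m [rm nm]] := h _ nzv.
 have [mn|/ltnW nm'] := leqP m n; first exact: nn (red _ _ _ z0 rn rm mn).
 have zi0 : z^-1 != 0 by rewrite invr_eq0.
 have rn' : Rep z^-1^-1 n.+1 by rewrite invrK.
 exact: nm (red _ _ _ zi0 rm rn' nm').
by exists (Place vrM).
Qed.

(** * Completed local rings and lattices of adeles *)

Section Completion.
Variable M : completions (@place_ring k E iota).

Lemma maxid_pow_vge (p : place) n x : maxid_pow (pring p) n x <-> vge p n x.
elim: n x => [|n IH] x /=; first by rewrite vge0n.
split=> [[s sP ->]|vx].
 rewrite big_seq; apply: vge_sum => -[a b] /sP[/= ma mb].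
 have h := vgeM ((maxid_vge _ _).1 ma) ((IH _).1 mb).
 by rewrite intS.
exists [:: (unif p, x / unif p)]; last first.
 by rewrite big_seq1 /= mulrC divfK // (unif_neq0 (unifP p)).
move=> u; rewrite inE => /eqP -> /=; split; first exact/unif_max/unifP.
apply/IH; rewrite /vge; have := vx; rewrite /vge intS opprD expfzDr.
 by rewrite mulrA.
exact: unif_neq0 (unifP p).
Qed.

Section AtPlace.
Variable p : place.
Notation F := (cring M p).
Notation Oh := (cint M p).
Notation j := (cmap M p).
Notation O := (pring p).
Notation t := (unif p).
Let cP := completionsP M p.
Let t0 : t != 0. exact: unif_neq0 (unifP p). Qed.
Definition cint1 := sr1 (compl_subring cP).
Definition cintB := srB (compl_subring cP).
Definition cintM := srM (compl_subring cP).
Definition cint0 := sr0 (compl_subring cP).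
Definition cintN := srN (compl_subring cP).
Definition cintD := srD (compl_subring cP).
Definition cintX := srX (compl_subring cP).
Definition cint_sum := sr_sum (compl_subring cP).
Definition hge (n : int) (x : F) := Oh (x * j (t ^ (- n))).
Lemma jtK n : j (t ^ n) * j (t ^ (- n)) = 1.
by rewrite -rmorphM -expfzDr // subrr rmorph1. Qed.

Lemma hge0n x : hge 0 x <-> Oh x.
by rewrite /hge oppr0 expr0z rmorph1 mulr1. Qed.
Lemma hge_0 n : hge n 0. by rewrite /hge mul0r; exact: cint0. Qed.
Lemma hgeB n x y : hge n x -> hge n y -> hge n (x - y).
by rewrite /hge mulrBl; exact: cintB. Qed.
Lemma hgeD n x y : hge n x -> hge n y -> hge n (x + y).
by rewrite /hge mulrDl; exact: cintD. Qed.
Lemma hgeN n x : hge n x -> hge n (- x).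
by rewrite /hge mulNr; exact: cintN. Qed.
Lemma hge_sum n I (r : seq I) (P : pred I) (G : I -> F) :
 (forall i, P i -> hge n (G i)) -> hge n (\sum_(i <- r | P i) G i).
by apply: big_ind; [exact: hge_0 | exact: hgeD]. Qed.
Lemma hgeM m n x y : hge m x -> hge n y -> hge (m + n) (x * y).
by move=> vx vy; rewrite /hge opprD expfzDr // rmorphM mulrACA; apply: cintM.
Qed.
Lemma hgeMc n x y : hge n x -> Oh y -> hge n (x * y).
by move=> hx /hge0n hy; rewrite -[n]addr0; apply: hgeM. Qed.

(** Powers of the maximal ideal of [O] are generated by powers of the uniformizer, so the ideals in
    the definition of completion become the filtration [hge]. *)
Lemma idealM_hge n x : idealM (j @` maxid_pow O n) Oh x <-> hge n x.
split=> [[s sP ->]|hx].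
 rewrite big_seq; apply: hge_sum => -[a b] /sP[/= [y /maxid_pow_vge vy <-] Ob].
 apply: hgeMc Ob; rewrite /hge -rmorphM; exact: compl_map cP _ vy.
exists [:: (j (t ^ n%:Z), x * j (t ^ (- n%:Z)))]; last first.
 by rewrite big_seq1 /= mulrCA jtK mulr1.
move=> u; rewrite inE => /eqP -> /=; split=> //; exists (t ^ n%:Z) => //.
exact/maxid_pow_vge/vge_unif.
Qed.

(** If an element of E with a pole became integral in the completion, 1 would lie in the ideal
    generated there by the maximal ideal of [O], and [compl_inj] brings this back to [O]. *)
Lemma cint_j x : Oh (j x) <-> O x.
split; last exact: compl_map cP _.
move=> Ojx; apply: contrapT => nO; have [x0 _] := npr_ord nO.
have mx : maxid O x^-1 by apply/maxidE; right; rewrite invrK.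
apply: (@max1 p); apply/maxid_vge; apply/(maxid_pow_vge p 1).
apply: (compl_inj cP); first exact: pr1.
apply/idealM_hge; rewrite -(mulVf x0) rmorphM; apply: hgeMc => //.
rewrite /hge -rmorphM; apply: (compl_map cP).
by have := (maxid_vge _ _).1 mx.
Qed.

Lemma hge_j n x : hge n (j x) <-> vge p n x.
by rewrite /hge -rmorphM cint_j. Qed.

Lemma hge_le m n x : m <= n -> hge n x -> hge m x.
move=> mn hx; rewrite /hge; have -> : - m = - n + (n - m) by rewrite addrA addNr add0r.
rewrite expfzDr // rmorphM mulrA; apply: cintM => //; apply/cint_j/unif_exp.
by rewrite subr_ge0.
Qed.

Lemma hge_t n : hge n (j (t ^ n)).
by apply/hge_j/vge_unif. Qed.

Lemma cint_dense (n : nat) x : Oh x -> exists2 y, O y & hge n (x - j y).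
by move=> /(compl_dense cP n)[y Oy /idealM_hge h]; exists y. Qed.

Lemma hge_separated x : (forall n : nat, hge n x) -> x = 0.
by move=> h; apply: (compl_separated cP) => n; apply/idealM_hge. Qed.

Lemma cint_complete (u : nat -> F) : (forall n, Oh (u n)) ->
 (forall n : nat, hge n (u n.+1 - u n)) ->
 exists2 x, Oh x & forall n : nat, hge n (x - u n).
move=> Ou hu; have [|x Ox hx] := compl_complete cP Ou.
 by move=> n; apply/idealM_hge.
by exists x => // n; apply/idealM_hge.
Qed.

(** The inverse is the limit of the geometric series. *)
Lemma unit_1D z : hge 1 z -> exists2 v, Oh v & (1 - z) * v = 1.
move=> hz; have Oz : Oh z by apply/hge0n; apply: hge_le hz.
have hzn (n : nat) : hge n (z ^+ n).
 elim: n => [|n IH]; first exact/hge0n/cint1.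
 by rewrite exprS intS; apply: hgeM.
have [|n|x Ox hx] := @cint_complete (fun n => \sum_(i < n) z ^+ i).
- by move=> n; apply: cint_sum => i _; apply: cintX.
- by rewrite big_ord_recr /= addrAC subrr add0r.
exists x => //; apply/subr0_eq/hge_separated => n.
have -> : (1 - z) * x - 1 = (1 - z) * (x - \sum_(i < n) z ^+ i) - z ^+ n.
 rewrite mulrBr -[(1 - z) * \sum_(i < n) _]opprK -mulNr opprB -subrX1.
 by rewrite opprK addrA (addrAC _ (- 1)) addrK.
apply: hgeB => //; rewrite mulrC; apply: hgeMc => //.
by apply: cintB => //; exact: cint1.
Qed.

Lemma hge1_nunit x y : hge 1 x -> Oh y -> x * y <> 1.
move=> hx Oy e; apply: (@max1 p); apply/maxid_vge/hge_j.
by rewrite rmorph1 -e; apply: hgeMc.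
Qed.

(** Dividing by a unit [y] of [O] that approximates [x] reduces to an element congruent to 1. *)
Lemma cint_unit x : Oh x -> ~ hge 1 x -> exists2 v, Oh v & x * v = 1.
move=> Ox nh; have [y Oy hy] := cint_dense 1 Ox.
have nmy : ~ maxid O y.
 move=> my; apply: nh; rewrite -[x](subrK (j y)); apply: hgeD => //.
 exact/hge_j/maxid_vge.
have y0 : y != 0 by apply: contra_notN nmy => /eqP ->; exact: max0.
have Oyv : O y^-1 by apply: contrapT => nO; apply: nmy; apply/maxidE; right.
have [|v Ov e] := @unit_1D (- (x - j y) * j y^-1).
 by apply: hgeMc; [exact: hgeN|exact/cint_j].
exists (j y^-1 * v); first by apply: cintM => //; apply/cint_j.
have -> : x * (j y^-1 * v) = (1 - - (x - j y) * j y^-1) * v.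
 rewrite mulrA; congr (_ * _); rewrite mulNr opprK mulrBl -rmorphM mulfV // rmorph1.
 by rewrite addrC subrK.
exact: e.
Qed.

Lemma cint_normal x : Oh x -> x != 0 ->
 exists (n : nat) u v, [/\ Oh u, Oh v, u * v = 1 & x = j (t ^ n%:Z) * u].
move=> Ox x0.
have exn : exists n : nat, `[< ~ hge n.+1 x >].
 apply: contrapT => nex; move/eqP: x0; apply; apply: hge_separated => n.
 apply: (@hge_le n n.+1); first lia.
 by apply: contrapT => nh; apply: nex; exists n; apply/asboolP.
have [n /asboolP nv nmin] := ex_minnP exn.
have hx : hge n x.
 case: n nv nmin => [|n] nv nmin; first exact/hge0n.
 by apply: contrapT => /asboolP/nmin; rewrite ltnn.
have [|v Ov e] := @cint_unit (x * j (t ^ (- n%:Z))) hx.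
 move=> h; apply: nv; have := hgeM h (hge_t n); rewrite -mulrA (mulrC (j _)) jtK mulr1.
 by rewrite -intS.
exists n, (x * j (t ^ (- n%:Z))), v; split=> //.
by rewrite mulrCA jtK mulr1.
Qed.

Lemma field_normal x : x != 0 ->
 exists (n : int) u v, [/\ Oh u, Oh v, u * v = 1 & x = j (t ^ n) * u].
move=> x0; have [a [s [Oa Os [s' ss'] e]]] := compl_frac cP x.
have s0 : s != 0 by apply: contra_eq_neq ss' => ->; rewrite mul0r eq_sym oner_eq0.
have a0 : a != 0.
 by apply: contra_neq x0 => a0; rewrite -[x]mulr1 -ss' mulrA e a0 mul0r.
have [n [u [v [Ou Ov uv es]]]] := cint_normal Os s0.
have [m [u' [v' [Ou' Ov' uv' ea]]]] := cint_normal Oa a0.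
exists (m%:Z - n%:Z), (u' * v), (v' * u); split; try exact: cintM.
 by rewrite mulrACA uv' mul1r mulrC.
rewrite expfzDr // rmorphM.
have -> : j (t ^ m%:Z) * j (t ^ (- n%:Z)) * (u' * v) =
  (j (t ^ m%:Z) * u') * (j (t ^ (- n%:Z)) * v) by ring.
rewrite -ea -e es.
have -> : x * (j (t ^ n%:Z) * u) * (j (t ^ (- n%:Z)) * v) =
  x * ((u * v) * (j (t ^ n%:Z) * j (t ^ (- n%:Z)))) by ring.
by rewrite uv jtK !mulr1.
Qed.

Lemma hge_bounded x : exists n : nat, hge (- n%:Z) x.
have [->|x0] := eqVneq x 0; first by exists 0%N; exact: hge_0.
have [n [u [v [Ou _ _ ->]]]] := field_normal x0; exists `|n|%N.
by apply: hgeMc => //; apply: (@hge_le _ n); [lia|exact: hge_t].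
Qed.

Lemma cring_inv (x : F) : x != 0 -> exists y, x * y = 1.
move=> /field_normal[n [u [v [_ _ uv ->]]]]; exists (j (t ^ (- n)) * v).
by rewrite mulrACA jtK uv mulr1.
Qed.

Lemma cring_domain (x y : F) : x * y = 0 -> x = 0 \/ y = 0.
move=> xy; have [->|/cring_inv[x' e]] := eqVneq x 0; [by left|right].
by rewrite -[y]mul1r -e -mulrA mulrCA xy mulr0.
Qed.

Lemma cmap_dense (n : int) x : exists y, hge n (x - j y).
have [m hm] := hge_bounded x.
have Oz : Oh (x * j (t ^ m%:Z)) by move: hm; rewrite /hge opprK.
have [y Oy hy] := cint_dense `|(n + m%:Z)%R|%N Oz.
exists (y * t ^ (- m%:Z)).
have -> : x - j (y * t ^ (- m%:Z)) = (x * j (t ^ m%:Z) - j y) * j (t ^ (- m%:Z)).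
 by rewrite mulrBl -mulrA jtK mulr1 rmorphM.
apply: (@hge_le _ (`|(n + m%:Z)%R|%N%:Z + (- m%:Z))); first lia.
by apply: hgeM hy (hge_t _).
Qed.

Lemma maxid_hge x : maxid Oh x <-> hge 1 x.
split=> [[Ox nx]|hx].
 by apply: contrapT => /(cint_unit Ox)[v Ov e]; apply: nx; exists v.
split; first by apply/hge0n; apply: hge_le hx.
by move=> [y [Oy]]; apply: hge1_nunit.
Qed.

Lemma maxid_pow_hge (n : nat) x : maxid_pow Oh n x <-> hge n x.
elim: n x => [|n IH] x /=; first by rewrite hge0n.
split=> [[s sP ->]|hx].
 rewrite big_seq; apply: hge_sum => -[a b] /sP[/= ma mb].
 by rewrite intS; apply: hgeM; [exact/maxid_hge|exact/IH].
exists [:: (j t, x * j (t ^ (- 1)))]; last first.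
 by rewrite big_seq1 /= mulrCA -rmorphM mulfV // rmorph1 mulr1.
move=> u; rewrite inE => /eqP -> /=; split.
 by apply/maxid_hge; have := hge_t 1; rewrite expr1z.
apply/IH; have -> : n%:Z = n.+1%:Z - 1 by lia.
by apply: hgeM hx (hge_t _).
Qed.

Lemma cint_rescover : exists s : seq E, forall x, Oh x ->
 exists2 y, y \in s & hge 1 (x - j y).
have [s [Os cs]] := residue_cover p; exists s => x Ox.
have [y Oy hy] := cint_dense 1 Ox; have [z zs mz] := cs y Oy; exists z => //.
have -> : x - j z = (x - j y) + j (y - z) by rewrite rmorphB addrA subrK.
by apply: hgeD => //; apply/hge_j/maxid_vge.
Qed.
End AtPlace.

Lemma aval_sum I (r : seq I) (P : pred I) (G : I -> adele M) p :
 aval (\sum_(i <- r | P i) G i) p = \sum_(i <- r | P i) aval (G i) p.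
exact: (big_morph (fun x : adele M => aval x p)). Qed.

(** A total constructor: a family with infinitely many non-integral components is sent to 0, so that
    adeles can be named before finiteness is proved. *)
Definition mkad (f : forall p, cring M p) : adele M :=
 if pselect (finite_set [set p | ~ cint M p (f p)]) is left h then Adele h else 0.

Lemma mkadE f p : finite_set [set p | ~ cint M p (f p)] -> aval (mkad f) p = f p.
by rewrite /mkad; case: pselect. Qed.

Lemma finite_fiber (A : set place) (f : place -> Prop) :
 finite_set A -> (forall p, ~ A p -> f p) -> finite_set [set p | ~ f p].
move=> fA h; apply: sub_finite_set fA => p /= nf.
by apply: contrapT => /h.
Qed.

Definition atp p (x : cring M p) : adele M := mkad (dfwith (fun q => 0 : cring M q) p x).

Let atp_fin p (x : cring M p) :
 finite_set [set q | ~ cint M q (dfwith (fun q => 0 : cring M q) p x q)].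
apply: (finite_fiber (@finite_set1 _ p)) => q /eqP/= qp.
by rewrite dfwithout 1?eq_sym //; exact: cint0.
Qed.

Lemma atp_in p (x : cring M p) : aval (atp x) p = x.
by rewrite mkadE ?dfwithin. Qed.
Lemma atp_out p (x : cring M p) q : q != p -> aval (atp x) q = 0.
by move=> qp; rewrite mkadE ?dfwithout 1?eq_sym. Qed.

Definition fsupp (D : place -> int) := finite_set [set p | D p <> 0].
Lemma fsuppD D D' : fsupp D -> fsupp D' -> fsupp (fun p => D p + D' p).
move=> fD fD'; apply: (@sub_finite_set _ _ ([set p | D p <> 0] `|` [set p | D' p <> 0])).
 move=> p /= h; apply: contrapT => /not_orP[/contrapT h1 /contrapT h2].
 by apply: h; rewrite h1 h2.
by rewrite finite_setU.
Qed.
Lemma fsuppN D : fsupp D -> fsupp (fun p => - D p).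
by apply: sub_finite_set => p /= h h'; apply: h; rewrite h' oppr0. Qed.
Lemma fsupp_ord e : e != 0 -> fsupp (fun p => ord p e).
move=> e0; have e0' : e^-1 != 0 by rewrite invr_eq0.
apply: (@sub_finite_set _ _ ([set p : place | maxid (pring p) e] `|`
  [set p : place | maxid (pring p) e^-1])).
 move=> p /= h; have [c|c|c] := ltgtP (ord p e) 0; last by case: h.
  by right; apply/maxid_vge/vge_ord => //; rewrite ordV //; lia.
 by left; apply/maxid_vge/vge_ord => //; lia.
by rewrite finite_setU; split; apply: finite_zeros.
Qed.
Lemma fsupp_fin (n : place -> nat) : fin_supp n <-> fsupp (fun p => n p).
by split; apply: sub_finite_set => p /=; [move=> h; apply/eqP => n0; apply: h; rewrite n0
 | move=> h n0; case: n0 h => ->; rewrite eqxx].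
Qed.
Lemma fsupp0 : fsupp (fun=> 0).
by apply: (sub_finite_set _ (@finite_set0 _)) => p /=; apply. Qed.
Lemma fsupp_max D D' : fsupp D -> fsupp D' -> fsupp (fun p => Num.max (D p) (D' p)).
move=> fD fD'; apply: (@sub_finite_set _ _ ([set p | D p <> 0] `|` [set p | D' p <> 0])).
 move=> p /= h; apply: contrapT => /not_orP[/contrapT h1 /contrapT h2].
 by apply: h; rewrite h1 h2 maxxx.
by rewrite finite_setU.
Qed.

(** With this sign a larger divisor gives a smaller lattice; it is the space of adeles of the
    divisor [- D] in the usual notation. *)
Definition lat (D : place -> int) : set (adele M) :=
 [set a | forall p, hge (D p) (aval a p)].

Lemma lat_sgp D : sgp (lat D).
split; first by move=> p; exact: hge_0.
by move=> x y hx hy p; apply: hgeB; [exact: hx|exact: hy].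
Qed.

Lemma lat_le D D' : (forall p, D p <= D' p) -> lat D' `<=` lat D.
by move=> h x hx p; apply: hge_le (h p) (hx p). Qed.

Lemma latM D D' x y : lat D x -> lat D' y -> lat (fun p => D p + D' p) (x * y).
by move=> hx hy p; apply: hgeM; [exact: hx|exact: hy]. Qed.

Lemma congr0_lat n a : congr0 n a <-> lat (fun p => n p) a.
by split=> h p; apply/maxid_pow_hge; apply: h. Qed.

Lemma lat_exists x : exists2 D, fsupp D & lat D x.
have /choice[n hn] : forall p, exists n : nat, hge (- n%:Z) (aval x p).
 by move=> p; exact: hge_bounded.
exists (fun p => if `[< cint M p (aval x p) >] then 0 else - (n p)%:Z).
 apply: sub_finite_set (avalP x) => p /=; case: asboolP => //.
by move=> p; case: asboolP => // c; apply/hge0n.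
Qed.

Fact dg_fin x : finite_set [set p | ~ cint M p (cmap M p x)].
apply: sub_finite_set (finite_poles x) => p /=.
by apply: contra_not => h; apply/cint_j.
Qed.

Definition dg (x : E) : adele M := Adele (dg_fin x).

Fact dg_zmod : zmod_morphism dg.
by move=> x y; apply: aval_inj => p /=; rewrite rmorphB. Qed.
Fact dg_monoid : monoid_morphism dg.
by split=> [|x y]; apply: aval_inj => p /=; rewrite ?rmorph1 ?rmorphM. Qed.
HB.instance Definition _ := GRing.isZmodMorphism.Build _ _ dg dg_zmod.
HB.instance Definition _ := GRing.isMonoidMorphism.Build _ _ dg dg_monoid.

Lemma principal_dg a : principal a <-> exists x, a = dg x.
split=> [[x h]|[x ->]]; last by exists x.
by exists x; apply: aval_inj => p; rewrite h.
Qed.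

Lemma lat_dg D x e : e != 0 -> lat D x -> lat (fun p => D p + ord p e) (dg e * x).
move=> e0 hx p; rewrite addrC; apply: hgeM; last exact: hx.
by apply/hge_j/vge_ord.
Qed.

Lemma lat_dgE D e : e != 0 -> lat D (dg e) <-> forall p, D p <= ord p e.
by move=> e0; split=> h p; [apply/vge_ord/hge_j/h => //|apply/hge_j/vge_ord].
Qed.

(** For finitely supported [D], an idele of divisor [D]; multiplication by it shifts lattices. *)
Definition tid (D : place -> int) : adele M := mkad (fun p => cmap M p (unif p ^ D p)).
Lemma aval_tid D p : fsupp D -> aval (tid D) p = cmap M p (unif p ^ D p).
move=> fD; rewrite mkadE //; apply: (finite_fiber fD) => q /contrapT ->.
by rewrite expr0z rmorph1; exact: cint1.
Qed.

Lemma tid_lat D D' x : fsupp D -> lat D' x -> lat (fun p => D p + D' p) (tid D * x).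
move=> fD hx p; apply: hgeM; last exact: hx.
by rewrite aval_tid //; exact: hge_t.
Qed.

Lemma tidK D x : fsupp D -> tid (fun p => - D p) * (tid D * x) = x.
move=> fD; apply: aval_inj => p; rewrite /= !aval_tid //; last exact: fsuppN.
by rewrite mulrA mulrC (mulrC (cmap M p _)) jtK // mulr1.
Qed.

Lemma cover_comp (T : zmodType) (s s' : seq T) (S U V : set T) :
 covers s S U -> covers s' U V -> covers [seq a + b | a <- s, b <- s'] S V.
move=> c c' x /c[y ys /c'[z zs h]]; exists (y + z); last by rewrite opprD addrA.
by apply/allpairsP; exists (y, z).
Qed.

Lemma cover_sub (T : zmodType) (s : seq T) (S S' U U' : set T) :
 S' `<=` S -> U `<=` U' -> covers s S U -> covers s S' U'.
by move=> h h' c x /h/c[y ys /h' ?]; exists y. Qed.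

Lemma cover_shift s D D' D0 : fsupp D0 -> covers s (lat D) (lat D') ->
 covers (map ( *%R (tid D0)) s) (lat (fun p => D0 p + D p)) (lat (fun p => D0 p + D' p)).
move=> f0 c x hx.
have [|y ys hy] := c (tid (fun p => - D0 p) * x).
 by have := tid_lat (fsuppN f0) hx; apply: lat_le => p; rewrite addKr.
exists (tid D0 * y); first exact: map_f.
have := tid_lat f0 hy; rewrite mulrBr.
have := tidK x (fsuppN f0).
have -> : tid (fun p => - - D0 p) = tid D0 by congr tid; apply/funext => p; rewrite opprK.
by move=> ->.
Qed.

Definition add1 (D : place -> int) (s : seq place) p : int := D p + (count_mem p s)%:Z.
Lemma cover_step D q : exists s, covers s (lat D) (lat (add1 D [:: q])).
have [s cs] := cint_rescover q.
exists [seq atp (cmap M q (y * unif q ^ D q)) | y <- s] => x hx.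
have [y ys hy] := cs _ (hx q); exists (atp (cmap M q (y * unif q ^ D q))).
 by apply/mapP; exists y.
move=> p; rewrite /add1 /= addn0; have [pq|pq] := eqVneq q p; last first.
 by rewrite addr0 atp_out 1?eq_sym // subr0; exact: hx.
subst p; rewrite atp_in [D q + _]addrC.
have -> : aval x q - cmap M q (y * unif q ^ D q) =
  (aval x q * cmap M q (unif q ^ (- D q)) - cmap M q y) * cmap M q (unif q ^ D q).
 by rewrite mulrBl -mulrA (mulrC (cmap M q (_ ^ (- _)))) jtK // mulr1 rmorphM.
by apply: hgeM => //; exact: hge_t.
Qed.

Lemma cover_steps D r : exists s, covers s (lat D) (lat (add1 D r)).
elim: r D => [|q r IH] D.
 exists [:: 0] => x hx; exists 0; rewrite ?mem_head // subr0.
 by apply: lat_le hx => p; rewrite /add1 addr0.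
have [s1 c1] := cover_step D q; have [s2 c2] := IH (add1 D [:: q]).
eexists; apply: cover_sub (cover_comp c1 c2) => // x; apply: lat_le => p.
by rewrite /add1 /= addn0 PoszD addrA.
Qed.

(** Adding every place of the joint support [N] times to [D] gives a divisor above [D'], and each
    single step has finite index by [cover_step]. *)
Lemma cover_lat D D' : fsupp D -> fsupp D' -> exists s, covers s (lat D) (lat D').
move=> fD fD'.
have fS := fsuppD fD (fsuppN fD'); have fS' := fsupp_max fS (fsuppN fS).
have /finite_seqP[r hr] : finite_set ([set p | D p <> 0] `|` [set p | D' p <> 0]).
 by rewrite finite_setU.
have [N hN] : exists N, forall p, p \in r -> (`|D' p - D p| <= N)%N.
 by apply: seq_bound => [p _|p n m nm /leq_trans]; [exists `|(D' p - D p)%R|%N|apply].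
have [s c] := cover_steps D (flatten (nseq N r)); exists s.
apply: cover_sub c => // x; apply: lat_le => p; rewrite /add1 count_flatten map_nseq sumn_nseq.
have [pr|pr] := boolP (p \in r).
 have := hN p pr; have : (0 < count_mem p r)%N by rewrite -has_count has_pred1.
 have := leq_pmulr N; nia.
have : ~ ([set p | D p <> 0] `|` [set p | D' p <> 0]) p by rewrite hr /=; apply/negP.
by move=> /not_orP[/contrapT -> /contrapT ->].
Qed.

(** * The adeles as the sum of E and a lattice *)

Lemma coprime_split (Q d : {poly k}) : Q != 0 ->
 exists Q1 Q2 n, [/\ Q = Q1 * Q2, Q1 %| d ^+ n & coprimep Q2 d].
move: {2}(size Q) (leqnn (size Q)) => n; elim: n Q => [|n IH] Q sQ Q0.
 by move: sQ Q0; rewrite leqn0 size_poly_eq0 => ->.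
have [c|nc] := boolP (coprimep Q d).
 by exists 1, Q, 0%N; split; rewrite ?mul1r // expr0.
have gQ := dvdp_gcdl Q d; have gd := dvdp_gcdr Q d; set g := gcdp Q d in gQ gd nc.
have Qg : Q = g * (Q %/ g) by rewrite mulrC divpK.
have g0 : g != 0 by apply: contra_neq Q0 => g0; rewrite Qg g0 mul0r.
have sg : (1 < size g)%N.
 by move: nc; rewrite /coprimep -/g neq_ltn ltnS leqn0 size_poly_eq0 (negPf g0).
have Q'0 : Q %/ g != 0 by apply: contra_neq Q0 => h; rewrite Qg h mulr0.
have [|//|Q1 [Q2 [m [e h1 h2]]]] := IH (Q %/ g).
 have sQ' : (size (g * (Q %/ g))%R <= n.+1)%N by rewrite -Qg.
 move: sQ'; rewrite size_mul //; move: sg; move: (size g) (size (Q %/ g)) => u v.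
 lia.
exists (g * Q1), Q2, m.+1; split=> //; first by rewrite -mulrA -e.
by rewrite exprS; apply: dvdp_mul.
Qed.

(** Two different powers of [x] agree in the finite residue field; their difference is the
    polynomial. *)
Lemma poly_in_max (p : place) x : pring p x ->
 exists2 P : {poly k}, P != 0 & maxid (pring p) (ev x P).
move=> px; have [s [_ cs]] := residue_cover p.
have /choice[f hf] : forall i, exists y, y \in s /\ maxid (pring p) (x ^+ i - y).
 by move=> i; have [y ys my] := cs _ (prX i px); exists y.
have [i [j [ij fij]]] : exists i j, (i < j)%N /\ f i = f j.
 apply: contrapT => nex.
 have um : uniq (mkseq f (size s).+1).
  apply/mkseq_uniqP => i j _ _ fij; apply/eqP; rewrite eqn_leq.
  by apply/andP; split; rewrite leqNgt; apply/negP => h; apply: nex;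
   [exists j, i|exists i, j].
 have /(uniq_leq_size um) : {subset mkseq f (size s).+1 <= s}.
  by move=> y /mapP[l _ ->]; case: (hf l).
 by rewrite size_mkseq ltnn.
exists ('X^i - 'X^j).
 apply/eqP => /polyP/(_ i); rewrite coefB !coefXn eqxx coef0 (ltn_eqF ij) subr0.
 by apply/eqP; exact: oner_neq0.
rewrite evD evN !evXn evX.
have -> : x ^+ i - x ^+ j = (x ^+ i - f i) - (x ^+ j - f j).
 by rewrite fij opprB addrA subrK.
by apply: maxD; [exact: (hf i).2|apply/maxN; exact: (hf j).2].
Qed.

Lemma poly_clear x e : exists2 d : {poly k}, d != 0 &
 forall p : place, pring p x -> pring p (ev x d * e).
have /finite_seqP[r hr] := finite_poles e.
have /choice[P hP] : forall p : place, exists P : {poly k}, P != 0 /\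
  (pring p x -> maxid (pring p) (ev x P)).
 move=> p; have [px|npx] := pselect (pring p x).
  by have [P P0 mP] := poly_in_max px; exists P.
 by exists 1; rewrite oner_neq0.
have [N hN] : exists N : nat, forall p, p \in r -> vge p (- N%:Z) e.
 by apply: seq_bound => [p _|p n m nm]; [exact: vge_exists|apply: vge_le; lia].
exists (\prod_(p <- r) P p ^+ N).
 by rewrite prodf_seq_neq0; apply/allP => p _; rewrite expf_neq0 // (hP p).1.
move=> p px; have Opr (r' : seq place) : pring p (ev x (\prod_(q <- r') P q ^+ N)).
 exact: pr_ev.
have [pr|pr] := boolP (p \in r); last first.
 apply: prM => //; apply: contrapT => np.
 have : [set p : place | ~ pring p e] p by [].
 by rewrite hr /=; apply/negP.
rewrite (big_rem p) //= evM mulrAC; apply: prM => //.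
apply/(vge0n p); have -> : 0 = N%:Z - N%:Z by rewrite subrr.
apply: vgeM; last exact: hN.
rewrite evXn; have := vgeX N ((maxid_vge _ _).1 ((hP p).2 px)).
by rewrite -mulr_natr mul1r natz.
Qed.

Lemma ev_coprime_unit (p : place) x (Q1 d : {poly k}) n : pring p x ->
 Q1 %| d ^+ n -> ~ maxid (pring p) (ev x d) ->
 ev x Q1 != 0 /\ pring p (ev x Q1)^-1.
move=> px /dvdpP[W e] nm.
have d0 : ev x d != 0 by apply: contra_notN nm => /eqP ->; exact: max0.
have Od : pring p (ev x d)^-1.
 by apply: contrapT => nO; apply: nm; apply/maxidE; right.
have eq1 : ev x W * ev x Q1 = ev x d ^+ n by rewrite -evXn e evM.
have q0 : ev x Q1 != 0.
 by apply: contraTneq (expf_neq0 n d0) => q0; rewrite -eq1 q0 mulr0 eqxx.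
split=> //; have -> : (ev x Q1)^-1 = ev x W * (ev x d)^-1 ^+ n.
 by apply: (mulIf q0); rewrite mulVf // mulrAC eq1 exprVn mulfV // expf_neq0.
by apply: prM; [exact: pr_ev|exact: prX].
Qed.

(** Strong approximation away from the poles of [x]. Weak approximation gives [e0] near [a] at the
    zeros of a polynomial [d] in [x] vanishing at the bad places; the poles of [e0] elsewhere are
    then removed by a factor congruent to 1 modulo a high power of [d]. *)
Lemma adele_finite_part x (a : adele M) : transc x ->
 exists e, forall p : place, pring p x -> cint M p (aval a p - cmap M p e).
move=> tx.
have /finite_seqP[r hr] := avalP a.
have /choice[P hP] : forall p : place, exists P : {poly k}, P != 0 /\
  (pring p x -> maxid (pring p) (ev x P)).
 move=> p; have [px|npx] := pselect (pring p x).
  by have [P P0 mP] := poly_in_max px; exists P.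
 by exists 1; rewrite oner_neq0.
pose d := \prod_(p <- r) P p.
have d0 : d != 0 by rewrite prodf_seq_neq0; apply/allP => p _; rewrite (hP p).1.
have xd0 : ev x d != 0 by apply: contra_neq d0 => /tx.
have /finite_seqP[r' hr'] := finite_zeros xd0.
have /choice[y hy] : forall p, exists y, cint M p (aval a p - cmap M p y).
 by move=> p; have [y h] := cmap_dense 0 (aval a p); exists y; apply/hge0n.
have [e0 he0] := weak_approx y 0 (undup_uniq r').
have [Q Q0 hQ] := poly_clear x e0.
(* [Q] clears the poles of [e0]. Only its part [Q2] prime to [d] is used as a factor, since [Q1] may
   vanish at the zeros of [d], where [e0] must not be disturbed; a Bezout multiple of [Q2] is
   congruent to 1 modulo [d ^+ N]. *)
have [Q1 [Q2 [n [QE Q1d cQ2]]]] := coprime_split d Q0.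
have [N hN] : exists N : nat, forall p, p \in r' -> vge p (- N%:Z) e0.
 by apply: seq_bound => [p _|p m m' nm]; [exact: vge_exists|apply: vge_le; lia].
have /Bezout_eq1_coprimepP[[m w] /= mw] : coprimep Q2 (d ^+ N) by rewrite coprimep_expr.
exists (ev x (m * Q2) * e0) => p px.
have Ox : forall W, pring p (ev x W) by move=> W; apply: pr_ev.
have [mp|nmp] := pselect (maxid (pring p) (ev x d)).
 have pr' : p \in r'.
  by have : [set p : place | maxid (pring p) (ev x d)] p by []; rewrite hr'.
 have -> : aval a p - cmap M p (ev x (m * Q2) * e0) =
   (aval a p - cmap M p (y p)) - cmap M p (e0 - y p) +
   cmap M p (ev x w * (ev x d ^+ N * e0)).
  have -> : ev x (m * Q2) = 1 - ev x w * ev x d ^+ N.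
   by rewrite -evXn -evM -(ev1 x) -mw evD addrK.
  by rewrite !(rmorphB, rmorphM) /=; ring.
 apply: cintD; first apply: cintB.
 - exact: hy.
 - by apply/cint_j/(vge0n p)/he0; rewrite mem_undup.
 - apply/cint_j/prM => //; apply/(vge0n p).
  have -> : 0 = N%:Z - N%:Z by rewrite subrr.
  apply: vgeM; last exact: hN.
  by have := vgeX N ((maxid_vge _ _).1 mp); rewrite -mulr_natr mul1r natz.
apply: cintB.
 apply: contrapT => nc; apply: nmp.
 have pr : p \in r by have : [set p | ~ cint M p (aval a p)] p by []; rewrite hr.
 rewrite /d (big_rem p) //= evM mulrC; apply: maxM; last exact: (hP p).2.
 exact: pr_ev.
apply/cint_j; have [q0 Oq] := ev_coprime_unit px Q1d nmp.
have -> : ev x (m * Q2) * e0 =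
  ev x m * (ev x Q1)^-1 * (ev x Q * e0).
 by rewrite QE !evM; field.
by apply: prM; [apply: prM|apply: hQ].
Qed.

(** Written in [x^-1], numerator and denominator share the factor [x ^+ n], and the reversed
    denominator has the leading coefficient of [Q] as constant term, hence is a unit at a pole of
    [x]. *)
Lemma ev_frac_pr (p : place) x (P Q : {poly k}) : ~ pring p x ->
 (size P <= size Q)%N -> Q != 0 -> pring p (ev x P / ev x Q).
move=> npx PQ Q0; have [x0 ox] := npr_ord npx.
have Ox : pring p x^-1 by apply: prV.
have mx : maxid (pring p) x^-1 by apply/maxidE; right; rewrite invrK.
pose n := (size Q).-1.
have sQ : size Q = n.+1 by rewrite prednK // size_poly_gt0.
have e (W : {poly k}) : (size W <= n.+1)%N ->
  ev x W = x ^+ n * ev x^-1 (\poly_(i < n.+1) W`_(n - i)).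
 move=> sW; rewrite ev_poly -[W in LHS](coefK W).
 have -> : \poly_(i < size W) W`_i = \poly_(i < n.+1) W`_i.
  apply/polyP => i; rewrite !coef_poly; case: ltnP => h; first by rewrite (leq_trans h sW).
  by case: ifP => // _; rewrite nth_default.
 rewrite ev_poly mulr_sumr (reindex_inj rev_ord_inj) /=; apply: eq_bigr => i _.
 have ip := ltn_ord i; rewrite subSS.
 have -> : x ^+ n = x ^+ (n - i) * x ^+ i by rewrite -exprD subnK.
 by rewrite exprVn mulrACA mulfV ?expf_neq0 // mulr1 mulrC.
rewrite !e ?sQ // -?sQ //.
have nm : ~ maxid (pring p) (ev x^-1 (\poly_(i < n.+1) Q`_(n - i))).
 move=> /(ev_max mx)/eqP; apply/negP.
 by rewrite horner_coef0 coef_poly /= subn0 -[n]/((n.+1).-1) -sQ -lead_coefE lead_coef_eq0.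
have nz : ev x^-1 (\poly_(i < n.+1) Q`_(n - i)) != 0.
 by apply: contra_notN nm => /eqP ->; exact: max0.
rewrite sQ -mulf_div divff ?expf_neq0 // mul1r; apply: prM; first exact: pr_ev.
by apply: contrapT => nO; apply: nm; apply/maxidE; right.
Qed.

(** After [adele_finite_part] and an approximation at the poles of [x], the correction in E is
    divided with remainder over k[x]: the polynomial part [s] is integral at the finite places, and
    the fractional part left out is bounded at the poles of [x] independently of the adele. *)
Lemma adele_dec : exists2 D, fsupp D &
 forall a, exists e, lat D (a - dg e).
have [x [tx [n [b hb]]]] := ff.
have /choice[d hd] : forall i, exists d : {poly k}, d != 0 /\
  forall p : place, pring p x -> pring p (ev x d * b i).
 by move=> i; have [d d0 h] := poly_clear x (b i); exists d.
have [x0 [p0 npx0]] : x != 0 /\ exists p0 : place, ~ pring p0 x.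
 have [p np] := pole_exists tx; split; last by exists p.
 by case: (npr_ord np).
pose b' i := ev x (d i) * b i.
have hb' e : exists (Q : {poly k}) (P : 'I_n -> {poly k}), Q != 0 /\
  e * ev x Q = \sum_i ev x (P i) * b' i.
 have [Q [P [Q0 eQ]]] := hb e.
 exists (Q * \prod_i d i), (fun i => P i * \prod_(j | j != i) d j); split.
  by rewrite mulf_neq0 // prodf_seq_neq0; apply/allP => i _; rewrite (hd i).1.
 rewrite evM mulrA eQ mulr_suml; apply: eq_bigr => i _.
 rewrite -/(ev x (P i)) (bigD1 i) //= !evM /b'; ring.
have /finite_seqP[r hr] := finite_poles x.
have [B hB] : exists B : nat, forall p, p \in r -> forall i, vge p (- B%:Z) (b' i).
 apply: seq_bound => [p _|p m m' mm h i]; last by apply: vge_le (h i); lia.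
 have [|i m m' mm h|m hm] := @seq_bound _ (enum 'I_n) (fun i m => vge p (- m%:Z) (b' i)).
 - by move=> i _; exact: vge_exists.
 - by apply: vge_le h; lia.
 - by exists m => i; apply: hm; rewrite mem_enum.
exists (fun p => if p \in r then - B%:Z else 0).
 apply: (sub_finite_set _ (finite_seq r)) => p /=; by case: ifP.
move=> a; have [e he] := adele_finite_part a tx.
have /choice[y hy] : forall p, exists y, cint M p (aval a p - cmap M p e - cmap M p y).
 by move=> p; have [y h] := cmap_dense 0 (aval a p - cmap M p e); exists y; apply/hge0n.
have [e' he'] := weak_approx y 0 (undup_uniq r).
have [Q [P [Q0 eQ]]] := hb' e'.
have xQ0 : ev x Q != 0 by apply: contra_neq Q0 => /tx.
pose s := \sum_i ev x (P i %/ Q) * b' i.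
have e's : e' = s + \sum_i ev x (P i %% Q) / ev x Q * b' i.
 apply: (mulIf xQ0); rewrite eQ mulrDl mulr_suml [X in _ + X]mulr_suml -big_split /=.
 apply: eq_bigr => i _; rewrite {1}(divp_eq (P i) Q) evD evM; field.
 exact: xQ0.
exists (e + s) => p; rewrite /= rmorphD /= opprD addrA.
have [pr|npr] := boolP (p \in r); last first.
 have px : pring p x.
  apply: contrapT => np; have : [set p : place | ~ pring p x] p by [].
  by rewrite hr /=; apply/negP.
 apply/hge0n; apply: cintB; first exact: he.
 apply/cint_j/pr_sum => i _; apply: prM; first exact: pr_ev.
 exact: (hd i).2.
have npx : ~ pring p x by have : [set` r] p by []; rewrite -hr.
have -> : aval a p - cmap M p e - cmap M p s =
  (aval a p - cmap M p e - cmap M p (y p)) - cmap M p (e' - y p) +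
  cmap M p (\sum_i ev x (P i %% Q) / ev x Q * b' i).
 by rewrite {1}e's !rmorphB rmorphD /=; ring.
apply: hgeD; first apply: hgeB.
- by apply: (@hge_le p _ 0); [lia|apply/hge0n/hy].
- by apply/hge_j; apply: (@vge_le _ _ 0); [lia|apply: he'; rewrite mem_undup].
- apply/hge_j/vge_sum => i _; rewrite -[- B%:Z]add0r; apply: vgeM; last exact: hB.
 apply/(vge0n p); apply: ev_frac_pr => //; apply: ltnW.
 by rewrite ltn_modp.
Qed.
End Completion.

(** * Weil differentials and duality by counting *)

Section Weil.
Variable M : completions (@place_ring k E iota).

(** A copy of the adeles carrying the k-vector space structure that traces and functionals need. *)
Definition kad : Type := adele M.
HB.instance Definition _ := GRing.Zmodule.on kad.
Notation A := kad.
Notation dg := (dg M).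

Definition kscale (a : k) (x : A) : A := dg (iota a) * x.
Fact kscaleA a b x : kscale a (kscale b x) = kscale (a * b) x.
by rewrite /kscale !rmorphM mulrA. Qed.
Fact kscale1 : left_id 1 kscale.
by move=> x; rewrite /kscale !rmorph1 mul1r. Qed.
Fact kscaleDr : right_distributive kscale +%R.
by move=> a x y; rewrite /kscale mulrDr. Qed.
Fact kscaleDl x : {morph kscale^~ x : a b / a + b}.
by move=> a b; rewrite /kscale !rmorphD mulrDl. Qed.
HB.instance Definition _ := GRing.Zmodule_isLmodule.Build k kad
 kscaleA kscale1 kscaleDr kscaleDl.

Lemma kscaleE (a : k) (x : A) : a *: x = dg (iota a) * x :> adele M.
by []. Qed.

Definition dgE : set A := [set x | exists e, x = dg e].
Lemma lat_linsub D : linsub (lat (M := M) D : set A).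
have [h0 hB] := lat_sgp M D; split=> // a x y hx hy p /=.
apply: hgeD; last exact: hy.
rewrite mulrC; apply: hgeMc; first exact: hx.
by apply/(cint_j M); exact: prc.
Qed.

Definition elat D : set A := sumset dgE (lat D).
Lemma dgE_linsub : linsub dgE.
split; first by exists 0; rewrite rmorph0.
by move=> a _ _ [e ->] [e' ->]; exists (iota a * e + e'); rewrite rmorphD rmorphM.
Qed.

Lemma linsub_sgp (S : set A) : linsub S -> sgp S.
move=> [S0 Sl]; split=> // x y Sx Sy.
by rewrite addrC -scaleN1r; apply: Sl.
Qed.

Lemma elat_linsub D : linsub (elat D).
have [l0 ll] := lat_linsub D; have [d0 dl] := dgE_linsub.
split; first by exists 0, 0; rewrite addr0.
move=> a _ _ [x [y [dx ly ->]]] [x' [y' [dx' ly' ->]]].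
exists (a *: x + x'), (a *: y + y'); rewrite scalerDr addrACA; split=> //.
 exact: dl.
exact: ll.
Qed.

Lemma elat_sgp D : sgp (elat D). exact: linsub_sgp (elat_linsub D). Qed.
(** Weil's notion of a differential; [residue_functional] later produces such functionals from
    Kaehler differentials. *)
Definition weil (f : A -> k) :=
 [/\ lfun f, forall e, f (dg e) = 0 & exists2 D, fsupp D & forall x, lat D x -> f x = 0].

Lemma weil_elat (f : A -> k) D : lfun f -> (forall e, f (dg e) = 0) ->
 (forall x, lat D x -> f x = 0) -> forall x, elat D x -> f x = 0.
by move=> lf fe fD _ [_ [y [[e ->] ly ->]]]; rewrite (lfunD lf) fe fD // addr0.
Qed.

Lemma weil_mul (f : A -> k) e : weil f -> weil (fun x => f (dg e * x)).
move=> [lf fe [D fD fz]]; split.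
- move=> a x y; rewrite -lf; congr f; rewrite !kscaleE mulrDr; congr (_ + _).
 by rewrite !mulrA (mulrC (dg e)).
- by move=> e'; rewrite -rmorphM fe.
- have [->|e0] := eqVneq e 0.
  by exists D => // x _; rewrite rmorph0 mul0r (lfun0 lf).
 exists (fun p => D p - ord p e).
  by apply: fsuppD => //; apply/fsuppN/fsupp_ord.
 move=> x hx; apply: fz; have := lat_dg e0 hx; apply: lat_le => p.
 by rewrite subrK.
Qed.

Lemma unif_exp_nvge (q : place) (m n : int) : m < n -> ~ vge q n (unif q ^ m).
move=> mn; rewrite /vge -expfzDr; last exact: unif_neq0 (unifP q).
by move=> /unif_exp; rewrite subr_ge0 leNgt mn.
Qed.

(** The adele equal to a uniformizer at [q] and to 0 elsewhere is not in E plus the lattice of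
    divisor [2 q]: its component in E would be nonzero, vanish at [q] and have no pole anywhere. A
    functional separates it. *)
Lemma weil_exists : exists f x, weil f /\ f x != 0.
have [t tt] := tr_exists; have [q _] := pole_exists tt.
have u0 := unif_neq0 (unifP q).
pose D (p : place) : int := if p == q then 2 else 0.
have fD : fsupp D.
 by apply: (sub_finite_set _ (@finite_set1 _ q)) => p /=; rewrite /D; case: eqP.
pose x : A := atp (cmap M q (unif q)).
have nx : ~ elat D x.
 move=> [_ [y [[e ->] ly xe]]].
 have ep p : aval x p - cmap M p e = aval y p by rewrite xe /= addrC addKr.
 have eq2 : vge q 2 (unif q - e).
  apply/(hge_j M); rewrite rmorphB.
  have := ep q; rewrite atp_in => ->; have := ly q; by rewrite /D eqxx.
 have u1 : vge q 1 (unif q) by have := vge_unif q 1; rewrite expr1z.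
 have u2 : ~ vge q 2 (unif q).
  by have := @unif_exp_nvge q 1 2 isT; rewrite expr1z.
 have e0 : e != 0 by apply/eqP => e0; apply: u2; rewrite e0 subr0 in eq2.
 have me : maxid (pring q) e.
  apply/maxid_vge; rewrite -[e](subKr (unif q)); apply: vgeB => //.
  by apply: vge_le eq2.
 have [p np] := pole_exists (max_transc me e0).
 have [pq|pq] := eqVneq p q; first by apply: np; rewrite pq; apply: max_pr.
 apply: np; apply/(cint_j M); have := ep p; rewrite atp_out // sub0r => h.
 by rewrite -[cmap M p e]opprK h; apply: cintN; apply/hge0n; have := ly p; rewrite /D (negPf pq).
have [f [lf fz f1]] := separating_fun (elat_linsub D) nx.
exists f, x; split; last by rewrite f1 oner_neq0.
split=> // [e|].
 apply: fz; exists (dg e), 0; rewrite addr0; split=> //; first by exists e.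
 by case: (lat_sgp M D).
exists D => // y ly; apply: fz; exists 0, y; rewrite add0r; split=> //.
by exists 0; rewrite rmorph0.
Qed.

Lemma covers_elat D : fsupp D -> exists s, covers s setT (elat D).
move=> fD; have [D0 f0 dec] := adele_dec M.
have [s cs] := cover_lat M f0 fD; exists s => x _.
have [e he] := dec x; have [y ys hy] := cs _ he; exists y => //.
exists (dg e), (x - dg e - y); split=> //; first by exists e.
by rewrite addrA (addrC (dg e)) subrK.
Qed.

Section Count.
Variables (C : numFieldType) (psi : k -> C).
Hypothesis hpsi : nontrivial_character psi.

Lemma psi_lfun_neq1 (V : lmodType k) (f : V -> k) y : lfun f -> f y != 0 ->
 exists c, psi (f (c *: y)) != 1.
move=> lf f0; have [_ _ [a pa]] := hpsi; exists (a / f y).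
by rewrite (lfunZ lf) divfK.
Qed.

(** Orthogonality of characters replaces dimensions: the values of [n] characters on representatives
    form a matrix [P] for which [P *m Q] is a nonzero scalar matrix, so [n] is at most the number of
    representatives. *)
Lemma functionals_le (S : set A) (s : seq A) n (F : 'I_n -> A -> k) :
 linsub S -> covers s setT S -> (forall i, lfun (F i)) ->
 (forall i x, S x -> F i x = 0) ->
 (forall i j, (forall x, F i x = F j x) -> i = j) -> (n <= size s)%N.
move=> subS cs lF FS Finj; have [p0 pD _] := hpsi.
have [r [_ sr ir cr]] := transversal (linsub_sgp subS) cs.
apply: leq_trans sr.
have sT : sgp [set: A] by [].
have r0 : r != [::] by have [y yr _] := cr 0 I; apply: contraTneq yr => ->.
have orth i j : i != j -> \sum_(x <- r) psi (F i x - F j x) = 0.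
 move=> ij; have lG : lfun (fun x => F i x - F j x).
  by move=> a x y; rewrite !lF; ring.
 have [y Gy] : exists y, F i y - F j y != 0.
  apply: contrapT => nex; move/eqP: ij; apply; apply: Finj => x.
  by apply/eqP; rewrite -subr_eq0; apply/negPn/negP => h; apply: nex; exists x.
 have [c pc] := psi_lfun_neq1 lG Gy.
 have := @sum_transversal _ _ _ sT r S (fun x => psi (F i x - F j x))
  (linsub_sgp subS) (@subsetT _ _) (fun _ _ => I) ir cr _ (c *: y) I.
 rewrite (eq_bigr (fun a => psi (F i (c *: y) - F j (c *: y)) * psi (F i a - F j a))).
  rewrite -mulr_sumr => h; apply/eqP; apply: contraNT pc => z.
  apply/eqP/(mulIf z); rewrite mul1r; apply: h => u x Su _.
  by rewrite !(lfunD (lF _)) !(FS _ _ Su) !add0r.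
 by move=> a _; rewrite -pD !(lfunD (lF _)); congr psi; ring.
pose P : 'M[C]_(n, size r) := \matrix_(i, l) psi (F i r`_l).
pose Q : 'M[C]_(size r, n) := \matrix_(l, i) psi (- F i r`_l).
have PQ : P *m Q = (size r)%:R%:M.
 apply/matrixP => i j; rewrite !mxE.
 have -> : \sum_l P i l * Q l j = \sum_(x <- r) psi (F i x - F j x).
  rewrite (big_nth 0) big_mkord; apply: eq_bigr => l _; by rewrite !mxE -pD.
 have [<-|ij] := eqVneq i j; last by rewrite orth.
 rewrite (eq_bigr (fun=> 1)) => [|x _]; last by rewrite subrr p0.
 by rewrite big_const_seq count_predT iter_addr_0.
have : \rank (P *m Q) = n.
 by rewrite PQ mxrank_scalar natr_neq0 ?mul1n || rewrite PQ -scalemx1 mxrank_scale_nz ?natr_neq0 // mxrank1.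
by move=> <-; apply: leq_trans (mxrankM_maxl _ _) (rank_leq_col _).
Qed.

Definition pt (q : place) (l : int) (p : place) : int := if p == q then l else 0.
Lemma fsupp_pt q l : fsupp (pt q l).
by apply: (sub_finite_set _ (@finite_set1 _ q)) => p /=; rewrite /pt; case: eqP.
Qed.

Lemma atp_lat D q (x : cring M q) : lat D (atp x) <-> hge (D q) x.
split=> [/(_ q)|hx p]; first by rewrite atp_in.
have [->|pq] := eqVneq p q; first by rewrite atp_in.
by rewrite atp_out //; exact: hge_0.
Qed.

Lemma atpB q (x y : cring M q) : atp (x - y) = atp x - atp y.
apply: aval_inj => p /=; have [->|pq] := eqVneq p q; first by rewrite !atp_in.
by rewrite !atp_out // subr0.
Qed.

(** Powers of the uniformizer with exponents [d] down to [d - l] are pairwise incongruent, because a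
    difference has the lower of the two orders. *)
Lemma pole_list_indep (q : place) (d : int) (l : nat) D : D q = d ->
 let r := [seq atp (cmap M q (unif q ^ (d - i%:Z))) : adele M | i <- seq.iota 0 l.+1] in
 indep r (lat D) /\ size r = l.+1.
move=> Dq r; have main (i i' : nat) : (i < i')%N ->
  ~ lat D (atp (cmap M q (unif q ^ (d - i%:Z))) - atp (cmap M q (unif q ^ (d - i'%:Z)))).
 move=> ii'; rewrite -atpB => /atp_lat; rewrite -rmorphB Dq => /hge_j h.
 apply: (@unif_exp_nvge q (d - i'%:Z) (d - i%:Z)); first lia.
 rewrite -[unif q ^ (d - i'%:Z)](subKr (unif q ^ (d - i%:Z))); apply: vgeB.
  exact: vge_unif.
 by apply: vge_le h; lia.
have ndiff (i i' : nat) : lat D (atp (cmap M q (unif q ^ (d - i%:Z))) -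
  atp (cmap M q (unif q ^ (d - i'%:Z)))) -> i = i'.
 move=> h; case: (ltngtP i i') => // ii'; first by case: (main _ _ ii' h).
 by case: (main _ _ ii' (sgpC (lat_sgp M D) h)).
split; last by rewrite size_map size_iota.
split.
 rewrite map_inj_uniq ?iota_uniq // => i i' e; apply: ndiff.
 by rewrite e subrr; case: (lat_sgp M D).
by move=> _ _ /mapP[i _ ->] /mapP[i' _ ->] /ndiff ->.
Qed.

(** If [f] and [g] were independent over E, pairs of elements of E indexed by [r] would give
    distinct functionals vanishing on a common subspace [S]. There are [size r * size r] of them,
    whereas the index of [S] grows only linearly in [size r]. *)
Lemma weil_onedim f g y : weil f -> weil g -> g y != 0 ->
 exists e, forall x, f x = g (dg e * x).
move=> wf wg gy; apply: contrapT => nex.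
have [lf fe [Bf fBf fz]] := wf; have [lg ge [Bg fBg gz]] := wg.
pose comb e e' (x : A) := f (dg e * x) + g (dg e' * x).
have nz e e' : (forall x, comb e e' x = 0) -> e = 0 /\ e' = 0.
 move=> h; have [e0|e0] := eqVneq e 0; last first.
  case: nex; exists (- (e' / e)) => x; have := h (dg e^-1 * x).
  rewrite /comb !mulrA -!rmorphM mulfV // rmorph1 mul1r => /eqP.
  by rewrite addr_eq0 => /eqP ->; rewrite rmorphN mulNr (lfunN lg).
 split=> //; apply/eqP; apply: contraNT gy => e'0; apply/eqP.
 have := h (dg e'^-1 * y); rewrite /comb e0 rmorph0 mul0r (lfun0 lf) add0r.
 by rewrite mulrA -rmorphM mulfV // rmorph1 mul1r.
have [D0 f0 dec] := adele_dec M.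
have [t tt] := tr_exists; have [q _] := pole_exists tt.
pose B p := Num.max (Bf p) (Bg p); have fB : fsupp B by apply: fsupp_max.
have [c0 hc0] := cover_lat M f0 (fsuppD fB (fsuppN f0)).
(* The index of [S] will be at most [size r * size c0], so any [r] longer than [c0] gives the
   contradiction; poles of order up to [l] at [q] supply more than [l] classes. *)
pose l := size c0; have fq := fsupp_pt q.
have [s0 cs0] := cover_lat M (fq (- l%:Z)) fsupp0.
have [r [rL _ [ur ir] cr]] := transversal (lat_sgp M _) cs0.
have lr : (l < size r)%N.
 have [i1 s1] := @pole_list_indep q 0 l (fun=> 0) erefl.
 rewrite -s1; apply: indep_le_cover (lat_sgp M _) i1 _ cr => _ /mapP[i il ->].
 move: il; rewrite mem_iota add0n leq0n /= ltnS => il.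
 by apply/atp_lat/hge_j; rewrite /pt eqxx; apply: vge_le (vge_unif q _); lia.
have /choice[e he] : forall x : adele M, exists e, lat D0 (tid M D0 * x - dg e).
 by move=> x; exact: dec.
have eL x : x \in r -> lat (fun p => D0 p + pt q (- l%:Z) p) (dg (e x)).
 move=> xr; rewrite -[dg (e x)](subKr (tid M D0 * x)).
 apply: (lat_sgp M _).2; first exact: tid_lat (rL x xr).
 apply: lat_le (he x) => p; rewrite /pt; case: eqP => _; lia.
have einj x x' : x \in r -> x' \in r -> e x = e x' -> x = x'.
 move=> xr x'r ee; apply: ir => //.
 have := (lat_sgp M _).2 _ _ (he x) (he x').
 rewrite ee opprB addrA subrK -mulrBr => h.
 have := tid_lat (M := M) (fsuppN f0) h; rewrite tidK //.
 by apply: lat_le => p; rewrite addNr.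
pose D1 p := D0 p + pt q l%:Z p.
pose S := elat (fun p => B p - D0 p + pt q l%:Z p).
have cS : covers [seq a + b | a <- map ( *%R (tid M D1)) r,
   b <- map ( *%R (tid M (pt q l%:Z))) c0] setT S.
 move=> x _; have [e1 he1] := dec x.
 have c1 := cover_shift (fsuppD f0 (fq l%:Z)) cr.
 have c2 := cover_shift (fq l%:Z) hc0.
 have c12 : covers [seq a + b | a <- map ( *%R (tid M D1)) r,
   b <- map ( *%R (tid M (pt q l%:Z))) c0] (lat D0)
   (lat (fun p => B p - D0 p + pt q l%:Z p)).
  apply: cover_comp (cover_sub _ _ c1) (cover_sub _ _ c2).
  - by move=> z; apply: lat_le => p; rewrite /pt; case: eqP; lia.
  - by move=> z; apply.
  - by move=> z; apply: lat_le => p; rewrite addr0 addrC.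
  - by move=> z; apply: lat_le => p; rewrite addrC.
 have [z zs hz] := c12 _ he1; exists z => //.
 exists (dg e1), (x - dg e1 - z); split=> //; first by exists e1.
by rewrite [dg e1 + _]addrA [dg e1 + _]addrC subrK.
pose F (ij : 'I_(size r) * 'I_(size r)) := comb (e r`_ij.1) (e r`_ij.2).
pose F' (i : 'I_#|{: 'I_(size r) * 'I_(size r)}|) := F (enum_val i).
have lcomb a b : lfun (comb a b).
 have [l1 _ _] := weil_mul a wf; have [l2 _ _] := weil_mul b wg.
 by move=> c x x'; rewrite /comb l1 l2; ring.
have fS a b x : a \in r -> b \in r -> S x -> comb (e a) (e b) x = 0.
 move=> ar br Sx.
 have van h c (Bh : place -> int) : weil h -> (forall p, Bh p <= B p) ->
   (forall z, lat Bh z -> h z = 0) -> c \in r -> h (dg (e c) * x) = 0.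
  move=> wh BhB hz cr'; have [l1 e1 _] := weil_mul (e c) wh.
  apply: (weil_elat l1 e1 _ Sx) => z lz; apply: hz.
  by have := latM (eL c cr') lz; apply: lat_le => p; have := BhB p; rewrite /pt; case: eqP; lia.
 by rewrite /comb (van f a Bf) // ?(van g b Bg) ?addr0 // => p; rewrite /B; lia.
have : (#|{: 'I_(size r) * 'I_(size r)}| <= size r * size c0)%N.
 have := functionals_le (F := F') (elat_linsub _) cS; rewrite size_allpairs !size_map => h0.
 apply: h0 => [i|i x Sx|i j h]; [exact: lcomb|by apply: fS => //; apply: mem_nth|].
 apply: enum_val_inj; rewrite /F' /F in h.
 case: (enum_val i) (enum_val j) h => i1 i2 [j1 j2] /= h.
 have [|h1 h2] := nz (e r`_i1 - e r`_j1) (e r`_i2 - e r`_j2).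
  move=> x; have /eqP := h x; rewrite -subr_eq0 => /eqP <-.
  rewrite /comb !rmorphB !mulrBl (lfunB lf) (lfunB lg); ring.
 congr (_, _); apply/val_inj/eqP => /=; rewrite -(nth_uniq 0 _ _ ur) //;
  apply/eqP/einj; rewrite ?mem_nth //; exact/subr0_eq.
rewrite card_prod card_ord leq_pmul2l ?(leq_ltn_trans _ lr) // leqNgt lr.
by [].
Qed.

(** Such an [e] is determined by the values in k of its functional on representatives of the adeles
    modulo [elat D]: if two coincided, a nonzero multiple of [g] would vanish identically. *)
Lemma weil_ann_finite g y D : weil g -> g y != 0 -> fsupp D ->
 exists r : seq E, forall e, (forall x, lat D x -> g (dg e * x) = 0) -> e \in r.
move=> wg gy fD; have [s cs] := covers_elat fD.
pose S : set E := [set e | forall x, lat D x -> g (dg e * x) = 0].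
suff /finite_seqP[r hr] : finite_set S.
 by exists r => e he; have : S e by []; rewrite hr.
apply: (@finite_by_bound _ _ #|{: (size s).-tuple k}|.+1) => u uu uS.
pose ev' e : (size s).-tuple k := map_tuple (fun x => g (dg e * x)) (in_tuple s).
rewrite ltnS -(size_map ev') cardE; apply: uniq_leq_size; last by move=> t _; rewrite mem_enum.
rewrite map_inj_in_uniq // => e e' eu e'u /(congr1 val) /= h.
have hs x : x \in s -> g (dg e * x) = g (dg e' * x) by move=> xs; move/eq_in_map: h; apply.
apply/eqP; rewrite -subr_eq0; apply: contraNT gy => d0; apply/eqP.
have [lh he _] := weil_mul (e - e') wg; have [lg _ _] := wg.
have sub x : g (dg (e - e') * x) = g (dg e * x) - g (dg e' * x).
 by rewrite rmorphB mulrBl (lfunB lg).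
have z x : g (dg (e - e') * x) = 0.
 have [w ws hw] := cs x I; rewrite -[x](subrK w) (lfunD lh).
 rewrite [X in _ + X]sub hs // subrr addr0; apply: (weil_elat lh he _ hw) => z hz.
 by rewrite sub (uS e eu) // (uS e' e'u) // subrr.
by have := z (dg (e - e')^-1 * y); rewrite mulrA -rmorphM mulfV // rmorph1 mul1r.
Qed.

(** Multiplication by such an [e] carries the lattice of [B - D] into that of [B], on which [g]
    vanishes, so [weil_ann_finite] applies. *)
Lemma E_lat_finite D : fsupp D -> exists r : seq E, forall e, lat D (dg e) -> e \in r.
move=> fD; have [g [y [wg gy]]] := weil_exists; have [_ _ [B fB gB]] := wg.
have [r hr] := weil_ann_finite wg gy (fsuppD fB (fsuppN fD)).
exists r => e he; apply: hr => x hx; apply: gB.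
by have := latM he hx; apply: lat_le => p; rewrite addrCA subrr addr0.
Qed.

Lemma lat_seq (s : seq (adele M)) : exists2 D, fsupp D & forall x, x \in s -> lat D x.
elim: s => [|x s [D fD hD]]; first by exists (fun=> 0); first exact: fsupp0.
have [D' fD' hD'] := lat_exists x; exists (fun p => - Num.max (- D p) (- D' p)).
 by apply/fsuppN/fsupp_max; exact: fsuppN.
by move=> y; move=> /predU1P[->|/hD h]; [apply: (lat_le _ hD')|apply: (lat_le _ h)] => p; lia.
Qed.

(* Modulo a lattice on which [g] vanishes there are finitely many such [x]: adeles
  modulo [E] and a lattice are finite, and so is the set of the [x] in [E]. *)
Lemma conductor g y : weil g -> g y != 0 -> exists2 D, fsupp D &
 forall x, (forall z, lat (fun=> 0) z -> g (x * z) = 0) -> lat D x.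
move=> wg gy; have [lg _ [B fB gB]] := wg.
pose W x := forall z, lat (fun=> 0) z -> g (x * z) = 0.
have WB x x' : W x -> W x' -> W (x - x').
 by move=> h h' z hz; rewrite mulrBl (lfunB lg) h // h' // subrr.
have BW x : lat B x -> W x.
 by move=> hx z hz; apply: gB; apply: (lat_le _ (latM hx hz)) => p; rewrite addr0.
have [r hr] := weil_ann_finite wg gy fsupp0; have [s cs] := covers_elat fB.
pose rep y := xget 0 [set x | W x /\ elat B (x - y)].
have [D fD hD] := lat_seq ([seq rep y | y <- s] ++ [seq dg e : adele M | e <- r]).
exists (fun p => - Num.max (- D p) (- B p)); first by apply/fsuppN/fsupp_max; exact: fsuppN.
move=> x Wx; have [z zs hz] := cs x I.
have [Wr hr'] : W (rep z) /\ elat B (rep z - z).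
 exact: (@xgetI _ 0 [set x | W x /\ elat B (x - z)] x (conj Wx hz)).
have [_ [b [[e ->] lb]]] := (elat_sgp B).2 _ _ hz hr'.
rewrite opprB addrA subrK => xE.
have eE : dg e = x - rep z - b by rewrite xE addrK.
have er : e \in r by apply: hr; rewrite eE; apply: WB (WB _ _ Wx Wr) (BW _ lb).
have -> : x = rep z - (0 - (dg e : adele M)) + b by rewrite sub0r opprK -addrA -xE addrC subrK.
have DE a : lat D a -> lat (fun p => - Num.max (- D p) (- B p)) a by apply: lat_le => p; lia.
apply: (sgpD (lat_sgp M _)); last by apply: (lat_le _ lb) => p; lia.
apply: DE; apply: (lat_sgp M _).2; first by apply: hD; rewrite mem_cat map_f.
by apply: (lat_sgp M _).2; [exact: (lat_sgp M _).1|apply: hD; rewrite mem_cat map_f ?orbT].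
Qed.
End Count.
End Weil.

(** * Coefficient fields, traces and Laurent expansions *)

Section CoefficientField.
Variable M : completions (@place_ring k E iota).

Lemma card_pnat (R : nzRingType) (f : {rmorphism k -> R}) m : ([pchar R]).-nat (#|k| ^ m)%N.
have [l pl chl] := finPcharP k.
have : l.-nat #|k|.
 by have /andP[] := fin_ring_pchar_abelem chl; rewrite /pgroup cardsT.
rewrite pnatX => h; apply/orP; left; apply: sub_in_pnat h => i _ /eqP ->.
exact: rmorph_pchar chl.
Qed.

Section AtPlace.
Variable p : place.
Notation F := (cring M p).
Notation Oh := (cint M p).
Notation j := (cmap M p).
Notation O := (pring p).
Notation q := #|k|.
Implicit Types (x y a b : F).
Let jk : {rmorphism k -> F} := (j \o iota)%FUN.
Let q1 : (1 < q)%N := finNzRing_gt1 k.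

Lemma frobD x y m : (x + y) ^+ (q ^ m) = x ^+ (q ^ m) + y ^+ (q ^ m).
by rewrite exprDn_pchar //; exact: (card_pnat jk). Qed.
Lemma frobN x m : (- x) ^+ (q ^ m) = - x ^+ (q ^ m).
by rewrite exprNn_pchar //; exact: (card_pnat jk). Qed.
Lemma frobB x y m : (x - y) ^+ (q ^ m) = x ^+ (q ^ m) - y ^+ (q ^ m).
by rewrite frobD frobN. Qed.
Lemma qX_gt0 m : (0 < q ^ m)%N. by rewrite expn_gt0 (ltnW q1). Qed.
Lemma frob0 m : (0 : F) ^+ (q ^ m) = 0.
by rewrite expr0n; case: (q ^ m)%N (qX_gt0 m). Qed.
Lemma frob_sum I (r : seq I) (P : pred I) (G : I -> F) m :
 (\sum_(i <- r | P i) G i) ^+ (q ^ m) = \sum_(i <- r | P i) G i ^+ (q ^ m).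
by apply: (big_morph (fun x => x ^+ (q ^ m))) => [x y|]; rewrite ?frobD ?frob0. Qed.
Lemma frob_k c m : jk c ^+ (q ^ m) = jk c.
rewrite -rmorphXn; congr (jk _); elim: m => [|m IH]; first by rewrite expn0 expr1.
by rewrite expnS exprM expf_card.
Qed.

Notation kap := (@coef_field k E iota M p).

Lemma frob_iter x m n : x ^+ (q ^ m) = x -> x ^+ (q ^ (m * n)) = x.
by move=> h; elim: n => [|n IH]; rewrite ?muln0 ?expn0 ?expr1 // mulnS expnD exprM h. Qed.

Lemma kap_common x y : kap x -> kap y ->
 exists m, [/\ (0 < m)%N, x ^+ (q ^ m) = x & y ^+ (q ^ m) = y].
move=> [m m0 hx] [n n0 hy]; exists (m * n)%N; rewrite muln_gt0 m0 n0; split=> //.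
 exact: frob_iter.
by rewrite mulnC; apply: frob_iter.
Qed.

Lemma kap_k c : kap (jk c). by exists 1%N => //; exact: frob_k. Qed.
Lemma kap0 : kap 0. by rewrite -(rmorph0 jk); exact: kap_k. Qed.
Lemma kap1 : kap 1. by rewrite -(rmorph1 jk); exact: kap_k. Qed.
Lemma kapB x y : kap x -> kap y -> kap (x - y).
by move=> kx /(kap_common kx)[m [m0 hx hy]]; exists m => //; rewrite frobB hx hy. Qed.
Lemma kapN x : kap x -> kap (- x). by move=> kx; rewrite -sub0r; apply: kapB kap0 kx. Qed.
Lemma kapD x y : kap x -> kap y -> kap (x + y).
by move=> kx ky; rewrite -[y]opprK; apply/kapB/kapN. Qed.
Lemma kapM x y : kap x -> kap y -> kap (x * y).
by move=> kx /(kap_common kx)[m [m0 hx hy]]; exists m => //; rewrite exprMn hx hy. Qed.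
Lemma kapX x n : kap x -> kap (x ^+ n).
by move=> kx; elim: n => [|n IH]; [exact: kap1|rewrite exprS; exact: kapM]. Qed.

Lemma hgeX (n : nat) x (l : nat) : hge n x -> hge (n * l)%N (x ^+ l).
move=> hx; elim: l => [|l IH]; first by rewrite muln0; apply/hge0n; exact: cint1.
by rewrite exprS mulnS PoszD; apply: hgeM.
Qed.

Lemma q_pow m : (0 < m)%N -> (q ^ m).-1.+1 = (q ^ m)%N /\ (0 < (q ^ m).-1)%N.
move=> m0; have h : (1 < q ^ m)%N by rewrite -(exp1n m) ltn_exp2r.
by rewrite prednK ?(ltnW h) //; split=> //; rewrite -ltnS prednK // ltnW.
Qed.

Lemma kap_inv x : kap x -> x != 0 -> exists2 y, kap y & x * y = 1.
move=> [m m0 hx] x0; have [y xy] := cring_inv x0.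
have [e e0] := q_pow m0; exists (x ^+ (q ^ m).-2); last first.
 rewrite -exprS prednK //.
 by rewrite -[LHS]mulr1 -{1}xy mulrA -exprSr e hx xy.
by apply: kapX; exists m.
Qed.

(** A non-integral element would have its inverse in the maximal ideal, although this inverse is a
    root of unity. *)
Lemma kap_unitint x : kap x -> Oh x.
move=> kx; have [->|x0] := eqVneq x 0; first exact: cint0.
have [m m0 hx] := kx; have [y [m' m'0 hy] xy] := kap_inv kx x0.
have [n [u [v [Ou Ov uv xE]]]] := field_normal x0.
have [n0|n0] := leP 0 n.
 apply/hge0n; apply: (hge_le n0); rewrite xE.
 by apply: hgeMc => //; exact: hge_t.
have h1 : hge 1 y.
 have -> : y = j (unif p ^ (- n)) * v.
  rewrite -[y]mul1r -uv -[u * v]mul1r -(jtK M p n).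
  have -> : j (unif p ^ n) * j (unif p ^ (- n)) * (u * v) * y =
   (j (unif p ^ n) * u) * y * (j (unif p ^ (- n)) * v) by ring.
  by rewrite -xE xy mul1r.
 apply: (hge_le (n := - n)); first lia.
 by apply: hgeMc => //; exact: hge_t.
have : y ^+ (q ^ m' ).-1 = 1.
 have [e _] := q_pow m'0.
 by rewrite -[LHS]mulr1 -{1}xy mulrCA -exprSr e hy.
have [e e0] := q_pow m'0.
rewrite -(prednK e0) exprS => /hge1_nunit []//.
apply: cintX; apply/hge0n; exact: (hge_le (n := 1)) h1.
Qed.

Lemma kap_hge1 x : kap x -> hge 1 x -> x = 0.
move=> [m m0 hx] h1; apply: hge_separated => n.
have e i : x ^+ (q ^ (m * i)) = x by apply: frob_iter.
rewrite -(e n); apply: (hge_le (n := (1 * q ^ (m * n))%N)); last exact: hgeX.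
rewrite mul1n lez_nat ltnW //; apply: leq_trans (ltn_expl n q1) _.
by rewrite leq_pexp2l ?(ltnW q1) // leq_pmull.
Qed.

(* Teichmueller representatives, as limits of the [q^(m n)]-th powers *)
Lemma teichmuller x : Oh x -> exists2 a, kap a & hge 1 (x - a).
move=> Ox; have [s cs] := cint_rescover M p.
have /choice[f hf] : forall i : nat, exists y : E, y \in s /\ hge 1 (x ^+ (q ^ i) - j y).
 by move=> i; have [y ys hy] := cs _ (cintX (q ^ i) Ox); exists y.
have [i [l [il hil]]] : exists i l, (i < l)%N /\ f i = f l.
 apply: contrapT => nex.
 have inj : {in seq.iota 0 (size s).+1 &, injective f}.
  move=> i l _ _ e; case: (ltngtP i l) => // h; case: nex; first by exists i, l.
  by exists l, i.
 have u : uniq (map f (seq.iota 0 (size s).+1)) by rewrite map_inj_in_uniq ?iota_uniq.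
 have := uniq_leq_size u; rewrite size_map size_iota => /(_ s).
 by rewrite ltnn => h; suff : false by []; apply: h => y /mapP[i _ ->]; case: (hf i).
pose m := (l - i)%N; have m0 : (0 < m)%N by rewrite subn_gt0.
(* Pigeonhole made two Frobenius iterates of [x] congruent; a Frobenius power is injective modulo
   the maximal ideal, which brings the coincidence back to [x] itself. *)
have hm : hge 1 (x - x ^+ (q ^ m)).
 have d : hge 1 ((x - x ^+ (q ^ m)) ^+ (q ^ i)).
  rewrite frobB -exprM -expnD subnK ?(ltnW il) //.
  have -> : x ^+ (q ^ i) - x ^+ (q ^ l) = (x ^+ (q ^ i) - j (f i)) - (x ^+ (q ^ l) - j (f l)).
   by rewrite hil opprB addrA subrK.
  by apply: hgeB; apply (hf _).2.
 apply: contrapT => nh; have Oz : Oh (x - x ^+ (q ^ m)) by apply/cintB/cintX.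
 have [v Ov e] := cint_unit Oz nh.
 by apply: (hge1_nunit d (cintX (q ^ i) Ov)); rewrite -exprMn e expr1n.
have [|n|a Oa ha] := @cint_complete M p (fun n => x ^+ (q ^ (m * n))).
- by move=> n; apply: cintX.
- rewrite mulnS expnD exprM -frobB -opprB frobN; apply: hgeN.
 apply: (hge_le (n := (1 * q ^ (m * n))%N)); last exact: hgeX.
 rewrite mul1n lez_nat ltnW //; apply: leq_trans (ltn_expl n q1) _.
 by rewrite leq_pexp2l ?(ltnW q1) // leq_pmull.
exists a; last first.
 have := hgeB hm (ha 1%N); rewrite muln1.
 by rewrite opprB addrA subrK.
exists m => //; apply/subr0_eq/hge_separated => n.
have -> : a ^+ (q ^ m) - a = (a - x ^+ (q ^ (m * n))) ^+ (q ^ m) - (a - x ^+ (q ^ (m * n.+1))).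
 by rewrite frobB -exprM -expnD -mulnSr opprB addrA subrK.
apply: hgeB; last by apply: (hge_le (n := n.+1)) (ha _); lia.
apply: (hge_le (n := (n * q ^ m)%N)); last exact: hgeX.
by rewrite lez_nat leq_pmulr // qX_gt0.
Qed.

Lemma kap_finite : exists s : seq F, uniq s /\ forall a, kap a <-> a \in s.
have [s cs] := cint_rescover M p.
have /choice[f hf] : forall a : F, exists y : E, kap a -> y \in s /\ hge 1 (a - j y).
 move=> a; have [ka|nka] := pselect (kap a); last by exists 0.
 by have [y ys hy] := cs a (kap_unitint ka); exists y.
have : finite_set kap.
 apply: (@finite_by_bound _ _ (size s).+1) => u uu uk.
 rewrite ltnS -(size_map f); apply: uniq_leq_size.
  rewrite map_inj_in_uniq // => a b au bu e; apply/subr0_eq/kap_hge1.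
   by apply: kapB; apply: uk.
  have [_ ha] := hf a (uk _ au); have [_ hb] := hf b (uk _ bu).
  by have := hgeB ha hb; rewrite e opprB addrA subrK.
 by move=> _ /mapP[a au ->]; case: (hf a (uk _ au)).
move=> /finite_seqP[r hr]; exists (undup r); rewrite undup_uniq; split=> // a.
by rewrite mem_undup hr.
Qed.

Lemma resdeg_exists : exists m, is_residue_degree M p m.
have [s [_ hs]] := kap_finite.
have [m m0 hm] : exists2 m, (0 < m)%N & forall a, a \in s -> a ^+ (q ^ m) = a.
 have : forall a, a \in s -> kap a by move=> a /hs.
 elim: s {hs} => [|a s IH] hs; first by exists 1%N.
 have [|m m0 hm] := IH; first by move=> b bs; apply: hs; rewrite in_cons bs orbT.
 have [n n0 hn] := hs a (mem_head _ _); exists (m * n)%N; first by rewrite muln_gt0 m0.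
 move=> b; move=> /predU1P[->|/hm]; last exact: frob_iter.
 by rewrite mulnC; apply: frob_iter.
pose P m := (0 < m)%N && `[< forall a, kap a -> a ^+ (q ^ m) = a >].
have exP : exists m, P m by exists m; rewrite /P m0; apply/asboolP => a /hs/hm.
case: (ex_minnP exP) => n /andP[n0 /asboolP hn] nmin; exists n; split=> // l l0 hl.
by apply: nmin; rewrite /P l0; apply/asboolP.
Qed.

Section Trace.
Variable m : nat.
Hypothesis mP : is_residue_degree M p m.
Definition ktr a := \sum_(i < m) a ^+ (q ^ i).
Lemma ktrD a b : ktr (a + b) = ktr a + ktr b.
by rewrite /ktr -big_split; apply: eq_bigr => i _; rewrite frobD. Qed.
Lemma ktrZ c a : ktr (jk c * a) = jk c * ktr a.
by rewrite /ktr mulr_sumr; apply: eq_bigr => i _; rewrite exprMn frob_k. Qed.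

(** The trace is fixed by Frobenius, and [X^q - X] is the product of the [X - c] over c in k, so in
    a domain it has no other roots. *)
Lemma ktr_in_k a : kap a -> exists c, jk c = ktr a.
move=> ka; have [m0 hm _] := mP.
have fx : ktr a ^+ q = ktr a.
 rewrite -{1}[q]expn1 frob_sum /ktr -[m in LHS](prednK m0) -[m in RHS](prednK m0).
 rewrite big_ord_recr big_ord_recl /= expn0 expr1 -exprM -expnD addn1 prednK // hm // addrC.
 by congr (_ + _); apply: eq_bigr => i _; rewrite -exprM -expnD addn1.
have [c _ /eqP hc] : exists2 c : k, c \in index_enum k & ktr a - jk c == 0.
 have prod0 (r : seq k) : \prod_(c <- r) (ktr a - jk c) = 0 ->
   exists2 c, c \in r & ktr a - jk c == 0.
  elim: r => [|c r IH]; first by rewrite big_nil => /eqP; rewrite oner_eq0.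
  rewrite big_cons => /cring_domain[/eqP h|/IH[c' c'r h]].
   by exists c => //; exact: mem_head.
  by exists c' => //; rewrite in_cons c'r orbT.
 apply: prod0; have := congr1 (fun P => (map_poly jk P).[ktr a]) (finField_genPoly k).
 rewrite rmorphB /= map_polyXn map_polyX !hornerE fx subrr => ->.
 rewrite rmorph_prod horner_prod; apply: eq_bigr => c _.
 by rewrite rmorphB /= map_polyX map_polyC !hornerE.
by exists c; apply/esym/subr0_eq.
Qed.

Lemma kap_sum_mul (s : seq F) (G : F -> F) c : uniq s -> (forall a, kap a <-> a \in s) ->
 kap c -> c != 0 -> \sum_(a <- s) G (c * a) = \sum_(a <- s) G a.
move=> us hs kc c0; have [b kb cb] := kap_inv kc c0.
rewrite -(big_map ( *%R c) xpredT G); apply: perm_big; apply: uniq_perm => //.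
 rewrite map_inj_uniq // => x y /(congr1 ( *%R b)).
 by rewrite !mulrA (mulrC b) cb !mul1r.
move=> a; apply/mapP/idP => [[x xs ->]|/hs ka]; first by apply/hs/kapM => //; apply/hs.
by exists (b * a); [apply/hs/kapM|rewrite mulrA cb mul1r].
Qed.

(** Translation by 1 permutes the coefficient field, so its number of elements is 0 in the ring;
    removing the zero element leaves -1. *)
Lemma kap_card (s : seq F) : uniq s -> (forall a, kap a <-> a \in s) ->
 \sum_(a <- s | a != 0) 1 = -1 :> F.
move=> us hs; have s0 : 0 \in s by apply/hs; exact: kap0.
have e : \sum_(a <- s) (1 + a) = \sum_(a <- s) a.
 rewrite -(big_map (+%R 1) xpredT id); apply: perm_big; apply: uniq_perm => //.
  by rewrite map_inj_uniq //; exact: addrI.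
 move=> a; apply/mapP/idP => [[x xs ->]|/hs ka].
  by apply/hs/kapD; [exact: kap1|apply/hs].
 by exists (a - 1); [apply/hs/kapB => //; exact: kap1|rewrite addrC subrK].
move: e; rewrite big_split /= -[RHS]add0r => /addIr; rewrite (bigD1_seq 0) //= => /eqP.
by rewrite addrC addr_eq0 => /eqP.
Qed.

(* Any [b] in the coefficient field is recovered from the traces [ktr (c b)]
  because [\sum_c c^(q^i - 1)] vanishes unless [i = 0 mod m]. *)
Lemma ktr_expand (s : seq F) (inv : F -> F) b : uniq s -> (forall a, kap a <-> a \in s) ->
 (forall a, a \in s -> a != 0 -> a * inv a = 1) -> kap b ->
 b = - \sum_(c <- s | c != 0) ktr (c * b) * inv c.
move=> us hs hi kb; have [m0 hm mmin] := mP.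
have -> : \sum_(c <- s | c != 0) ktr (c * b) * inv c =
  \sum_(i < m) b ^+ (q ^ i) * \sum_(c <- s | c != 0) c ^+ (q ^ i).-1.
 under [RHS]eq_bigr do rewrite mulr_sumr.
 rewrite exchange_big /= big_seq_cond [RHS]big_seq_cond; apply: eq_bigr => c /andP[cs c0].
 rewrite /ktr mulr_suml; apply: eq_bigr => i _.
 rewrite exprMn [c ^+ _ * _]mulrC -mulrA; congr (_ * _).
 by rewrite -[in LHS](prednK (qX_gt0 i)) exprSr -mulrA hi // mulr1.
rewrite -(prednK m0) big_ord_recl /= [X in _ + X]big1 ?addr0.
 rewrite expn0 expr1 /= (eq_bigr (fun=> 1)) => [|c _]; last by rewrite expr0.
 by rewrite kap_card // mulrN1 opprK.
move=> i _; set S := \sum_(c <- s | c != 0) _.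
have i0 : (0 < lift o0 i)%N by [].
have il : (lift o0 i < m)%N by rewrite -[X in (_ < X)%N](prednK m0).
(* Since the exponent is below the residue degree, some [c0] is moved by this Frobenius power.
   Multiplication by [c0] permutes the nonzero elements, so [S] is unchanged by a factor different
   from 1. *)
have [c0 [kc0 nc]] : exists c, kap c /\ c ^+ (q ^ lift o0 i) <> c.
 apply: contrapT => nex; have := mmin _ i0; rewrite leqNgt il => h; suff : false by []; apply: h => a ka.
 by apply: contrapT => na; apply: nex; exists a.
have c00 : c0 != 0 by apply: contra_notN nc => /eqP ->; rewrite frob0.
have [e e0] := q_pow i0.
have : c0 ^+ (q ^ lift o0 i).-1 * S = S.
 have G0 : forall f : F -> F, \sum_(c <- s | c != 0) f c = \sum_(c <- s) (if c != 0 then f c else 0).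
  by move=> f; rewrite big_mkcond.
 rewrite /S G0 -[RHS](@kap_sum_mul s _ c0) // mulr_sumr; apply: eq_bigr => c _.
 have -> : (c0 * c != 0) = (c != 0).
  apply/idP/idP => [|c1]; first by apply: contra_neq => ->; rewrite mulr0.
  by apply/eqP => /cring_domain[/eqP|/eqP]; apply/negP.
 by case: ifP => _; rewrite ?mulr0 // exprMn.
move=> /eqP; rewrite -subr_eq0 -[X in _ - X]mul1r -mulrBl => /eqP/cring_domain[|->]; last by rewrite mulr0.
move=> /subr0_eq h; case: nc; have [b' _ cb] := kap_inv kc0 c00.
by rewrite -e exprS h mulr1.
Qed.
End Trace.

Section Expansion.
Variable t : E.
Hypothesis tu : is_uniformizer p t.

Lemma uniformizer_ratio t' : is_uniformizer p t' -> O (t / t').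
move=> tu'; have [y Oy ->] := (tu' t).1 (unif_max tu).
by rewrite mulrC mulKf //; exact: unif_neq0 tu'.
Qed.

Lemma uniformizer_ratioV t' : is_uniformizer p t' -> O (t' / t).
move=> tu'; have [y Oy ->] := (tu t').1 (unif_max tu').
by rewrite mulrC mulKf //; exact: unif_neq0 tu.
Qed.

Let t0 : t != 0. exact: unif_neq0 tu. Qed.
Lemma hge_tu (n : int) : hge n (j (t ^ n)).
apply/hge_j; have u0 := unif_neq0 (unifP p).
rewrite /vge -exprz_inv -expfzMl.
case: n => n; first by apply/prX/uniformizer_ratio/unifP.
rewrite NegzE -exprz_inv invf_div.
by apply/prX/uniformizer_ratioV/unifP.
Qed.

Lemma jtuK (n : int) : j (t ^ n) * j (t ^ (- n)) = 1.
by rewrite -rmorphM -expfzDr // subrr expr0z rmorph1. Qed.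

Lemma hge_shift (n m : int) x : hge (n + m) (x * j (t ^ m)) -> hge n x.
move=> h; have := hgeM h (hge_tu (- m)).
by rewrite -mulrA jtuK mulr1 addrK.
Qed.

(** Terms of order below [d], listed downwards from order [d - 1]. For [d = 0] the term of index 0
    is the one in [t^-1], as in [is_residue]. *)
Definition psum (d : int) (a : nat -> F) n := \sum_(i < n) a i * j (t ^ (d - 1 - i%:Z)).
Definition polar (d : int) x := exists n (a : nat -> F), (forall i, kap (a i)) /\ x = psum d a n.
Lemma psum_widen d (a : nat -> F) n n' : (n <= n')%N ->
 psum d a n = psum d (fun i => if (i < n)%N then a i else 0) n'.
move=> nn'; rewrite /psum (big_ord_widen n' (fun i => a i * j (t ^ (d - 1 - i%:Z)))) //.
by rewrite big_mkcond; apply: eq_bigr => i _; case: ifP => //; rewrite mul0r.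
Qed.

Lemma polar0 d : polar d 0.
by exists 0%N, (fun=> 0); split; [move=> _; exact: kap0|rewrite /psum big_ord0]. Qed.

Lemma polarB d x y : polar d x -> polar d y -> polar d (x - y).
move=> [n [a [ka ->]]] [m [b [kb ->]]].
rewrite (psum_widen d a (leq_maxl n m)) (psum_widen d b (leq_maxr n m)).
set a' := (fun i => _); set b' := (fun i => _).
exists (maxn n m), (fun i => a' i - b' i); split.
 by move=> i; apply: kapB; rewrite ?/a' ?/b'; case: ifP => // _; exact: kap0.
by rewrite -sumrB; apply: eq_bigr => i _; rewrite mulrBl.
Qed.

Lemma polarD d x y : polar d x -> polar d y -> polar d (x + y).
by move=> hx hy; rewrite -[y]opprK; apply: polarB => //; rewrite -sub0r; apply: polarB (polar0 d) hy.
Qed.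

Lemma polarZ d c x : kap c -> polar d x -> polar d (c * x).
move=> kc [n [a [ka ->]]]; exists n, (fun i => c * a i); split; first by move=> i; apply: kapM.
by rewrite mulr_sumr; apply: eq_bigr => i _; rewrite mulrA.
Qed.

Lemma polar_term d a (n : nat) : kap a -> polar d (a * j (t ^ (d - 1 - n%:Z))).
move=> ka; exists n.+1, (fun i => if i == n then a else 0); split.
 by move=> i; case: ifP => // _; exact: kap0.
rewrite /psum big_ord_recr /= eqxx big1 ?add0r // => i _.
by rewrite ltn_eqF ?mul0r.
Qed.

Lemma psum_eq0 d (a : nat -> F) n : (forall i, kap (a i)) -> hge d (psum d a n) ->
 forall i, (i < n)%N -> a i = 0.
move=> ka; elim: n => [//|n IH]; rewrite /psum big_ord_recr /= -/(psum d a n) => h.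
have hl : hge (d - n%:Z) (psum d a n).
 apply: hge_sum => i _; rewrite mulrC; apply: hgeMc; last exact: kap_unitint.
 by apply: hge_le (hge_tu _); have := ltn_ord i; lia.
have an : a n = 0.
 apply: kap_hge1 => //; apply: (hge_shift (m := d - 1 - n%:Z)).
 have -> : 1 + (d - 1 - n%:Z) = d - n%:Z by lia.
 rewrite -[_ * _](addKr (psum d a n)); apply: hgeD; first exact: hgeN.
 by apply: hge_le h; lia.
move: h; rewrite an mul0r addr0 => /IH a0 i; rewrite ltnS leq_eqVlt => /orP[/eqP ->//|].
exact: a0.
Qed.

Lemma polar_hge d x : polar d x -> hge d x -> x = 0.
move=> [n [a [ka ->]]] /(psum_eq0 ka) h; rewrite /psum big1 // => i _.
by rewrite h ?mul0r.
Qed.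

(** Teichmueller representatives are peeled off from the lowest order upwards until order [d] is
    reached. *)
Lemma polar_exists d x : exists2 z, polar d z & hge d (x - z).
have [N] : exists N : nat, hge (d - N%:Z) x.
 have [n hn] := hge_bounded x; exists `|(d + n%:Z)%R|%N.
 by apply: hge_le hn; lia.
elim: N x => [|N IH] x hx.
 by exists 0; [exact: polar0|rewrite subr0; move: hx; rewrite subr0].
have [|a ka ha] := @teichmuller (x * j (t ^ (- (d - 1 - N%:Z)))).
 apply/hge0n; rewrite -(subrr (d - N.+1%:Z)); apply: hgeM => //.
 have -> : - (d - N.+1%:Z) = - (d - 1 - N%:Z) by lia.
 exact: hge_tu.
have [|z pz hz] := IH (x - a * j (t ^ (d - 1 - N%:Z))).
 have := hgeM ha (hge_tu (d - 1 - N%:Z)).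
 rewrite mulrBl -mulrA [j _ * j _]mulrC jtuK mulr1.
 by have -> : 1 + (d - 1 - N%:Z) = d - N%:Z by lia.
exists (z + a * j (t ^ (d - 1 - N%:Z))); first exact/polarD/polar_term.
by rewrite opprD addrA addrAC.
Qed.
End Expansion.
End AtPlace.
End CoefficientField.

(** * The global Tate symbol and the residue theorem *)

Section TateSymbol.
Variable M : completions (@place_ring k E iota).
Notation A := (kad M).
Notation dg := (dg M).
Implicit Types x y g h : A.

Definition amul (x : A) : A -> A := fun y => (x : adele M) * y.
Lemma lop_amul x : lop (amul x).
by move=> a y z; rewrite /amul mulrDr !kscaleE mulrCA. Qed.

Variable D : place -> int.
Hypothesis fD : fsupp D.
Notation L := (lat D : set A).

Definition latproj (pi : A -> A) :=
 [/\ lop pi, forall x, L (pi x) & forall x, L x -> pi x = x].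

(** Tate's formula for the sum of the residues of [x] times the differential of [g], where [pi] is a
    projector onto the lattice of divisor [D]. *)
Definition symb (pi : A -> A) x g c := trop (opcomm (compr pi (amul x)) (compr pi (amul g))) c.
(** [x] carries the lattice into finitely many of its translates, so an operator with finitely many
    values on the lattice also has finitely many on its image under [x]. Such an image gives finite
    rank by [finrank_image]. *)
Lemma image_lat (T pi : A -> A) (r : seq A) x : lop T -> (forall y, L y -> T y \in r) ->
 (forall y, L (pi y)) -> exists r' : seq A, forall y, T (amul x (pi y)) \in r'.
move=> lT Tr Lpi; have [Dx fx hx] := lat_exists x.
have [s cs] := cover_lat M (fsuppD fx fD) fD.
exists [seq a + b | a <- map T s, b <- r] => y.
have [z zs hz] := cs _ (latM hx (Lpi y)).
rewrite -[amul x _](subrK z) (lopD lT) addrC; apply/allpairsP.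
by exists (T z, T (amul x (pi y) - z)); split=> //=; [exact: map_f|exact: Tr].
Qed.

Lemma finrank_lat (T pi : A -> A) (r : seq A) x : lop T -> (forall y, L y -> T y \in r) ->
 lop pi -> (forall y, L (pi y)) -> finrank (fun y => T (amul x (pi y))).
move=> lT Tr lp Lpi; have [r' hr'] := image_lat x lT Tr Lpi.
by apply: finrank_image hr' => a u v; rewrite lp (lop_amul x) lT.
Qed.

Lemma latprojB_image pi pi' : latproj pi -> latproj pi' ->
 forall y, L y -> pi y - pi' y \in [:: 0].
by move=> [_ _ h] [_ _ h'] y Ly; rewrite h // h' // subrr mem_head. Qed.

Section Projector.
Variable pi : A -> A.
Hypothesis hpi : latproj pi.
Let lp : lop pi. by case: hpi. Qed.
Let pL x : L (pi x). by case: hpi. Qed.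
Let pid x : L x -> pi x = x. by case: hpi => _ _; apply. Qed.
Let pp x : pi (pi x) = pi x. exact: pid. Qed.

Let cp (y : A) : A := y - pi y.
Let lcp : lop cp.
by move=> a x y; rewrite /cp lp scalerBr opprD addrACA. Qed.
Let cpL y : L y -> cp y \in [:: 0].
by move=> Ly; rewrite /cp pid // subrr mem_head. Qed.

(** The defect is [pi \o x \o (1 - pi) \o g \o pi], and [1 - pi] vanishes on the lattice. *)
Lemma compr_mul x g : finrank (fun y => compr pi (amul ((x : adele M) * g)) y -
 compr pi (amul x) (compr pi (amul g) y)).
have f := finrank_lat g lcp cpL lp pL.
apply: finrank_ext (finrank_compr (finrank_compr f (lop_amul x)) lp) => y /=.
by rewrite /compr /cp (lopB (lop_amul x)) (lopB lp) pp /amul mulrA.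
Qed.

Lemma compr_mulV x g : finrank (fun y => compr pi (amul x) (compr pi (amul g) y) -
 compr pi (amul ((x : adele M) * g)) y).
apply: finrank_ext (finrankB (ex_intro _ _ (trop0 _)) (compr_mul x g)) => y.
by rewrite sub0r opprB.
Qed.

Lemma symb_exists x g : exists c, symb pi x g c.
apply: finrank_ext (finrankB (compr_mul g x) (compr_mul x g)) => y.
by rewrite /opcomm (mulrC (g : adele M)) opprB addrC addrA subrK.
Qed.

Lemma symbD x g g' c c' : symb pi x g c -> symb pi x g' c' -> symb pi x (g + g') (c + c').
move=> h h'; apply: trop_ext (tropD h h') => y; rewrite /opcomm /compr.
rewrite /amul !mulrDl !(lopD lp) !mulrDr !(lopD lp) -/(amul _ _).
by rewrite opprD addrACA.
Qed.

Lemma symb_lin a x x' g c c' : symb pi x g c -> symb pi x' g c' ->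
 symb pi (a *: x + x') g (a * c + c').
move=> h h'; apply: trop_ext (tropD (tropZ a h) h') => y; rewrite /opcomm.
have cl z : compr pi (amul (a *: x + x')) z = a *: compr pi (amul x) z + compr pi (amul x') z.
 by rewrite /compr -lp; congr (pi _); rewrite /amul mulrDl !kscaleE mulrA.
by rewrite !cl (lop_compr lp (lop_amul g)) scalerBr opprD addrACA.
Qed.

Lemma symb_const x (a : k) : symb pi x (dg (iota a)) 0.
have c1 z : compr pi (amul (dg (iota a))) z = a *: pi z.
 by rewrite /compr /amul -[_ * _]/(a *: pi z) (lopZ lp) pp.
have lc : lop (compr pi (amul x)) by apply: lop_compr => //; exact: lop_amul.
apply: trop_ext (trop0 _) => y; rewrite /opcomm !c1 (lopZ lc).
by rewrite {2}/compr pp -/(compr _ _ _) /compr !pp subrr.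
Qed.

(** The Leibniz rule, from the identity [[ab, c] + [ca, b] = [a, bc]], compressions being
    multiplicative up to finite rank. *)
Lemma symb_prod x g h c c' : symb pi ((x : adele M) * g) h c -> symb pi ((x : adele M) * h) g c' ->
 symb pi x ((g : adele M) * h) (c + c').
have lc z : lop (compr pi (amul z)) by apply: lop_compr => //; exact: lop_amul.
have f0 (S : A -> A) : finrank (fun y => S y - S y).
 by exists 0; apply: trop_ext (trop0 _) => y; rewrite subrr.
move=> tc tc'.
have t1 := opcomm_perturb (lc _) (lop_comp (lc x) (lc g)) (lc _) (lc _) (compr_mulV x g) (f0 _) tc.
rewrite mulrC in tc'.
have t2 := opcomm_perturb (lc _) (lop_comp (lc h) (lc x)) (lc _) (lc _) (compr_mulV h x) (f0 _) tc'.
apply: (opcomm_perturb (lc x) (lc x) (lop_comp (lc g) (lc h)) (lc _) (f0 _) (compr_mul g h)).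
apply: trop_ext (tropD t1 t2) => y; rewrite /opcomm /=.
by rewrite addrA subrK.
Qed.

(** For [x] deep enough the commutator equals [- x \o U] with [U = (1 - pi) \o g \o pi], and
    [U \o x \o U] vanishes, so [trop_nilpotent] gives trace 0. *)
Lemma symb_integral g : exists2 D', fsupp D' & forall x, lat D' x -> symb pi x g 0.
have [Dg fg hg] := lat_exists g.
(* Depth [2 m] ensures that [x], [x * g] and [g * x * g] all preserve the lattice. *)
pose m p := Num.max 0 (- Dg p); have fm : fsupp m by apply: fsupp_max (fsuppN fg); exact: fsupp0.
exists (fun p => m p + m p); first exact: fsuppD.
move=> x hx.
have m0 p : 0 <= m p /\ - Dg p <= m p by rewrite /m !le_max !lexx orbT.
have xL y : L y -> L (amul x y).
 by move=> hy; apply: lat_le (latM hx hy) => p; have := m0 p; lia.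
have xgL y : L y -> L (amul x (amul g y)).
 by move=> hy; apply: lat_le (latM hx (latM hg hy)) => p; have := m0 p; lia.
have gxgL y : L y -> L (amul g (amul x (amul g y))).
 by move=> hy; apply: lat_le (latM hg (latM hx (latM hg hy))) => p; have := m0 p; lia.
have gxC y : amul g (amul x y) = amul x (amul g y) by rewrite /amul mulrCA.
pose U (y : A) : A := cp (amul g (pi y)).
have lU : lop U by move=> a u v; rewrite /U lp (lop_amul g) lcp.
have [r hr] := image_lat g lcp cpL pL.
have UTU y : U (amul x (U y)) = 0.
 have h1 : L (amul x (U y)).
  rewrite /U /cp (lopB (lop_amul x)); apply: (lat_sgp M D).2; first exact: xgL.
  exact: xL.
 have U0 z : L z -> L (amul g z) -> U z = 0.
  by move=> Lz Lgz; rewrite /U (pid Lz) /cp pid ?subrr.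
 apply: (U0 _ h1); rewrite /U /cp !(lopB (lop_amul _)).
 apply: (lat_sgp M D).2; first exact: gxgL.
 by rewrite gxC; apply: xgL.
have t := trop_nilpotent (lop_amul x) lU hr UTU.
have t' := tropZ (-1) t; rewrite mulr0 in t'; apply: trop_ext t' => y.
rewrite /= scaleN1r /U /cp /opcomm /compr pp (lopB (lop_amul x)) opprB.
rewrite [pi (amul x (pi (amul g (pi y))))]pid; last exact: xL.
rewrite [pi (amul x (pi y))]pid; last exact: xL.
rewrite [pi (amul x (pi y))]pid; last exact: xL.
by rewrite gxC [pi (amul x (amul g _))]pid //; apply: xgL.
Qed.

(** E and the lattice span the adeles, so there is a projection [piE] along E, once the finite
    intersection of the two is split off. Its kernel is stable under multiplication by E, and on the
    lattice it differs from [pi] by finitely many values; hence [tate_vanish]. *)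
Lemma symb_principal (e g : E) c : (forall a : A, exists e, L (a - dg e)) ->
 symb pi (dg e) (dg g) c -> c = 0.
move=> dec; have [r hr] := E_lat_finite M fD.
have /choice[ex hex] : forall a : A, exists e, L (a - dg e) by [].
pose B : seq A := [seq dg e | e <- r & `[< lat D (dg e) >]].
have [P [lP fP sP Ps]] := lspan_projection B.
have [L0 Ll] := lat_linsub M D; have [d0 dl] := dgE_linsub M.
have subB : lspan B `<=` [set z | L z /\ dgE z].
 apply: lspan_sub => [|_ /mapP[e' + ->]].
  by split=> [//|a u v [Lu du] [Lv dv]]; split; [exact: Ll|exact: dl].
 by rewrite mem_filter => /andP[/asboolP le' _]; split=> //; exists e'.
have PE e' : L (dg e') -> P (dg e') = dg e'.
 move=> le'; apply/Ps/mem_lspan/map_f; rewrite mem_filter hr // andbT.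
 exact/asboolP.
pose K (z : A) : A := z - P z.
have lK : lop K by move=> a x y; rewrite /K lP scalerBr opprD addrACA.
have KE (z z' : A) e' : z = z' + dg e' -> L (dg e') -> K z = K z'.
 by move=> -> le'; rewrite (lopD lK) [K (dg e')]/K PE // subrr addr0.
(* [ex x] is ambiguous by an element of E lying in the lattice; [K] kills these, which makes [piE]
   linear. *)
pose piE (x : A) : A := K (x - dg (ex x)).
have piEE x e' : L (x - dg e') -> piE x = K (x - dg e').
 move=> h; apply: (@KE _ _ (e' - ex x)); first by rewrite rmorphB addrA subrK.
 have := (lat_sgp M D).2 _ _ (hex x) h.
 by rewrite opprB addrC addrA subrK rmorphB.
have lpE : lop piE.
 move=> a x y; rewrite (piEE _ (iota a * ex x + ex y)).
  rewrite -lK; congr K; rewrite rmorphD rmorphM -[dg _ * _]/(a *: (dg (ex x) : A)).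
  by rewrite scalerBr opprD addrACA.
 rewrite rmorphD rmorphM -[dg _ * _]/(a *: (dg (ex x) : A)).
 by rewrite opprD addrACA -scalerBr; apply: Ll.
have LpE x : L (piE x).
 by apply: (lat_sgp M D).2; [exact: hex|case: (subB _ (sP (x - dg (ex x))))].
have pE0 e' : piE (dg e') = 0.
 by rewrite (piEE _ e') ?subrr ?(lop0 lK) //; case: (lat_sgp M D).
have pEx x : exists e', piE x = x - dg e'.
 have [_ [e' he']] := subB _ (sP (x - dg (ex x))); exists (ex x + e').
 by rewrite /piE /K he' rmorphD opprD addrA.
have st e' x : piE (amul (dg e') (piE x)) = piE (amul (dg e') x).
 have [e1 ->] := pEx x; rewrite (lopB (lop_amul _)) (lopB lpE).
 by rewrite /amul -rmorphM pE0 subr0.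
have pil x : L x -> piE x - pi x \in map (fun e => - (dg e : A)) r.
 move=> Lx; rewrite (piEE x 0) rmorph0 subr0 // pid // /K addrAC subrr add0r.
 by have [LP [e' he']] := subB _ (sP x); apply/mapP; exists e'; rewrite ?he' // hr // -he'.
have ldiff : lop (fun y => piE y - pi y) by apply: lop_sub.
apply: (tate_vanish (pi := piE) (pi' := pi)) => //; try exact: lop_amul.
- by move=> x; rewrite /amul mulrCA.
- by move=> x; exact: pid.
- exact: (finrank_lat (dg e) ldiff pil).
- exact: (finrank_lat (dg g) ldiff pil).
Qed.

Lemma symb_indep pi' x g c c' : latproj pi' -> symb pi x g c -> symb pi' x g c' -> c = c'.
move=> hpi'; have [lp' pL' pid'] := hpi'; move=> t t'.
have ldiff : lop (fun y => pi' y - pi y) by apply: lop_sub.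
apply: (tate_indep (pi := pi') (pi' := pi) lp' lp (lop_amul x) (lop_amul g)) t t' => //.
- by move=> y; rewrite pid.
- by move=> y; rewrite pid'.
- exact: (finrank_lat x ldiff (latprojB_image hpi' hpi)).
- exact: (finrank_lat g ldiff (latprojB_image hpi' hpi)).
Qed.
End Projector.
End TateSymbol.

(** * The Tate symbol of an adele concentrated at one place *)

Section LocalSymbol.
Variable M : completions (@place_ring k E iota).
Notation A := (kad M).
Notation dg := (dg M).

(** The complement of the lattice consists of the adeles that are purely polar at every place, so
    this projector is compatible with expansions in chosen uniformizers. *)
Lemma polar_projector (tf : place -> E) D : (forall p, is_uniformizer p (tf p)) -> fsupp D ->
 exists pi : A -> A, [/\ latproj D pi,
  forall x : A, (forall p, polar (M := M) (p := p) (tf p) (D p) (aval x p)) -> pi x = 0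
  & forall (x : A) p, polar (M := M) (p := p) (tf p) (D p) (aval (x - pi x) p)].
move=> tu fD; pose N : set A := [set x | forall p, polar (M := M) (p := p) (tf p) (D p) (aval x p)].
have [||||pi [h1 h2 h3 h4 h5]] := @complement_projector k A (lat D) N.
- exact: lat_linsub.
- split=> [p|a x y hx hy p]; first exact: polar0.
 by apply: polarD => //; apply: (polarZ (kap_k M p a)).
- by move=> x Lx Nx; apply: aval_inj => p; apply: (polar_hge (tu p) (Nx p) (Lx p)).
move=> x; pose Z p : set (cring M p) :=
 [set z | polar (tf p) (D p) z /\ hge (D p) (aval x p - z)].
pose z p := xget 0 (Z p); have hz p : Z p (z p).
 have [z0 h1 h2] := polar_exists (tu p) (D p) (aval x p).
 by apply: (@xgetI _ 0 (Z p) z0).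
have fz : finite_set [set p | ~ cint M p (z p)].
 apply: (@sub_finite_set _ _ ([set p | ~ cint M p (aval x p)] `|` [set p | D p <> 0])).
  move=> p nz; apply: contrapT => /not_orP[/contrapT cx /contrapT D0]; apply: nz.
  rewrite -[z p](subKr (aval x p)); apply: cintB => //.
  by have [_] := hz p; rewrite D0 hge0n.
 by rewrite finite_setU; split=> //; exact: avalP.
by exists (mkad z) => p; rewrite ?[aval (x - _) p]/= mkadE //; case: (hz p).
by exists pi; split=> //; exact: h4.
Qed.

Section AtPlace.
Variables (p : place) (t : E).
Hypothesis tu : is_uniformizer p t.
Notation F := (cring M p).
Notation j := (cmap M p).
Notation kap := (@coef_field k E iota M p).
Notation polar := (@polar M p t).

(** [b] is the coefficient of [t ^ (d - 1)] in the expansion of [w]. *)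
Definition leadP (d : int) (w b : F) := kap b /\ exists u z,
 [/\ hge d u, polar (d - 1) z & w = u + b * j (t ^ (d - 1)) + z].

Let t0 : t != 0. exact: unif_neq0 tu. Qed.
Lemma psum_head d (a : nat -> F) n :
 psum t d a n.+1 = a 0%N * j (t ^ (d - 1)) + psum t (d - 1) (fun i => a i.+1) n.
rewrite /psum big_ord_recl /= subr0; congr (_ + _); apply: eq_bigr => i _.
by congr (_ * j (_ ^ _)); rewrite /bump /=; lia.
Qed.

Lemma leadP_psum d w (a : nat -> F) n : (forall i, kap (a i)) -> hge d (w - psum t d a n.+1) ->
 leadP d w (a 0%N).
move=> ka h; split=> //; exists (w - psum t d a n.+1), (psum t (d - 1) (fun i => a i.+1) n).
by split=> //; [exists n, (fun i => a i.+1)|rewrite psum_head -addrA subrK].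
Qed.

Lemma leadP_exists d w : exists b, leadP d w b.
have [z [n [a [ka ->]]] h] := polar_exists tu d w.
exists (if (0 < n)%N then a 0%N else 0).
apply: (@leadP_psum d w (fun i => if (i < n)%N then a i else 0) n).
 by move=> i; case: ifP => // _; exact: kap0.
by rewrite -psum_widen.
Qed.

Lemma polarS d b z : kap b -> polar (d - 1) z -> polar d (b * j (t ^ (d - 1)) + z).
move=> kb [n [a [ka ->]]]; exists n.+1, (fun i => if i is i'.+1 then a i' else b).
by rewrite psum_head; split=> // -[].
Qed.

Lemma polar_shift d m z : polar d z -> polar (d + m) (z * j (t ^ m)).
move=> [n [a [ka ->]]]; exists n, a; split=> //; rewrite mulr_suml; apply: eq_bigr => i _.
by rewrite -mulrA -rmorphM -expfzDr //; congr (_ * j (_ ^ _)); lia.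
Qed.

Lemma leadP_lin d w w' b b' c : kap c -> leadP d w b -> leadP d w' b' ->
 leadP d (c * w + w') (c * b + b').
move=> kc [kb [u [z [hu pz ->]]]] [kb' [u' [z' [hu' pz' ->]]]]; split; first exact/kapD/kb'/kapM.
exists (c * u + u'), (c * z + z'); split; last by ring.
 by apply: hgeD => //; rewrite mulrC; apply: hgeMc hu (kap_unitint kc).
by apply: polarD => //; apply: polarZ.
Qed.

Lemma leadP_shift d m w b : leadP d w b -> leadP (d + m) (w * j (t ^ m)) b.
move=> [kb [u [z [hu pz ->]]]]; split=> //; exists (u * j (t ^ m)), (z * j (t ^ m)); split.
- by apply: hgeM hu _; exact: hge_tu.
- by rewrite addrAC; apply: polar_shift.
- rewrite !mulrDl -mulrA -rmorphM -expfzDr //; congr (_ + _ * j (_ ^ _) + _); lia.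
Qed.

Lemma leadP0 d b : leadP d 0 b -> b = 0.
move=> [kb [u [z [hu [n [a [ka ->]]] /esym/eqP]]]].
rewrite -addrA addrC addr_eq0 => /eqP e.
pose a' i := if i is i'.+1 then a i' else b.
have := @psum_eq0 M p t tu d a' n.+1; rewrite psum_head e => h.
by apply: (h _ _ 0%N) => //; [case|exact: hgeN].
Qed.

Lemma leadP_uniq d w b b' : leadP d w b -> leadP d w b' -> b = b'.
move=> h h'; have := leadP_lin (kapN (kap1 M p)) h h'.
by rewrite !mulN1r addNr => /leadP0/eqP; rewrite addrC subr_eq0 => /eqP.
Qed.

Lemma atpD (x y : F) : atp (x + y) = atp x + atp y.
apply: aval_inj => q /=; have [->|pq] := eqVneq q p; first by rewrite !atp_in.
by rewrite !atp_out // addr0.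
Qed.

Lemma atpM (x : F) (y : adele M) : atp x * y = atp (x * aval y p).
apply: aval_inj => q /=; have [->|pq] := eqVneq q p; first by rewrite !atp_in.
by rewrite !atp_out // mul0r.
Qed.

(** The symbol does not depend on the projector, so one adapted to [t] may be used. For it the
    commutator sends [v] to [b v * t^d] at [p], with [b v] the coefficient of [t^(d-1)] in
    [y * pi0 v]; the operator factors through the finite coefficient field. *)
Lemma symb_local D pi m y (a : nat -> F) n r : fsupp D -> latproj D pi ->
 is_residue_degree M p m -> (forall i, kap (a i)) -> cint M p (y - psum t 0 a n.+1) ->
 j (iota r) = ktr m (a 0%N) -> symb pi (atp y : A) (dg t) r.
move=> fD hpi mP ka hy hr.
pose tf q := if q == p then t else unif q.
have tfu q : is_uniformizer q (tf q).
 by rewrite /tf; case: eqP => [->|_] //; exact: unifP.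
have [pi0 [hpi0 N0 N1]] := polar_projector tfu fD; have [lp0 pL0 pid0] := hpi0.
suff h0 : symb pi0 (atp y : A) (dg t) r.
 have [c hc] := symb_exists fD hpi (atp y : A) (dg t).
 by rewrite -(symb_indep fD hpi hpi0 hc h0).
pose d := D p.
have pi0_polar z : polar d z -> pi0 (atp z) = 0.
 move=> pz; apply: N0 => q; have [->|qp] := eqVneq q p.
  by rewrite atp_in /tf eqxx.
 by rewrite atp_out //; exact: polar0.
have pi0_atp u z : hge d u -> polar d z -> pi0 (atp (u + z)) = atp u.
 by move=> hu pz; rewrite atpD (lopD lp0) (pi0_polar _ pz) [LHS]addr0; apply/pid0/atp_lat.
have pi0_at (x : A) : hge d (aval x p) -> aval (pi0 x) p = aval x p.
 move=> hx; apply/esym/subr0_eq/(polar_hge tu) => [|]; last exact: hgeB hx (pL0 x p).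
 by have := N1 x p; rewrite /tf eqxx.
have /choice[b hb] : forall v : A, exists b, leadP d (y * aval (pi0 v) p) b.
 by move=> v; exact: leadP_exists.
have lb c v v' : b (c *: v + v') = j (iota c) * b v + b v'.
 apply: (leadP_uniq (hb _)); rewrite lp0 kscaleE /= mulrDr mulrCA.
 by apply: leadP_lin => //; exact: kap_k.
have jt : j t = j (t ^ 1) by rewrite expr1z.
have comm v : opcomm (compr pi0 (amul (atp y : A))) (compr pi0 (amul (dg t))) v =
  atp (b v * j (t ^ d)).
 have pp z : pi0 (pi0 z) = pi0 z by apply: pid0.
 have [kb [u [z [hu pz e]]]] := hb v.
 have tS w : hge d w -> hge d (j t * w).
  move=> hw; have := hgeM (hge_tu M tu 1) hw; rewrite expr1z.
  by apply: hge_le; lia.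
 have tu1 := tS _ hu.
 have pz' : polar d (b v * j (t ^ (d - 1)) + z) by apply: polarS.
 rewrite /opcomm /compr !pp /amul !atpM pi0_at; last first.
  exact/tS/pL0.
 rewrite /= mulrCA e -addrA pi0_atp // mulrDr.
 have -> : j t * (b v * j (t ^ (d - 1)) + z) = b v * j (t ^ d) + z * j (t ^ 1).
  rewrite mulrDr mulrCA jt -rmorphM -expfzDr // [_ * z]mulrC.
  by congr (_ * j (_ ^ _) + _); lia.
 have pz1 : polar d (z * j (t ^ 1)).
  by have := polar_shift 1 pz; rewrite subrK.
 have bt : hge d (b v * j (t ^ d)).
  by rewrite mulrC; apply: hgeMc (hge_tu M tu d) (kap_unitint kb).
 rewrite addrA pi0_atp //; last exact: hgeD.
 rewrite (mulrC (dg t)) atpM /= (mulrC u) [pi0 (atp (j t * u))]pid0; last exact/atp_lat.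
 exact: (etrans (congr1 (fun z : adele M => z - atp (j t * u)) (etrans (atpD _ _) (addrC _ _))) (addrK _ _)).
have [s [us hs]] := kap_finite M p.
pose inv c := xget 0 [set c' | kap c' /\ c * c' = 1].
have hinv c : c \in s -> c != 0 -> kap (inv c) /\ c * inv c = 1.
 move=> /hs kc c0; have [c' kc' e] := kap_inv kc c0.
 by apply: (@xgetI _ 0 [set c' | kap c' /\ c * c' = 1] c').
have /choice[rho hrho] : forall c, exists r', kap c -> j (iota r') = ktr m c.
 move=> c; have [kc|nkc] := pselect (kap c); last by exists 0.
 by have [r' hr'] := ktr_in_k mP kc; exists r'.
have jinj : injective (fun c => j (iota c)) by move=> c c' /fmorph_inj/fmorph_inj.
have rhoL c v v' : kap v -> kap v' -> rho (j (iota c) * v + v') = c * rho v + rho v'.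
 move=> kv kv'; apply: jinj; rewrite hrho; last by apply: kapD => //; apply/kapM/kv/kap_k.
 by rewrite ktrD ktrZ !rmorphD !rmorphM !hrho.
pose s' := [seq c <- s | c != 0].
have ss' (i : 'I_(size s')) : s'`_i \in s /\ s'`_i != 0.
 by have := mem_nth 0 (ltn_ord i); rewrite mem_filter => /andP[].
have kb v : kap (b v) by case: (hb v).
(* [ktr_expand] writes [b v] through traces with values in k, which presents the commutator as a sum
   of rank-one operators over k indexed by the nonzero elements of the coefficient field. *)
exists ('I_(size s') : finType), (fun (i : 'I_(size s')) (v : A) => - rho (s'`_i * b v)),
 (fun i : 'I_(size s') => atp (inv s'`_i * j (t ^ d)) : A); split.
- move=> i c v v'; have [ks s0] := ss' i; rewrite lb mulrDr mulrCA.
 by rewrite rhoL; [rewrite opprD mulrN|apply: kapM => //; exact/hs..].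
- move=> v; rewrite comm.
 have hs2 c : c \in s -> c != 0 -> c * inv c = 1 by move=> cs c0; case: (hinv c cs c0).
 rewrite {1}(ktr_expand mP us hs hs2 (kb v)) -big_filter -/s' (big_nth 0) big_mkord.
 have am (G : 'I_(size s') -> F) : atp (\sum_i G i) = \sum_i (atp (G i) : adele M).
  by apply: (big_morph _ atpD); apply: aval_inj => q; have [->|qp] := eqVneq q p; rewrite ?atp_in ?atp_out.
 rewrite mulNr mulr_suml -sumrN am; apply: eq_bigr => i _; have [ks s0] := ss' i.
 rewrite -mulrA -hrho; last by apply: kapM => //; exact/hs.
 rewrite scaleNr kscaleE; apply: aval_inj => q /=; have [->|qp] := eqVneq q p.
  by rewrite !atp_in.
 by rewrite !atp_out // mulr0 oppr0.
- have bi (i : 'I_(size s')) : b (atp (inv s'`_i * j (t ^ d))) = inv s'`_i * a 0%N.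
  have [ks s0] := ss' i; have [ki _] := hinv _ ks s0.
  apply: (leadP_uniq (hb _)); rewrite pid0; last first.
   by apply/atp_lat; rewrite mulrC; apply: hgeMc (hge_tu M tu d) (kap_unitint ki).
  rewrite atp_in mulrCA.
  have z0 : leadP d 0 0.
   split; first exact: kap0.
   by exists 0, 0; split; [exact: hge_0|exact: polar0|rewrite mul0r !addr0].
  have y0 : leadP d (y * j (t ^ d)) (a 0%N).
   have y1 : hge 0 (y - psum t 0 a n.+1) by apply/hge0n.
   by have := leadP_shift d (leadP_psum ka y1); rewrite add0r.
  by have := leadP_lin ki y0 z0; rewrite !addr0.
 rewrite (eq_bigr (fun=> - r)) => [|i _]; last first.
  have [ks s0] := ss' i; have [_ e] := hinv _ ks s0.
  rewrite bi mulrA e mul1r; congr (- _); apply: jinj.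
  by rewrite hr hrho.
 (* Each rank-one term contributes [- r], and the number of nonzero elements of the coefficient
    field is -1 in k, so the trace is [r]. *)
 have e1 : (size s')%:R = -1 :> k.
  apply: jinj; rewrite !rmorphN !rmorph1 -(kap_card us hs) -big_filter -/s' !rmorph_nat.
  by rewrite big_const_seq count_predT iter_addr_0.
 by rewrite big_const card_ord iter_addr_0 -mulr_natl e1 mulrN mulN1r opprK.
Qed.
End AtPlace.
End LocalSymbol.

(** * Polynomial relations and derivations in characteristic p *)

Section BivariateRelations.
Variables (x t : E).

Definition biev n (a : nat -> nat -> k) : E := \sum_(i < n) \sum_(j < n) iota (a i j) * (x ^+ i * t ^+ j).
Definition deg_lt n (a : nat -> nat -> k) := forall i j, (n <= i + j)%N -> a i j = 0.
(** Total degree is the measure because both partial derivatives lower it. *)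
Definition relation n := exists a, [/\ exists i j, a i j != 0, deg_lt n a & biev n a = 0].
Lemma sum_ord_widen (F : nat -> E) n m : (n <= m)%N -> (forall i, (n <= i)%N -> F i = 0) ->
 \sum_(i < m) F i = \sum_(i < n) F i.
move=> nm F0; rewrite [RHS](big_ord_widen m F nm) [RHS]big_mkcond; apply: eq_bigr => i _.
by case: ltnP => // /F0.
Qed.

Lemma biev_widen n m a : (n <= m)%N -> deg_lt n a -> biev m a = biev n a.
move=> nm a0; rewrite /biev (@sum_ord_widen (fun i => \sum_(j < m) iota (a i j) * (x ^+ i * t ^+ j)) n) //.
 apply: eq_bigr => i _; rewrite (@sum_ord_widen (fun j => iota (a i j) * (x ^+ i * t ^+ j)) n) // => j nj.
 by rewrite a0 ?rmorph0 ?mul0r // (leq_trans nj) // leq_addl.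
move=> i ni; apply: big1 => j _.
by rewrite a0 ?rmorph0 ?mul0r // (leq_trans ni) // leq_addr.
Qed.

Lemma relation_exists : transc t -> exists n, relation n.
move=> tt; have [N hN] := dep_boundP t.
have [c [[i0 ci0] c0]] := hN (fun i => x ^+ i).
pose C (i : nat) := if insub i is Some i' then c i' else 0.
have CE (i : 'I_N) : C i = c i by rewrite /C valK.
have C0 i : (N <= i)%N -> C i = 0 by rewrite /C leqNgt => h; rewrite insubF //; apply/negbTE.
pose S := \max_(i < N) size (c i); pose n := (N + S)%N.
have szC i : (size (C i) <= S)%N.
 case: (ltnP i N) => [iN|/C0 ->]; last by rewrite size_poly0.
 by rewrite (CE (Ordinal iN)); exact: (leq_bigmax (Ordinal iN)).
exists n, (fun i j => (C i)`_j); split.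
- exists i0, (size (c i0)).-1; rewrite CE -/(lead_coef _) lead_coef_eq0 //.
- move=> i j nij; case: (leqP N i) => [/C0 ->|iN]; first by rewrite coef0.
 by apply: nth_default; apply: leq_trans (szC i) _; move: nij; rewrite /n; lia.
rewrite /biev (@sum_ord_widen (fun i => \sum_(j < n) iota (C i)`_j * (x ^+ i * t ^+ j)) N).
- rewrite -[RHS]c0; apply: eq_bigr => i _; rewrite /ev (@horner_coef_wide _ n); last first.
  by rewrite size_map_poly -CE (leq_trans (szC i)) // leq_addl.
 rewrite mulr_suml; apply: eq_bigr => j _; rewrite coef_map CE /=; ring.
- exact: leq_addr.
- by move=> i Ni; apply: big1 => j _; rewrite C0 // coef0 rmorph0 mul0r.
Qed.

Lemma sum_shift (F : nat -> E) (G : nat -> E) n : F 0%N = 0 -> (forall i, F i.+1 = G i) ->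
 (forall i, (n <= i.+1)%N -> G i = 0) -> \sum_(i < n) F i = \sum_(i < n) G i.
move=> F0 FG G0; case: n G0 => [|n] G0; first by rewrite !big_ord0.
by rewrite big_ord_recl F0 add0r big_ord_recr /= G0 // addr0; apply: eq_bigr => i _; rewrite FG.
Qed.

Lemma sum_multiples l (F : nat -> E) n : (0 < l)%N -> (forall i, ~~ (l %| i)%N -> F i = 0) ->
 \sum_(i < l * n) F i = \sum_(i < n) F (l * i)%N.
move=> l0 F0; elim: n => [|n IH]; first by rewrite muln0 !big_ord0.
rewrite big_ord_recr -IH /= mulnSr big_split_ord /=; congr (_ + _).
case: l l0 F0 {IH} => // l _ F0; rewrite big_ord_recl /= addn0 big1 ?addr0 // => i _.
apply: F0; rewrite dvdn_addr ?dvdn_mulr // gtnNdvd // /bump /= add1n ltnS; exact: ltn_ord.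
Qed.
End BivariateRelations.

Section Derivations.
Section OneDerivation.
Variables (V : lmodType E) (e : E -> V).
Hypothesis he : is_derivation iota e.

Lemma derD x y : e (x + y) = e x + e y. by case: he. Qed.
Lemma derM x y : e (x * y) = x *: e y + y *: e x. by case: he. Qed.
Lemma derC a : e (iota a) = 0. by case: he. Qed.
Lemma der0 : e 0 = 0. by rewrite -(rmorph0 iota) derC. Qed.
Lemma der1 : e 1 = 0. by rewrite -(rmorph1 iota) derC. Qed.
Lemma der_sum I (r : seq I) (P : pred I) (F : I -> E) :
 e (\sum_(i <- r | P i) F i) = \sum_(i <- r | P i) e (F i).
by apply: (big_morph e derD); exact: der0. Qed.

Lemma derX x n : e (x ^+ n) = (n%:R * x ^+ n.-1) *: e x.
elim: n => [|n IH]; first by rewrite expr0 der1 mul0r scale0r.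
rewrite exprS derM IH scalerA -scalerDl; congr (_ *: _); rewrite /=.
case: n {IH} => [|n]; first by rewrite mulr0n mul0r mulr0 add0r mul1r.
by rewrite /= mulrCA -exprS -[in RHS](addn1 n.+1) natrD mulrDl mul1r.
Qed.

Definition der_l (a : nat -> nat -> k) i j : k := i.+1%:R * a i.+1 j.
Definition der_r (a : nat -> nat -> k) i j : k := j.+1%:R * a i j.+1.
Lemma der_biev x t n a : deg_lt n a ->
 e (biev x t n a) = biev x t n (der_l a) *: e x + biev x t n (der_r a) *: e t.
move=> a0; rewrite /biev der_sum.
transitivity (\sum_(i < n) \sum_(j < n)
  ((iota (a i j) * (i%:R * x ^+ i.-1 * t ^+ j)) *: e x +
  (iota (a i j) * (x ^+ i * (j%:R * t ^+ j.-1))) *: e t)).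
 apply: eq_bigr => i _; rewrite der_sum; apply: eq_bigr => j _.
 rewrite derM derC scaler0 addr0 derM !derX scalerDr !scalerA addrC.
 by congr (_ *: _ + _ *: _); ring.
under eq_bigr do rewrite big_split /= -!scaler_suml.
rewrite big_split /= -!scaler_suml; congr (_ *: _ + _ *: _).
 rewrite (@sum_shift (fun i => \sum_(j < n) iota (a i j) * (i%:R * x ^+ i.-1 * t ^+ j))
  (fun i => \sum_(j < n) iota (der_l a i j) * (x ^+ i * t ^+ j))) //.
 - by apply: big1 => j _; ring.
 - by move=> i; apply: eq_bigr => j _; rewrite /der_l rmorphM rmorph_nat /=; ring.
 - by move=> i ni; apply: big1 => j _; rewrite /der_l a0 ?mulr0 ?rmorph0 ?mul0r // (leq_trans ni) ?leq_addr.
apply: eq_bigr => i _.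
rewrite (@sum_shift (fun j => iota (a i j) * (x ^+ i * (j%:R * t ^+ j.-1)))
 (fun j => iota (der_r a i j) * (x ^+ i * t ^+ j))) //.
- by ring.
- by move=> j; rewrite /der_r rmorphM rmorph_nat /=; ring.
- by move=> j nj; rewrite /der_r a0 ?mulr0 ?rmorph0 ?mul0r // (leq_trans nj) ?leq_addl.
Qed.
End OneDerivation.

(* A minimal relation between [x] and [t] whose partial derivatives both vanish
  would be a [p]-th power, [k] being perfect. *)
Lemma derivation_zero (V : lmodType E) (e : E -> V) (c : E -> E^o) t :
 is_derivation iota e -> is_derivation iota c -> transc t ->
 e t = 0 -> c t = 1 -> forall x, e x = 0.
move=> he hc tt et ct x; apply: contrapT => ex.
have [m hm] := relation_exists x tt.
have exP : exists n, `[< relation x t n >] by exists m; apply/asboolP.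
case: (ex_minnP exP) => n /asboolP[a [[i0 [j0 aij]] a0 ae]] nmin.
have n0 : (0 < n)%N.
 by case: n a0 {ae nmin} => // a0; move: aij; rewrite a0 ?eqxx.
have dl0 b : deg_lt n.-1 b -> biev x t n b = 0 -> forall i j, b i j = 0.
 move=> b0 be i j; apply/eqP; apply: contraPT isT => bij _.
 have : (n <= n.-1)%N; last by rewrite -ltnS prednK // ltnn.
 apply: nmin; apply/asboolP; exists b; split=> //; first by exists i, j.
 by rewrite -be; apply/esym/biev_widen => //; exact: leq_pred.
have dl1 : deg_lt n.-1 (der_l a).
 by move=> i j; rewrite /der_l => h; rewrite a0 ?mulr0 //; move: h n0; clear; lia.
have dr1 : deg_lt n.-1 (der_r a).
 by move=> i j; rewrite /der_r => h; rewrite a0 ?mulr0 //; move: h n0; clear; lia.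
(* [e] kills [t], so it leaves only the partial derivative in [x]; then [c], with [c t = 1],
   isolates the one in [t]. By minimality all coefficients of both are zero. *)
have l0 : biev x t n (der_l a) = 0.
 have := der_biev he x t a0; rewrite ae (der0 he) et scaler0 addr0 => /esym/eqP.
 by rewrite scaler_eq0 => /orP[/eqP //|/eqP /ex].
have r0 : biev x t n (der_r a) = 0.
 have := der_biev hc x t a0; rewrite ae (der0 hc) l0 scale0r add0r ct => /esym.
 by rewrite /GRing.scale /= mulr1.
have dl := dl0 _ dl1 l0; have dr := dl0 _ dr1 r0.
have [l pl chl] := finPcharP k; have chE := rmorph_pchar iota chl.
have al i j : ~~ (l %| i)%N -> a i j = 0.
 case: i => [|i] li; first by rewrite dvdn0 in li.
 have /eqP := dl i j; rewrite mulf_eq0 => /orP[h|/eqP //].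
 by move: li; rewrite (dvdn_pcharf chl) h.
have ar i j : ~~ (l %| j)%N -> a i j = 0.
 case: j => [|j] lj; first by rewrite dvdn0 in lj.
 have /eqP := dr i j; rewrite mulf_eq0 => /orP[h|/eqP //].
 by move: lj; rewrite (dvdn_pcharf chl) h.
have [root rootK] : exists root : k -> k, forall y, root y ^+ l = y.
 have fi : injective (pFrobenius_aut chl) by apply: fmorph_inj.
 have [g _ gK] := injF_bij fi; exists g => y; by rewrite -[RHS]gK pFrobenius_autE.
pose a' i j := root (a (l * i)%N (l * j)%N).
have l2 := prime_gt1 pl.
have a'0 i j : a' i j != 0 -> a (l * i)%N (l * j)%N != 0.
 apply: contra_neq => h; have /eqP : a' i j ^+ l = 0 by rewrite rootK h.
 by rewrite expf_eq0 => /andP[_ /eqP].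
have aln i j : a' i j != 0 -> (l * (i + j) < n)%N.
 by move=> /a'0; apply: contraNT; rewrite -leqNgt mulnDr => /a0 ->.
have n2 : (1 < n)%N.
 rewrite ltnNge; apply/negP => n1; have e1 : n = 1%N by apply/eqP; rewrite eqn_leq n1.
 move: ae aij; rewrite e1 /biev !big_ord1 !expr0 !mulr1 => /eqP.
 rewrite fmorph_eq0 => /eqP a00; case: (posnP (i0 + j0)) => [/eqP|ij].
  by rewrite addn_eq0 => /andP[/eqP -> /eqP ->]; rewrite a00 eqxx.
 by rewrite a0 ?eqxx // e1.
have d' : deg_lt n.-1 a'.
 move=> i j h; apply/eqP; apply: contraPT isT => /aln h' _.
 move: (leq_mul2r (i + j) 2 l); rewrite l2 orbT => h2.
 move: h h' h2 n2; clear; move: (i + j)%N => s; move: (l * s)%N => ls; lia.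
suff : (n <= n.-1)%N by rewrite -ltnS prednK // ltnn.
apply: nmin; apply/asboolP; exists a'; split=> //.
 have li : (l %| i0)%N by apply: contraNT aij => /al ->.
 have lj : (l %| j0)%N by apply: contraNT aij => /ar ->.
 exists (i0 %/ l)%N, (j0 %/ l)%N; rewrite /a' ![(l * _)%N]mulnC !divnK //.
 by apply: contra_neq aij => h; rewrite -[LHS]rootK h expr0n; case: (l) pl.
have : pFrobenius_aut chE (biev x t n a') = 0.
 have nln : (n <= l * n)%N by rewrite leq_pmull // prime_gt0.
 rewrite -ae -(biev_widen _ _ nln a0) /biev rmorph_sum /=.
 rewrite (@sum_multiples l (fun i => \sum_(j < l * n) iota (a i j) * (x ^+ i * t ^+ j))) ?prime_gt0 //.
  apply: eq_bigr => i _; rewrite rmorph_sum /=.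
  rewrite (@sum_multiples l (fun j => iota (a (l * i)%N j) * (x ^+ (l * i) * t ^+ j))) ?prime_gt0 //.
   apply: eq_bigr => j _; rewrite pFrobenius_autE !exprMn -rmorphXn rootK -!exprM.
   by rewrite ![(_ * l)%N]mulnC.
  by move=> j /ar ->; rewrite rmorph0 mul0r.
 by move=> i li; apply: big1 => j _; rewrite al // rmorph0 mul0r.
rewrite pFrobenius_autE => /eqP; rewrite expf_eq0 => /andP[_ /eqP h].
by rewrite -(biev_widen x t (leq_pred n) d').
Qed.
End Derivations.

(** * Kaehler differentials as functionals on the adeles *)

Section Residues.
Variable M : completions (@place_ring k E iota).
Notation A := (kad M).
Notation dg := (dg M).

(** All k-linear functionals on the adeles, with E acting by multiplication of the argument; as an
    E-module it is a target for derivations of E. *)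
Record functl := Functl { fval : A -> k; fvalP : lfun fval }.
HB.instance Definition _ := gen_eqMixin functl.
HB.instance Definition _ := gen_choiceMixin functl.

Lemma fctl_ext (f g : functl) : (forall x, fval f x = fval g x) -> f = g.
case: f g => [f lf] [g lg] /= fg; have {}fg : f = g by apply/funext.
by subst g; rewrite (Prop_irrelevance lf lg).
Qed.

Fact functl0P : lfun (fun _ : A => 0 : k).
by move=> a x y; rewrite mulr0 addr0. Qed.
Fact functlDP (f g : functl) : lfun (fun x => fval f x + fval g x).
by move=> a x y; rewrite !fvalP; ring. Qed.
Fact functlNP (f : functl) : lfun (fun x => - fval f x).
by move=> a x y; rewrite fvalP; ring. Qed.
Fact functlZP (e : E) (f : functl) : lfun (fun x : A => fval f ((dg e : adele M) * x)).
by move=> a x y; rewrite -fvalP; congr (fval f _); rewrite !kscaleE mulrDr mulrCA.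
Qed.

Let fl0 := Functl functl0P.
Let flD f g := Functl (functlDP f g).
Let flN f := Functl (functlNP f).
Let flZ e f := Functl (functlZP e f).
Fact functl_addA : associative flD. by move=> f g h; apply: fctl_ext => x /=; rewrite addrA. Qed.
Fact functl_addC : commutative flD. by move=> f g; apply: fctl_ext => x /=; rewrite addrC. Qed.
Fact functl_add0 : left_id fl0 flD. by move=> f; apply: fctl_ext => x /=; rewrite add0r. Qed.
Fact functl_addN : left_inverse fl0 flN flD. by move=> f; apply: fctl_ext => x /=; rewrite addNr. Qed.
HB.instance Definition _ := GRing.isZmodule.Build functl functl_addA functl_addC functl_add0 functl_addN.
Fact functl_scaleA a b f : flZ a (flZ b f) = flZ (a * b) f.
by apply: fctl_ext => x /=; congr (fval f _); rewrite mulrA -rmorphM [b * a]mulrC. Qed.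
Fact functl_scale1 : left_id 1 flZ.
by move=> f; apply: fctl_ext => x /=; rewrite rmorph1 mul1r. Qed.
Fact functl_scaleDr : right_distributive flZ +%R.
by move=> e f g; apply: fctl_ext. Qed.
Fact functl_scaleDl f : {morph flZ^~ f : a b / a + b}.
by move=> a b; apply: fctl_ext => x /=; rewrite rmorphD mulrDl (lfunD (fvalP f)). Qed.
HB.instance Definition _ := GRing.Zmodule_isLmodule.Build E functl
 functl_scaleA functl_scale1 functl_scaleDr functl_scaleDl.

Variables (Om : lmodType E) (d : E -> Om).
Hypothesis hk : is_kaehler iota d.

(** The symbol is a derivation in [g] with values in functionals, so the universal property extends
    it to a linear map on differentials; the residue theorem and [symb_integral] make its values at
    the [d g] Weil differentials. *)
Lemma tate_residue : exists R : {linear Om -> functl},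
 (forall g, weil (fval (R (d g)))) /\
 forall p t m (a : nat -> cring M p) n y r, is_uniformizer p t -> is_residue_degree M p m ->
  (forall i, coef_field (a i)) -> cint M p (y - psum t 0 a n.+1) ->
  cmap M p (iota r) = ktr m (a 0%N) -> fval (R (d t)) (atp y) = r.
have [D fD dec] := adele_dec M.
have [pi [hpi _ _]] := polar_projector M unifP fD.
pose beta x g := xget 0 [set c | symb pi x (dg g) c].
have hb x g : symb pi x (dg g) (beta x g).
 have [c hc] := symb_exists fD hpi x (dg g).
 by apply: (@xgetI _ 0 [set c | symb pi x (dg g) c] c).
have bE x g c : symb pi x (dg g) c -> beta x g = c.
 by move=> h; exact: trop_uniq (hb x g) h.
have lb g : lfun (beta^~ g) by move=> a x y; apply: bE; apply: (symb_lin hpi).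
pose e g := Functl (lb g).
have [hder univ] := hk.
have he : is_derivation iota e.
 split=> [x y|x y|a]; apply: fctl_ext => z /=.
 - by apply: bE; rewrite rmorphD; exact: (symbD hpi (hb _ _) (hb _ _)).
 - have hs u v : symb pi ((z : adele M) * dg u) (dg v) (beta ((dg u : adele M) * z) v).
   by rewrite -(mulrC (dg u)); exact: hb.
  by apply: bE; rewrite rmorphM; exact: (symb_prod fD hpi (hs _ _) (hs _ _)).
 - by apply: bE; exact: (symb_const hpi).
have [R [hR _]] := univ _ _ he; exists R; split.
 move=> g; rewrite hR; split=> [|e'|]; first exact: lb.
  by apply: (symb_principal fD hpi (c := beta (dg e') g)) => //; exact: hb.
 have [D' fD' hD'] := symb_integral fD hpi (dg g); exists D' => // x hx.
 exact/bE/hD'.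
move=> p t m a n y r tu mP ka hy hr; rewrite hR /=.
exact/bE/(symb_local tu fD hpi mP ka hy hr).
Qed.

(** If all traces vanished, [ktr_expand] would give 1 = 0. *)
Lemma ktr_neq0 p m : is_residue_degree M p m ->
 exists2 a, coef_field a & ktr (M := M) (p := p) m a != 0.
move=> mP; apply: contrapT => nex; have [s [us hs]] := kap_finite M p.
pose inv (c : cring M p) := xget 0 [set c' | coef_field c' /\ c * c' = 1].
have hinv c : c \in s -> c != 0 -> c * inv c = 1.
 move=> /hs kc c0; have [c' kc' e] := kap_inv kc c0.
 by have [] := @xgetI _ 0 [set c' | coef_field c' /\ c * c' = 1] c' (conj kc' e).
have := ktr_expand mP us hs hinv (kap1 M p).
rewrite big_seq_cond big1 ?oppr0 => [/eqP|c /andP[/hs kc _]]; first by rewrite oner_eq0.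
have [->|t0] := eqVneq (ktr m (c * 1)) 0; first by rewrite mul0r.
by case: nex; exists (c * 1) => //; apply: kapM => //; exact: kap1.
Qed.

Section Generator.
Variables (C : numFieldType) (psi : k -> C).
Hypothesis hpsi : nontrivial_character psi.

Lemma weil_cancel (w : A -> k) y c c' : weil w -> w y != 0 ->
 (forall x : A, w ((dg c : adele M) * x) = w ((dg c' : adele M) * x)) -> c = c'.
move=> [lw _ _] wy h; apply/subr0_eq/eqP; apply: contraNT wy => z; apply/eqP.
have sub (x : A) : w ((dg (c - c') : adele M) * x) = 0.
 by rewrite rmorphB mulrBl (lfunB lw) h subrr.
by have := sub ((dg (c - c')^-1 : adele M) * y); rewrite mulrA -rmorphM mulfV // rmorph1 mul1r.
Qed.

(** Generation by one differential is extracted from Weil's side: each [R (d g)] is a multiple [c g]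
    of [R (d t)], [c] is a derivation with [c t = 1], and the derivation [d g - c g *: d t] kills
    [t], hence is 0. So every form has the shape that [is_residue] asks for. *)
Lemma residue_functional : exists R : {linear Om -> functl},
 [/\ forall alpha, weil (fval (R alpha)), forall alpha, R alpha = 0 -> alpha = 0
  & forall p x alpha, residue (Mbar := M) d x alpha = fval (R alpha) (atp (p := p) x)].
have [R [hR locR]] := tate_residue.
have nz (p : place) t : is_uniformizer p t -> exists x, fval (R (d t)) x != 0.
 move=> tu; have [m mP] := resdeg_exists M p; have [b kb tb] := ktr_neq0 mP.
 have [r hr] := ktr_in_k mP kb.
 exists (atp (psum t 0 (fun=> b) 1)); rewrite (locR p t m (fun=> b) 0%N _ r) //.
  by apply: contra_neq tb => r0; rewrite -hr r0 /= !rmorph0.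
 by rewrite subrr; exact: cint0.
have gen (p : place) t : is_uniformizer p t -> forall alpha, exists h, alpha = h *: d t.
 move=> tu; have [y wy] := nz p t tu.
 have /choice[c hc] : forall g, exists c, forall x : A,
   fval (R (d g)) x = fval (R (d t)) ((dg c : adele M) * x).
  by move=> g; apply: (weil_onedim hpsi (hR g) (hR t) wy).
 have cE g c' : (forall x : A, fval (R (d g)) x = fval (R (d t)) ((dg c' : adele M) * x)) -> c g = c'.
  by move=> h; apply: (weil_cancel (hR t) wy) => x; rewrite -hc h.
 have [hder univ] := hk; have [dD dM dC] := hder.
 have lt x z : fval (R (d t)) (x + z) = fval (R (d t)) x + fval (R (d t)) z.
  exact: (lfunD (fvalP _)).
 have hcder : is_derivation iota (c : E -> E^o).
  split=> [x z|x z|a].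
  - by apply: cE => v; rewrite dD linearD /= (hc x) (hc z) rmorphD mulrDl lt.
  - apply: cE => v; rewrite dM linearD !linearZ /= (hc x) (hc z) rmorphD !rmorphM mulrDl lt.
   by rewrite !mulrA (mulrC (dg x)) (mulrC (dg z)).
  - apply: cE => v; rewrite dC linear0 rmorph0 mul0r; apply/esym; exact: (lfun0 (fvalP _)).
 have ct : c t = 1 by apply: cE => x; rewrite rmorph1 mul1r.
 have he : is_derivation iota (fun g => d g - c g *: d t).
  have [cD cM cC] := hcder; split=> [x z|x z|a].
  - by rewrite dD cD scalerDl opprD addrACA.
  - by rewrite dM cM !scalerBr scalerDl opprD !scalerA addrACA.
  - by rewrite dC cC scale0r subr0.
 have tt : transc t by apply: (max_transc (unif_max tu) (unif_neq0 tu)).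
 have dE g : d g = c g *: d t.
  apply/subr0_eq/(derivation_zero he hcder tt _ ct).
  by rewrite ct scale1r subrr.
 have [l [hl _]] := univ _ _ hcder; have [l0 [_ unil]] := univ _ _ hder.
 move=> alpha; exists (l alpha).
 have h1 := unil (rank_one l (d t)) _ alpha.
 have h2 := unil (idfun : {linear Om -> Om}) _ alpha.
 rewrite -[LHS]/(idfun alpha) h2 // -h1 // => g.
 by rewrite /= /rank_one hl -dE.
have [q _] : exists q : place, True.
 by have [u tu] := tr_exists; have [q _] := pole_exists tu; exists q.
have wR alpha : weil (fval (R alpha)).
 by have [h ->] := gen q _ (unifP q) alpha; rewrite linearZ; exact: (weil_mul h (hR _)).
exists R; split=> //.
- move=> alpha; have [h ->] := gen q _ (unifP q) alpha; rewrite linearZ => h0.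
 have [y wy] := nz q _ (unifP q).
 suff -> : h = 0 by rewrite scale0r.
 apply: (weil_cancel (hR _) wy) => x; rewrite rmorph0 mul0r (lfun0 (fvalP _)).
 exact: (congr1 (fun f => fval f x) h0).
move=> p x alpha.
have key r : is_residue (Mbar := M) d x alpha r -> r = fval (R alpha) (atp x).
 move=> [t [h [m [n [a [tu -> mP [ka hy] hr]]]]]]; rewrite linearZ /= (mulrC (dg h)) atpM.
 apply/esym; apply: (locR p t m a n) => //.
 have -> : psum t 0 a n.+1 = \sum_(i < n.+1) a i * cmap M p t^-1 ^+ i.+1; last exact: hy.
 apply: eq_bigr => i _; rewrite -rmorphXn; congr (_ * cmap M p _).
 have -> : 0 - 1 - i%:Z = - i.+1%:Z by lia.
 by rewrite -exprz_inv.
have [r hr] : exists r, is_residue (Mbar := M) d x alpha r.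
 have tu := unifP p; set t := unif p in tu.
 have [h hh] := gen p t tu alpha; have [m mP] := resdeg_exists M p.
 have [z [n [a [ka zE]]] hz] := polar_exists tu 0 (x * cmap M p h).
 pose a' i := if (i < n)%N then a i else 0.
 have ka' i : coef_field (a' i) by rewrite /a'; case: ifP => // _; exact: kap0.
 have [r hr] := ktr_in_k mP (ka' 0%N).
 exists r, t, h, m, n, a'; split=> //; split=> //.
 have <- : z = \sum_(i < n.+1) a' i * cmap M p t^-1 ^+ i.+1; last exact/hge0n.
 rewrite zE (psum_widen t 0 a (leqnSn n)); apply: eq_bigr => i _.
 rewrite -rmorphXn; congr (_ * cmap M p _).
 have -> : 0 - 1 - i%:Z = - i.+1%:Z by lia.
 by rewrite -exprz_inv.
apply: key; exact: (@xgetI _ 0 [set r | is_residue d x alpha r] r hr).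
Qed.

(** Outside finitely many places the local terms vanish, and the adele minus its remaining
    components lies in a lattice killed by the functional. *)
Lemma psi_curve_functional (R : Om -> functl) (x : adele M) alpha :
 weil (fval (R alpha)) ->
 (forall p y, residue (Mbar := M) d y alpha = fval (R alpha) (atp (p := p) y)) ->
 psi_curve d psi x alpha = psi (fval (R alpha) x).
move=> [lR _ [B fB hB]] hres; congr psi.
have [Dx fx hx] := lat_exists x.
have : finite_set [set p | Dx p <> 0 \/ B p <> 0].
 apply: (@sub_finite_set _ _ ([set p | Dx p <> 0] `|` [set p | B p <> 0])) => //.
 by rewrite finite_setU; split.
move=> /finite_seqP[s0 hs0]; pose s := undup s0.
have hs p : p \notin s -> Dx p = 0 /\ B p = 0.
 rewrite mem_undup => ps; have np : ~ (Dx p <> 0 \/ B p <> 0).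
  move=> h; have : [set` s0] p by rewrite -hs0.
  by apply/negP.
 by split; apply: contrapT => h; apply: np; [left|right].
have small p : p \notin s -> hge (B p) (aval x p).
 by move=> /hs[D0 ->]; have := hx p; rewrite D0.
rewrite (fsbigE s) ?undup_uniq //=; last first.
 by move=> p _ /small h; rewrite hres; apply/hB/atp_lat.
transitivity (\sum_(p <- s) fval (R alpha) (atp (aval x p))).
 by apply: eq_big => [p|p _]; rewrite ?in_setT ?hres.
rewrite -(lfun_sum lR) -[x in RHS](subrK (\sum_(p <- s) (atp (aval x p) : A))) (lfunD lR) [X in X + _]hB ?add0r //.
move=> p; have -> : aval (x - \sum_(q <- s) atp (aval x q)) p =
  aval x p - \sum_(q <- s) aval (atp (aval x q)) p by rewrite /= aval_sum.
have [ps|ps] := boolP (p \in s).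
 rewrite (bigD1_seq p) ?undup_uniq //= atp_in big1 ?addr0 ?subrr; first exact: hge_0.
 by move=> q qp; rewrite atp_out // eq_sym.
rewrite big_seq big1 ?subr0; first exact: small.
by move=> q qs; rewrite atp_out //; apply: contraNneq ps => ->.
Qed.
End Generator.
End Residues.

(** * Fourier analysis on the adeles modulo E *)

Section Fourier.
Variable M : completions (@place_ring k E iota).
Notation A := (kad M).
Notation dg := (dg M).
Variables (C : numFieldType) (psi : k -> C).
Hypothesis hpsi : nontrivial_character psi.

Lemma psiD a b : psi (a + b) = psi a * psi b. by case: hpsi. Qed.
Lemma psi0 : psi 0 = 1. by case: hpsi. Qed.
Lemma bar_mean (phi : adele M -> C) : test_fun setT (@principal _ _ _ M) phi ->
 exists c, meanon setT phi c.
apply: (@test_fun_mean _ _ _ M C (fun p n => hge (p := p) n)).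
- by move=> p n; split; [exact: hge_0|move=> x y; exact: hgeB].
- by move=> p m n mn x; apply: hge_le; rewrite lez_nat.
- by move=> p x /hge0n.
- by move=> p n x; exact: (maxid_pow_hge _ _).2.
- move=> p n; have [s cs] := cover_lat M fsupp0 (fsupp_pt p n%:Z).
 exists [seq aval a p | a <- s] => x cx; have [|y ys hy] := cs (atp x).
  by apply/atp_lat/hge0n.
 exists (aval y p); first exact: map_f.
 by have := hy p; rewrite /pt eqxx /= atp_in.
- by move=> p u; exact: cint_complete.
- move=> n /fsupp_fin fn; have [s cs] := covers_elat M fn; exists s => x _.
 have [z zs [_ [l [[e ->] hl xz]]]] := cs x Logic.I; exists z => //.
 by exists (dg e), l; split=> //; apply/principal_dg; exists e.
Qed.

Variables (w : A -> k) (y0 : A).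
Hypotheses (hw : weil w) (wy0 : w y0 != 0).
Let lw : lfun w. by case: hw. Qed.
Definition chi (e : E) (x : adele M) : C := psi (w (dg e * x)).
Lemma chiD e x y : chi e (x + y) = chi e x * chi e y.
by rewrite /chi mulrDr (lfunD lw) psiD. Qed.
Lemma chi_add e e' x : chi (e + e') x = chi e x * chi e' x.
by rewrite /chi rmorphD mulrDl (lfunD lw) psiD. Qed.
Lemma chi0 e : chi e 0 = 1. by rewrite /chi mulr0 (lfun0 lw) psi0. Qed.
Lemma chi_0 x : chi 0 x = 1. by rewrite /chi rmorph0 mul0r (lfun0 lw) psi0. Qed.
Lemma chiN e x : chi e x * chi e (- x) = 1. by rewrite -chiD subrr chi0. Qed.
Lemma chi_dg e e' : chi e (dg e') = 1.
by rewrite /chi -rmorphM; case: hw => _ -> _; rewrite psi0. Qed.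
Lemma chiM e e' x : chi e (dg e' * x) = chi (e * e') x.
by rewrite /chi mulrA rmorphM. Qed.

Lemma chi_level e : exists2 D, fsupp D & forall x, lat D x -> chi e x = 1.
have [_ _ [D fD h]] := weil_mul e hw; exists D => // x /h.
by rewrite /chi => ->; rewrite psi0.
Qed.

Lemma chi_neq1 e x : w (dg e * x) != 0 -> exists a : k, chi e (dg (iota a) * x) != 1.
move=> z; have [_ _ [a pa]] := hpsi; exists (a / w (dg e * x)).
by rewrite /chi mulrCA -[dg (iota _) * _]/(_ *: (dg e * x : A)) (lfunZ lw) divfK.
Qed.

Lemma chi_nontrivial e : e != 0 -> exists x, chi e x != 1.
move=> e0; have [|a] := @chi_neq1 e (dg e^-1 * y0); last by exists (dg (iota a) * (dg e^-1 * y0)).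
by rewrite mulrA -rmorphM mulfV // rmorph1 mul1r.
Qed.

Definition biperiodic D (phi : adele M -> C) := forall u x, elat D u -> phi (u + x) = phi x.
Lemma mean_eigen (phi : adele M -> C) c u a : meanon setT phi c ->
 (forall x, phi (u + x) = a * phi x) -> a != 1 -> c = 0.
move=> hc eig a1.
have sT : sgp [set: adele M] by [].
have h1 := mean_shift (h := u) sT Logic.I hc.
have h2 := meanonZ sT a hc.
have e : a * c = c.
 by apply: (mean_uniq sT) h2 _; apply: (mean_ext sT _ h1) => x _; rewrite eig.
by apply/eqP; apply: contraNT a1 => c0; apply/eqP/(mulIf c0); rewrite mul1r.
Qed.

Lemma mean_chi e : meanon setT (chi e) (e == 0)%:R.
have sT : sgp [set: adele M] by [].
have [->|e0] := eqVneq e 0.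
 by apply: (mean_ext sT _ (mean_cst sT 1)) => x _; rewrite chi_0.
have [D fD hD] := chi_level e; have [s cs] := covers_elat M fD.
have [|c hc] := mean_periodic sT (phi := chi e) (elat_sgp M D) (@subsetT _ _) cs.
 by move=> _ x [_ [l [[e' ->] hl ->]]] _; rewrite !chiD chi_dg hD // !mul1r.
have [u u1] := chi_nontrivial e0.
by have c0 := mean_eigen hc (chiD e u) u1; rewrite c0 in hc.
Qed.

(** Finite duality: the [chi e] with [e] in a finite list [G] are trivial on [elat D] and separate
    points modulo it. Vanishing of their sum outside [elat D] gives inversion, and [mean_chi]
    identifies the coefficients with means. *)
Lemma fourier D (phi : adele M -> C) : fsupp D -> biperiodic D phi ->
 exists (s : seq E) (c : E -> C), [/\ uniq s,
  forall e, meanon setT (fun x => phi x * chi e (- x)) (c e),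
  forall e, e \notin s -> c e = 0,
  forall e, e \in s -> forall x, lat D x -> chi e x = 1
  & forall x, phi x = \sum_(e <- s) c e * chi e x].
move=> fD; have sT : sgp [set: adele M] by [].
have [r0 hr0] := weil_ann_finite hw wy0 fD.
pose G := [seq e <- undup r0 | `[< forall x, lat D x -> w (dg e * x) = 0 >]].
have uG : uniq G by rewrite filter_uniq // undup_uniq.
have GP e : e \in G <-> forall x, lat D x -> w (dg e * x) = 0.
 rewrite mem_filter mem_undup; split=> [/andP[/asboolP]//|h].
 by rewrite hr0 // andbT; apply/asboolP.
have G1 e (x : A) : e \in G -> elat D x -> chi e x = 1.
 move=> /GP eG [_ [l [[e' ->] hl ->]]]; rewrite chiD chi_dg mul1r.
 by rewrite /chi eG // psi0.
have GD e e' : e \in G -> e' \in G -> e + e' \in G.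
 move=> /GP h /GP h'; apply/GP => x hx; rewrite rmorphD mulrDl (lfunD lw).
 by rewrite h // h' // addr0.
have GN e : e \in G -> - e \in G.
 by move=> /GP h; apply/GP => x hx; rewrite rmorphN mulNr (lfunN lw) h // oppr0.
have sumG (x : A) : ~ elat D x -> \sum_(e <- G) chi e x = 0.
 move=> nx; have [f [lf fz f1]] := separating_fun (elat_linsub M D) nx.
 have wf : weil f.
  split=> // [e|]; first by apply: fz; exists (dg e), 0; rewrite addr0; split=> //; [exists e|case: (lat_sgp M D)].
  exists D => // z hz; apply: fz; exists 0, z; rewrite add0r; split=> //.
  by exists 0; rewrite rmorph0.
 have [e1 he1] := weil_onedim hpsi wf hw wy0.
 have [|a pa] := @chi_neq1 e1 x; first by rewrite -he1 f1 oner_neq0.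
 pose e0 := e1 * iota a; rewrite chiM -/e0 in pa.
 have e0G : e0 \in G.
  apply/GP => z hz; rewrite rmorphM -mulrA -he1 -[dg (iota a) * _]/(a *: (z : A)) (lfunZ lf).
  rewrite fz ?mulr0 //; exists 0, z; rewrite add0r; split=> //.
  by exists 0; rewrite rmorph0.
 have : \sum_(e <- G) chi (e0 + e) x = \sum_(e <- G) chi e x.
  rewrite -(big_map (+%R e0) xpredT (fun e => chi e x)); apply: perm_big; apply: uniq_perm => //.
   by rewrite map_inj_uniq //; exact: addrI.
  move=> e; apply/mapP/idP => [[e' e'G ->]|eG]; first exact: GD.
  by exists (e - e0); [apply: GD => //; exact: GN|rewrite addrC subrK].
 rewrite (eq_bigr (fun e => chi e0 x * chi e x)) => [|e _]; last by rewrite chi_add.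
 rewrite -mulr_sumr => /eqP; rewrite -subr_eq0 -[X in _ - X]mul1r -mulrBl mulf_eq0 subr_eq0.
 by rewrite (negPf pa) => /eqP.
have [s0 cs0] := covers_elat M fD.
have [r [_ _ ir cr]] := transversal (elat_sgp M D) cs0.
move=> per; pose c e := if e \in G then (size G)%:R^-1 * (\sum_(a <- r) phi a * chi e (- a)) else 0.
have G0 : 0 \in G by apply/GP => x _; rewrite rmorph0 mul0r (lfun0 lw).
have sG : (size G)%:R != 0 :> C by rewrite pnatr_eq0 size_eq0; apply: contraTneq G0 => ->.
have c0 e : e \notin G -> c e = 0 by rewrite /c => /negPf ->.
have phiE x : phi x = \sum_(e <- G) c e * chi e x.
 apply: (mulfI sG); rewrite mulr_sumr.
 rewrite [RHS](eq_big_seq (fun e => \sum_(a <- r) phi a * chi e (x - a))); last first.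
  move=> e eG; rewrite /c eG !mulrA mulfV // mul1r mulr_suml.
  by apply: eq_bigr => a _; rewrite -mulrA -chiD addrC.
 have [a ar ha] := cr x Logic.I; have [ur ir'] := ir.
 rewrite exchange_big /= (bigD1_seq a) //= [X in _ + X]big_seq_cond [X in _ + X]big1 ?addr0.
  rewrite (eq_big_seq (fun=> phi a)) => [|e eG]; last by rewrite G1 // mulr1.
  by rewrite big_const_seq count_predT iter_addr_0 mulr_natl -{1}(subrK a x) per.
 move=> b /andP[br ba]; rewrite -mulr_sumr sumG ?mulr0 // => h; move/eqP: ba; apply; apply: ir' => //.
 have := (elat_sgp M D).2 _ _ ha h.
 by rewrite opprB addrC addrA subrK.
exists G, c; split=> // [e|e eG x hx]; last first.
 by apply: G1 => //; exists 0, x; rewrite add0r; split=> //; exists 0; rewrite rmorph0.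
have -> : c e = \sum_(e' <- G) c e' * (e' - e == 0)%:R.
 have [eG|eG] := boolP (e \in G).
  rewrite (bigD1_seq e) //= subrr eqxx mulr1 big1 ?addr0 // => e' ee'.
  by rewrite subr_eq0 (negPf ee') mulr0.
 rewrite c0 // big_seq big1 // => e' e'G; rewrite subr_eq0 (negPf (_ : e' != e)) ?mulr0 //.
 by apply: contraNneq eG => <-.
apply: (mean_ext sT _ (mean_sum sT _ (fun e' _ => meanonZ sT (c e') (mean_chi (e' - e))))) => x _.
rewrite phiE mulr_suml; apply: eq_bigr => e' _; rewrite -mulrA; congr (_ * _).
by rewrite chi_add /chi rmorphN mulNr mulrN.
Qed.
End Fourier.

(** * Iwasawa decomposition, locally and for adeles *)

Section Local.
Variables (M : completions (@place_ring k E iota)) (p : place).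
Notation L := (cring M p).
Notation Oh := (cint M p).
Notation j := (cmap M p).
Notation t := (unif p).

Let max_total (c d : L) : c != 0 \/ d != 0 ->
 (exists2 z, Oh z & c = d * z /\ d != 0) \/ (exists2 z, Oh z & d = c * z /\ c != 0).
have main (x y : L) : x != 0 -> y != 0 ->
  (exists2 z, Oh z & x = y * z) \/ (exists2 z, Oh z & y = x * z).
 move=> /field_normal[m [u [v [Ou Ov uv ->]]]] /field_normal[m' [u' [v' [Ou' Ov' uv' ->]]]].
 have key (l l' : int) (a b b' : L) : l <= l' -> Oh a -> Oh b' -> b * b' = 1 ->
   exists2 z, Oh z & j (t ^ l') * a = j (t ^ l) * b * z.
  move=> ll Oa Ob bb; exists (j (t ^ (l' - l)) * (a * b')).
   apply: (cintM _); last exact: cintM.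
   by apply/hge0n; apply: (hge_le _ (hge_t M p (l' - l))); lia.
  have -> : j (t ^ l) * b * (j (t ^ (l' - l)) * (a * b')) = j (t ^ l) * j (t ^ (l' - l)) * a * (b * b') by ring.
  by rewrite bb mulr1 -rmorphM -expfzDr ?(unif_neq0 (unifP p)) // addrC subrK.
 have [h|h] := lerP m m'; [right|left].
  exact: (key _ _ _ _ _ h Ou' Ov uv).
 exact: (key _ _ _ _ _ (ltW h) Ou Ov' uv').
have [->|c0] := eqVneq c 0; have [->|d0] := eqVneq d 0.
- by case.
- by left; exists 0; rewrite ?mulr0 //; exact: cint0.
- by right; exists 0; rewrite ?mulr0 //; exact: cint0.
- by have [[z Oz e]|[z Oz e]] := main c d c0 d0; [left|right]; exists z.
Qed.

Definition int_mx (B : 'M[L]_2) := forall i i', Oh (B i i').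
Lemma int_mx2 a b c d : Oh a -> Oh b -> Oh c -> Oh d -> int_mx (mx2 a b c d).
by move=> *; move=> i i'; rewrite mxE; case: ifP => _; case: ifP. Qed.

(** The bottom row is a scalar times an integral row with an entry 1, which is completed to an
    integral invertible matrix. The last clause, trivial data when [B] and [B'] are integral, is
    what lets the local choices be assembled into adeles. *)
Lemma iwasawa_local (B B' : 'M[L]_2) : gl2 (B, B') ->
 exists (m : int) (y c c' : L) (K K' : 'M[L]_2),
 [/\ gl2 (K, K'), int_mx K /\ int_mx K', c * c' = 1, B = c *: (mx2 (j (t ^ m)) y 0 1 *m K)
  & int_mx B -> int_mx B' -> [/\ m = 0, y = 0, c = 1 & c' = 1]].
move=> h; have [[iB iB']|nint] := pselect (int_mx B /\ int_mx B').
 exists 0, 0, 1, 1, B, B'; split=> //; first by rewrite mulr1.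
 by rewrite expr0z rmorph1 -scalar_mx2 mul1mx scale1r.
suff [m [y [c [c' [K [K' [h1 h2 h3 h4]]]]]]] : exists (m : int) (y c c' : L) (K K' : 'M[L]_2),
 [/\ gl2 (K, K'), int_mx K /\ int_mx K', c * c' = 1 & B = c *: (mx2 (j (t ^ m)) y 0 1 *m K)].
 by exists m, y, c, c', K, K'; split=> // iB iB'; case: nint.
move: h; rewrite [B]mx2E [B']mx2E; set a := B _ _; set b := B _ _; set c := B _ _; set d := B _ _.
set a' := B' _ _; set b' := B' _ _; set c' := B' _ _; set d' := B' _ _ => h.
have := gl2_1 h; rewrite mul_mx2 scalar_mx2 => /mx2_inj[e1 e2 e3 e4].
have row0 : c != 0 \/ d != 0.
 have [c0|] := eqVneq c 0; [right|by left]; apply: contraTneq isT => d0.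
 by have := e4; rewrite c0 d0 !mul0r addr0 => /esym/eqP; rewrite oner_eq0.
have det0 : a * d - b * c <> 0.
 have : (a * d - b * c) * (a' * d' - b' * c') = 1.
  have -> : (a * d - b * c) * (a' * d' - b' * c') = (a * a' + b * c') * (c * b' + d * d') -
    (a * b' + b * d') * (c * a' + d * c') by ring.
  by rewrite e1 e2 e4; ring.
 by move=> + h0; rewrite h0 mul0r => /esym/eqP; rewrite oner_eq0.
have [[z Oz [ce x0]]|[z Oz [de x0]]] := max_total row0.
 have [x' xx] := cring_inv x0.
 have q0 : (a - b * z) * x' != 0.
  apply/eqP => h0; apply: det0; rewrite ce; have -> : a * d - b * (d * z) = (a - b * z) * x' * d * d + (a - b * z) * d * (1 - d * x') by ring.
  by rewrite h0 xx subrr; ring.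
 have [m [u [v [Ou Ov uv qe]]]] := field_normal q0.
 exists m, (b * x'), d, x', (mx2 u 0 z 1), (mx2 v 0 (- z * v) 1); split=> //.
 - by apply: gl2P; rewrite mul_mx2 scalar_mx2 uv; congr mx2; ring.
 - split; apply: int_mx2; rewrite ?cint0 ?cint1 //; try exact: cint0; try exact: cint1.
  by apply: cintM => //; exact: cintN.
 - rewrite mul_mx2 scale_mx2 -qe; congr mx2; rewrite ?ce; try ring.
   have -> : d * ((a - b * z) * x' + b * x' * z) = a * (d * x') by ring.
   by rewrite xx mulr1.
  have -> : d * (j (t ^ m) * 0 + b * x' * 1) = b * (d * x') by ring.
  by rewrite xx mulr1.
have [x' xx] := cring_inv x0.
have q0 : (b - a * z) * x' != 0.
 apply/eqP => h0; apply: det0; rewrite de; have -> : a * (c * z) - b * c = - ((b - a * z) * x' * c * c + (b - a * z) * c * (1 - c * x')) by ring.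
 by rewrite h0 xx subrr; ring.
have [m [u [v [Ou Ov uv qe]]]] := field_normal q0.
exists m, (a * x'), c, x', (mx2 0 u 1 z), (mx2 (- z * v) 1 v 0); split=> //.
- by apply: gl2P; rewrite mul_mx2 scalar_mx2; congr mx2; try ring; rewrite mul0r add0r.
- split; apply: int_mx2; rewrite ?cint0 ?cint1 //; try exact: cint0; try exact: cint1.
 by apply: cintM => //; exact: cintN.
- rewrite mul_mx2 scale_mx2 -qe; congr mx2; rewrite ?de; try ring.
  have -> : c * (j (t ^ m) * 0 + a * x' * 1) = a * (c * x') by ring.
  by rewrite xx mulr1.
 have -> : c * ((b - a * z) * x' + a * x' * z) = b * (c * x') by ring.
 by rewrite xx mulr1.
Qed.
End Local.
Lemma ord_unif (p : place) n : ord p (unif p ^ n) = n.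
have u0 : unif p ^ n != 0 by rewrite expfz_neq0 ?(unif_neq0 (unifP p)).
apply: ord_uniq => //; first exact: vge_unif.
by rewrite mulVf //; have [] := vr_subring (place_ringP p).
Qed.

Section Global.
Variable M : completions (@place_ring k E iota).
Notation Ab := (adele M).

Definition int_adele (a : Ab) := forall p, cint M p (aval a p).
Lemma int_lat a : int_adele a <-> lat (fun=> 0) a.
by split=> h p; apply/hge0n; exact: h. Qed.

Lemma mx_local p (B B' : 'M[Ab]_2) : gl2 (B, B') ->
 gl2 (map_mx (fun a : Ab => aval a p) B, map_mx (fun a : Ab => aval a p) B').
move=> /gl2_1 /matrixP e; apply: gl2P; apply: mx2P; rewrite mul2E !mxE /=.
all: by rewrite -[LHS]/(aval (_ * _ + _ * _) p) -mul2E e mxE.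
Qed.

Lemma iwasawa (B B' : 'M[Ab]_2) : gl2 (B, B') ->
 exists D (y c c' : Ab) (K K' : 'M[Ab]_2),
 [/\ fsupp D, gl2 (K, K'), forall i j, int_adele (K i j) /\ int_adele (K' i j), c * c' = 1
  & B = c *: (mx2 (tid M D) y 0 1 *m K)].
move=> h; pose at_ p (Q : 'M[Ab]_2) := map_mx (fun a : Ab => aval a p) Q.
have loc p : exists q : int * (cring M p * cring M p * cring M p) * ('M[cring M p]_2 * 'M[cring M p]_2),
  let: (m, (y, c, c'), (K, K')) := q in
  [/\ gl2 (K, K'), int_mx K /\ int_mx K', c * c' = 1,
   at_ p B = c *: (mx2 (cmap M p (unif p ^ m)) y 0 1 *m K)
  & int_mx (at_ p B) -> int_mx (at_ p B') -> [/\ m = 0, y = 0, c = 1 & c' = 1]].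
 have [m [y [c [c' [K [K' hK]]]]]] := iwasawa_local (mx_local p h).
 by exists (m, (y, c, c'), (K, K')).
pose q p := projT1 (cid (loc p)); have qP p := projT2 (cid (loc p)); rewrite -/(q _) in qP.
pose D p := (q p).1.1; pose y p := (q p).1.2.1.1; pose c p := (q p).1.2.1.2; pose c' p := (q p).1.2.2.
pose K p := (q p).2.1; pose K' p := (q p).2.2.
have {}qP p : [/\ gl2 (K p, K' p), int_mx (K p) /\ int_mx (K' p), c p * c' p = 1,
   at_ p B = c p *: (mx2 (cmap M p (unif p ^ D p)) (y p) 0 1 *m K p)
  & int_mx (at_ p B) -> int_mx (at_ p B') -> [/\ D p = 0, y p = 0, c p = 1 & c' p = 1]].
 by have := qP p; rewrite -/(q p) /K /K' /c /c' /y /D; case: (q p) => [[m [[y' c1] c2]] [K1 K2]].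
pose bad := \bigcup_(i in [set: 'I_2 * 'I_2])
 ([set p | ~ cint M p (aval (B i.1 i.2) p)] `|` [set p | ~ cint M p (aval (B' i.1 i.2) p)]).
have fbad : finite_set bad.
 by apply: bigcup_finite => [|i _]; [exact: finite_finset|rewrite finite_setU; split; exact: avalP].
have good p : ~ bad p -> [/\ D p = 0, y p = 0, c p = 1 & c' p = 1].
 move=> nb; have [_ _ _ _] := qP p; apply; move=> i i'; rewrite mxE; apply: contrapT => ni; apply: nb.
  by exists (i, i') => //; left.
 by exists (i, i') => //; right.
have fin (z : forall p, cring M p) : (forall p, ~ bad p -> cint M p (z p)) -> finite_set [set p | ~ cint M p (z p)].
 by move=> hz; apply: sub_finite_set fbad => p /= nz; apply: contrapT => /hz.
have fy : finite_set [set p | ~ cint M p (y p)].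
 by apply: fin => p /good[_ -> _ _]; exact: cint0.
have fc : finite_set [set p | ~ cint M p (c p)].
 by apply: fin => p /good[_ _ -> _]; exact: cint1.
have fc' : finite_set [set p | ~ cint M p (c' p)].
 by apply: fin => p /good[_ _ _ ->]; exact: cint1.
have fK i i' : finite_set [set p | ~ cint M p (K p i i')].
 by apply: fin => p _; have [_ [h1 _] _ _ _] := qP p; exact: h1.
have fK' i i' : finite_set [set p | ~ cint M p (K' p i i')].
 by apply: fin => p _; have [_ [_ h1] _ _ _] := qP p; exact: h1.
have fD : fsupp D by apply: sub_finite_set fbad => p /= Dp; apply: contrapT => /good[].
exists D, (Adele fy), (Adele fc), (Adele fc'), (\matrix_(i, i') Adele (fK i i')), (\matrix_(i, i') Adele (fK' i i')).
split=> //.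
- apply: gl2P; apply/matrixP => i i'; apply: aval_inj => p; have [hp _ _ _ _] := qP p.
 have /matrixP/(_ i i') := gl2_1 hp; rewrite !mul2E !mxE /= => ->.
 by case: (i == i').
- by move=> i i'; rewrite !mxE; split=> p /=; have [_ [h1 h2] _ _ _] := qP p.
- by apply: aval_inj => p /=; have [_ _ h1 _ _] := qP p.
- apply/matrixP => i i'; apply: aval_inj => p; have [_ _ _ h1 _] := qP p.
 have /matrixP/(_ i i') := h1; rewrite [RHS]mxE mul2E mxE => ->.
 rewrite [in RHS]mxE mul2E !mxE /=.
 by case: (i == o0); rewrite /= ?aval_tid.
Qed.
End Global.

(** * Local rings of the nonreduced curve *)

Section SpecialExtension.
Variable X : special_extension iota.
Notation F := (sF X).
Local Notation sO := (@Defs.sO k E iota X).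
Notation red := (@sred k E iota X).
Implicit Types p q : place.
Section Charts.
Implicit Types x y a b : F.

(** A lift of the inverse is correct up to [1 - n] with [n] nilpotent of square zero, and the factor
    [1 + n] repairs it. *)
Lemma sF_unit a : red a != 0 -> exists b, a * b = 1.
move=> a0; have [b rb] := sred_surj X (red a)^-1.
have n0 : red (1 - a * b) = 0 by rewrite rmorphB rmorph1 rmorphM rb mulfV // subrr.
have n2 := snil_sq0 n0 n0; exists (b * (1 + (1 - a * b))).
have -> : a * (b * (1 + (1 - a * b))) = 1 - (1 - a * b) * (1 - a * b) by ring.
by rewrite n2 subr0.
Qed.

Lemma inv_uniq (R : comPzRingType) (a b b' : R) : a * b = 1 -> a * b' = 1 -> b = b'.
by move=> h h'; rewrite -[b]mulr1 -h' mulrA (mulrC b) h mul1r. Qed.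

Section Local.
Variable p : place.
Notation O := (sO p).

Definition sO1 := sr1 (sO_subring X p).
Definition sOB := srB (sO_subring X p).
Definition sOM := srM (sO_subring X p).
Definition sO0 := sr0 (sO_subring X p).
Definition sON := srN (sO_subring X p).
Definition sOD := srD (sO_subring X p).
Definition sOX := srX (sO_subring X p).
Definition sO_sum := sr_sum (sO_subring X p).
Lemma sO_pr x : O x -> pring p (red x).
by move=> Ox; rewrite -(sO_red X p); exists x. Qed.

Definition lft (e : E) : F := xget 0 [set x | O x /\ red x = e].
Lemma lftP e : pring p e -> O (lft e) /\ red (lft e) = e.
move=> Oe; have [x Ox rx] : (red @` O) e by rewrite sO_red.
exact: (@xgetI _ 0 [set x | O x /\ red x = e] x (conj Ox rx)).
Qed.

Lemma sO_inv a b : O a -> a * b = 1 -> pring p (red a)^-1 -> O b.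
move=> Oa ab Oi; have [Oc rc] := lftP Oi; set c := lft _ in Oc rc.
have a0 : red a != 0.
 by apply/eqP => a0; have := congr1 red ab; rewrite rmorphM a0 mul0r rmorph1 => /eqP; rewrite eq_sym oner_eq0.
have n0 : red (1 - a * c) = 0 by rewrite rmorphB rmorph1 rmorphM rc mulfV // subrr.
have n2 := snil_sq0 n0 n0.
have -> : b = c * (1 + (1 - a * c)).
 apply: inv_uniq ab _; have -> : a * (c * (1 + (1 - a * c))) = 1 - (1 - a * c) * (1 - a * c) by ring.
 by rewrite n2 subr0.
by apply: sOM => //; apply: sOD sO1 _; apply: sOB sO1 _; apply: sOM.
Qed.

Definition tl : F := lft (unif p).
Lemma tlP : O tl /\ red tl = unif p.
by apply/lftP/max_pr/unif_max/unifP. Qed.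

Lemma tl_inv : exists b, tl * b = 1.
by apply: sF_unit; rewrite tlP.2; exact: unif_neq0 (unifP p). Qed.

Definition np : F := xget 0 [set n | [/\ red n = 0, n != 0, O n
  & forall x, red x = 0 -> O x -> exists2 a, O a & x = a * n]].

Lemma npP : [/\ red np = 0, np != 0, O np & forall x, red x = 0 -> O x -> exists2 a, O a & x = a * np].
have [n hn] := snil_loc X p.
exact: (@xgetI _ 0 [set n | [/\ red n = 0, n != 0, O n
  & forall x, red x = 0 -> O x -> exists2 a, O a & x = a * n]] n hn).
Qed.

Lemma sO_lift_bounded x : exists N y, O y /\ red (x * tl ^+ N - y) = 0.
have [N hN] := vge_exists p (red x).
have Oe : pring p (red x * unif p ^+ N) by move: hN; rewrite /vge opprK.
have [Oy ry] := lftP Oe; exists N, (lft (red x * unif p ^+ N)); split=> //.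
by rewrite rmorphB rmorphM rmorphXn tlP.2 ry subrr.
Qed.
End Local.

Definition nilgen : F := xget 0 [set n | [/\ red n = 0, n != 0
  & forall x, red x = 0 -> exists a, x = a * n]].

Lemma nilgenP : [/\ red nilgen = 0, nilgen != 0 & forall x, red x = 0 -> exists a, x = a * nilgen].
have [n hn] := snil_gen X.
exact: (@xgetI _ 0 [set n | [/\ red n = 0, n != 0
  & forall x, red x = 0 -> exists a, x = a * n]] n hn).
Qed.

Lemma np_nilgen p : exists c c', [/\ np p = c * nilgen, nilgen = c' * np p & c * c' = 1].
have [r0 n0 gen] := nilgenP; have [rp np0 _ _] := npP p.
have [c ec] := gen _ rp; have c0 : red c != 0.
 by apply: contra_neq np0 => c0; rewrite ec; apply: snil_sq0.
have [c' cc'] := sF_unit c0; exists c, c'; split=> //.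
by rewrite ec mulrA (mulrC c') cc' mul1r.
Qed.

(** Two rounds: one power of the lifted uniformizer makes the reduction integral, a second one the
    coefficient of the remaining nilpotent part. *)
Lemma sO_bounded p x : exists N, sO p (x * tl p ^+ N).
have [N [y [Oy ny]]] := sO_lift_bounded p x.
have [_ _ gen] := nilgenP; have [a ea] := gen _ ny.
have [c [c' [_ ec' _]]] := np_nilgen p; have [rn _ On _] := npP p.
have [N' [y' [Oy' ny']]] := sO_lift_bounded p (a * c').
exists (N + N')%N; have -> : x * tl p ^+ (N + N') = (y' * np p) + y * tl p ^+ N'.
 have e1 : (x * tl p ^+ N - y) * tl p ^+ N' = y' * np p.
  have := snil_sq0 ny' rn; rewrite mulrBl => /subr0_eq <-.
  by rewrite ea ec' -!mulrA; congr (_ * (_ * _)); rewrite mulrC.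
 by rewrite -e1 mulrBl exprD mulrA subrK.
have [Ot _] := tlP p; apply: sOD; apply: sOM => //; exact: sOX.
Qed.

Definition ae (P : place -> Prop) := finite_set [set p | ~ P p].
Lemma ae_and (P Q : place -> Prop) : ae P -> ae Q -> ae (fun p => P p /\ Q p).
move=> hP hQ; apply: (@sub_finite_set _ _ ([set p | ~ P p] `|` [set p | ~ Q p])).
 by move=> p /= /not_andP.
by rewrite finite_setU.
Qed.

Lemma ae_le (P Q : place -> Prop) : (forall p, P p -> Q p) -> ae P -> ae Q.
by move=> PQ; apply: sub_finite_set => p /=; apply: contra_not => /PQ. Qed.

Lemma ae_seq (T : eqType) (s : seq T) (P : T -> place -> Prop) :
 (forall i, ae (P i)) -> ae (fun p => forall i, i \in s -> P i p).
move=> h; elim: s => [|i s IH]; first by apply: (sub_finite_set _ (@finite_set0 _)) => p /=; apply.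
by apply: ae_le (ae_and (h i) IH) => p [Pi hs] i'; move=> /predU1P[->|/hs].
Qed.

Lemma ae_all (T : finType) (P : T -> place -> Prop) :
 (forall i, ae (P i)) -> ae (fun p => forall i, P i p).
by move=> h; apply: ae_le (ae_seq (enum T) h) => p hp i; apply: hp; rewrite mem_enum.
Qed.

Lemma subring_gen_subring (s : seq F) : is_subring (subring_gen s).
split=> [B [B1 _ _] _ //|x y hx hy B sB h|x y hx hy B sB h].
 by have [_ BB _] := sB; apply: BB; [exact: hx|exact: hy].
by have [_ _ BM] := sB; apply: BM; [exact: hx|exact: hy].
Qed.

Lemma place_inhabited : exists p : place, True.
by have [t tt] := tr_exists; have [p _] := pole_exists tt; exists p. Qed.

Lemma chart_exists : exists p (s : seq F) (Z : set place),
 [/\ finite_set Z, ~ Z p & forall q, ~ Z q -> sO q =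
   [set x | exists a b, [/\ subring_gen s a, subring_gen s b, red b != 0,
     pring q (red b) /\ pring q (red b)^-1 & x * b = a]]].
by have [p _] := place_inhabited; have [s [Z h]] := sO_chart X p; exists p, s, Z. Qed.

Lemma ae_unit (e : E) : e != 0 -> ae (fun q => pring q e^-1).
move=> e0; apply: (sub_finite_set _ (finite_zeros e0)) => q /= h.
by apply/maxidE; right.
Qed.

(** In the chart at one place a power of the lifted uniformizer makes [x] a fraction, and the
    uniformizer is itself a fraction; so [x] is a fraction whose denominator, in the finitely
    generated ring, is a unit at almost all places. *)
Lemma sO_ae x : ae (fun q => sO q x).
have [p [s [Z [fZ nZp hZ]]]] := chart_exists; have [A1 AB AM] := subring_gen_subring s.
have AX y n : subring_gen s y -> subring_gen s (y ^+ n).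
 by move=> hy; elim: n => [|n IH]; rewrite ?expr0 ?exprS //; apply: AM.
have [N ON] := sO_bounded p x; have [Ot rt] := tlP p.
move: Ot ON; rewrite hZ // => -[a1 [b1 [Aa1 Ab1 rb1 _ e1]]] [a2 [b2 [Aa2 Ab2 rb2 _ e2]]].
pose b := a1 ^+ N * b2; have Ab : subring_gen s b by apply: AM => //; apply: AX.
have rb : red b != 0.
 rewrite rmorphM rmorphXn -e1 rmorphM rt mulf_neq0 // expf_neq0 // mulf_neq0 //.
 exact: unif_neq0 (unifP p).
have fz : ae (fun q => ~ Z q).
 by apply: sub_finite_set fZ => q /= h; apply: contrapT => /h.
apply: ae_le (ae_and fz (ae_unit rb)) => q [nZ Ob].
rewrite hZ //; exists (a2 * b1 ^+ N), b; split=> //.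
- by apply: AM => //; apply: AX.
- split=> //; apply: sO_pr; rewrite hZ //; exists b, 1; split=> //; rewrite ?rmorph1 ?oner_neq0 ?mulr1 //.
 by rewrite invr1; split; exact: pr1.
- by rewrite /b -e1 exprMn -e2; ring.
Qed.

(** A k(t)-basis of E with scalars restricted to k[t]; it is independent of maximal length, so every
    further element satisfies a relation. *)
Lemma independent_family t : transc t -> exists n (b : 'I_n -> E),
 (forall P : 'I_n -> {poly k}, \sum_i ev t (P i) * b i = 0 -> forall i, P i = 0) /\
 forall x : E, exists Q (P : 'I_n -> {poly k}), Q != 0 /\ ev t Q * x = \sum_i ev t (P i) * b i.
move=> tt; have [N0 hN0] := dep_boundP t.
pose indepF n (b : 'I_n -> E) := forall P : 'I_n -> {poly k},
 \sum_i ev t (P i) * b i = 0 -> forall i, P i = 0.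
have exP : exists n, `[< exists b : 'I_n -> E, indepF n b >].
 by exists 0%N; apply/asboolP; exists (fun=> 0) => P _ [].
have bound n (b : 'I_n -> E) : indepF n b -> (n < N0)%N.
 move=> ib; rewrite ltnNge; apply/negP => Nn.
 have [c [[i ci] ce]] := hN0 (fun i => b (widen_ord Nn i)).
 pose P (l : 'I_n) := if insub (l : nat) is Some l' then c l' else 0.
 have Pw l : P (widen_ord Nn l) = c l by rewrite /P /= valK.
 have := ib P _ (widen_ord Nn i); rewrite Pw => h; move/eqP: ci; apply; apply: h.
 rewrite -[RHS]ce (bigID (fun l : 'I_n => (l < N0)%N)) /= [X in _ + X]big1 ?addr0; last first.
  by move=> l h; rewrite /P insubN // /ev rmorph0 horner0 mul0r.
 by rewrite (big_ord_narrow Nn); apply: eq_bigr => l _; rewrite Pw.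
have ub n : `[< exists b : 'I_n -> E, indepF n b >] -> (n <= N0)%N.
 by move=> /asboolP[b /bound]; exact: ltnW.
have [n /asboolP[b ib] nmax] := ex_maxnP exP ub; exists n, b; split=> // x.
pose b' (i : 'I_n.+1) := if unlift o0 i is Some l then b l else x.
have [P [P0 [i Pi]]] : exists P : 'I_n.+1 -> {poly k}, \sum_i ev t (P i) * b' i = 0 /\ exists i, P i != 0.
 apply: contrapT => nP; have : (n.+1 <= n)%N; last by rewrite ltnn.
 apply: nmax; apply/asboolP; exists b' => P eP i.
 by apply/eqP/negPn/negP => Pi; apply: nP; exists P; split=> //; exists i.
move: P0; rewrite big_ord_recl /b' unlift_none => /eqP; rewrite addr_eq0 => /eqP e.
have [P00|P00] := eqVneq (P o0) 0.
 have := ib (fun l => P (lift o0 l)) _; case: (unliftP o0 i) Pi => [l -> Pl|->]; last by rewrite P00 eqxx.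
 move=> h; move/eqP: Pl; case; apply: h.
 move: e; rewrite P00 /ev rmorph0 horner0 mul0r => /esym/eqP; rewrite oppr_eq0 => /eqP e0.
 by rewrite -[RHS]e0; apply: eq_bigr => l' _; rewrite liftK.
exists (P o0), (fun l => - P (lift o0 l)); split=> //.
rewrite e -sumrN; apply: eq_bigr => l _.
by rewrite liftK evN mulNr.
Qed.

(** * One generator of the nilradical at almost all places *)

Section GenericTriviality.
Variables (t : E) (n : nat) (b : 'I_n -> E).
Hypothesis t_tr : transc t.
Hypothesis b_ind : forall P : 'I_n -> {poly k}, \sum_i ev t (P i) * b i = 0 -> forall i, P i = 0.
Hypothesis b_gen : forall x : E, exists Q (P : 'I_n -> {poly k}), Q != 0 /\
 ev t Q * x = \sum_i ev t (P i) * b i.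

(** A set-theoretic lift, compatible with sums and products only up to nilpotents; 0 goes to 0 so
    that sums over polynomial coefficients can be widened. *)
Let liftE (e : E) : F := if e == 0 then 0 else xget 0 [set x | red x = e].
Let liftP e : red (liftE e) = e.
rewrite /liftE; case: eqP => [->|_]; first exact: rmorph0.
by have [x rx] := sred_surj X e; apply: (@xgetI _ 0 [set x | red x = e] x rx).
Qed.
Let kt (c : k) : F := liftE (iota c).
Let tt := liftE t.
Let bt i := liftE (b i).

Let evt (P : {poly k}) : F := \sum_(i < size P) kt P`_i * tt ^+ i.

Let evtP P : red (evt P) = ev t P.
rewrite rmorph_sum /ev horner_coef size_map_poly; apply: eq_bigr => i _.
by rewrite rmorphM rmorphXn !liftP coef_map.
Qed.

Let comb (P : 'I_n -> {poly k}) := \sum_i evt (P i) * bt i.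
Let combP P : red (comb P) = \sum_i ev t (P i) * b i.
by rewrite rmorph_sum; apply: eq_bigr => i _; rewrite rmorphM evtP liftP. Qed.

Let On q : set F := [set x | exists2 o, sO q o & x = o * nilgen].
Let OnB q x y : On q x -> On q y -> On q (x - y).
by move=> [o Oo ->] [o' Oo' ->]; exists (o - o'); [exact: sOB|rewrite mulrBl]. Qed.
Let On0 q : On q 0. by exists 0; [exact: sO0|rewrite mul0r]. Qed.
Let OnN q x : On q x -> On q (- x). by move=> h; rewrite -sub0r; apply: OnB. Qed.
Let OnD q x y : On q x -> On q y -> On q (x + y).
by move=> hx hy; rewrite -[y]opprK; apply/OnB/OnN. Qed.
Let OnM q x y : sO q x -> On q y -> On q (x * y).
by move=> Ox [o Oo ->]; exists (x * o); [exact: sOM|rewrite mulrA]. Qed.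
Let On_sum q I (r : seq I) (G : I -> F) : (forall i, On q (G i)) -> On q (\sum_(i <- r) G i).
by move=> h; elim: r => [|i r IH]; rewrite ?big_nil ?big_cons; [exact: On0|exact: OnD]. Qed.

Let On_ae x : red x = 0 -> ae (fun q => On q x).
move=> rx; have [_ _ gen] := nilgenP; have [a ->] := gen x rx.
by apply: ae_le (sO_ae a) => q Oa; exists a.
Qed.

(** Places where the lifts are integral and the lift of constants is additive and multiplicative
    modulo [On q]: finitely many conditions because k is finite, hence true at almost all places. *)
Let good q := [/\ (forall c, sO q (kt c)), sO q tt, (forall i, sO q (bt i)),
 (forall c c', On q (kt (c - c') - (kt c - kt c'))) & (forall c c', On q (kt (c * c') - kt c * kt c'))].

Let good_ae : ae good.
have h1 := ae_all (fun c : k => sO_ae (kt c)).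
have h3 := ae_all (fun i : 'I_n => sO_ae (bt i)).
have h4 : ae (fun q => forall cc : k * k, On q (kt (cc.1 - cc.2) - (kt cc.1 - kt cc.2))).
 by apply: ae_all => -[c c']; apply: On_ae; rewrite !rmorphB /= !liftP !rmorphB /= subrr.
have h5 : ae (fun q => forall cc : k * k, On q (kt (cc.1 * cc.2) - kt cc.1 * kt cc.2)).
 by apply: ae_all => -[c c']; apply: On_ae; rewrite !rmorphB !rmorphM /= !liftP !rmorphM /= subrr.
apply: ae_le (ae_and (ae_and h1 (sO_ae tt)) (ae_and h3 (ae_and h4 h5))) => q [[g1 g2] [g3 [g4 g5]]].
by split=> // c c'; [exact: (g4 (c, c'))|exact: (g5 (c, c'))].
Qed.

Section Good.
Variable q : place.
Hypothesis gq : good q.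
Let cong x y := On q (x - y).
Let congT x y z : cong x y -> cong y z -> cong x z.
by move=> h h'; have := OnD h h'; rewrite addrA subrK. Qed.
Let congS x y : cong x y -> cong y x.
by move=> /OnN; rewrite opprB. Qed.

Let Lq : set F := [set x | exists P, cong x (comb P)].

Let evt_wide (P : {poly k}) m : (size P <= m)%N -> evt P = \sum_(i < m) kt P`_i * tt ^+ i.
move=> h; rewrite /evt (big_ord_widen m (fun i => kt P`_i * tt ^+ i)) // big_mkcond.
apply: eq_bigr => i _; case: ltnP => // hi.
by rewrite nth_default // /kt rmorph0 /liftE eqxx mul0r.
Qed.

Let evtB P Q : cong (evt (P - Q)) (evt P - evt Q).
have [_ Ot _ hB _] := gq; pose m := maxn (size P) (size Q).
rewrite !(@evt_wide _ m) ?leq_maxl ?leq_maxr //; last first.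
 by apply: leq_trans (size_polyD _ _) _; rewrite size_polyN.
rewrite /cong -!sumrB; apply: On_sum => i; rewrite coefB.
rewrite -mulrBl -mulrBl mulrC; apply: OnM => //; exact: sOX.
Qed.

Let LqB x y : Lq x -> Lq y -> Lq (x - y).
have [_ _ Ob _ _] := gq.
move=> [P hP] [Q hQ]; exists (fun i => P i - Q i).
apply: (congT (y := comb P - comb Q)).
 rewrite /cong; have -> : x - y - (comb P - comb Q) = (x - comb P) - (y - comb Q) by ring.
 exact: OnB.
apply: congS; rewrite /cong /comb -!sumrB; apply: On_sum => i.
by rewrite -!mulrBl mulrC; apply: OnM => //; exact: evtB.
Qed.

Let Lq_cong x y : cong x y -> Lq y -> Lq x.
by move=> h [P hP]; exists P; exact: congT hP. Qed.

Let Lq0 : Lq 0.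
exists (fun=> 0); rewrite /cong /comb big1 ?subr0; first exact: On0.
by move=> i _; rewrite /evt size_poly0 big_ord0 mul0r.
Qed.

Let LqN x : Lq x -> Lq (- x). by move=> h; rewrite -sub0r; apply: LqB Lq0 h. Qed.
Let LqD x y : Lq x -> Lq y -> Lq (x + y).
by move=> hx hy; rewrite -[y]opprK; apply/LqB/LqN. Qed.
Let Lq_sum I (r : seq I) (G : I -> F) : (forall i, Lq (G i)) -> Lq (\sum_(i <- r) G i).
by move=> h; apply: big_ind => // *; exact: LqD. Qed.

Let LqC c x : Lq x -> Lq (kt c * x).
have [Ok Ot Ob _ hM] := gq.
move=> [P hP]; exists (fun i => c *: P i).
apply: (congT (y := kt c * comb P)); first by rewrite /cong -mulrBr; apply: OnM.
apply: congS; rewrite /cong /comb mulr_sumr -sumrB; apply: On_sum => i.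
rewrite mulrA -mulrBl mulrC; apply: OnM => //.
rewrite !(@evt_wide _ (size (P i))) ?size_scale_leq // mulr_sumr -sumrB; apply: On_sum => l.
by rewrite coefZ mulrA -mulrBl mulrC; apply: OnM; [exact: sOX|exact: hM].
Qed.

Let LqT x : Lq x -> Lq (tt * x).
have [Ok Ot Ob _ hM] := gq.
move=> [P hP]; exists (fun i => P i * 'X).
apply: (congT (y := tt * comb P)); first by rewrite /cong -mulrBr; apply: OnM.
have -> : comb (fun i => P i * 'X) = tt * comb P; last by rewrite /cong subrr; exact: On0.
rewrite /comb mulr_sumr; apply: eq_bigr => i _; rewrite mulrA; congr (_ * _).
rewrite (@evt_wide _ (size (P i)).+1); last first.
 by apply: leq_trans (size_polyMleq _ _) _; rewrite size_polyX addn2.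
have kt0 : kt 0 = 0 by rewrite /kt rmorph0 /liftE eqxx.
rewrite big_ord_recl coefMX /= kt0 mul0r add0r /evt mulr_sumr.
by apply: eq_bigr => l _; rewrite /bump /= add1n coefMX /= exprS; ring.
Qed.

Let LqP P x : Lq x -> Lq (evt P * x).
move=> hx; rewrite /evt mulr_suml; apply: Lq_sum => i; rewrite -mulrA; apply: LqC.
by elim: (i : nat) => [|l IH]; rewrite ?mul1r // exprS -mulrA; apply: LqT.
Qed.

Variables (s : seq F) (Q : {poly k}).
Hypothesis Q1 : Lq (evt Q).
Hypothesis Os : forall y, y \in s -> sO q y.
Hypothesis Qs : forall y, y \in s -> forall i, Lq (evt Q * (y * bt i)).

Let Mq : set F := [set x | exists N, Lq (evt Q ^+ N * x)].

Let evtO P : sO q (evt P).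
by have [Ok Ot _ _ _] := gq; apply: sO_sum => i _; apply: sOM => //; exact: sOX. Qed.

Let MqN N x : Lq (evt Q ^+ N * x) -> forall N', (N <= N')%N -> Lq (evt Q ^+ N' * x).
move=> h N' /subnK <-; elim: (N' - N)%N => [|l IH]; first by rewrite add0n.
by rewrite addSn exprS -mulrA; apply: LqP.
Qed.

(** With one denominator [Q], products of generators with basis elements are again combinations of
    the lifted basis modulo [On q]; so the whole generated ring consists of such combinations up to
    powers of [Q]. *)
Lemma subring_in_Mq a : subring_gen s a -> Mq a.
have MB x y : Mq x -> Mq y -> Mq (x - y).
 move=> [N hN] [N' hN']; exists (maxn N N'); rewrite mulrBr; apply: LqB.
  by apply: MqN hN _ _; exact: leq_maxl.
 by apply: MqN hN' _ _; exact: leq_maxr.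
have M1 : Mq 1 by exists 1%N; rewrite expr1 mulr1.
move=> ha; suff : [set x | forall y, Mq y -> Mq (x * y)] a by move=> /(_ 1 M1); rewrite mulr1.
apply: ha.
 split=> [y|x y hx hy z Mz|x y hx hy z Mz] /=; first by rewrite mul1r.
  by rewrite mulrBl; apply: MB; [exact: hx|exact: hy].
 by rewrite -mulrA; apply/hx/hy.
move=> y ys x [N [P hP]]; exists N.+1.
have -> : evt Q ^+ N.+1 * (y * x) = evt Q * y * (evt Q ^+ N * x) by rewrite exprS; ring.
apply: (@Lq_cong _ (evt Q * y * comb P)).
 by rewrite /cong -mulrBr; apply: OnM => //; apply: sOM; [exact: evtO|exact: Os].
rewrite /comb mulr_sumr; apply: Lq_sum => i.
have -> : evt Q * y * (evt (P i) * bt i) = evt (P i) * (evt Q * (y * bt i)) by ring.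
exact/LqP/Qs.
Qed.

(** A nilpotent element of the chart ring has, after clearing denominators, coordinates over k[t]
    that vanish by independence; what is left lies in [On q], and [Q] is a unit at [q]. *)
Lemma nil_subring a v : subring_gen s a -> red a = 0 -> evt Q * v = 1 -> sO q v -> On q a.
move=> /subring_in_Mq[N [P hP]] ra Qv Ov.
have P0 i : P i = 0.
 apply: b_ind; have := congr1 red (subrK (comb P) (evt Q ^+ N * a)).
 have [o Oo ->] := hP; have [r0 _ _] := nilgenP.
 by rewrite rmorphD rmorphM r0 mulr0 add0r combP rmorphM ra mulr0.
have e0 : comb P = 0.
 by apply: big1 => i _; rewrite P0 /evt size_poly0 big_ord0 mul0r.
move: hP; rewrite /cong e0 subr0 => /(OnM (sOX N Ov)).
by rewrite mulrA -exprMn [v * _]mulrC Qv expr1n mul1r.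
Qed.
End Good.

Lemma generic_triviality_aux : ae (fun q => forall x, sO q x -> red x = 0 -> On q x).
have [p [s [Z [fZ _ hZ]]]] := chart_exists.
have fz : ae (fun q => ~ Z q) by apply: sub_finite_set fZ => q /= h; apply: contrapT => /h.
have [Q [Q0 [R1 hR1] Rs]] : exists Q : {poly k}, [/\ Q != 0,
  exists P : 'I_n -> {poly k}, ev t Q * 1 = \sum_i ev t (P i) * b i &
  forall y, y \in s -> forall i, exists P : 'I_n -> {poly k},
   ev t Q * (red y * b i) = \sum_i ev t (P i) * b i].
 have scale (e : E) (Q R : {poly k}) : (exists P : 'I_n -> {poly k}, ev t Q * e = \sum_i ev t (P i) * b i) ->
   exists P : 'I_n -> {poly k}, ev t (R * Q) * e = \sum_i ev t (P i) * b i.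
  move=> [P hP]; exists (fun i => R * P i); rewrite evM -mulrA hP mulr_sumr.
  by apply: eq_bigr => i _; rewrite evM mulrA.
 have main (r : seq E) : exists Q : {poly k}, Q != 0 /\ forall e, e \in r ->
   exists P : 'I_n -> {poly k}, ev t Q * e = \sum_i ev t (P i) * b i.
  elim: r => [|e r [Q [Q0 hQ]]]; first by exists 1; rewrite oner_neq0.
  have [R [P [R0 hP]]] := b_gen e; exists (R * Q); split; first by rewrite mulf_neq0.
  move=> e'; move=> /predU1P[->|/hQ]; last exact: scale.
  by rewrite [R * Q]mulrC; apply: scale; exists P.
 have [Q [Q0 hQ]] := main (1 :: [seq red y * b i | y <- s, i <- enum 'I_n]).
 exists Q; split=> //; first by apply: hQ; rewrite mem_head.
 move=> y ys i; apply: hQ; rewrite in_cons; apply/orP; right.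
 by apply: (allpairs_f (fun y i => red y * b i)) => //; rewrite mem_enum.
have rQ : red (evt Q) != 0 by rewrite evtP; apply: contra_neq Q0; exact: t_tr.
have [v Qv] := sF_unit rQ.
have c1 : ae (fun q => On q (evt Q - comb R1)).
 by apply: On_ae; rewrite rmorphB evtP combP -hR1 mulr1 subrr.
have c2 : ae (fun q => forall y, y \in s -> forall i, exists P, On q (evt Q * (y * bt i) - comb P)).
 have h y : ae (fun q => y \in s -> forall i, exists P, On q (evt Q * (y * bt i) - comb P)).
  have [ys|ys] := boolP (y \in s); last by apply: ae_le (sO_ae 0) => q _; move/negP: ys.
  have /choice[P hP] := Rs y ys.
  have : ae (fun q => forall i, On q (evt Q * (y * bt i) - comb (P i))).
   apply: ae_all => i; apply: On_ae.
   by rewrite rmorphB !rmorphM evtP combP liftP hP subrr.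
  by apply: ae_le => q hq _ i; exists (P i).
 by apply: ae_le (ae_seq s h) => q hq y ys; apply: hq.
have c3 : ae (fun q => forall y, y \in s -> sO q y) by exact: (ae_seq s sO_ae).
apply: ae_le (ae_and (ae_and fz good_ae) (ae_and (ae_and c1 c2) (ae_and c3 (sO_ae v)))).
move=> q [[nZ gq] [[h1 h2] [h3 Ov]]] x; rewrite {1}hZ // => -[a [c [Aa Ac rc [Oc Oci] e]]] rx.
have [c' cc'] := sF_unit rc.
have OC : sO q c.
 by rewrite hZ //; exists c, 1; split; rewrite ?rmorph1 ?oner_neq0 ?mulr1 ?invr1 //;
  [case: (subring_gen_subring s)|split; exact: pr1].
have -> : x = c' * a by rewrite -e mulrCA [c' * _]mulrC cc' mulr1.
apply: OnM; first exact: sO_inv OC cc' Oci.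
apply: (nil_subring gq _ h3 _ Aa _ Qv Ov); first by exists R1.
 by move=> y ys i; exact: h2.
by rewrite -e rmorphM rx mul0r.
Qed.
End GenericTriviality.

(** The local generators could a priori differ from [nilgen] by non-units at infinitely many places;
    finite type of a chart excludes this. It is what makes [eps] below reach every nilpotent
    adele. *)
Lemma generic_triviality : ae (fun q => forall x, sO q x -> red x = 0 ->
 exists2 o, sO q o & x = o * nilgen).
have [t tt] := tr_exists; have [n [b [ib gb]]] := independent_family tt.
exact: generic_triviality_aux tt ib gb.
Qed.
End Charts.

Variable D : adelic_data X.
Notation M := (aM D).
Notation Mb := (aMbar D).

(** * Completed local rings of the nonreduced curve *)

Section AtPlace.
Variable p : place.
Notation Oh := (cint M p).
Notation j := (cmap M p).
Notation Ob := (cint Mb p).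
Notation jb := (cmap Mb p).
Notation rho := (ared_loc D p).
Notation O := (sO p).
Notation t := (tl p).
Notation T := (j t).
Notation n := (np p).
Let cP := completionsP M p.
Implicit Types (x y : cring M p).

Lemma ohS : is_subring Oh. exact: compl_subring cP. Qed.
Definition oh1 := sr1 ohS.
Definition ohB := srB ohS.
Definition ohM := srM ohS.
Definition oh0 := sr0 ohS.
Definition ohN := srN ohS.
Definition ohD := srD ohS.
Definition ohX := srX ohS.
Lemma oh_sum I (r : seq I) (G : I -> cring M p) : (forall i, Oh (G i)) -> Oh (\sum_(i <- r) G i).
by move=> h; apply: (sr_sum ohS). Qed.
Lemma oh_j z : O z -> Oh (j z). exact: compl_map cP z. Qed.
Lemma oh_T : Oh T. by apply: oh_j; case: (tlP p). Qed.
Lemma rho_j z : rho (j z) = jb (red z). exact: ared_map. Qed.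
Lemma rho_T m : rho (T ^+ m) = jb (unif p ^+ m).
by rewrite rmorphXn /= rho_j (tlP p).2 rmorphXn. Qed.
Lemma rho_n : rho (j n) = 0.
by rewrite rho_j; have [-> _ _ _] := npP p; rewrite rmorph0. Qed.
Lemma nn0 : j n * j n = 0.
by have [rn _ _ _] := npP p; rewrite -rmorphM (snil_sq0 rn rn) rmorph0. Qed.
Lemma oh_n : Oh (j n). by apply: oh_j; have [] := npP p. Qed.
Lemma T_inv : exists b, T * b = 1.
by have [b e] := tl_inv p; exists (j b); rewrite -rmorphM e rmorph1. Qed.

Lemma T_cancel m x y : T ^+ m * x = T ^+ m * y -> x = y.
have [b Tb] := T_inv; move=> /(congr1 ( *%R (b ^+ m))).
by rewrite !mulrA -exprMn (mulrC b) Tb expr1n !mul1r.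
Qed.

(** The filtration by powers of the lifted uniformizer [T]. It interlaces with the powers of the
    maximal ideal up to a shift by one, see [Sp_maxid] and [maxid_Sp], and [T] can be cancelled in
    it. *)
Definition Sp (m : nat) : set (cring M p) := [set x | exists2 y, Oh y & x = T ^+ m * y].
Lemma Sp_sgp m : sgp (Sp m).
split; first by exists 0; [exact: oh0|rewrite mulr0].
by move=> _ _ [x Ox ->] [y Oy ->]; exists (x - y); [exact: ohB|rewrite mulrBr].
Qed.

Lemma Sp0 x : Sp 0 x <-> Oh x.
by split=> [[y Oy ->]|Ox]; [rewrite mul1r|exists x; rewrite ?mul1r]. Qed.

Lemma Sp_dec l m : (l <= m)%N -> Sp m `<=` Sp l.
move=> /subnKC <- _ [y Oy ->]; exists (T ^+ (m - l) * y); last by rewrite exprD mulrA.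
by apply: ohM => //; apply/ohX/oh_T.
Qed.

Lemma Sp_hge m x : Sp m x -> hge (M := Mb) m (rho x).
move=> [y Oy ->]; rewrite rmorphM rho_T; apply: hgeMc; first exact: (hge_t Mb p m%:Z).
exact: ared_int.
Qed.

Lemma max_sO (x : F) : maxid O x -> exists a b, [/\ O a, O b & x = t * a + n * b].
move=> [Ox nx].
have mx : maxid (pring p) (red x).
 apply/maxidE; have [->|x0] := eqVneq (red x) 0; [by left|right] => Oi.
 have [b xb] := sF_unit x0; apply: nx; exists b; split=> //; exact: sO_inv Ox xb Oi.
have [e Oe re] := (unifP p _).1 mx; have [Ol rl] := lftP Oe.
have [Ot rt] := tlP p; have [rn _ On gen] := npP p.
have [b Ob' eb] : exists2 b, O b & x - t * lft p e = b * n.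
 by apply: gen; [rewrite rmorphB rmorphM rt rl re subrr|apply: sOB => //; apply: sOM].
by exists (lft p e), b; split=> //; rewrite (mulrC n) -eb addrC subrK.
Qed.

Lemma max_t : maxid O t.
have [Ot rt] := tlP p; split=> // -[b [Ob' tb]].
have [_ nu] := unif_max (unifP p); apply: nu; exists (red b); split; first exact: sO_pr.
by rewrite -rt -rmorphM tb rmorph1.
Qed.

Lemma Sp_ideal m x : Sp m x -> idealM (j @` maxid_pow O m) Oh x.
move=> [y Oy ->]; exists [:: (T ^+ m, y)]; last by rewrite big_seq1.
move=> u; rewrite inE => /eqP -> /=; split=> //; exists (t ^+ m); last by rewrite rmorphXn.
rewrite -[t ^+ m]mulr1; apply: pow_maxid max_t (sO1 p); exact: sO_subring.
Qed.

Lemma sO_local_pow l (x : F) : maxid_pow O l.+1 x -> exists a b, [/\ O a, O b & x = t ^+ l * (t * a + n * b)].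
have [rn _ On gen] := npP p; have [Ot rt] := tlP p.
exact: (local_pow (sO_subring X p) (snil_sq0 rn rn) max_sO).
Qed.

Lemma ideal_Sp m x : idealM (j @` maxid_pow O m.+1) Oh x -> Sp m x.
move=> [s sP ->]; elim: s sP => [|u s IH] sP; first by rewrite big_nil; exact: (Sp_sgp m).1.
rewrite big_cons; apply: (sgpD (Sp_sgp m)); last first.
 by apply: IH => v vs; apply: sP; rewrite in_cons vs orbT.
have [[z hz <-] Ou] := sP u (mem_head _ _).
have [a [b [Oa Ob' ->]]] := sO_local_pow hz; have [rn _ On _] := npP p; have [Ot _] := tlP p.
exists (j (t * a + n * b) * u.2); last by rewrite rmorphM rmorphXn mulrA.
by apply: ohM => //; apply: oh_j; apply: sOD; apply: sOM.
Qed.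

Lemma oh_dense m x : Oh x -> exists2 y, O y & Sp m (x - j y).
by move=> /(compl_dense cP m.+1)[y Oy /ideal_Sp h]; exists y. Qed.

Lemma Sp_separated x : (forall m, Sp m x) -> x = 0.
by move=> h; apply: (compl_separated cP) => m; apply/Sp_ideal. Qed.

Lemma Sp_complete (u : nat -> cring M p) : (forall m, Oh (u m)) ->
 (forall m, Sp m (u m.+1 - u m)) -> exists2 x, Oh x & forall m, Sp m (x - u m).
move=> Ou hu; have [|x Ox hx] := compl_complete cP Ou; first by move=> m; apply/Sp_ideal.
exists x => // m; have := sgpD (Sp_sgp m) (ideal_Sp (hx m.+1)) (hu m).
by rewrite addrA subrK.
Qed.

(** An integral element of the reduced completion is expanded in powers of [unif p]; its digits are
    lifted one by one, and the lifted series converges. *)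
Lemma rho_surj z : Ob z -> exists2 x, Oh x & rho x = z.
move=> Oz.
have /choice[y hy] : forall m : nat, exists y : E, pring p y /\ hge m (z - jb y).
 by move=> m; have [y] := cint_dense m Oz; exists y.
pose e m := (y m.+1 - y m) * unif p ^ (- m%:Z).
have Oe m : pring p (e m).
 have h : hge m (jb (y m.+1 - y m)).
  rewrite rmorphB; have [_ h1] := hy m; have [_ h2] := hy m.+1.
  have := hgeB h1 (hge_le (_ : m%:Z <= m.+1%:Z) h2); rewrite opprB addrC addrA subrK.
  by apply; lia.
 by move/(hge_j Mb): h.
have eE m : y m.+1 - y m = unif p ^+ m * e m.
 rewrite /e mulrC -mulrA -[unif p ^+ m]/(unif p ^ m%:Z) -expfzDr; last exact: unif_neq0 (unifP p).
 by rewrite addNr expr0z mulr1.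
pose u m := j (lft p (y 0%N)) + \sum_(i < m) T ^+ i * j (lft p (e i)).
have [|m|x Ox hx] := @Sp_complete u.
- move=> m; apply: ohD; first by apply/oh_j; case: (lftP (hy 0%N).1).
 apply: oh_sum => i; apply: ohM; first by apply/ohX/oh_T.
 by apply/oh_j; case: (lftP (Oe i)).
- rewrite /u opprD addrACA subrr add0r big_ord_recr /= addrAC subrr add0r.
 by exists (j (lft p (e m))) => //; apply/oh_j; case: (lftP (Oe m)).
exists x => //; apply/subr0_eq/hge_separated => m.
have ru : rho (u m) = jb (y m).
 rewrite rmorphD rho_j (lftP (hy 0%N).1).2 rmorph_sum.
 elim: m => [|m IH]; first by rewrite big_ord0 addr0.
 rewrite big_ord_recr /= addrA IH rmorphM rho_T rho_j (lftP (Oe m)).2 -rmorphM -eE rmorphB.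
 by rewrite addrC subrK.
have := hgeB (Sp_hge (hx m)) (hy m).2; rewrite rmorphB ru.
by rewrite opprB addrA subrK.
Qed.

Lemma jb_unif_inv (z : cring Mb p) m : jb (unif p ^+ m) * z = 0 -> z = 0.
move=> /(congr1 ( *%R (jb (unif p ^ (- m%:Z))))); rewrite mulrA (mulrC (jb _)).
by rewrite -[unif p ^+ m]/(unif p ^ m%:Z) (jtK) mul1r mulr0.
Qed.

Lemma ker_step x : Oh x -> rho x = 0 -> exists a x1, [/\ O a, Oh x1, rho x1 = 0 & x = j n * j a + T * x1].
move=> Ox rx; have [y Oy [w Ow xy]] := oh_dense 1 Ox; rewrite expr1 in xy.
have xE : x = j y + T * w by rewrite -xy addrC subrK.
have h1 : hge 1 (jb (red y)).
 have /eqP := congr1 rho xE; rewrite rx rmorphD rho_j rmorphM eq_sym addr_eq0 => /eqP ->.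
 rewrite -[T]expr1 rho_T; apply: hgeN; apply: hgeMc; last exact: ared_int.
 exact: (hge_t Mb p 1).
have my : maxid (pring p) (red y) by apply/maxid_vge/(hge_j Mb).
have [e Oe re] := (unifP p _).1 my.
have [Ol rl] := lftP Oe; have [Ot rt] := tlP p; have [rn _ On gen] := npP p.
have [b Ob' eb] : exists2 b, O b & y - t * lft p e = b * n.
 by apply: gen; [rewrite rmorphB rmorphM rt rl re subrr|apply: sOB => //; apply: sOM].
have xE' : x = j n * j b + T * (j (lft p e) + w).
 rewrite xE -rmorphM (mulrC n) -eb rmorphB rmorphM; ring.
exists b, (j (lft p e) + w); split=> //; first by apply: ohD => //; exact: oh_j.
apply: (@jb_unif_inv _ 1); rewrite -rho_T expr1 -rmorphM.
have := congr1 rho xE'; rewrite rx rmorphD rmorphM rho_n mul0r add0r => /esym //.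
Qed.

(** Each step removes a multiple of the nilpotent generator and leaves [T] times another element of
    the kernel; the iteration converges by completeness. *)
Lemma rho_ker x : Oh x -> rho x = 0 -> exists2 c, Oh c & x = j n * c.
move=> Ox rx.
have /choice[f hf] : forall x : cring M p, exists ax : F * cring M p, Oh x -> rho x = 0 ->
  [/\ O ax.1, Oh ax.2, rho ax.2 = 0 & x = j n * j ax.1 + T * ax.2].
 move=> z; have [[Oz rz]|h] := pselect (Oh z /\ rho z = 0).
  by have [a [x1 h]] := ker_step Oz rz; exists (a, x1).
 by exists (0, 0) => h1 h2; case: h.
pose xs m := iter m (fun z => (f z).2) x.
have hxs m : Oh (xs m) /\ rho (xs m) = 0.
 by elim: m => [//|m [O1 r1]]; have [] := hf _ O1 r1.
pose c m := \sum_(i < m) T ^+ i * j (f (xs i)).1.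
have Oi i : Oh (j (f (xs i)).1).
 by have [O1 r1] := hxs i; apply: oh_j; case: (hf _ O1 r1).
have [|m|c' Oc hc] := @Sp_complete c.
- by move=> m; apply: oh_sum => i; apply: ohM => //; apply/ohX/oh_T.
- by rewrite /c big_ord_recr /= addrAC subrr add0r; exists (j (f (xs m)).1).
exists c' => //; apply/subr0_eq/Sp_separated => m.
have e : x = j n * c m + T ^+ m * xs m.
 elim: m => [|m IH]; first by rewrite /c big_ord0 mulr0 add0r mul1r.
 have [O1 r1] := hxs m; have [_ _ _ e1] := hf _ O1 r1.
 rewrite {1}IH /c big_ord_recr /= -/(c m) {1}e1 exprS -[(f (xs m)).2]/(xs m.+1); ring.
have -> : x - j n * c' = T ^+ m * xs m - j n * (c' - c m) by rewrite {1}e; ring.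
apply: (Sp_sgp m).2; first by exists (xs m) => //; case: (hxs m).
have [y Oy ->] := hc m; exists (j n * y); last by ring.
exact: ohM oh_n Oy.
Qed.

Lemma rho_lift_level (m : nat) z : hge m z -> exists2 x, Sp m x & rho x = z.
move=> hz; have [y Oy ry] := rho_surj hz; exists (T ^+ m * y); first by exists y.
rewrite rmorphM rho_T ry mulrCA -[unif p ^+ m]/(unif p ^ m%:Z) (jtK); exact: mulr1.
Qed.

Lemma rho_lift z : exists x, rho x = z.
have [m hm] := hge_bounded z; have [b Tb] := T_inv.
have [|y Oy ry] := @rho_surj (jb (unif p ^+ m) * z).
 by move: hm; rewrite /hge opprK mulrC.
exists (b ^+ m * y); rewrite rmorphM ry mulrA.
have -> : rho (b ^+ m) * jb (unif p ^+ m) = 1.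
 by rewrite -rho_T -rmorphM -exprMn (mulrC b) Tb expr1n rmorph1.
by rewrite mul1r.
Qed.

Lemma oh_unit u v : Oh u -> Ob v -> rho u * v = 1 -> exists2 w, Oh w & u * w = 1.
move=> Ou Ov uv; have [v' Ov' rv] := rho_surj Ov.
have [c Oc ec] : exists2 c, Oh c & u * v' - 1 = j n * c.
 apply: rho_ker; first by apply: ohB oh1; apply: ohM.
 by rewrite rmorphB rmorphM rv uv rmorph1 subrr.
exists (v' * (1 - j n * c)); first by apply: ohM => //; apply: ohB oh1 _; apply: ohM oh_n Oc.
rewrite mulrA -[u * v'](subrK 1) ec.
have -> : (j n * c + 1) * (1 - j n * c) = 1 - (j n * j n) * c * c by ring.
by rewrite nn0 !mul0r subr0.
Qed.

Lemma max_oh x : maxid Oh x -> exists a b, [/\ Oh a, Oh b & x = T * a + j n * b].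
move=> [Ox nx].
have h1 : hge 1 (rho x).
 apply: contrapT => nh; have [v Ov xv] := cint_unit (ared_int Ox) nh.
 by have [w Ow xw] := oh_unit Ox Ov xv; apply: nx; exists w.
have [y [y' Oy' ->] ry] := rho_lift_level h1.
have [c Oc ec] : exists2 c, Oh c & x - T ^+ 1 * y' = j n * c.
 by apply: rho_ker; [apply: ohB => //; apply: ohM => //; apply/ohX/oh_T|rewrite rmorphB ry subrr].
by exists y', c; split=> //; rewrite -ec expr1 addrC subrK.
Qed.

Lemma max_T : maxid Oh T.
split; first exact: oh_T.
move=> [b [Ob' Tb]]; have := congr1 rho Tb; rewrite rmorphM rmorph1 -[T]expr1 rho_T.
exact: (hge1_nunit (hge_t Mb p 1) (ared_int Ob')).
Qed.

Lemma Sp_maxid m : Sp m `<=` maxid_pow Oh m.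
by move=> _ [y Oy ->]; apply: pow_maxid max_T (Oy); exact: ohS. Qed.

Lemma maxid_Sp m : maxid_pow Oh m.+1 `<=` Sp m.
move=> x /(local_pow ohS nn0 max_oh)[a [b [Oa Ob' ->]]].
by exists (T * a + j n * b) => //; apply: ohD; apply: ohM => //; [exact: oh_T|exact: oh_n].
Qed.

(** A denominator has the form [s = T ^+ m * u' + n * c] with [u'] a unit; as [n] has square zero,
    [s] divides [T ^+ (m + m)]. *)
Lemma cring_bounded x : exists N, Oh (T ^+ N * x).
have [a [s [Oa Os [s' ss'] e]]] := compl_frac cP x.
have rs0 : rho s != 0.
 by apply/eqP => h; have := congr1 rho ss'; rewrite rmorphM h mul0r rmorph1 => /eqP; rewrite eq_sym oner_eq0.
have [m [u [v [Ou Ov uv es]]]] := cint_normal (ared_int Os) rs0.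
have [u' Ou' ru] := rho_surj Ou.
have [w Ow uw] : exists2 w, Oh w & u' * w = 1 by apply: (oh_unit Ou' Ov); rewrite ru.
have [c Oc ec] : exists2 c, Oh c & s - T ^+ m * u' = j n * c.
 apply: rho_ker; first by apply: ohB => //; apply: ohM => //; apply/ohX/oh_T.
 by rewrite rmorphB rmorphM rho_T ru es subrr.
pose z := w * T ^+ m - w * w * (j n * c).
have Oz : Oh z.
 apply: ohB; first by apply: ohM => //; apply/ohX/oh_T.
 by apply: ohM; apply: ohM => //; exact: oh_n.
exists (m + m)%N; have -> : T ^+ (m + m) * x = a * z; last exact: ohM.
have sE : s = T ^+ m * u' + j n * c by rewrite -ec addrC subrK.
have sz : s * z = T ^+ (m + m).
 rewrite sE /z exprD.
 have -> : (T ^+ m * u' + j n * c) * (w * T ^+ m - w * w * (j n * c)) =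
  (u' * w) * (T ^+ m * T ^+ m) + (1 - u' * w) * (w * T ^+ m * (j n * c)) - j n * j n * (c * c * w * w) by ring.
 by rewrite uw nn0; ring.
by rewrite -sz -e; ring.
Qed.

Lemma ker_nilgen x : rho x = 0 -> j nilgen * x = 0.
move=> rx; have [N ON] := cring_bounded x.
have [c Oc ec] : exists2 c, Oh c & T ^+ N * x = j n * c.
 by apply: rho_ker => //; rewrite rmorphM rx mulr0.
have [c1 [c' [_ -> _]]] := np_nilgen p; apply: (@T_cancel N).
by rewrite mulr0 mulrCA ec rmorphM -mulrA (mulrA (j n) (j n)) nn0 mul0r mulr0.
Qed.

(** Were it zero, [compl_inj] would put [n] into the square of the maximal ideal, and the resulting
    expression of [n] would make a unit kill it. *)
Lemma j_n_neq0 : j n <> 0.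
move=> jn0; have [rn n0 On gen] := npP p; have [Ot rt] := tlP p.
have : maxid_pow O 2 n.
 apply: (compl_inj cP) => //; rewrite jn0; exists [::]; rewrite ?big_nil //.
move=> /sO_local_pow[a [b [Oa Ob' e]]]; rewrite expr1 in e.
have u0 := unif_neq0 (unifP p).
have ra : red a = 0.
 have /eqP := congr1 red e; rewrite rn !rmorphM rmorphD !rmorphM rn rt mul0r addr0 eq_sym.
 by rewrite !mulf_eq0 (negPf u0) => /eqP.
have [a' Oa' ea] := gen _ ra Oa.
pose w := 1 - t * (t * a' + b); have wn : w * n = 0.
 by rewrite /w mulrBl mul1r {1}e ea; ring.
have [v wv] : exists v, w * v = 1.
 apply: sF_unit; rewrite rmorphB rmorph1 rmorphM rt subr_eq0; apply/eqP => h.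
 have [_ nu] := unif_max (unifP p); apply: nu; exists (red (t * a' + b)); split=> //.
 by apply: sO_pr; apply: sOD => //; apply: sOM.
by move/eqP: n0; apply; rewrite -[n]mul1r -wv mulrAC wn mul0r.
Qed.

Lemma nilgen_ker x : j nilgen * x = 0 -> rho x = 0.
move=> nx; apply/eqP/negPn/negP => r0; have [z xz] := cring_inv r0; have [y ry] := rho_lift z.
have r1 : rho (x * y - 1) = 0 by rewrite rmorphB rmorphM ry xz rmorph1 subrr.
have := ker_nilgen r1; rewrite mulrBr mulr1 mulrA nx mul0r sub0r => /eqP.
rewrite oppr_eq0 => /eqP jn0; apply: j_n_neq0.
by have [c [c' [-> _ _]]] := np_nilgen p; rewrite rmorphM jn0 mulr0.
Qed.

Lemma ker_image x : rho x = 0 -> exists y, x = j nilgen * y.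
move=> rx; have [N ON] := cring_bounded x; have [b Tb] := T_inv.
have [c Oc ec] : exists2 c, Oh c & T ^+ N * x = j n * c.
 by apply: rho_ker => //; rewrite rmorphM rx mulr0.
have [c1 [c' [nE _ _]]] := np_nilgen p; exists (j c1 * (b ^+ N * c)).
apply: (@T_cancel N); rewrite ec nE rmorphM.
have -> : T ^+ N * (j nilgen * (j c1 * (b ^+ N * c))) = (T * b) ^+ N * (j c1 * j nilgen * c).
 by rewrite exprMn; ring.
by rewrite Tb expr1n mul1r.
Qed.

(** Two digits are needed, one for the reduction modulo the uniformizer and one for the coefficient
    of the nilpotent generator. *)
Lemma oh_cover1 : exists s, covers s Oh (Sp 1).
have [s0 cs0] := cint_rescover Mb p.
have step w : Oh w -> exists2 y, y \in s0 & exists z c, [/\ Oh z, Oh c &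
  w = j (lft p y) + T * z + j n * c].
 move=> Ow; have [y ys hy] := cs0 _ (ared_int Ow); exists y => //.
 have Oy : pring p y.
  apply/(cint_j Mb); rewrite -[jb y](subKr (rho w)); apply: cintB; first exact: ared_int.
  by apply/hge0n; exact: (hge_le (n := 1)) hy.
 have [Ol rl] := lftP Oy; have [_ [z Oz ->] rz] := rho_lift_level hy.
 have [c Oc ec] : exists2 c, Oh c & w - j (lft p y) - T ^+ 1 * z = j n * c.
  apply: rho_ker; last by rewrite rmorphB rz rmorphB rho_j rl subrr.
  by apply: ohB; [apply/ohB/oh_j|apply: ohM => //; apply/ohX/oh_T].
 by exists z, c; split=> //; rewrite -ec expr1; ring.
exists [seq j (lft p y) + j n * j (lft p y') | y : E <- s0, y' : E <- s0] => w Ow.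
have [y ys [z [c [Oz Oc ->]]]] := step w Ow; have [y' ys' [z' [c' [Oz' Oc' ->]]]] := step c Oc.
exists (j (lft p y) + j n * j (lft p y')).
 by apply/allpairsP; exists (y, y').
exists (z + j n * z'); first by apply: ohD => //; exact: ohM oh_n Oz'.
have -> : j (lft p y) + T * z + j n * (j (lft p y') + T * z' + j n * c') -
 (j (lft p y) + j n * j (lft p y')) = T * (z + j n * z') + (j n * j n) * c' by ring.
by rewrite nn0 mul0r addr0 expr1.
Qed.

Lemma oh_cover m : exists s, covers s Oh (Sp m).
have [s1 cs1] := oh_cover1; elim: m => [|m [s cs]].
 by exists [:: 0] => x Ox; exists 0; rewrite ?mem_head // subr0; apply/Sp0.
exists [seq y + T ^+ m * r | y <- s, r <- s1] => x /cs[y ys [w Ow xy]].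
have [r rs [z Oz wr]] := cs1 w Ow; exists (y + T ^+ m * r).
 by apply/allpairsP; exists (y, r).
exists z => //; rewrite opprD addrA xy -mulrBr wr expr1 exprSr mulrA.
by [].
Qed.
End AtPlace.

Notation A := (adele M).
Notation Ab := (adele Mb).
Notation nil0 := (nilgen).
Notation Slat := (Slat Sp).
Notation ared := (ared (D := D)).
Notation dg := (dg Mb).

(** * Adeles of the nonreduced curve and their nilpotent part *)

Section LiftedAdeles.
Implicit Types (a b z : A) (x y : Ab) (m : place -> nat).

Lemma aredE a p : aval (ared a) p = ared_loc D p (aval a p). by []. Qed.
Lemma aredB a b : ared (a - b) = ared a - ared b. exact: rmorphB. Qed.
Lemma aredD a b : ared (a + b) = ared a + ared b. exact: rmorphD. Qed.
Lemma aredM a b : ared (a * b) = ared a * ared b. exact: rmorphM. Qed.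
Lemma aredN a : ared (- a) = - ared a. exact: rmorphN. Qed.
Lemma ared0 : ared (0 : A) = 0. exact: rmorph0. Qed.
Lemma ared1 : ared (1 : A) = 1. exact: rmorph1. Qed.
Lemma ared_lift m x : fin_supp m -> exists a, ared a = x /\ forall p, hge (m p) (aval x p) -> Sp (m p) (aval a p).
move=> fm; pose Z p : set (cring M p) := [set u | ared_loc D p u = aval x p /\
 (hge (m p) (aval x p) -> Sp (m p) u)].
have hZ p : Z p (xget 0 (Z p)).
 have [u hu] : exists u, Z p u.
  have [h|nh] := pselect (hge (m p) (aval x p)).
   by have [u Su ru] := rho_lift_level h; exists u.
  by have [u ru] := rho_lift (aval x p); exists u.
 exact: (@xgetI _ 0 (Z p) u hu).
have fin : finite_set [set p | ~ cint M p (xget 0 (Z p))].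
 apply: (@sub_finite_set _ _ ([set p | ~ cint Mb p (aval x p)] `|` [set p | m p != 0%N])).
  move=> p np; apply: contrapT => /not_orP[/contrapT cx mp]; apply: np.
  have [_ h] := hZ p; move: h; have -> : m p = 0%N by apply/eqP/negPn/negP.
  by move=> h; apply/Sp0/h/hge0n.
 by rewrite finite_setU; split=> //; exact: avalP.
exists (Adele fin); split=> [|p]; last by case: (hZ p).
by apply: aval_inj => p /=; case: (hZ p).
Qed.

Lemma ared_lift_lat m x : fin_supp m -> lat (fun p => m p) x -> exists2 a, Slat m a & ared a = x.
by move=> fm hx; have [a [ra ha]] := ared_lift x fm; exists a => // p; apply: ha; exact: hx.
Qed.

Definition lftA x : A := xget 0 [set a | ared a = x].
Lemma lftAP x : ared (lftA x) = x.
have [a [ra _]] := ared_lift x (fin_supp0 _).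
exact: (@xgetI _ 0 [set a | ared a = x] a ra).
Qed.

Lemma dgA_fin (f : F) : finite_set [set p | ~ cint M p (cmap M p f)].
by apply: sub_finite_set (sO_ae f) => p /=; apply: contra_not; exact: oh_j. Qed.

Definition dgA (f : F) : A := Adele (dgA_fin f).

Fact dgA_zmod : zmod_morphism dgA.
by move=> f g; apply: aval_inj => p /=; rewrite rmorphB. Qed.
Fact dgA_monoid : monoid_morphism dgA.
by split=> [|f g]; apply: aval_inj => p /=; rewrite ?rmorph1 ?rmorphM. Qed.
HB.instance Definition _ := GRing.isZmodMorphism.Build _ _ dgA dgA_zmod.
HB.instance Definition _ := GRing.isMonoidMorphism.Build _ _ dgA dgA_monoid.

Lemma diagonal_dgA f a : diagonal f a <-> a = dgA f.
by split=> [h|-> //]; apply: aval_inj => p; rewrite h. Qed.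

Lemma principal_dgA a : principal a <-> exists f, a = dgA f.
by split=> [[f /diagonal_dgA ->]|[f ->]]; [exists f|exists f => p]. Qed.

Lemma ared_dgA f : ared (dgA f) = dg (red f).
by apply: aval_inj => p /=; rewrite rho_j. Qed.

(** [nilgen] trivialises L at the general point, and [eps] is the resulting identification of
    reduced adeles with nilpotent adeles. The choice of lift disappears by [eps_ared]. *)
Definition eps x : A := lftA x * dgA nil0.
Lemma nil_mul a : ared a = 0 -> a * dgA nil0 = 0.
move=> ra; apply: aval_inj => p /=; rewrite mulrC; apply: ker_nilgen.
by rewrite -aredE ra.
Qed.

Lemma eps_ared a : eps (ared a) = a * dgA nil0.
by apply/subr0_eq; rewrite -mulrBl nil_mul // aredB lftAP subrr. Qed.

Lemma eps_zmod : zmod_morphism eps.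
by move=> x y; rewrite -(lftAP x) -(lftAP y) -rmorphB !eps_ared mulrBl. Qed.
HB.instance Definition _ := GRing.isZmodMorphism.Build _ _ eps eps_zmod.

Lemma epsM a x : a * eps x = eps (ared a * x).
by rewrite -{2}(lftAP x) -rmorphM eps_ared mulrA. Qed.

Lemma ared_nil0 : ared (dgA nil0) = 0.
by rewrite ared_dgA; have [-> _ _] := nilgenP; rewrite rmorph0. Qed.

Lemma ared_eps x : ared (eps x) = 0.
by rewrite aredM ared_nil0 mulr0. Qed.

Lemma eps_inj : injective eps.
move=> x y /eqP; rewrite -subr_eq0 -raddfB => /eqP e; apply/subr0_eq.
rewrite -[x - y]lftAP; apply: aval_inj => p; rewrite aredE; apply: nilgen_ker.
by have := congr1 (fun a => aval a p) e; rewrite /= mulrC.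
Qed.

Lemma eps_mul0 x y : eps x * eps y = 0.
by rewrite epsM ared_eps mul0r raddf0. Qed.

(** At almost all places an integral nilpotent element is an integral multiple of [nilgen], by
    [generic_triviality]; at the others any multiple will do. So the quotients form an adele. *)
Lemma nilA_eps z : nilA z <-> exists x, z = eps x.
split=> [rz|[x ->]]; last exact: ared_eps.
pose Z p : set (cring M p) := [set u | aval z p = cmap M p nil0 * u].
have rz0 p : ared_loc D p (aval z p) = 0 by rewrite -aredE rz.
pose W p := if pselect (exists2 u, cint M p u & Z p u) is left _ then Z p `&` cint M p else Z p.
have hW p : W p (xget 0 (W p)).
 have [u hu] : exists u, W p u.
  rewrite /W; case: pselect => [[u Ou Zu]|_]; first by exists u.
  by have [u hu] := ker_image (rz0 p); exists u.
 exact: (@xgetI _ 0 (W p) u hu).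
have fin : finite_set [set p | ~ cint M p (xget 0 (W p))].
 apply: sub_finite_set (ae_and (avalP z) (generic_triviality)) => p /= nW [cz gt].
 apply: nW; have := hW p; rewrite /W; case: pselect => [_ [//]|h _]; case: h.
 have [c Oc ec] := rho_ker cz (rz0 p); have [rn _ On _] := npP p.
 have [o Oo eo] := gt _ On rn; exists (cmap M p o * c).
  by apply: ohM => //; exact: oh_j.
 by rewrite /Z /= ec eo rmorphM; ring.
exists (ared (Adele fin)); rewrite eps_ared; apply: aval_inj => p /=; rewrite mulrC.
by have := hW p; rewrite {1}/W; case: pselect => [_ []|_].
Qed.

Lemma eps_dg f : eps (dg (red f)) = dgA (f * nil0).
by rewrite -ared_dgA eps_ared rmorphM. Qed.

Lemma eps_dg_principal e : principal (eps (dg e)).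
by have [f rf] := sred_surj X e; apply/principal_dgA; exists (f * nil0); rewrite -rf eps_dg.
Qed.

Lemma dg_inj : injective dg.
have [p _] := place_inhabited.
move=> e e' /(congr1 (fun a : Ab => aval a p)) /= h; apply/subr0_eq/eqP/negPn/negP => n0.
have := congr1 ( *%R (cmap Mb p (e - e')^-1)) (congr1 (+%R^~ (- cmap Mb p e')) h).
rewrite subrr mulr0 -rmorphB -rmorphM mulVf // rmorph1 => /eqP; exact/negP/oner_neq0.
Qed.

Lemma nilF_eps z : nilF z <-> exists e, z = eps (dg e).
split=> [[nz /principal_dgA[f zf]]|[e ->]]; last first.
 by split; [exact: ared_eps|exact: eps_dg_principal].
have rf : red f = 0.
 by apply: dg_inj; rewrite -ared_dgA -zf nz rmorph0.
have [_ _ gen] := nilgenP; have [g fg] := gen f rf.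
by exists (red g); rewrite eps_dg -fg.
Qed.

Lemma adele_bounded a : exists2 m, fin_supp m & forall p, cint M p (cmap M p (tl p) ^+ m p * aval a p).
have /choice[N hN] : forall p, exists N, cint M p (cmap M p (tl p) ^+ N * aval a p).
 by move=> p; exact: cring_bounded.
exists (fun p => if `[< cint M p (aval a p) >] then 0%N else N p).
 by apply: sub_finite_set (avalP a) => p /=; case: asboolP.
by move=> p; case: asboolP => [|_]; rewrite ?mul1r.
Qed.

Lemma fin_suppD m m' : fin_supp m -> fin_supp m' -> fin_supp (fun p => m p + m' p)%N.
move=> fm fm'; apply: (@sub_finite_set _ _ ([set p | m p != 0%N] `|` [set p | m' p != 0%N])).
 by move=> p /=; have [->|n0] := eqVneq (m p) 0%N; [rewrite add0n; right|left].
by rewrite finite_setU.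
Qed.

Lemma Slat_mul a : exists2 m', fin_supp m' & forall m b, Slat (fun p => m p + m' p)%N b -> Slat m (a * b).
have [m' fm' hm'] := adele_bounded a; exists m' => // m b hb p.
have [u Ou bE] := hb p; exists ((cmap M p (tl p) ^+ m' p * aval a p) * u); first exact: ohM.
by rewrite /= bE exprD; ring.
Qed.

Lemma eps_level m : fin_supp m -> exists2 m', fin_supp m' & forall x, lat (fun p => m' p) x -> Slat m (eps x).
move=> fm; have [m1 fm1 h1] := Slat_mul (dgA nil0).
exists (fun p => m p + m1 p)%N; first exact: fin_suppD.
move=> x /(ared_lift_lat (fin_suppD fm fm1))[a Sa <-].
by rewrite eps_ared mulrC; apply: h1.
Qed.

Lemma Slat_congr0 m : Slat m `<=` congr0 m.
by move=> a ha p; exact/Sp_maxid/ha. Qed.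

(** The shift by one is omitted where the exponent is 0, which keeps the support finite. *)
Lemma congr0_Slat m : fin_supp m -> exists2 m', fin_supp m' & congr0 (M := M) m' `<=` Slat m.
move=> fm; exists (fun p => if m p == 0%N then 0%N else (m p).+1).
 by apply: sub_finite_set fm => p /=; case: (m p).
move=> a ha p; have := ha p; case: eqP => [->|_]; first by move=> h; apply/Sp0.
exact: maxid_Sp.
Qed.

(** The adeles are covered first modulo nilpotents; the nilpotent remainder, read through [eps], is
    covered by the same fact on the reduced curve. *)
Lemma A_cover m : fin_supp m -> exists s, covers s setT (sumset (@principal _ _ _ M) (Slat m)).
move=> fm; have [m' fm' hm'] := eps_level fm.
have [s1 c1] := covers_elat Mb ((fsupp_fin _).1 fm).
have [s2 c2] := covers_elat Mb ((fsupp_fin _).1 fm').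
exists [seq lftA y + eps y' | y <- s1, y' <- s2] => a _.
have [y ys [_ [l [[e ->] hl rE]]]] := c1 (ared a) Logic.I.
have [f rf] := sred_surj X e; have [l' Sl' rl'] := ared_lift_lat fm hl.
have /nilA_eps[x' xE] : nilA (a - lftA y - dgA f - l').
 by rewrite /nilA /= !aredB lftAP ared_dgA rf rl' /= rE; ring.
have [y' ys' [_ [l2 [[e' ->] hl2 rE']]]] := c2 x' Logic.I.
have [f' rf'] := sred_surj X e'.
exists (lftA y + eps y'); first by apply/allpairsP; exists (y, y').
exists (dgA (f + f' * nil0)), (l' + eps l2); split.
- by apply/principal_dgA; exists (f + f' * nil0).
- by apply: (sgpD (Slat_sgp (@Sp_sgp) m)) => //; exact: hm'.
have aE : a = eps x' + l' + dgA f + lftA y by rewrite -xE; ring.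
have x'E : eps x' = dgA (f' * nil0) + eps l2 + eps y'.
 by rewrite -eps_dg rf' -!raddfD -rE' subrK.
by rewrite aE x'E rmorphD; ring.
Qed.

Section Means.
Variable C : numFieldType.

Lemma A_mean (phi : A -> C) : test_fun setT (@principal _ _ _ M) phi -> exists c, meanon setT phi c.
apply: (@test_fun_mean _ _ _ M C Sp).
- exact: Sp_sgp.
- by move=> p m n; exact: Sp_dec.
- by move=> p u /Sp0.
- exact: Sp_maxid.
- exact: oh_cover.
- exact: Sp_complete.
exact: A_cover.
Qed.

Lemma nil_mean (phi : A -> C) : test_fun (@nilA _ _ _ X D) (@nilF _ _ _ X D) phi ->
 exists c, meanon (@nilA _ _ _ X D) phi c.
move=> /test_funP[per loc].
have [|c hc] := bar_mean (phi := phi \o eps).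
 apply/test_funP; split=> [l x /principal_dg[e ->] _|x _] /=.
  by rewrite raddfD per //; [apply/nilF_eps; exists e|exact: ared_eps].
 have [m [fm hm]] := loc (eps x) (ared_eps x); have [m' fm' hm'] := eps_level fm.
 exists m'; split=> // y _ /congr0_lat hy; apply: hm; first exact: ared_eps.
 by rewrite -raddfB; apply/Slat_congr0/hm'.
exists c; apply/(@mean_morph C _ _ setT _ eps) => //.
- by move=> x y _ _; exact: raddfD.
- by move=> x _; exact: ared_eps.
- by move=> y /nilA_eps[x ->]; exists x.
Qed.

Lemma nilA_sgp : sgp (@nilA _ _ _ X D).
by split; rewrite /nilA /= ?ared0 // => a b ra rb; rewrite aredB ra rb subrr. Qed.

Lemma haar_A (phi : A -> C) c : test_fun setT (@principal _ _ _ M) phi -> meanon setT phi c ->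
 haar_int setT (@principal _ _ _ M) phi = c.
by apply: haar_intE => //; exact: A_mean. Qed.

Lemma haar_nil (phi : A -> C) c : test_fun (@nilA _ _ _ X D) (@nilF _ _ _ X D) phi ->
 meanon setT (phi \o eps) c -> haar_int (@nilA _ _ _ X D) (@nilF _ _ _ X D) phi = c.
move=> tp hc; apply: (haar_intE nilA_sgp nil_mean tp).
apply/(@mean_morph C _ _ setT _ eps) => //.
- by move=> x y _ _; exact: raddfD.
- by move=> x _; exact: ared_eps.
- by move=> y /nilA_eps[x ->]; exists x.
Qed.
End Means.
End LiftedAdeles.

(** * Fourier coefficients on an abstract group *)

Section AbstractGroup.
(* The properties of [PGL_2] of the adeles used by the harmonic analysis *)
Record pgl_axioms (C : Type) (G : groupType) (nu : 'M[Ab]_2 -> G) (U : A -> G) (rat cg : set G) : Prop := PglAxioms {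
 ax_nuD : forall Y Z, nu (Y + Z) = (nu Y * nu Z)%g;
 ax_nu_scalar : forall b, nu b%:M = 1%g;
 ax_U_nu : forall u Y, (U u * nu Y = nu (mx2 1 (ared u) 0 1 *m Y *m mx2 1 (- ared u) 0 1) * U u)%g;
 ax_UD : forall u v, U (u + v) = (U u * U v)%g;
 ax_U_eps : forall b, U (eps b) = nu (b *: dl01);
 ax_rat_nu : forall Q : 'M[E]_2, rat (nu (map_mx dg Q));
 ax_rat_U : forall a : F, rat (U (dgA a));
 ax_rat_conj : forall Q Q' : 'M[E]_2, gl2 (Q, Q') -> exists2 g, rat g &
  forall Y, (g * nu Y = nu (map_mx dg Q *m Y *m map_mx dg Q') * g)%g;
 ax_rat_mx : forall g, rat g -> exists Q Q' : 'M[E]_2, gl2 (Q, Q') /\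
  forall Y, (g * nu Y = nu (map_mx dg Q *m Y *m map_mx dg Q') * g)%g;
 ax_lev : forall g : G, exists2 m : place -> nat, fin_supp m & forall f : G -> C, (forall g x : G, cg x -> f (g * x)%g = f g) ->
  (forall (a : A) (x : G), Slat m a -> f (x * U a * g)%g = f (x * g)%g) /\
  (forall (Y : 'M[Ab]_2) (x : G), (forall i j, lat (fun p => m p) (Y i j)) -> f (x * nu Y * g)%g = f (x * g)%g) }.

Variables (G : groupType) (nu : 'M[Ab]_2 -> G) (U : A -> G) (rat cg : set G).
Variable C : numFieldType.
Hypothesis ax : pgl_axioms C nu U rat cg.
Variables (St : set G) (eta : G -> 'M[Ab]_2).
Implicit Types (g h : G) (Y Z : 'M[Ab]_2).
Variable psi : k -> C.
Hypothesis hpsi : nontrivial_character psi.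
Variables (w : kad Mb -> k) (y0 : kad Mb).
Hypotheses (hw : weil w) (wy0 : w y0 != 0).
Notation chi := (chi psi w).
Implicit Types f : G -> C.

Let sT (T : zmodType) : sgp [set: T]. by []. Qed.
Notation mext := (mean_ext (sT _)).
Notation rep := (xget 1%g).

Lemma chi_opp e (x : Ab) : chi (- e) x = chi e (- x).
by rewrite /chi; congr (psi (w _)); rewrite rmorphN mulNr mulrN. Qed.

Lemma nuDA Y Z g : (nu (Y + Z) * g = nu Y * (nu Z * g))%g.
by rewrite (ax_nuD ax) mulgA. Qed.

Lemma nuCA Y Z g : (nu Y * (nu Z * g) = nu Z * (nu Y * g))%g.
by rewrite -!nuDA (addrC Y). Qed.

Definition rinv f := forall g x : G, cg x -> f (g * x)%g = f g.
(** Enough for Fourier expansion along [nu]. Unlike invariance under all of [rat], this property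
    passes to the coefficients [Pd]. *)
Definition nice f := rinv f /\ forall (Q : 'M[E]_2) g, f (nu (map_mx dg Q) * g)%g = f g.
Lemma mx_cover (d : place -> int) : fsupp d -> exists s : seq 'M[Ab]_2,
 covers s setT [set Y | forall i j, elat (M := Mb) d (Y i j)].
move=> fd; have [s cs] := covers_elat Mb fd.
exists [seq (\matrix_(i, j) nth 0 s (t (i, j)) : 'M[Ab]_2) | t : {ffun 'I_2 * 'I_2 -> 'I_(size s)}] => Y _.
have /choice[t ht] : forall ij : 'I_2 * 'I_2, exists l : 'I_(size s),
  elat (M := Mb) d (Y ij.1 ij.2 - nth 0 s l).
 move=> ij; have [y ys hy] := cs (Y ij.1 ij.2) Logic.I.
 by exists (Ordinal (etrans (index_mem _ _) ys : (index y s < size s)%N)); rewrite nth_index.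
exists (\matrix_(i, j) nth 0 s ([ffun ij => t ij] (i, j))); first exact: map_f (mem_enum _ _).
by move=> i j; rewrite !mxE ffunE; exact: (ht (i, j)).
Qed.

Lemma nice_level f e g : nice f -> exists2 d, fsupp d & forall Y Z,
 (forall i j, elat (M := Mb) d (Y i j)) ->
 f (nu (Y + Z) * g)%g = f (nu Z * g)%g /\ forall i j, chi e ((Y + Z) i j) = chi e (Z i j).
move=> [rf ratf]; have [m fm hm] := ax_lev ax g; have [d1 fd1 hd1] := chi_level hpsi hw e.
exists (fun p => Num.max (m p : int) (d1 p)); first exact: fsupp_max ((fsupp_fin _).1 fm) fd1.
move=> Y Z hY; have /choice[q hq] : forall ij : 'I_2 * 'I_2, exists ql : E * Ab,
  lat (fun p => Num.max (m p : int) (d1 p)) ql.2 /\ Y ij.1 ij.2 = dg ql.1 + ql.2.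
 by move=> ij; have [_ [l [[c ->] hl rE]]] := hY ij.1 ij.2; exists (c, l).
pose Q : 'M[E]_2 := \matrix_(i, j) (q (i, j)).1; pose L : 'M[Ab]_2 := \matrix_(i, j) (q (i, j)).2.
have YE : Y = map_mx dg Q + L by apply/matrixP => i j; rewrite !mxE; have [_ ->] := hq (i, j).
have hL i j : lat (fun p => Num.max (m p : int) (d1 p)) (L i j) by rewrite mxE; have [] := hq (i, j).
split.
 have -> : Y + Z = map_mx dg Q + (Z + L) by rewrite YE -addrA (addrC L).
 rewrite nuDA ratf (ax_nuD ax); apply: (hm f rf).2 => i j.
 by apply: lat_le (hL i j) => // p; rewrite le_max lexx.
move=> i j; rewrite YE !mxE !(chiD hpsi hw) (chi_dg hpsi hw) mul1r.
rewrite (hd1 (q (i, j)).2) ?mul1r //; have := hL i j; rewrite mxE => h p.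
by apply: (@lat_le _ _ _ _ _ h p) => p'; rewrite le_max lexx orbT.
Qed.

(** The coefficient along all of N_A at the matrix [e] times e_12, since pairing with that matrix
    reads the (2,1) entry. The values 0 and 1 of [e] give the coefficients at 0 and at eta_0. *)
Definition Pm e f g : C := xget 0 [set c | meanon [set: 'M[Ab]_2]
 (fun Y => chi e (- Y o1 o0) * f (nu Y * g)%g) c].

Lemma PmP e f g : nice f -> meanon [set: 'M[Ab]_2]
 (fun Y => chi e (- Y o1 o0) * f (nu Y * g)%g) (Pm e f g).
move=> nf; have [d fd hd] := nice_level (- e) g nf; have [s cs] := mx_cover fd.
have [|//|u x Uu _|c hc] := @mean_periodic C _ _ (sT _) s [set Y | forall i j, elat (M := Mb) d (Y i j)]
 (fun Y => chi e (- Y o1 o0) * f (nu Y * g)%g) _ _ cs.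
- have sd := elat_sgp Mb d; split=> [i j|Y Z hY hZ i j]; rewrite !mxE; first exact: sd.1.
 exact: sd.2 (hY i j) (hZ i j).
- have [h1 h2] := hd u x Uu.
 have h3 : chi e (- (u + x) o1 o0) = chi e (- x o1 o0).
  by have := h2 o1 o0; rewrite !chi_opp.
 exact: (f_equal2 *%R h3 h1).
exact: (@xgetI _ 0 [set c | meanon [set: 'M[Ab]_2] (fun Y => chi e (- Y o1 o0) * f (nu Y * g)%g) c] c).
Qed.

Lemma PmE e f g c : nice f -> meanon [set: 'M[Ab]_2]
 (fun Y => chi e (- Y o1 o0) * f (nu Y * g)%g) c -> Pm e f g = c.
by move=> nf; apply: (mean_uniq (sT _)); exact: PmP. Qed.

Definition md i j (b : Ab) : 'M[Ab]_2 := b *: delta_mx i j.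
(** The coefficient along a single matrix entry; iterating it splits the mean that defines [Pm]. *)
Definition Pd i j e f g : C := xget 0 [set c | meanon [set: Ab]
 (fun b => chi e (- b) * f (nu (md i j b) * g)%g) c].

Lemma mdD i j b b' : md i j (b + b') = md i j b + md i j b'. exact: scalerDl. Qed.
Lemma md_biperiodic i j f g : nice f -> exists2 d, fsupp d & biperiodic d (fun b => f (nu (md i j b) * g)%g).
move=> nf; have [d fd hd] := nice_level 0 g nf; exists d; first exact: fd.
move=> u x hu; have [|h _] := hd (md i j u) (md i j x).
 move=> i' j'; rewrite !mxE; have sd := elat_sgp Mb d.
 by case: andP => _; rewrite ?mulr1 // mulr0; exact: sd.1.
exact: (etrans (congr1 (fun Z => f (nu Z * g)%g) (mdD i j u x)) h).
Qed.

Lemma PdP i j e f g : nice f -> meanon [set: Ab]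
 (fun b => chi e (- b) * f (nu (md i j b) * g)%g) (Pd i j e f g).
move=> nf; have [d fd hd] := md_biperiodic i j g nf.
have [s [c [_ hc _ _ _]]] := fourier hpsi hw wy0 fd hd.
apply: (@xgetI _ 0 [set c | meanon [set: Ab] (fun b => chi e (- b) * f (nu (md i j b) * g)%g) c] (c e)).
by apply: (mext _ (hc e)) => b _; rewrite mulrC.
Qed.

Lemma PdE i j e f g c : nice f -> meanon [set: Ab]
 (fun b => chi e (- b) * f (nu (md i j b) * g)%g) c -> Pd i j e f g = c.
by move=> nf; apply: (mean_uniq (sT _)); exact: PdP. Qed.

Lemma Pd_eq i j e f g g' : (forall b, f (nu (md i j b) * g)%g = f (nu (md i j b) * g')%g) ->
 Pd i j e f g = Pd i j e f g'.
by move=> h; rewrite /Pd; congr (xget 0 _); apply/funext => c /=; congr (meanon _ _ c); apply/funext => b; rewrite h. Qed.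

Lemma nice_Pd i j e f : nice f -> nice (Pd i j e f).
move=> [rf qf]; split=> [g x hx|Q g]; apply: Pd_eq => b.
 exact: (etrans (congr1 f (mulgA _ _ _)) (rf _ _ hx)).
by rewrite nuCA qf.
Qed.

Lemma Pd_eigen i j e f g b : nice f -> Pd i j e f (nu (md i j b) * g)%g = chi e b * Pd i j e f g.
move=> nf; apply: PdE => //.
have := meanonZ (sT _) (chi e b) (mean_shift (sT _) Logic.I (PdP i j e g nf) (h := b)).
apply: mext => x _.
have e1 : chi e b * chi e (- (b + x)) = chi e (- x).
 by rewrite opprD (chiD hpsi hw) mulrA (chiN hpsi hw) mul1r.
by rewrite mulrA e1 mdD nuDA nuCA.
Qed.

Lemma Pd_expansion i j f g : nice f -> exists s : seq E, uniq s /\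
 (forall e, e \notin s -> Pd i j e f g = 0) /\
 forall b, f (nu (md i j b) * g)%g = \sum_(e <- s) Pd i j e f g * chi e b.
move=> nf; have [d fd hd] := md_biperiodic i j g nf.
have [s [c [us hc c0 _ hx]]] := fourier hpsi hw wy0 fd hd.
have ce e : Pd i j e f g = c e.
 by apply: PdE => //; apply: (mext _ (hc e)) => b _; rewrite mulrC.
exists s; split=> //; split=> [e /c0|b]; first by rewrite ce.
by rewrite hx; apply: eq_bigr => e _; rewrite ce.
Qed.

Definition linv f := forall x g, rat x -> f (x * g)%g = f g.
Definition cusp f := forall g, meanon [set: A] (fun u => f (U u * g)%g) 0.
Definition U_rat f := forall (a : F) g, f (U (dgA a) * g)%g = f g.
Definition U_nil f := forall b g, f (nu (md o0 o1 b) * g)%g = f g.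
Lemma linv_nice f : rinv f -> linv f -> nice f.
by move=> rf lf; split=> // Q g; apply: lf; exact: (ax_rat_nu ax). Qed.

Lemma UDA u v g : (U (u + v) * g = U u * (U v * g))%g.
by rewrite (ax_UD ax) mulgA. Qed.

Lemma U_nuA u Y g : (U u * (nu Y * g) = nu (mx2 1 (ared u) 0 1 *m Y *m mx2 1 (- ared u) 0 1) * (U u * g))%g.
by rewrite !mulgA (ax_U_nu ax). Qed.

Lemma nu_scalarA b g : (nu b%:M * g = g)%g. by rewrite (ax_nu_scalar ax) mul1g. Qed.
Lemma nu_md0 i j g : (nu (md i j 0) * g = g)%g.
by rewrite /md scale0r -[RHS](nu_scalarA 0) -scalemx1 scale0r. Qed.

Lemma md00 b : md o0 o0 b = mx2 b 0 0 0. by apply: mx2P; rewrite !mxE /= ?mulr1 ?mulr0. Qed.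
Lemma md01 b : md o0 o1 b = mx2 0 b 0 0. by apply: mx2P; rewrite !mxE /= ?mulr1 ?mulr0. Qed.
Lemma md10 b : md o1 o0 b = mx2 0 0 b 0. by apply: mx2P; rewrite !mxE /= ?mulr1 ?mulr0. Qed.
Lemma nu_mx2 a b c d g : (nu (mx2 a b c d) * g =
 nu (md o0 o1 b) * (nu (md o0 o0 (a - d)) * (nu (md o1 o0 c) * g)))%g.
have -> : mx2 a b c d = d%:M + (md o0 o1 b + (md o0 o0 (a - d) + md o1 o0 c)).
 rewrite md00 md01 md10 scalar_mx2 !add_mx2; congr mx2; ring.
by rewrite nuDA nu_scalarA !nuDA.
Qed.

Lemma U_epsA b g : (U (eps b) * g = nu (md o0 o1 b) * g)%g.
by rewrite (ax_U_eps ax). Qed.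

Lemma U_nil_dep f a a' g : U_nil f -> ared a = ared a' -> f (U a * g)%g = f (U a' * g)%g.
move=> hf e; have /nilA_eps[b eb] : nilA (a - a') by rewrite /nilA /= aredB e subrr.
by rewrite -[a](subrK a') eb UDA U_epsA hf.
Qed.

Lemma U_lft f a g : U_nil f -> f (U a * g)%g = f (U (lftA (ared a)) * g)%g.
by move=> hf; apply: U_nil_dep => //; rewrite lftAP. Qed.

Lemma U_biperiodic f g : rinv f -> U_nil f -> U_rat f ->
 exists2 d, fsupp d & biperiodic d (fun x => f (U (lftA x) * g)%g).
move=> rf nf qf; have [m fm hm] := ax_lev ax g; exists (fun p => m p); first exact: (fsupp_fin _).1.
move=> u x [_ [l [[e ->] hl ->]]].
have [a ra] := sred_surj X e; have [l' Sl' rl'] := ared_lift_lat fm hl.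
rewrite /= (@U_nil_dep f (lftA (dg e + l + x)) (dgA a + (lftA x + l'))) //; last first.
 by rewrite !aredD !lftAP // ared_dgA ra rl' -addrA (addrC l).
by rewrite UDA qf (ax_UD ax) (hm f rf).1.
Qed.

(** The coefficient along U of the reduced adeles, computed on lifts; it is meaningful for functions
    invariant under the nilpotent part of U. *)
Definition Pu e f g : C := xget 0 [set c | meanon [set: Ab] (fun x => chi e (- x) * f (U (lftA x) * g)%g) c].
Lemma U_expansion f g : rinv f -> U_nil f -> U_rat f ->
 (forall e, meanon [set: Ab] (fun x => chi e (- x) * f (U (lftA x) * g)%g) (Pu e f g)) /\
 exists s : seq E, [/\ uniq s, forall e, e \notin s -> Pu e f g = 0
  & forall u, f (U u * g)%g = \sum_(e <- s) Pu e f g * chi e (ared u)].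
move=> rf nf qf; have [d fd hd] := U_biperiodic g rf nf qf.
have [s [c [us hc c0 _ hx]]] := fourier hpsi hw wy0 fd hd.
have hc' e : meanon [set: Ab] (fun x => chi e (- x) * f (U (lftA x) * g)%g) (c e).
 by apply: (mext _ (hc e)) => b _; rewrite mulrC.
have hP e : meanon [set: Ab] (fun x => chi e (- x) * f (U (lftA x) * g)%g) (Pu e f g).
 by apply: (@xgetI _ 0 [set c | meanon [set: Ab] (fun x => chi e (- x) * f (U (lftA x) * g)%g) c] (c e)); exact: hc'.
have ce e : Pu e f g = c e := mean_uniq (sT _) (hP e) (hc' e).
split=> //; exists s; split=> // [e /c0|u]; first by rewrite ce.
by rewrite U_lft // hx; apply: eq_bigr => e _; rewrite ce.
Qed.

Lemma ared_mean (phi : Ab -> C) c : meanon [set: A] (phi \o ared) c <-> meanon [set: Ab] phi c.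
apply: (@mean_morph C _ _ [set: A] [set: Ab] ared) => //.
- by move=> x y _ _; exact: aredD.
- by move=> y _; exists (lftA y) => //; exact: lftAP.
Qed.

(** Fubini for the nilpotent part inside U. *)
Lemma nice_nil_cusp f : nice f -> cusp f -> cusp (Pd o0 o1 0 f).
move=> nf cf g; apply: (mean_fubini (j := eps) (cf g)) => u.
apply: (mext _ (PdP o0 o1 0 (U u * g)%g nf)) => b _.
by rewrite chi_0 // mul1r UDA U_epsA.
Qed.

(** A coefficient that commutes with translations by U may be taken after the mean over U;
    [mean_swap] applies because the functions of [u] share a period of finite index. *)
Lemma cusp_Pd i j e (h : G -> C) : nice h -> U_rat h -> cusp h ->
 (forall b u g, h (nu (md i j b) * (U u * g))%g = h (U u * (nu (md i j b) * g))%g) -> cusp (Pd i j e h).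
move=> nh qh ch com g; have [m fm hm] := ax_lev ax g.
have [s cs] := A_cover fm.
apply: (@mean_swap C _ _ (fun u b => chi e (- b) * h (nu (md i j b) * (U u * g))%g) _
 (sumset (@principal _ _ _ M) (Slat m)) s _ cs).
- apply: sgp_sumset; last exact: Slat_sgp Sp_sgp m.
 exact: principal_sgp.
- move=> _ u b [_ [l [/principal_dgA[a ->] Sl ->]]]; congr (_ * _).
 rewrite com -addrA UDA qh -com (addrC l) (ax_UD ax) mulgA mulgA ; have := (hm h nh.1).1 l (nu (md i j b) * U u)%g Sl.
 by rewrite -!mulgA.
- move=> b; rewrite -(mulr0 (chi e (- b))); apply: (meanonZ (sT _)).
 by apply: (mext _ (ch (nu (md i j b) * g)%g)) => u _; rewrite com.
- by move=> u; exact: PdP.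
Qed.

Lemma U_nil_Pd i j e f : U_nil f -> U_nil (Pd i j e f).
by move=> nf b g; apply: Pd_eq => x; rewrite nuCA nf. Qed.

Lemma U_nil_Pd01 f : nice f -> U_nil (Pd o0 o1 0 f).
by move=> nf b g; rewrite Pd_eigen // chi_0 // mul1r. Qed.

Lemma U_rat_Pd i j e f : U_rat f ->
 (forall b u g, f (nu (md i j b) * (U u * g))%g = f (U u * (nu (md i j b) * g))%g) -> U_rat (Pd i j e f).
by move=> qf com a g; apply: Pd_eq => b; rewrite com qf. Qed.

Lemma U_nu01 u b g : (U u * (nu (md o0 o1 b) * g) = nu (md o0 o1 b) * (U u * g))%g.
by rewrite U_nuA; congr (nu _ * _)%g; rewrite md01 !mul_mx2; congr mx2; ring. Qed.

Lemma U_nu00 u b g : (U u * (nu (md o0 o0 b) * g) =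
 nu (md o0 o1 (- (b * ared u))%R) * (nu (md o0 o0 b) * (U u * g)))%g.
rewrite U_nuA -nuDA; congr (nu _ * _)%g; rewrite md00 md01 !mul_mx2 add_mx2; congr mx2; ring.
Qed.

(** The diagonal term [2 b u] created by conjugation is the one by which [torus_part] divides. *)
Lemma U_nu10 u b g : (U u * (nu (md o1 o0 b) * g) =
 nu (md o0 o1 (- (b * ared u * ared u))%R) * (nu (md o0 o0 (2%:R * b * ared u)%R) * (nu (md o1 o0 b) * (U u * g))))%g.
rewrite U_nuA md10 !mul_mx2 nu_mx2 -md10.
congr (nu (md _ _ _) * (nu (md _ _ _) * (nu (md _ _ _) * _)))%g; ring.
Qed.

(** * Consequences of cuspidality *)

Section Cuspidal.
Hypothesis two : 2%:R != 0 :> E.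
Variable f : G -> C.
Hypotheses (rf : rinv f) (lf : linv f) (cf : cusp f).
Let nf : nice f := linv_nice rf lf.
Let h := Pd o0 o1 0 f.
Let nh : nice h := nice_Pd _ _ _ nf.
Let nilh : U_nil h := U_nil_Pd01 nf.

Let qh : U_rat h.
apply: U_rat_Pd => [a g|b u g]; first by apply: lf; exact: (ax_rat_U ax).
by rewrite U_nu01.
Qed.

Let ch : cusp h := nice_nil_cusp nf cf.

Let com00 b u g : h (nu (md o0 o0 b) * (U u * g))%g = h (U u * (nu (md o0 o0 b) * g))%g.
by rewrite U_nu00 nilh. Qed.

(** All coefficients of [hb] along U vanish. Inserting the rational lower nilpotent matrix with
    entry [c] multiplies [hb] by the character [chi e] of [2 c u]; as every character of U indexed
    by E arises so, each coefficient equals a mean that cuspidality makes 0. *)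
Lemma torus_part e g : e != 0 -> Pd o0 o0 e h g = 0.
move=> e0; set hb := Pd o0 o0 e h.
have nhb : nice hb := nice_Pd _ _ _ nh.
have nilhb : U_nil hb := U_nil_Pd _ _ _ nilh.
have qhb : U_rat hb := U_rat_Pd _ qh com00.
have chb : cusp hb := cusp_Pd _ nh qh ch com00.
have [hP [s [_ _ hx]]] := U_expansion g nhb.1 nilhb qhb.
have P0 e' : Pu e' hb g = 0.
 apply: (mean_uniq (sT _) (hP e')); apply/ared_mean.
 (* Chosen so that [e * (2 * c) = - e'], the character in the definition of the coefficient. *)
 pose c := - e' / (2%:R * e).
 apply: (mext _ (chb (nu (md o1 o0 (dg c)) * g)%g)) => u _ /=.
 have eig b g' : hb (nu (md o0 o0 b) * g')%g = chi e b * hb g' by exact: Pd_eigen.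
 rewrite U_nu10 nilhb eig -U_lft //.
 have -> : md o1 o0 (dg c) = map_mx dg (c *: delta_mx o1 o0).
  apply/matrixP => i j; rewrite !mxE; case: andP => _; first by rewrite !mulr1.
  by rewrite !mulr0 rmorph0.
 rewrite nhb.2; congr (_ * _).
 have -> : 2%:R * dg c = dg (2%:R * c) by rewrite !mulr_natl rmorphMn.
 rewrite chiM -chi_opp; congr chi; rewrite /c; field.
 by rewrite two e0.
have := hx 0; have := ax_UD ax 0 0.
rewrite addr0 => e1; have {e1} U0 : U 0 = 1%g by apply: (mulgI (U 0)); rewrite -e1 mulg1.
by rewrite U0 mul1g => ->; rewrite big1 // => e' _; rewrite P0 mul0r.
Qed.

(** The (1,2) entry acts trivially by construction of [h], scalars by [ax_nu_scalar], and the
    diagonal because only its trivial character survives [torus_part]. *)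
Lemma upper_inv a b c d g : h (nu (mx2 a b c d) * g)%g = h (nu (md o1 o0 c) * g)%g.
rewrite nu_mx2 nilh; set g' := (nu _ * g)%g.
have [s [us [hs0 hx]]] := Pd_expansion o0 o0 g' nh.
have const x : h (nu (md o0 o0 x) * g')%g = \sum_(e <- s) Pd o0 o0 e h g'.
 rewrite hx; apply: eq_bigr => e _; have [->|e0] := eqVneq e 0; first by rewrite chi_0 // mulr1.
 by rewrite torus_part // mul0r.
have e1 : h g' = \sum_(e <- s) Pd o0 o0 e h g'.
 by rewrite -(const 0) nu_md0.
by rewrite const e1.
Qed.

(** [h] is already the mean over the (1,2) entry and does not see the diagonal, so the mean over all
    matrices reduces to the (2,1) entry. *)
Lemma Pm_Pd e g : Pm e f g = Pd o1 o0 e h g.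
have h1 : meanon [set: 'M[Ab]_2] (fun Y => chi e (- Y o1 o0) * h (nu Y * g)%g) (Pm e f g).
 apply: (mean_fubini (j := md o0 o1) (PmP e g nf)) => Y.
 apply: (mext _ (meanonZ (sT _) (chi e (- Y o1 o0)) (PdP o0 o1 0 (nu Y * g)%g nf))) => b _.
 by rewrite chi_0 // mul1r nuDA md01 !mxE /= add0r.
apply/esym/PdE => //.
apply/(@mean_morph C _ _ [set: 'M[Ab]_2] [set: Ab] (fun Y => Y o1 o0)) => //.
- by move=> Y Z _ _; rewrite mxE.
- by move=> b _; exists (mx2 0 0 b 0); rewrite ?mxE.
apply: (mext _ h1) => Y _ /=; congr (_ * _).
by rewrite [in LHS](mx2E Y) upper_inv.
Qed.

Lemma cusp_Pm e : cusp (Pm e f).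
have com b u g : h (nu (md o1 o0 b) * (U u * g))%g = h (U u * (nu (md o1 o0 b) * g))%g.
 rewrite U_nu10 nilh; have := upper_inv (2%:R * b * ared u) 0 b 0 (U u * g)%g.
 by rewrite nu_mx2 nilh subr0.
move=> g; apply: (mext _ (cusp_Pd e nh qh ch com g)) => u _.
by rewrite Pm_Pd.
Qed.

(** The [Pm e] are all the coefficients of [h] along the (2,1) entry, so they determine [h], the
    integral in the definition of strong cuspidality. *)
Lemma nil_mean_Pm g : (forall e, Pm e f g = 0) -> h g = 0.
move=> h0; have [s [us [hs0 hx]]] := Pd_expansion o1 o0 g nh.
have := hx 0; rewrite big1 => [|e _]; last by rewrite -Pm_Pd h0 mul0r.
by rewrite nu_md0.
Qed.
End Cuspidal.

(** The mean over the (1,2) entry may be taken first, since the character does not involve that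
    entry. *)
Lemma Pm_strong e f g : nice f -> (forall g, Pd o0 o1 0 f g = 0) -> Pm e f g = 0.
move=> nf h0.
have : meanon [set: 'M[Ab]_2] (fun=> 0 : C) (Pm e f g).
 apply: (mean_fubini (j := md o0 o1) (PmP e g nf)) => Y.
 have := meanonZ (sT _) (chi e (- Y o1 o0)) (PdP o0 o1 0 (nu Y * g)%g nf).
 rewrite h0 mulr0; apply: mext => b _.
 by rewrite chi_0 // mul1r nuDA md01 !mxE /= add0r.
by move/(mean_uniq (sT _)); apply; exact: (mean_cst (sT _)).
Qed.

Lemma Pm_eigen e f Y g : nice f -> Pm e f (nu Y * g)%g = chi e (Y o1 o0) * Pm e f g.
move=> nf; apply: PmE => //.
have := meanonZ (sT _) (chi e (Y o1 o0)) (mean_shift (sT _) Logic.I (PmP e g nf) (h := Y)).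
apply: mext => Z _.
have e1 : chi e (Y o1 o0) * chi e (- (Y + Z) o1 o0) = chi e (- Z o1 o0).
 by rewrite mxE opprD (chiD hpsi hw) mulrA (chiN hpsi hw) mul1r.
by rewrite mulrA e1 nuDA nuCA.
Qed.

Lemma Pm_right (K : set G) e f : (forall g x, K x -> f (g * x)%g = f g) ->
 forall g x, K x -> Pm e f (g * x)%g = Pm e f g.
move=> rf g x hx; rewrite /Pm; congr (xget 0 _); apply/funext => c /=.
by congr (meanon _ _ c); apply/funext => Y; rewrite mulgA (rf _ _ hx).
Qed.

Lemma Pu_right (K : set G) e f : (forall g x, K x -> f (g * x)%g = f g) ->
 forall g x, K x -> Pu e f (g * x)%g = Pu e f g.
move=> rf g x hx; rewrite /Pu; congr (xget 0 _); apply/funext => c /=.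
by congr (meanon _ _ c); apply/funext => u; rewrite mulgA (rf _ _ hx).
Qed.

(** Change of variable by the conjugation action of the rational element [x], under which [f] is
    invariant. *)
Lemma Pm_conj e e' f x (Q Q' : 'M[E]_2) g : nice f -> linv f -> rat x -> gl2 (Q, Q') ->
 (forall Y, x * nu Y = nu (map_mx dg Q *m Y *m map_mx dg Q') * x)%g ->
 (forall Y, chi e (- (map_mx dg Q *m Y *m map_mx dg Q') o1 o0) = chi e' (- Y o1 o0)) ->
 Pm e f (x * g)%g = Pm e' f g.
move=> nf lf rx hQ hx he; apply: PmE => //.
have hq := gl2_map dg hQ.
apply/(@mean_morph C _ _ [set: 'M[Ab]_2] [set: 'M[Ab]_2] (fun Y => map_mx dg Q *m Y *m map_mx dg Q')) => //.
- by move=> Y Z _ _; rewrite mulmxDr mulmxDl.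
- move=> Y _; exists (map_mx dg Q' *m Y *m map_mx dg Q) => //.
 by rewrite -!mulmxA (gl2_1 hq) mulmx1 !mulmxA (gl2_1 hq) mul1mx.
apply: (mext _ (PmP e' g nf)) => Y _ /=.
by rewrite he mulgA -hx -mulgA (lf _ _ rx).
Qed.

(** * Functions equivariant under the stabilizer and their sums over cosets *)

Definition bar_of (B B' : 'M[Ab]_2) (h : G) := gl2 (B, B') /\ forall g, eta (g * h)%g = B' *m eta g *m B.

(** The second half of the interface. [eta g] stands for the conjugate of e_12 by the inverse of
    [g]; cosets of the stabilizer thereby become rational matrices, which can be bounded by
    lattices. *)
Record st_axioms : Prop := StAxioms {
 st_rat1 : rat 1%g;
 st_ratM : forall x y, rat x -> rat y -> rat (x * y)%g;
 st_ratV : forall x, rat x -> rat x^-1%g;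
 st_eta1 : eta 1%g = dl01;
 st_bar : forall h, exists B B', bar_of B B' h;
 st_bar_cg : forall h, cg h -> exists B B', bar_of B B' h /\
  forall i j, lat (fun=> 0) (B i j) /\ lat (fun=> 0) (B' i j);
 st_eta_rat : forall g, rat g -> exists Q : 'M[E]_2, [/\ eta g = map_mx dg Q, Q != 0 &
  forall Z, exists2 Z', (g * nu Z = nu Z' * g)%g & Z' o1 o0 = \tr (eta g *m Z)];
 st_StE : forall g, St g <-> eta g = dl01;
 st_St_rat : forall g, St g -> rat g -> exists Y a e, g = (nu Y * U (dgA a))%g /\ Y o1 o0 = dg e;
 st_St_nu : forall Y u, St (nu Y * U u)%g;
 st_borel : forall g, rat g -> eta g o1 o0 = 0 -> exists s t c,
  [/\ St s, rat s, g = (s * t)%g, red c != 0 & forall u, (t * U u = U (dgA c * u)%R * t)%g] }.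

Hypothesis st : st_axioms.

Definition eqvar e f := forall Y u g,
 f (nu Y * U u * g)%g = chi 1 (Y o1 o0) * chi e (ared u) * f g.

Lemma eqvar_nu e f Y g : eqvar e f -> f (nu Y * g)%g = chi 1 (Y o1 o0) * f g.
move=> h; have U0 : U 0 = 1%g.
 by apply: (mulgI (U 0)); rewrite -(ax_UD ax) addr0 mulg1.
by have := h Y 0 g; rewrite U0 mulg1 ared0 (chi0 hpsi hw) mulr1.
Qed.

Lemma eqvar_U e f u g : eqvar e f -> f (U u * g)%g = chi e (ared u) * f g.
move=> h; have := h 0 u g; rewrite mxE (chi0 hpsi hw) mul1r.
by have := ax_nu_scalar ax 0; rewrite -scalemx1 scale0r => ->; rewrite mul1g.
Qed.

Lemma St_V s t : St s -> St t -> St (s * t^-1)%g.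
move=> /(st_StE st) es /(st_StE st) et; apply/(st_StE st).
have [B [B' [h hB]]] := st_bar st t^-1%g.
by rewrite hB es -et -hB mulgV (st_eta1 st).
Qed.

Lemma St_1 : St 1%g. by apply/(st_StE st)/(st_eta1 st). Qed.
Lemma eta_St s g : St s -> eta (s * g)%g = eta g.
move=> /(st_StE st) es; have [B [B' [h hB]]] := st_bar st g.
by rewrite hB es -[in RHS](mul1g g) hB (st_eta1 st).
Qed.

Lemma eta_eqSt g h : eta g = eta h -> St (g * h^-1)%g.
move=> e; apply/(st_StE st); have [B [B' [_ hB]]] := st_bar st h^-1%g.
by rewrite hB e -hB mulgV (st_eta1 st).
Qed.

Definition cosets : set (set G) :=
 [set Y | exists2 x, rat x & Y = [set (s * x)%g | s in St `&` rat]].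

Lemma cosets_mem (Y : set G) x : cosets Y -> Y x -> rat x /\ Y = [set (s * x)%g | s in St `&` rat].
move=> [y ry ->] [s [Ss rs] <-]; split; first exact: (st_ratM st).
apply/seteqP; split=> _ [t [St_ rt] <-].
 exists (t * s^-1)%g; last by rewrite mulgA mulgKV.
 by split; [exact: St_V|apply: (st_ratM st) => //; exact: (st_ratV st)].
exists (t * s)%g; last by rewrite mulgA.
by split; [rewrite -[s]invgK; apply: St_V => //; rewrite -[s^-1%g]mul1g; exact: St_V St_1 Ss|exact: (st_ratM st)].
Qed.

Lemma cosets_rep (Y : set G) : cosets Y -> Y (rep Y).
move=> [y ry ->]; apply: (@xgetI _ 1%g _ y); exists 1%g; last by rewrite mul1g.
by split; [exact: St_1|exact: (st_rat1 st)].
Qed.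

Lemma cosets_rat (Y : set G) : cosets Y -> rat (rep Y).
by move=> cY; have [] := cosets_mem cY (cosets_rep cY). Qed.

Lemma cosets_eta (Y Y' : set G) : cosets Y -> cosets Y' -> eta (rep Y) = eta (rep Y') -> Y = Y'.
move=> cY cY' e; have [ry YE] := cosets_mem cY (cosets_rep cY); have [ry' YE'] := cosets_mem cY' (cosets_rep cY').
have m : Y' (rep Y).
 rewrite YE'; exists (rep Y * (rep Y')^-1)%g; last by rewrite mulgKV.
 by split; [exact: eta_eqSt|apply: (st_ratM st) => //; exact: (st_ratV st)].
by have [_ ->] := cosets_mem cY' m.
Qed.

Lemma St_rat_inv e f s g : eqvar e f -> St s -> rat s -> f (s * g)%g = f g.
move=> ef Ss rs; have [Y [a [e' [-> eY]]]] := st_St_rat st Ss rs.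
by rewrite ef eY ared_dgA !(chi_dg hpsi hw) !mul1r.
Qed.

Lemma coset_const e f (Y : set G) x g : eqvar e f -> cosets Y -> Y x -> f (x * g)%g = f (rep Y * g)%g.
move=> ef cY Yx; have [_ YE] := cosets_mem cY (cosets_rep cY).
by move: Yx; rewrite {1}YE => -[s [Ss rs] <-]; rewrite -mulgA; exact: St_rat_inv ef Ss rs.
Qed.

Lemma eqvar_rat e f x Z g : eqvar e f -> rat x ->
 f (x * (nu Z * g))%g = chi 1 (\tr (eta x *m Z)) * f (x * g)%g.
move=> ef rx; have [Q [_ _ hZ]] := st_eta_rat st rx; have [Z' e1 <-] := hZ Z.
by rewrite mulgA e1 -mulgA (eqvar_nu _ _ ef).
Qed.

Definition embG f g : C := \sum_(Y \in cosets) f (rep Y * g)%g.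
(** Compactness of the support modulo the stabilizer, uniform in [f]: the list depends only on the
    level and on [e]. *)
Definition supported (e : E) := exists s : seq G, forall f, rinv f -> eqvar e f ->
 forall g, f g != 0 -> exists Y u x h, [/\ x \in s, cg h & g = (nu Y * U u * (x * h))%g].

Lemma mx_lat (B : 'M[Ab]_2) : exists2 d, fsupp d & forall i j, lat d (B i j).
have [d fd hd] := lat_seq [seq B ij.1 ij.2 | ij : 'I_2 * 'I_2]; exists d => // i j.
by apply: hd; apply/mapP; exists (i, j); rewrite ?mem_enum.
Qed.

Lemma mx_latM d d' (B B' : 'M[Ab]_2) : (forall i j, lat d (B i j)) -> (forall i j, lat d' (B' i j)) ->
 forall i j, lat (fun p => d p + d' p) ((B *m B') i j).
move=> hB hB' i j; rewrite mul2E; apply: (sgpD (lat_sgp Mb _)); exact: latM.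
Qed.

Lemma seq_lat (s : seq G) : exists2 d, fsupp d & forall x, x \in s -> forall i j, lat d (eta x i j).
have [d fd hd] := lat_seq [seq eta x ij.1 ij.2 | x <- s, ij <- enum {: 'I_2 * 'I_2}]; exists d => // x xs i j.
by apply: hd; apply/allpairsP; exists (x, (i, j)); rewrite mem_enum.
Qed.

(** A coset contributes only if its matrix [eta] lies in a lattice determined by [g] and the list of
    [supported], and a lattice contains finitely many rational matrices. One list serves all [f]. *)
Lemma finite_cosets e g : supported e -> exists l : seq (set G), [/\ uniq l, forall Y : set G, Y \in l -> cosets Y
 & forall f, rinv f -> eqvar e f -> forall Y : set G, cosets Y -> Y \notin l -> f (rep Y * g)%g = 0].
move=> [s hs]; have [d fd hd] := seq_lat s.
have [B [B' [hB eB]]] := st_bar st g; have [dB fB hdB] := mx_lat B; have [dB' fB' hdB'] := mx_lat B'.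
pose dd p := (dB p + (0 + d p + 0)) + dB' p.
have fdd : fsupp dd by do !apply: fsuppD => //; exact: fsupp0.
have [r hr] := E_lat_finite Mb fdd.
pose L : set (set G) := [set Y | cosets Y /\ forall i j, lat dd (eta (rep Y) i j)].
have fL : finite_set L.
 pose R : set 'M[Ab]_2 := [set map_mx dg (\matrix_(i, j) nth 0 r (t (i, j))) | t in [set: {ffun 'I_2 * 'I_2 -> 'I_(size r)}]].
 have fR : finite_set R by apply: finite_image; exact: finite_finset.
 pose v (B0 : 'M[Ab]_2) : set G := xget set0 [set Y : set G | cosets Y /\ eta (rep Y) = B0].
 apply: (sub_finite_set _ (finite_image v fR)) => Y [cY lY].
 exists (eta (rep Y)).
  have [Q [eQ _ _]] := st_eta_rat st (cosets_rat cY).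
  have Qr i j : Q i j \in r by apply: hr => p; have := lY i j p; rewrite eQ mxE.
  exists [ffun ij => Ordinal (etrans (index_mem _ _) (Qr ij.1 ij.2) : (index (Q ij.1 ij.2) r < size r)%N)] => //.
  by rewrite eQ; apply/matrixP => i j; rewrite !mxE ffunE nth_index.
 have [] : [set Y' : set G | cosets Y' /\ eta (rep Y') = eta (rep Y)] (v (eta (rep Y))).
  exact: (@xgetI _ set0 _ Y).
 by move=> cv /(cosets_eta cv cY).
have /finite_seqP[l0 hl] := fL; exists (undup l0); split; first exact: undup_uniq.
 by move=> Y; rewrite mem_undup => Yl; have : [set` l0] Y by []; rewrite -hl => -[].
move=> f rf ef Y cY; rewrite mem_undup => Yl; apply/eqP/negPn/negP => f0.
suff LY : L Y by move: Yl; have /= -> : [set` l0] Y by rewrite -hl.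
split=> // i j; have [Z [u [x [h [xs ch e1]]]]] := hs f rf ef _ f0.
have [H [H' [[_ eH] iH]]] := st_bar_cg st ch.
have e2 : eta (rep Y) = B *m (H' *m eta x *m H) *m B'.
 rewrite -eH -(eta_St (x * h)%g (st_St_nu st Z u)) -e1 eB.
 have BB := mulmx1C (gl2_1 (gl2C hB)); rewrite !mulmxA BB mul1mx -mulmxA.
 by rewrite BB mulmx1.
rewrite e2; apply: mx_latM => //; apply: mx_latM => //; apply: mx_latM => [|i' j']; last by case: (iH i' j').
by apply: mx_latM => [i' j'|]; [case: (iH i' j')|exact: hd].
Qed.

Lemma sum_cosets (P : set G -> C) (l : seq (set G)) : uniq l -> (forall Y : set G, Y \in l -> cosets Y) ->
 (forall Y : set G, cosets Y -> Y \notin l -> P Y = 0) -> \sum_(Y \in cosets) P Y = \sum_(Y <- l) P Y.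
move=> ul cl hl; rewrite (fsbigE l) // big_mkcond /=.
by apply: eq_big_seq => Y Yl; rewrite mem_set //; exact: cl.
Qed.

Lemma mean_tr (Q : 'M[E]_2) : meanon [set: 'M[Ab]_2] (fun Z => chi 1 (\tr (map_mx dg Q *m Z))) (Q == 0)%:R.
have [->|Q0] := eqVneq Q 0.
 apply: (mext _ (mean_cst (sT _) 1)) => Z _.
 by rewrite map_mx0 mul0mx raddf0 (chi0 hpsi hw).
have [i [j Qij]] : exists i j, Q i j != 0.
 apply: contrapT => h; move/eqP: Q0; apply; apply/matrixP => i j; rewrite mxE; apply/eqP/negPn/negP => n0.
 by apply: h; exists i, j.
have h := mean_chi hpsi hw wy0 1; rewrite oner_eq0 in h.
apply/(@mean_morph C _ _ [set: 'M[Ab]_2] [set: Ab] (fun Z => \tr (map_mx dg Q *m Z))); last exact: h.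
- by move=> Y Z _ _; rewrite mulmxDr raddfD.
- by [].
- move=> x _; exists ((dg (Q i j)^-1 * x) *: delta_mx j i) => //.
 rewrite -scalemxAr mxtraceZ mxtrace_mulC /mxtrace.
 have -> : \sum_l (delta_mx j i *m map_mx dg Q) l l = dg (Q i j).
  rewrite (bigD1 j) //= big1 ?addr0 => [|l lj].
   rewrite mxE (bigD1 i) //= big1 => [|l li]; first by rewrite addr0 !mxE !eqxx mul1r.
   by rewrite !mxE (negPf li) andbF mul0r.
  by rewrite mxE big1 // => l' _; rewrite !mxE (negPf lj) mul0r.
 by rewrite mulrAC -rmorphM mulVf // rmorph1 mul1r.
Qed.

Lemma cosets_tr x (W : set G) : rat x -> cosets W -> cosets [set (y * x)%g | y in W].
move=> rx [y ry ->]; exists (y * x)%g; first exact: (st_ratM st).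
apply/seteqP; split=> [_ [_ [s hs <-] <-]|_ [s hs <-]]; first by exists s; rewrite ?mulgA.
by exists (s * y)%g; [exists s|rewrite mulgA].
Qed.

Lemma image_trK x (W : set G) : [set (y * x)%g | y in [set (y * x^-1)%g | y in W]] = W.
apply/seteqP; split=> [_ [_ [y Wy <-] <-]|y Wy]; first by rewrite mulgKV.
by exists (y * x^-1)%g; [exists y|rewrite mulgKV].
Qed.

Section Equivariant.
Variables (e : E) (f : G -> C).
Hypotheses (rf : rinv f) (ef : eqvar e f) (se : supported e).

Lemma embG_rinv (K : set G) : (forall g x, K x -> f (g * x)%g = f g) ->
 forall g x, K x -> embG f (g * x)%g = embG f g.
by move=> hK g x Kx; rewrite /embG; apply: eq_fsbigr => Y _; rewrite mulgA hK. Qed.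

Lemma embG_linv : linv (embG f).
move=> x g rx; rewrite /embG.
rewrite [RHS](reindex_fsbig (fun W : set G => [set (y * x)%g | y in W]) cosets cosets).
 apply: eq_fsbigr => Y /set_mem cY; rewrite mulgA.
 apply: (coset_const _ ef); first exact: cosets_tr.
 by exists (rep Y) => //; exact: cosets_rep.
split=> [Y cY|Y Y' _ _ h|Y cY]; first exact: cosets_tr.
 have := congr1 (fun W : set G => [set (y * x^-1)%g | y in W]) h.
 by rewrite -{1 3}(invgK x) !image_trK.
exists [set (y * x^-1)%g | y in Y]; last exact: image_trK.
by apply: cosets_tr => //; exact: (st_ratV st).
Qed.

Lemma embG_nu g (l : seq (set G)) : uniq l -> (forall Y : set G, Y \in l -> cosets Y) ->
 (forall Y : set G, cosets Y -> Y \notin l -> f (rep Y * g)%g = 0) ->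
 forall Z, embG f (nu Z * g)%g = \sum_(Y <- l) chi 1 (\tr (eta (rep Y) *m Z)) * f (rep Y * g)%g.
move=> ul cl hl Z; rewrite /embG (sum_cosets ul cl).
 by apply: eq_big_seq => Y /cl cY; rewrite (eqvar_rat _ _ ef) //; exact: cosets_rat.
by move=> Y cY Yl; rewrite (eqvar_rat _ _ ef) ?hl ?mulr0 //; exact: cosets_rat.
Qed.

Lemma dg_mx_inj : injective (map_mx dg : 'M[E]_2 -> 'M[Ab]_2).
by move=> Q Q' /matrixP h; apply/matrixP => i j; apply: dg_inj; have := h i j; rewrite !mxE. Qed.

Definition coset1 : set G := [set (s * 1)%g | s in St `&` rat].
Lemma coset1P : cosets coset1. by exists 1%g => //; exact: (st_rat1 st). Qed.
Lemma eta_coset1 (Y : set G) : cosets Y -> eta (rep Y) = dl01 <-> Y = coset1.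
have e1 : eta (rep coset1) = dl01.
 by have [s [Ss _] <-] := cosets_rep coset1P; rewrite eta_St // (st_eta1 st).
by move=> cY; split=> [h|-> //]; apply: cosets_eta => //; [exact: coset1P|rewrite h].
Qed.

Lemma f_coset1 g : f (rep coset1 * g)%g = f g.
have [s [Ss rs] <-] := cosets_rep coset1P.
by rewrite mulg1; exact: St_rat_inv ef Ss rs.
Qed.

(** Each coset contributes the character of its rational matrix. These matrices are distinct and
    nonzero, so orthogonality keeps no coset for [c = 0] and only the trivial one for [c = 1]. *)
Lemma embG_mean c g : c = 0 \/ c = 1 ->
 meanon [set: 'M[Ab]_2] (fun Z => chi c (- Z o1 o0) * embG f (nu Z * g)%g) ((c == 1)%:R * f g).
move=> hc; have [l [ul cl hl]] := finite_cosets g se; have {hl} := hl f rf ef => hl.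
pose N : 'M[E]_2 := c *: dl01.
have -> : (c == 1)%:R * f g = \sum_(Y <- l | Y \in l) f (rep Y * g)%g * (eta (rep Y) == map_mx dg N)%:R.
 have [c0|c1] := hc.
  rewrite c0 eq_sym oner_eq0 mul0r big1 // => Y /cl cY.
  have [Q [-> Q0 _]] := st_eta_rat st (cosets_rat cY).
  by rewrite /N c0 scale0r (inj_eq dg_mx_inj) (negPf Q0) mulr0.
 have NE : map_mx dg N = dl01 by rewrite /N c1 scale1r map_delta_mx.
 have term (Y : set G) : Y \in l -> f (rep Y * g)%g * (eta (rep Y) == map_mx dg N)%:R =
   if Y == coset1 then f g else 0.
  move=> /cl cY; rewrite NE; have [->|n1] := eqVneq Y coset1.
   by rewrite f_coset1 ((eta_coset1 coset1P).2 erefl) eqxx mulr1.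
  by rewrite (_ : _ == _ = false) ?mulr0 //; apply: contra_neqF n1 => /eqP/(eta_coset1 cY).
 rewrite c1 eqxx mul1r (eq_bigr _ term) -big_mkcondr /=.
 have [l1|l1] := boolP (coset1 \in l).
  rewrite big_mkcond (bigD1_seq coset1) //= l1 eqxx big1 ?addr0 // => Y n1.
  by rewrite (negPf n1) andbF.
 rewrite big1 => [|Y /andP[Yl /eqP e1]]; last by rewrite -e1 Yl in l1.
 by rewrite -[LHS]f_coset1 hl //; exact: coset1P.
have key (Y : set G) : Y \in l -> meanon [set: 'M[Ab]_2]
  (fun Z => f (rep Y * g)%g * (chi c (- Z o1 o0) * chi 1 (\tr (eta (rep Y) *m Z))))
  (f (rep Y * g)%g * (eta (rep Y) == map_mx dg N)%:R).
 move=> /cl cY; apply: (meanonZ (sT _)); have [Q [-> _ _]] := st_eta_rat st (cosets_rat cY).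
 rewrite (inj_eq dg_mx_inj) -subr_eq0; apply: (mext _ (mean_tr (Q - N))) => Z _.
 rewrite map_mxB mulmxBl raddfB /= (chiD hpsi hw) mulrC; congr (_ * _).
 have -> : \tr (map_mx dg N *m Z) = dg c * Z o1 o0.
  rewrite /mxtrace big_ord_recl big_ord1 !mul2E !mxE /= !mulr0 !mulr1 rmorph0 !mul0r !add0r addr0.
  by congr (_ * Z _ _); apply: val_inj.
 by rewrite -mulrN chiM mul1r.
apply: (mext _ (mean_sum (sT _) _ key)) => Z _.
rewrite (embG_nu ul cl hl) mulr_sumr -big_seq; apply: eq_bigr => Y _.
by rewrite mulrC -mulrA.
Qed.

Lemma embG_nice : nice (embG f).
by apply: linv_nice; [exact: embG_rinv|exact: embG_linv]. Qed.

Lemma Pm_embG c g : c = 0 \/ c = 1 -> Pm c (embG f) g = (c == 1)%:R * f g.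
by move=> hc; apply: (PmE embG_nice); exact: embG_mean. Qed.

Hypothesis e0 : e != 0.

Lemma f_borel (Y : set G) : cosets Y -> eta (rep Y) o1 o0 = 0 -> exists2 c : F, red c != 0 &
 forall u g, f (rep Y * (U u * g))%g = chi e (dg (red c) * ared u) * f (rep Y * g)%g.
move=> cY h0; have [s [t [c [Ss rs -> rc hU]]]] := st_borel st (cosets_rat cY) h0.
exists c => // u g; rewrite -!mulgA !(St_rat_inv _ ef Ss rs) [(t * (U u * g))%g]mulgA hU -mulgA.
by rewrite (eqvar_U _ _ ef) aredM ared_dgA.
Qed.

(** The mean over the nilpotent part of U keeps the cosets whose matrix has (2,1) entry 0. Their
    representatives are Borel, and there [f] transforms under U by [chi e] rescaled by a nonzero
    factor, of mean 0 because [e] is nonzero. *)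
Lemma embG_cusp : cusp (embG f).
move=> g; have [l [ul cl hl]] := finite_cosets g se; have {hl} := hl f rf ef => hl.
pose B (Y : set G) := (eta (rep Y) o1 o0 == 0)%:R : C.
have e1 u : \sum_(Y \in cosets) B Y * f (rep Y * (U u * g))%g = \sum_(Y <- l) B Y * f (rep Y * (U u * g))%g.
 apply: sum_cosets => // Y cY Yl; rewrite /B; case: eqP => [h0|_]; last by rewrite mul0r.
 by have [c _ hc] := f_borel cY h0; rewrite hc hl // mulr0 mulr0.
have [m fm hm] := ax_lev ax g; have [s cs] := A_cover fm.
have [c hc] : exists c, meanon setT (fun u => embG f (U u * g)%g) c.
 apply: (@mean_periodic C _ _ (sT _) s (sumset (@principal _ _ _ M) (Slat m)) _ _ _ cs) => //.
  apply: sgp_sumset; last exact: Slat_sgp Sp_sgp m.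
  exact: principal_sgp.
 move=> _ u [_ [v [/principal_dgA[a ->] Sv ->]]] _.
 rewrite -addrA (UDA) (embG_linv _ (ax_rat_U ax a)) (addrC v) (ax_UD ax).
 by have [h1 _] := hm (embG f) (embG_rinv rf); exact: h1.
suff h : meanon [set: A] (fun u => \sum_(Y <- l) B Y * f (rep Y * (U u * g))%g) 0.
 have h2 := mean_fubini (j := eps) hc (m := fun u => \sum_(Y <- l) B Y * f (rep Y * (U u * g))%g).
 suff h3 : forall x, meanon [set: Ab] (fun b => embG f (U (eps b + x) * g)%g) (\sum_(Y <- l) B Y * f (rep Y * (U x * g))%g).
  by have -> : 0 = c by exact: (mean_uniq (sT _) h (h2 h3)).
 move=> x; have [l1 [ul1 cl1 hl1]] := finite_cosets (U x * g)%g se; have {hl1} := hl1 f rf ef => hl1.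
 rewrite -e1 (@sum_cosets _ l1) //; last by move=> Y cY Yl; rewrite hl1 // mulr0.
 rewrite big_seq; have key (Y : set G) : Y \in l1 -> meanon [set: Ab]
   (fun b => chi 1 (\tr (eta (rep Y) *m md o0 o1 b)) * f (rep Y * (U x * g))%g)
   (B Y * f (rep Y * (U x * g))%g).
  move=> /cl1 cY; have [Q [eQ _ _]] := st_eta_rat st (cosets_rat cY).
  have := meanonZ (sT _) (f (rep Y * (U x * g))%g) (mean_chi hpsi hw wy0 (Q o1 o0)).
  have -> : (Q o1 o0 == 0)%:R = B Y.
   by rewrite /B eQ mxE -(rmorph0 dg) (inj_eq dg_inj).
  rewrite mulrC; apply: mext => b _; rewrite mulrC; congr (_ * _).
  have -> : \tr (eta (rep Y) *m md o0 o1 b) = dg (Q o1 o0) * b.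
   rewrite eQ md01 /mxtrace big_ord_recl big_ord1 !mul2E !mxE /= !mulr0 !add0r.
   by rewrite addr0 (_ : lift o0 o0 = o1) //; apply: val_inj.
  by rewrite chiM mul1r.
 apply: (mext _ (mean_sum (sT _) _ key)) => b _.
 by rewrite (UDA) (U_epsA) (embG_nu ul1 cl1 hl1) -big_seq.
have key (Y : set G) : Y \in l -> meanon [set: A] (fun u => B Y * f (rep Y * (U u * g))%g) 0.
 move=> /cl cY; rewrite /B; case: eqP => [h0|_]; last first.
  by apply: (mext _ (mean_cst (sT _) 0)) => u _; rewrite mul0r.
 have [c' rc hc'] := f_borel cY h0.
 have h1 := mean_chi hpsi hw wy0 (e * red c'); rewrite mulf_eq0 (negPf e0) (negPf rc) in h1.
 have := meanonZ (sT _) (f (rep Y * g)%g) ((ared_mean _ _).2 h1); rewrite mulr0.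
 by apply: mext => u _ /=; rewrite hc' chiM mul1r mulrC.
have := mean_sum (sT _) l key; rewrite [X in meanon _ _ X -> _]big1 //.
by apply: mext => u _; rewrite -big_seq.
Qed.
End Equivariant.

(** * The decomposition in the abstract setting *)

Variable K : set G.
Hypothesis cgK : cg `<=` K.
Hypothesis two : 2%:R != 0 :> E.
(** [I] will be the space of differentials and [co] the coordinate with respect to a fixed
    generator. *)
Variables (I : eqType) (co : I -> E).
Hypotheses (co_inj : injective co) (co_surj : forall e, exists a, co a = e).
Hypothesis supp : forall e, e != 0 -> supported e.
Hypothesis suppf : exists r : seq E, forall f e, rinv f -> eqvar e f -> e != 0 -> (exists g, f g != 0) -> e \in r.

Definition Kinv f := forall g x, K x -> f (g * x)%g = f g.
Definition nu_inv f := forall Y g, f (nu Y * g)%g = f g.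
Definition aV f := [/\ linv f, Kinv f & cusp f].
Definition aVbar f := aV f /\ nu_inv f.
Definition aV1 f := aV f /\ forall g, meanon [set: Ab] (fun b => f (nu (md o0 o1 b) * g)%g) 0.
Definition fam (s : seq I) (phi : I -> G -> C) :=
 [/\ uniq s, forall a, a \in s -> co a != 0 & forall a, a \in s -> eqvar (co a) (phi a) /\ Kinv (phi a)].
Definition aVn f := exists s phi, fam s phi /\ f = \sum_(a <- s) embG (phi a).
Lemma Kinv_rinv f : Kinv f -> rinv f. by move=> h g x /cgK; exact: h. Qed.
Lemma aV_nice f : aV f -> nice f.
by move=> [lf kf _]; apply: linv_nice => //; exact: Kinv_rinv. Qed.

Lemma fct_sum (J : Type) (r : seq J) (F : J -> G -> C) g : (\sum_(j <- r) F j) g = \sum_(j <- r) F j g.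
by rewrite fct_sumE. Qed.

Lemma aV_lin c f f' : aV f -> aV f' -> aV (fun g => c * f g + f' g).
move=> [l1 k1 c1] [l2 k2 c2]; split=> [x g rx|g x Kx|g].
- by rewrite l1 // l2.
- by rewrite (k1 _ _ Kx) (k2 _ _ Kx).
- have := mean_lin (sT _) c (c1 g) (c2 g); by rewrite mulr0 addr0.
Qed.

Lemma aV_0 : aV (fun=> 0).
by split=> // g; exact: (mean_cst (sT _)). Qed.

Lemma aV_sum (J : eqType) (r : seq J) (F : J -> G -> C) : (forall j, j \in r -> aV (F j)) -> aV (\sum_(j <- r) F j).
elim: r => [|j r IH] h; first by rewrite big_nil; exact: aV_0.
rewrite big_cons; have hj := h j (mem_head _ _).
have hr : aV (\sum_(j <- r) F j) by apply: IH => i ir; apply: h; rewrite in_cons ir orbT.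
have -> : F j + \sum_(j <- r) F j = (fun g => 1 * F j g + (\sum_(j <- r) F j) g).
 by apply/funext => g; rewrite mul1r.
exact: aV_lin.
Qed.

Lemma aV_embG e f : e != 0 -> eqvar e f -> Kinv f -> aV (embG f).
move=> e0 ef kf; have rf := Kinv_rinv kf; split.
- exact: (embG_linv ef).
- exact: embG_rinv.
- exact: (embG_cusp rf ef (supp e0) e0).
Qed.

Lemma Pm_lin e c f f' g : aV f -> aV f' -> Pm e (fun g => c * f g + f' g) g = c * Pm e f g + Pm e f' g.
move=> hf hf'; have h := aV_nice (aV_lin c hf hf'); apply: (PmE h).
have := mean_lin (sT _) c (PmP e g (aV_nice hf)) (PmP e g (aV_nice hf')).
by apply: mext => Y _; ring.
Qed.

Lemma Pm_sum (J : eqType) e (r : seq J) (F : J -> G -> C) g : (forall j, j \in r -> aV (F j)) ->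
 Pm e (\sum_(j <- r) F j) g = \sum_(j <- r) Pm e (F j) g.
elim: r => [|j r IH] h.
 rewrite !big_nil; apply: (PmE (aV_nice aV_0)).
 by apply: (mext _ (mean_cst (sT _) 0)) => Y _; rewrite mulr0.
rewrite !big_cons; have hj := h j (mem_head _ _).
have hr' i : i \in r -> aV (F i) by move=> ir; apply: h; rewrite in_cons ir orbT.
have -> : F j + \sum_(j <- r) F j = (fun g => 1 * F j g + (\sum_(j <- r) F j) g).
 by apply/funext => x; rewrite mul1r.
by rewrite Pm_lin //; [rewrite mul1r IH|exact: aV_sum].
Qed.

Lemma aVn_V f : aVn f -> aV f.
move=> [s [phi [[us s0 hp] ->]]]; apply: aV_sum => a as_.
by have [ef kf] := hp a as_; exact: (aV_embG (s0 a as_)).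
Qed.

Lemma Pm_fam c s phi g : c = 0 \/ c = 1 -> fam s phi ->
 Pm c (\sum_(a <- s) embG (phi a)) g = (c == 1)%:R * \sum_(a <- s) phi a g.
move=> hc [us s0 hp]; rewrite Pm_sum.
 rewrite mulr_sumr; apply: eq_big_seq => a as_; have [ef kf] := hp a as_.
 exact: (Pm_embG (Kinv_rinv kf) ef (supp (s0 a as_))).
by move=> a as_; have [ef kf] := hp a as_; exact: (aV_embG (s0 a as_)).
Qed.

Lemma Pm_nu_inv f g : aVbar f -> Pm 0 f g = f g /\ Pm 1 f g = 0.
move=> [hV nf]; have hn := aV_nice hV; split.
 apply: (PmE hn); apply: (mext _ (mean_cst (sT _) (f g))) => Y _.
 by rewrite chi_0 // mul1r nf.
have [x hx] := chi_nontrivial hpsi hw wy0 (oner_neq0 E).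
have e1 := Pm_eigen 1 (mx2 0 0 x 0) g hn; rewrite mxE /= in e1.
have e2 : Pm 1 f (nu (mx2 0 0 x 0) * g)%g = Pm 1 f g.
 rewrite /Pm; congr (xget 0 _); apply/funext => c /=; congr (meanon _ _ c); apply/funext => Y.
 by rewrite !nf.
apply/eqP; move: e1; rewrite e2 => /eqP; rewrite -subr_eq0 -{1}[Pm 1 f g]mul1r -mulrBl mulf_eq0.
by rewrite subr_eq0 eq_sym (negPf hx).
Qed.

(** A rational element acting as the diagonal matrix with entries [e^-1] and 1 carries the
    coefficient at [e] to the one at 1; so the values 0 and 1 control all [e]. *)
Lemma Pm_torus e f g : aV f -> e != 0 -> (forall g, Pm 1 f g = 0) -> Pm e f g = 0.
move=> hV e0 h1; have hn := aV_nice hV; have [lf _ _] := hV.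
have hQ : gl2 (mx2 e^-1 0 0 1, mx2 e 0 0 1) by apply: dgl_pred; rewrite mulVf.
have [x rx hx] := ax_rat_conj ax hQ.
rewrite -(h1 (x * g)%g); apply/esym; apply: (Pm_conj g hn lf rx hQ hx) => Y.
rewrite !map_mx_mx2 !mul2E !mxE /= !rmorph0 !rmorph1 !mul0r !mul1r !mulr0 !add0r !addr0.
by rewrite mulrC -mulrN chiM mul1r.
Qed.

(** Strong cuspidality is tested on the two coefficients that the decomposition isolates. The way
    back goes through [nil_mean_Pm], hence through division by 2. *)
Lemma aV1_Pm f : aV1 f <-> aV f /\ forall g, Pm 0 f g = 0 /\ Pm 1 f g = 0.
split=> [[hV h]|[hV h]].
 have hn := aV_nice hV; split=> // g.
 have h0 x : Pd o0 o1 0 f x = 0.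
  apply: (PdE hn); apply: (mext _ (h x)) => b _.
  by rewrite chi_0 // mul1r.
 by split; exact: (Pm_strong _ _ hn).
have [lf kf cf] := hV; have hn := aV_nice hV; split=> // g.
have e0 := nil_mean_Pm two (Kinv_rinv kf) lf cf (g := g).
have := PdP o0 o1 0 g hn; rewrite e0.
 by apply: mext => b _; rewrite chi_0 // mul1r.
move=> e; have [->|en] := eqVneq e 0; first by case: (h g).
by apply: Pm_torus => // x; case: (h x).
Qed.

(** The members transform under distinct characters of U, so one coefficient along U extracts one
    member. *)
Lemma Pu_fam s phi a g : fam s phi ->
 Pu (co a) (fun x => \sum_(b <- s) phi b x) g = if a \in s then phi a g else 0.
move=> [us s0 hp].
have hm : meanon [set: Ab] (fun x => chi (co a) (- x) * \sum_(b <- s) phi b (U (lftA x) * g)%g)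
  (\sum_(b <- s | b \in s) phi b g * (co b - co a == 0)%:R).
 have key b : b \in s -> meanon [set: Ab] (fun x => chi (co a) (- x) * phi b (U (lftA x) * g)%g)
   (phi b g * (co b - co a == 0)%:R).
  move=> bs; have [ef _] := hp b bs.
  have := meanonZ (sT _) (phi b g) (mean_chi hpsi hw wy0 (co b - co a)).
  apply: mext => x _.
  rewrite (eqvar_U _ _ ef) lftAP // (chi_add hpsi hw) chi_opp; ring.
 apply: (mext _ (mean_sum (sT _) _ key)) => x _.
 by rewrite mulr_sumr [RHS]big_seq.
have -> : Pu (co a) (fun x => \sum_(b <- s) phi b x) g = \sum_(b <- s | b \in s) phi b g * (co b - co a == 0)%:R.
 apply: (mean_uniq (sT _) _ hm).
 exact: (@xgetI _ 0 [set c | meanon [set: Ab] (fun x => chi (co a) (- x) * \sum_(b <- s) phi b (U (lftA x) * g)%g) c] _ hm).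
rewrite -big_seq; case: ifPn => as_.
 rewrite (bigD1_seq a) //= subrr eqxx mulr1 big1 ?addr0 // => b ba.
 by rewrite subr_eq0 (inj_eq co_inj) (negPf ba) mulr0.
rewrite big_seq big1 // => b bs; rewrite subr_eq0 (inj_eq co_inj).
by rewrite (_ : b == a = false) ?mulr0 //; apply: contraNF as_ => /eqP <-.
Qed.

Lemma fam_uniq s phi phi' : fam s phi -> fam s phi' ->
 \sum_(a <- s) embG (phi a) = \sum_(a <- s) embG (phi' a) -> forall a, a \in s -> phi a = phi' a.
move=> hf hf' e a as_; apply/funext => g.
have e1 : (fun x => \sum_(b <- s) phi b x) = (fun x => \sum_(b <- s) phi' b x).
 apply/funext => x; have h1 := @Pm_fam 1 s phi x (or_intror erefl) hf.
 have := @Pm_fam 1 s phi' x (or_intror erefl) hf'.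
 by rewrite -e h1 eqxx !mul1r.
by have := Pu_fam a g hf; rewrite e1 (Pu_fam a g hf') as_.
Qed.

(** Each element is recovered from its [Pm 1] by a formula valid over any duplicate-free list
    containing its indices, so two elements can be compared over the union of their lists. *)
Lemma aVn_eq f f' : aVn f -> aVn f' -> (forall g, Pm 1 f g = Pm 1 f' g) -> f = f'.
have rep f0 s phi L : fam s phi -> f0 = \sum_(a <- s) embG (phi a) -> uniq L -> {subset s <= L} ->
  f0 = \sum_(a <- L) embG (Pu (co a) (Pm 1 f0)).
 move=> hf -> uL sL; have [us _ _] := hf.
 have e1 : Pm 1 (\sum_(a <- s) embG (phi a)) = (fun x => \sum_(b <- s) phi b x).
  by apply/funext => x; rewrite Pm_fam //; [rewrite eqxx mul1r|right].
 have e2 a : embG (Pu (co a) (Pm 1 (\sum_(a <- s) embG (phi a)))) = if a \in s then embG (phi a) else 0.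
  rewrite e1; have [as_|as_] := boolP (a \in s).
   by congr embG; apply/funext => g; rewrite (Pu_fam a g hf) as_.
  apply/funext => g; rewrite /embG; apply: fsbig1 => Y _.
  by rewrite (Pu_fam a _ hf) (negPf as_).
 rewrite (eq_bigr _ (fun a _ => e2 a)) -big_mkcond /= -[RHS]big_filter.
 apply: perm_big; apply: uniq_perm; rewrite ?filter_uniq // => a.
 by rewrite mem_filter; case: (boolP (a \in s)) => // /sL ->.
move=> [s [phi [hf e]]] [s' [phi' [hf' e']]] h.
rewrite (rep f s phi (undup (s ++ s')) hf e (undup_uniq _)); last first.
 by move=> a as_; rewrite mem_undup mem_cat as_.
rewrite [RHS](rep f' s' phi' (undup (s ++ s')) hf' e' (undup_uniq _)); last first.
 by move=> a as_; rewrite mem_undup mem_cat as_ orbT.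
by have -> : Pm 1 f = Pm 1 f' by apply/funext.
Qed.

(** [Pm 0] sees only the first summand; [Pm 1] vanishes on the first and third and determines the
    second. *)
Lemma sum_uniq f0 f1 f2 f0' f1' f2' : aVbar f0 -> aVn f1 -> aV1 f2 -> aVbar f0' -> aVn f1' -> aV1 f2' ->
 f0 + f1 + f2 = f0' + f1' + f2' -> [/\ f0 = f0', f1 = f1' & f2 = f2'].
have pr c x0 x1 x2 g : c = 0 \/ c = 1 -> aVbar x0 -> aVn x1 -> aV1 x2 ->
  Pm c (x0 + x1 + x2) g = Pm c x0 g + Pm c x1 g.
 move=> hc [v0 _] /aVn_V v1 h2; have [v2 p2] := (aV1_Pm x2).1 h2.
 have -> : x0 + x1 + x2 = (fun x => 1 * (1 * x0 x + x1 x) + x2 x).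
  by apply/funext => x; rewrite !mul1r.
 rewrite (Pm_lin _ _ _ (aV_lin 1 v0 v1) v2) Pm_lin // !mul1r.
 by have [p0 p1] := p2 g; case: hc => ->; rewrite ?p0 ?p1 addr0.
have p0n x1 g : aVn x1 -> Pm 0 x1 g = 0.
 by move=> [s [phi [hf ->]]]; rewrite Pm_fam //; [rewrite eq_sym oner_eq0 mul0r|left].
move=> b0 n1 v2 b0' n1' v2' e.
have e0 : f0 = f0'.
 apply/funext => g; have := pr 0 f0 f1 f2 g (or_introl erefl) b0 n1 v2.
 rewrite e (pr 0 f0' f1' f2' g (or_introl erefl) b0' n1' v2') (p0n f1' g n1') (p0n f1 g n1) !addr0.
 by rewrite (Pm_nu_inv g b0).1 (Pm_nu_inv g b0').1.
have e1 : f1 = f1'.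
 apply: aVn_eq => // g; have := pr 1 f0 f1 f2 g (or_intror erefl) b0 n1 v2.
 rewrite e (pr 1 f0' f1' f2' g (or_intror erefl) b0' n1' v2').
 by rewrite (Pm_nu_inv g b0).2 (Pm_nu_inv g b0').2 !add0r.
by split=> //; move: e; rewrite e0 e1 => /addrI.
Qed.

(** [Pm 0] gives [f0]; the pieces of [Pm 1] along U, summed over cosets, give [f1]. Both
    coefficients of the remainder vanish, which is the criterion [aV1_Pm]. *)
Lemma decomposition f : aV f -> exists f0 f1 f2, [/\ aVbar f0, aVn f1, aV1 f2 & f = f0 + f1 + f2].
move=> hV; have [lf kf cf] := hV; have hn := aV_nice hV; have rf := Kinv_rinv kf.
pose f0 := Pm 0 f; have b0 : aVbar f0.
 split; last by move=> Y g; rewrite /f0 (Pm_eigen) // chi_0 // mul1r.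
 split; [|exact: Pm_right|exact: (cusp_Pm two rf lf cf 0)].
 move=> x g rx; have [Q [Q' [hQ hx]]] := ax_rat_mx ax rx.
 by apply: (Pm_conj g hn lf rx hQ hx) => Y; rewrite !chi_0.
pose phi := Pm 1 f.
have kphi : Kinv phi by apply: Pm_right.
have rphi : rinv phi := Kinv_rinv kphi.
have nuphi Y g : phi (nu Y * g)%g = chi 1 (Y o1 o0) * phi g := Pm_eigen 1 Y g hn.
have nphi : U_nil phi by move=> b g; rewrite nuphi md01 mxE /= (chi0 hpsi hw) mul1r.
have qphi : U_rat phi.
 move=> a g; have hQ := unip_pred (red a).
 apply: (Pm_conj g hn lf (ax_rat_U ax a) hQ) => Y.
  rewrite (ax_U_nu ax) ared_dgA !map_mx_mx2 rmorph0 rmorph1 rmorphN //.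
 rewrite !map_mx_mx2 !mul2E !mxE /= !rmorph0 !rmorph1 !mul0r !mul1r !mulr0 !mulr1 !add0r !addr0.
 by [].
have cphi : cusp phi := cusp_Pm two rf lf cf 1.
have hP g := (U_expansion g rphi nphi qphi).1.
have Ulft u g := U_lft u g nphi.
have P0 g : Pu 0 phi g = 0.
 apply: (mean_uniq (sT _) (hP g 0)); apply/ared_mean.
 apply: (mext _ (cphi g)) => u _ /=.
 by rewrite chi_0 // mul1r -Ulft.
have eP e : eqvar e (Pu e phi).
 move=> Y u g; apply: (mean_uniq (sT _) (hP _ e)).
 have := meanonZ (sT _) (chi 1 (Y o1 o0) * chi e (ared u)) (mean_shift (sT _) Logic.I (hP g e) (h := ared u)).
 apply: mext => x _.
 have e2 : phi (U (lftA x) * (nu Y * U u * g))%g = chi 1 (Y o1 o0) * phi (U (lftA (ared u + x)) * g)%g.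
  rewrite -mulgA (U_nuA) nuphi -(UDA) [LHS]mulrC [RHS]mulrC; congr (_ * _).
   by rewrite [LHS]Ulft aredD lftAP // addrC.
  by rewrite lftAP // !mul2E !mxE /= !mul0r !mulr0 !mulr1 !mul1r !add0r !addr0.
 have e3 : chi e (ared u) * chi e (- (ared u + x)) = chi e (- x).
  by rewrite opprD (chiD hpsi hw) mulrA (chiN hpsi hw) mul1r.
 rewrite e2 -e3; ring.
have [ic hic] := choice co_surj; have [r hr] := suppf.
pose L := undup [seq e <- r | e != 0]; pose s := map ic L.
have uL : uniq L by exact: undup_uniq.
have us : uniq s by rewrite map_inj_uniq // => a b e; rewrite -(hic a) e hic.
have fs : fam s (fun a => Pu (co a) phi).
 split=> // a; first by move=> /mapP[e]; rewrite mem_undup mem_filter => /andP[e0 _] ->; rewrite hic.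
 by move=> _; split; [exact: eP|exact: Pu_right].
(* The expansion at [g] comes with a list depending on [g], while [suppf] gives one list for all
   [g]; the two sums are compared on their nonzero terms. *)
have sumphi g : \sum_(a <- s) Pu (co a) phi g = phi g.
 rewrite big_map (eq_bigr (fun e => Pu e phi g)) => [|e _]; last by rewrite hic.
 have [_ [s' [us' h0 hx]]] := U_expansion g rphi nphi qphi.
 have U0 : U 0 = 1%g by apply: (mulgI (U 0)); rewrite -(ax_UD ax) addr0 mulg1.
 have := hx 0; rewrite U0 mul1g => ->.
 have a0 : ared (0 : A) = 0 := ared0.
 rewrite [RHS](eq_bigr (fun e => Pu e phi g)) => [|e _]; last by rewrite a0 (chi0 hpsi hw) mulr1.
 pose N := [seq e <- L | Pu e phi g != 0].
 have sub l : uniq l -> (forall e, e \notin l -> Pu e phi g = 0) ->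
   \sum_(e <- l) Pu e phi g = \sum_(e <- [seq e <- l | Pu e phi g != 0]) Pu e phi g.
  by move=> _ _; rewrite big_filter [RHS]big_mkcond; apply: eq_bigr => e _; case: eqP.
 have hL e : e \notin L -> Pu e phi g = 0.
  move=> eL; apply/eqP/negPn/negP => n0; move/negP: eL; apply; rewrite mem_undup mem_filter.
  have e0 : e != 0 by apply: contraNneq n0 => ->; rewrite P0.
  by rewrite e0 /=; apply: (hr _ _ _ (eP e) e0); [apply: Kinv_rinv; exact: Pu_right|exists g].
 rewrite (sub L uL hL) (sub s' us' h0); apply: perm_big; apply: uniq_perm; rewrite ?filter_uniq // => e.
 rewrite !mem_filter /=; case: (eqVneq (Pu e phi g) 0) => //= n0.
 have -> : e \in L by apply: contraNT n0 => /hL ->.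
 by apply/esym; apply: contraNT n0 => /h0 ->.
pose f1 := \sum_(a <- s) embG (Pu (co a) phi).
have n1 : aVn f1 by exists s, (fun a => Pu (co a) phi).
pose f2 := fun g => -1 * f0 g + (-1 * f1 g + f g).
have v01 := aV_lin (-1) (aVn_V n1) hV; have v2 : aV f2 := aV_lin (-1) b0.1 v01.
exists f0, f1, f2; split=> //; last by apply/funext => g; rewrite /f2 /= !fctE; ring.
apply/aV1_Pm; split=> // g; split.
 rewrite (Pm_lin _ _ _ b0.1 v01) (Pm_lin _ _ _ (aVn_V n1) hV) (Pm_nu_inv g b0).1.
 rewrite (@Pm_fam 0 s _ g (or_introl erefl) fs) eq_sym oner_eq0 /= ?mulr0n ?mul0r /f0; ring.
rewrite (Pm_lin _ _ _ b0.1 v01) (Pm_lin _ _ _ (aVn_V n1) hV) (Pm_nu_inv g b0).2.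
rewrite (@Pm_fam 1 s _ g (or_intror erefl) fs) eqxx sumphi /= ?mul1r /phi; ring.
Qed.

Section Hecke.
Variables (N : nat) (c : 'I_N -> C) (xs : 'I_N -> G) (act : (G -> C) -> G -> C).
Hypothesis actE : forall f, Kinv f -> forall g, act f g = \sum_i c i * f (g * xs i)%g.
Hypothesis actK : forall f, Kinv f -> Kinv (act f).

Lemma act_mean (T : zmodType) (a : T -> G) f g : Kinv f -> (forall g, meanon [set: T] (fun t => f (a t * g)%g) 0) ->
 meanon [set: T] (fun t => act f (a t * g)%g) 0.
move=> kf h; have key i : true -> meanon [set: T] (fun t => c i * f (a t * (g * xs i))%g) (c i * 0).
 by move=> _; exact: (meanonZ (sT _)).
have := mean_sum (sT _) (index_enum 'I_N) key; rewrite big1 => [|i _]; last by rewrite mulr0.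
apply: mext => t _; rewrite actE //; apply: eq_bigr => i _.
by rewrite mulgA.
Qed.

Lemma act_V f : aV f -> aV (act f).
move=> [lf kf cf]; split=> [x g rx||g]; [|exact: actK|].
 by rewrite !actE //; apply: eq_bigr => i _; rewrite -mulgA (lf _ _ rx).
exact: act_mean.
Qed.

Lemma act_Vbar f : aVbar f -> aVbar (act f).
move=> [hV nf]; have [_ kf _] := hV; split; first exact: act_V.
by move=> Y g; rewrite !actE //; apply: eq_bigr => i _; rewrite -mulgA nf.
Qed.

Lemma act_V1 f : aV1 f -> aV1 (act f).
move=> [hV nf]; have [_ kf _] := hV; split=> [|g]; first exact: act_V.
exact: (@act_mean _ (fun b => nu (md o0 o1 b))).
Qed.

Lemma act_eqvar e f : Kinv f -> eqvar e f -> eqvar e (act f).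
move=> kf ef Y u g; rewrite !actE // mulr_sumr; apply: eq_bigr => i _.
by rewrite -mulgA ef; ring.
Qed.

(** The lists of cosets for the translates [g * xs i] are merged, after which the two sums are
    finite and can be exchanged. *)
Lemma act_embG e f : e != 0 -> Kinv f -> eqvar e f -> act (embG f) = embG (act f).
move=> e0 kf ef; apply/funext => g.
have kE : Kinv (embG f) by apply: embG_rinv.
have /choice[l hl] : forall i, exists l : seq (set G), [/\ uniq l, forall Y : set G, Y \in l -> cosets Y
 & forall f, rinv f -> eqvar e f -> forall Y : set G, cosets Y -> Y \notin l -> f (rep Y * (g * xs i))%g = 0].
 by move=> i; exact: (finite_cosets (g * xs i)%g (supp e0)).
pose L := undup (flatten [seq l i | i : 'I_N]).
have cL (Y : set G) : Y \in L -> cosets Y.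
 by rewrite mem_undup => /flattenP[_ /mapP[i _ ->]]; have [_ h _] := hl i; exact: h.
have hL i (Y : set G) : cosets Y -> Y \notin L -> f (rep Y * (g * xs i))%g = 0.
 move=> cY; rewrite mem_undup => nY; have [_ _ h] := hl i; apply: h => //; first exact: Kinv_rinv.
 apply: contraNN nY => Yi; apply/flattenP; exists (l i) => //; apply/mapP; exists i => //; exact: mem_enum.
have uL : uniq L := undup_uniq _.
rewrite actE // /embG (@sum_cosets (fun Y : set G => act f (rep Y * g)%g) L uL cL).
 rewrite (eq_bigr (fun i => \sum_(Y <- L) c i * f (rep Y * (g * xs i))%g)) => [|i _].
  rewrite exchange_big /=; apply: eq_bigr => Y _; rewrite actE //; apply: eq_bigr => i _.
  by rewrite mulgA.
 by rewrite (@sum_cosets (fun Y : set G => f (rep Y * (g * xs i))%g) L uL cL) ?mulr_sumr //; exact: hL.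
move=> Y cY YL; rewrite actE // big1 // => i _; rewrite -mulgA hL ?mulr0 //.
Qed.

Lemma act_Vn f : aVn f -> aVn (act f).
move=> [s [phi [[us s0 hp] ->]]]; exists s, (fun a => act (phi a)); split.
 split=> // a as_; have [ef kf] := hp a as_; split; [exact: act_eqvar|exact: actK].
have kE a : a \in s -> Kinv (embG (phi a)) by move=> as_; have [_ kf] := hp a as_; apply: embG_rinv.
have kS : Kinv (\sum_(a <- s) embG (phi a)).
 by have [] : aV (\sum_(a <- s) embG (phi a)) by apply: aVn_V; exists s, phi.
apply/funext => g; rewrite actE // fct_sum.
rewrite (eq_bigr (fun i => \sum_(a <- s) c i * embG (phi a) (g * xs i)%g)) => [|i _]; last first.
 by rewrite fct_sum mulr_sumr.
rewrite exchange_big /=; apply: eq_big_seq => a as_; have [ef kf] := hp a as_.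
by rewrite -(act_embG (s0 a as_)) // actE //; exact: kE.
Qed.
End Hecke.
End AbstractGroup.

(** * PGL_2 of the adeles: kernel of reduction, rational points, stabilizer *)

Notation G := (PGL2A M).
Notation Gb := (PGL2A Mb).
Notation gred := (gred (D := D)).
Implicit Types (g h : G) (Y Z : 'M[Ab]_2).

Lemma ared_surj (y : Ab) : exists x, ared x = y. by exists (lftA y); exact: lftAP. Qed.
Lemma ared_sq0 (a b : A) : ared a = 0 -> ared b = 0 -> a * b = 0.
by move=> /nilA_eps[x ->] /nilA_eps[y ->]; exact: eps_mul0. Qed.

Lemma gredM g h : gred (g * h)%g = (gred g * gred h)%g. exact: pgl_mapM. Qed.
Lemma gredV g : gred g^-1%g = (gred g)^-1%g. exact: pgl_mapV. Qed.
Lemma gred_unip (x : A) : gred (unip x) = unip (ared x). exact: pgl_map_unip. Qed.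
Lemma gred_pgl (B B' : 'M[A]_2) : gl2 (B, B') -> gred (pgl B) = pgl (map_mx ared B).
exact: pgl_mapE. Qed.
Lemma gred_surj (y : Gb) : exists x, gred x = y. exact: pgl_map_surj ared_surj ared_sq0 y. Qed.
(** All 2 by 2 matrices are allowed, and scalar ones act trivially by [nu_scalar]; this presents the
    Lie algebra of PGL_2 as matrices modulo scalars. *)
Definition nu Y : G := pgl (1%:M + map_mx eps Y).
Lemma map_ared_eps Y : map_mx ared (map_mx eps Y) = 0.
by apply/matrixP => i j; rewrite !mxE ared_eps. Qed.

Lemma nu_pred Y : gl2 (1%:M + map_mx eps Y, 1%:M - map_mx eps Y).
exact: nil_mx_pred ared_sq0 _ (map_ared_eps Y). Qed.

Lemma nuD Y Z : nu (Y + Z) = (nu Y * nu Z)%g.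
rewrite /nu -(pglM (nu_pred Y) (nu_pred Z)) mulmxDl mul1mx mulmxDr mulmx1.
by rewrite (nil_mx_mul0 ared_sq0 (map_ared_eps Y) (map_ared_eps Z)) addr0 map_mxD -addrA [_ + map_mx eps Y]addrC.
Qed.

Lemma nu0 : nu 0 = 1%g. by rewrite /nu map_mx0 addr0 pgl1. Qed.
Lemma eps_mull (B : 'M[A]_2) Y : B *m map_mx eps Y = map_mx eps (map_mx ared B *m Y).
by apply/matrixP => i j; rewrite !mxE raddf_sum; apply: eq_bigr => l _; rewrite !mxE epsM. Qed.

Lemma eps_mulr (B : 'M[A]_2) Y : map_mx eps Y *m B = map_mx eps (Y *m map_mx ared B).
by apply/matrixP => i j; rewrite !mxE raddf_sum; apply: eq_bigr => l _; rewrite !mxE mulrC epsM mulrC.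
Qed.

Lemma nu_conj (B B' : 'M[A]_2) Y : gl2 (B, B') ->
 (pgl B * nu Y = nu (map_mx ared B *m Y *m map_mx ared B') * pgl B)%g.
move=> h; rewrite /nu -(pglM h (nu_pred Y)) -(pglM (nu_pred _) h); congr pgl.
rewrite mulmxDr mulmx1 mulmxDl mul1mx; congr (_ + _).
rewrite eps_mull eps_mulr -mulmxA -map_mxM (mulmx1C (gl2_1 h)) map_mx1 mulmx1.
by [].
Qed.

Lemma nu_conj_unip (u : A) Y : (unip u * nu Y = nu (mx2 1 (ared u) 0 1 *m Y *m mx2 1 (- ared u) 0 1) * unip u)%g.
by rewrite unipE (nu_conj Y (unip_pred u)) !map_mx_mx2 ared0 ared1 aredN. Qed.

Lemma nu_scalar (b : Ab) : nu b%:M = 1%g.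
have e0 : map_mx eps b%:M = ((eps b)%:M : 'M[A]_2) by apply/matrixP => i j; rewrite !mxE raddfMn.
have e1 : 1%:M + (eps b)%:M = (1 + eps b) *: (1%:M : 'M[A]_2) by rewrite scalemx1 raddfD.
rewrite /nu e0 e1 -pgl1.
apply: (pgl_scale (d := 1 - eps b) (gl2_oneP _)).
have := eps_mul0 b b; move=> e; rewrite mulrDl mul1r mulrBr mulr1 e subr0.
by rewrite subrK.
Qed.

Lemma unip_eps (b : Ab) : unip (eps b) = nu (b *: dl01).
congr pgl; congr (_ + _); apply/matrixP => i j; rewrite !mxE.
by case: andP => _; rewrite ?mulr1 // !mulr0 raddf0.
Qed.

Lemma NA_nu g : NA g <-> exists Y, g = nu Y.
split=> [gg|[Y ->]]; last first.
 rewrite /NA /= (gred_pgl (nu_pred Y)) map_mxD map_mx1 map_ared_eps addr0; exact: pgl1.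
have [N eN ->] := pgl_map_ker ared_surj ared_sq0 gg.
have /choice[f hf] : forall ij : 'I_2 * 'I_2, exists y, N ij.1 ij.2 = eps y.
 by move=> [i j]; apply/nilA_eps; have /matrixP/(_ i j) := eN; rewrite !mxE.
exists (\matrix_(i, j) f (i, j)); congr (pgl (_ + _)); apply/matrixP => i j.
by rewrite !mxE (hf (i, j)).
Qed.

Lemma nu_inj21 Y Z : nu Y = nu Z -> Y o1 o0 = Z o1 o0.
move=> /(pgl_eq (nu_pred Y) (nu_pred Z))[c [d [cd /matrixP e]]].
have c1 : ared c = 1.
 have := congr1 ared (e o0 o0); rewrite !mxE /= aredM !aredD !ared_eps ared1.
 by rewrite !addr0 mulr1 => ->.
have := e o1 o0; rewrite !mxE /= !mulr0n !add0r epsM c1 mul1r.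
exact: eps_inj.
Qed.

Lemma gred_eq g h : gred g = gred h -> exists Y, g = (nu Y * h)%g.
move=> e; have /NA_nu[Y eY] : NA (g * h^-1)%g by rewrite /NA /= gredM gredV e mulgV.
by exists Y; rewrite -eY mulgKV.
Qed.

Lemma gred_nu Y : gred (nu Y) = 1%g. by have /NA_nu : exists Z, nu Y = nu Z by exists Y. Qed.

Notation rat := (@PGL2_rat _ _ _ M).

Lemma ratP g : rat g <-> exists P P' : 'M[F]_2, gl2 (P, P') /\ g = pgl (map_mx dgA P).
split=> [[P [B [[P' PP'] hB ->]]]|[P [P' [h ->]]]].
 exists P, P'; split; first exact: gl2P.
 by congr pgl; apply/matrixP => i j; rewrite mxE; apply/diagonal_dgA.
exists P, (map_mx dgA P); split=> //; first by exists P'; exact: gl2_1 h.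
by move=> i j; rewrite mxE; apply/diagonal_dgA.
Qed.

Lemma rat1 : rat 1%g.
by apply/ratP; exists 1%:M, 1%:M; rewrite map_mx1 pgl1; split=> //; exact: gl2_oneP. Qed.

Lemma ratM g h : rat g -> rat h -> rat (g * h)%g.
move=> /ratP[P [P' [hP ->]]] /ratP[Q [Q' [hQ ->]]]; apply/ratP; exists (P *m Q), (Q' *m P').
split; first exact: gl2M.
by rewrite map_mxM -(pglM (gl2_map dgA hP) (gl2_map dgA hQ)).
Qed.

Lemma ratV g : rat g -> rat g^-1%g.
move=> /ratP[P [P' [hP ->]]]; apply/ratP; exists P', P; split; first exact: gl2C.
exact: pglV (gl2_map dgA hP).
Qed.

Lemma rat_unip f : rat (unip (dgA f)).
apply/ratP; exists (mx2 1 f 0 1), (mx2 1 (- f) 0 1); split; first exact: unip_pred.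
by rewrite map_mx_mx2 rmorph0 rmorph1 unipE.
Qed.

Lemma rat_nu (Q : 'M[E]_2) : rat (nu (map_mx dg Q)).
have /choice[s hs] := sred_surj X.
have nn (x y : F) : (x * nilgen) * (y * nilgen) = 0.
 have [rn _ _] := nilgenP; by rewrite mulrACA (snil_sq0 rn rn) mulr0.
pose N := \matrix_(i, j) (s (Q i j) * nilgen) : 'M[F]_2.
apply/ratP; exists (1%:M + N), (1%:M - N); split.
 apply: gl2P; have -> : (1%:M + N) *m (1%:M - N) = 1%:M - N *m N.
  by rewrite mulmxDl mul1mx mulmxBr mulmx1 addrA subrK.
 suff -> : N *m N = 0 by rewrite subr0.
 by apply: mx2P; rewrite mul2E !mxE !nn addr0.
rewrite map_mxD map_mx1; congr (pgl (_ + _)); apply/matrixP => i j.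
by rewrite !mxE -{1}(hs (Q i j)) eps_dg.
Qed.

Lemma rat_lift (Q Q' : 'M[E]_2) : gl2 (Q, Q') -> exists B B' : 'M[A]_2,
 [/\ gl2 (B, B'), rat (pgl B), map_mx ared B = map_mx dg Q & map_mx ared B' = map_mx dg Q'].
move=> /(gl2_lift (sred_surj X) (@snil_sq0 _ _ _ X))[P [P' [h <- <-]]].
exists (map_mx dgA P), (map_mx dgA P'); split; first exact: gl2_map.
- by apply/ratP; exists P, P'.
- by apply/matrixP => i j; rewrite !mxE ared_dgA.
- by apply/matrixP => i j; rewrite !mxE ared_dgA.
Qed.

Lemma rat_red g : rat g -> exists (B B' : 'M[A]_2) (Q Q' : 'M[E]_2),
 [/\ gl2 (B, B'), g = pgl B, gl2 (Q, Q'), map_mx ared B = map_mx dg Q & map_mx ared B' = map_mx dg Q'].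
move=> /ratP[P [P' [h ->]]]; exists (map_mx dgA P), (map_mx dgA P'), (map_mx red P), (map_mx red P').
split=> //; try exact: gl2_map; by apply/matrixP => i j; rewrite !mxE ared_dgA.
Qed.

Lemma rat_bar_lift (x : Gb) : @PGL2_rat _ _ _ Mb x -> exists2 g, rat g & gred g = x.
move=> [Q [B [[Q' h] hB ->]]]; have [B1 [B1' [hB1 rB e _]]] := rat_lift (gl2P h).
exists (pgl B1) => //; rewrite (gred_pgl hB1) e; congr pgl; apply/matrixP => i j.
by apply: aval_inj => p; rewrite mxE hB.
Qed.

Lemma rat_gred g : rat g -> @PGL2_rat _ _ _ Mb (gred g).
move=> /rat_red[B [B' [Q [Q' [hB -> hQ e _]]]]]; rewrite (gred_pgl hB) e.
exists Q, (map_mx dg Q); split=> //; first by exists Q'; exact: gl2_1 hQ.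
by move=> i j p; rewrite mxE.
Qed.

(* [gbar^-1 e_12 gbar], whose stabilizer is [St] *)
Definition eta g : 'M[Ab]_2 := map_mx ared (gmxV (generic_quotient.repr g)) *m
 dl01 *m map_mx ared (gmx (generic_quotient.repr g)).

Lemma eta_pgl (B B' : 'M[A]_2) : gl2 (B, B') ->
 eta (pgl B) = map_mx ared B' *m dl01 *m map_mx ared B.
move=> h; rewrite /eta; set r := generic_quotient.repr _.
have [c [d [cd e]]] := (pi_pglP _ _).1 (etrans (pi_pgl_repr (pgl B)) (pgl_pi h)).
rewrite -/r in e; have e1 : gmx r = c *: B by [].
have e2 : gmxV r = d *: B'.
 have : B' *m (gmx r *m gmxV r) = B' by rewrite gmxK mulmx1.
 rewrite e1 -scalemxAl -scalemxAr mulmxA (mulmx1C (gl2_1 h)) mul1mx => <-.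
 by rewrite scalerA mulrC cd scale1r.
rewrite e1 e2 !map_mxZ -!scalemxAl -scalemxAr scalerA -aredM mulrC cd ared1 scale1r.
by [].
Qed.

Lemma etaM g (B B' : 'M[A]_2) : gl2 (B, B') ->
 eta (g * pgl B)%g = map_mx ared B' *m eta g *m map_mx ared B.
move=> h; have [H [H' [hH ->]]] := pgl_ex g.
by rewrite -(pglM hH h) (eta_pgl (gl2M hH h)) (eta_pgl hH) !map_mxM !mulmxA.
Qed.

Lemma e12E : dl01 = mx2 0 1 0 0 :> 'M[Ab]_2.
by apply: mx2P; rewrite !mxE. Qed.

(** An element fixing e_12 reduces to an upper triangular matrix with equal diagonal entries;
    rescaled, it is unipotent, and the remaining factor lies in the kernel of reduction. *)
Lemma St_eta g : St g <-> eta g = dl01.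
have eta_nu Y : eta (nu Y) = dl01.
 rewrite (eta_pgl (nu_pred Y)) !map_mxD map_mxN map_mx1 map_ared_eps.
 by rewrite subr0 addr0 mul1mx mulmx1.
split=> [[n [u [/NA_nu[Y ->] [x _ <-] ->]]]|].
 rewrite unipE (etaM _ (unip_pred x)) eta_nu !map_mx_mx2 ared0 ared1 e12E !mul_mx2.
 by congr mx2; ring.
have [B [B' [h ->]]] := pgl_ex g; rewrite (eta_pgl h) => e.
have hb := gl2_map ared h; set b := map_mx ared B in e hb *.
have {}e : dl01 *m b = b *m dl01.
 by rewrite -[in RHS]e !mulmxA (gl2_1 hb) mul1mx.
have [a [x eb]] : exists a x, b = mx2 a x 0 a.
 exists (b o0 o0), (b o0 o1); move: e; rewrite [b]mx2E e12E !mul_mx2.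
 by move=> /mx2_inj[]; rewrite !mxE /= !mul0r !mulr0 !mul1r !mulr1 !add0r !addr0 => -> -> _ _.
have [a' aa'] : exists a', a * a' = 1.
 have := gl2_1 hb; rewrite eb [map_mx _ B']mx2E mul_mx2 scalar_mx2 => /mx2_inj[_ _ _].
 by rewrite mul0r add0r; exists (map_mx ared B' o1 o1).
have [|Y eY] := @gred_eq (pgl B) (unip (lftA (x * a'))).
 have e1 : gred (pgl B) = pgl b := gred_pgl h.
 have e2 : gred (unip (lftA (x * a'))) = unip (x * a').
  by rewrite gred_unip; congr unip; exact: lftAP.
 apply: (etrans e1); apply: (etrans _ (esym e2)); apply: (etrans _ (esym (unipE _))).
 have e3 : a * (x * a') = x by rewrite mulrCA aa' mulr1.
 by rewrite -(pgl_scale (unip_pred _) aa') scale_mx2 eb e3 (mulr1 a) (mulr0 a).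
exists (nu Y), (unip (lftA (x * a'))); split=> //; first by apply/NA_nu; exists Y.
by exists (lftA (x * a')).
Qed.

Section Levels.
Variable C : Type.
Variable K : set G.
Hypotheses (sK : is_subgroup K) (oK : open K).

Lemma Slat_mulr (l : seq A) m : fin_supp m -> exists2 m', fin_supp m' &
 forall a a' b, a \in l -> a' \in l -> Slat m' b -> Slat m (a * b * a').
move=> fm; have h1 (s : seq A) m1 : fin_supp m1 -> exists2 m', fin_supp m' &
  forall a b, a \in s -> Slat m' b -> Slat m1 (a * b).
 move=> fm1; elim: s => [|a s [m' fm' hm']]; first by exists m1.
 have [m2 fm2 hm2] := Slat_mul a.
 exists (fun p => maxn (m1 p + m2 p) (m' p))%N.
  by apply: fin_supp_max => //; exact: fin_suppD.
 move=> c b; move=> /predU1P[->|cs] hb.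
  by apply: hm2 => p; exact: (Sp_dec (leq_maxl _ _) (hb p)).
 by apply: hm' => // p; exact: (Sp_dec (leq_maxr _ _) (hb p)).
have [m1 f1 hm1] := h1 l m fm; have [m2 f2 hm2] := h1 l m1 f1.
exists m2 => // a a' b al al' hb; rewrite mulrC; apply: hm1 => //; exact: hm2.
Qed.

(** Conjugation by [g] multiplies entries by finitely many fixed adeles, which costs only a bounded
    amount of level. *)
Lemma open_level g : exists2 m, fin_supp m & forall Y Y' : 'M[A]_2, gl2 (1%:M + Y, 1%:M + Y') ->
 (forall i j, Slat m (Y i j)) -> (forall i j, Slat m (Y' i j)) -> K (g^-1 * pgl (1%:M + Y) * g)%g.
have /nbhs_pgl[n [fn hn]] : nbhs (1%g : G) K by apply: open_nbhs_nbhs; split=> //; case: sK.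
have [B [B' [hB ->]]] := pgl_ex g; rewrite (pglV hB).
pose l := [seq B ij.1 ij.2 | ij : 'I_2 * 'I_2] ++ [seq B' ij.1 ij.2 | ij : 'I_2 * 'I_2].
have Bl i j : B i j \in l.
 by rewrite mem_cat (map_f (fun ij : 'I_2 * 'I_2 => B ij.1 ij.2) (mem_enum _ (i, j))).
have Bl' i j : B' i j \in l.
 by rewrite mem_cat orbC (map_f (fun ij : 'I_2 * 'I_2 => B' ij.1 ij.2) (mem_enum _ (i, j))).
have [m fm hm] := Slat_mulr l fn; exists m => // Y Y' h hY hY'.
have key (Z : 'M[A]_2) : (forall i j, Slat m (Z i j)) -> forall i j, congr0 n ((B' *m Z *m B) i j).
 move=> hZ i j; apply: Slat_congr0; rewrite !mul2E !mulrDl.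
 have sg := Slat_sgp Sp_sgp n.
 by apply: (sgpD sg); apply: (sgpD sg); apply: hm.
have conj (Z : 'M[A]_2) : B' *m (1%:M + Z) *m B = 1%:M + B' *m Z *m B.
 by rewrite mulmxDr mulmx1 mulmxDl (mulmx1C (gl2_1 hB)).
rewrite -[X in K X]mul1g; apply: hn; apply/congrP.
exists (B' *m Y *m B), (B' *m Y' *m B); split.
- by rewrite -!conj; have := gl2M (gl2M (gl2C hB) h) hB; rewrite mulmxA.
- by move=> i j; split; exact: key.
- by rewrite -conj (pglM (gl2M (gl2C hB) h) hB) (pglM (gl2C hB) h).
Qed.

Lemma unip_level g : exists2 m, fin_supp m & forall f : G -> C, (forall g x, K x -> f (g * x)%g = f g) ->
 forall a x, Slat m a -> f (x * unip a * g)%g = f (x * g)%g.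
have [m fm hm] := open_level g; exists m => // f fK a x ha.
have S0 : Slat m 0 by exact: (Slat_sgp Sp_sgp m).1.
have e b : unip b = pgl (1%:M + mx2 0 b 0 0).
 by rewrite unipE scalar_mx2 add_mx2 !addr0 !add0r.
have hK : K (g^-1 * unip a * g)%g.
 rewrite e; apply: (hm _ (mx2 0 (- a) 0 0)).
 - by rewrite !scalar_mx2 !add_mx2 !addr0 !add0r; exact: unip_pred.
 - by move=> i j; rewrite mxE; case: ifP => _; case: ifP => _.
 - move=> i j; rewrite mxE; case: ifP => _; case: ifP => _ //.
  exact: sgpN (Slat_sgp Sp_sgp m) ha.
by rewrite -(fK (x * g)%g _ hK) -!mulgA; congr (f (_ * _)%g); rewrite mulKVg.
Qed.

Lemma nu_level g : exists2 m, fin_supp m & forall f : G -> C, (forall g x, K x -> f (g * x)%g = f g) ->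
 forall Y x, (forall i j, lat (fun p => m p) (Y i j)) -> f (x * nu Y * g)%g = f (x * g)%g.
have [m fm hm] := open_level g; have [m' fm' hm'] := eps_level fm; exists m' => // f fK Y x hY.
have hK : K (g^-1 * nu Y * g)%g.
 apply: (hm _ (- map_mx eps Y)).
 - exact: nu_pred.
 - by move=> i j; rewrite mxE; exact: hm'.
 - move=> i j; rewrite !mxE; apply: (sgpN (Slat_sgp Sp_sgp m)); exact: hm'.
by rewrite -(fK (x * g)%g _ hK) -!mulgA; congr (f (_ * _)%g); rewrite mulKVg.
Qed.
End Levels.

Section Characters.
Variable C : numFieldType.
Variable psi : k -> C.
Hypothesis hpsi : nontrivial_character psi.
Variables (Om : lmodType E) (d : E -> Om) (alpha0 : F -> Om).
Hypothesis hL : is_Linv_omega alpha0.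
Variable R : {linear Om -> functl Mb}.
Hypothesis hW : forall alpha, weil (fval (R alpha)).
Hypothesis hres : forall (p : place) (x : cring Mb p) alpha,
 residue d x alpha = fval (R alpha) (atp x).

Notation omega := (4%:R *: alpha0 nilgen).
Notation chi := (chi psi (fval (R omega))).

Lemma psi_curveE (x : Ab) alpha : psi_curve d psi x alpha = psi (fval (R alpha) x).
exact: psi_curve_functional. Qed.

Lemma psi_curve_chi (x : Ab) e : psi_curve d psi x (e *: omega) = chi e x.
by rewrite psi_curveE linearZ. Qed.

(** The factor 4 of the Killing form is absorbed in [omega]. Every way of writing the entry as an
    adele times a rational section gives the same value, so the [xget] in [psi_eta0] is
    determined. *)
Lemma psi_eta0_nu Y : psi_eta0 d psi alpha0 (nu Y) = chi 1 (Y o1 o0).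
have [nil0 _ _] := nilgenP.
rewrite /psi_eta0; set S := [set c | _].
have hS c : S c -> c = chi 1 (Y o1 o0).
 move=> [Z [x [y [l [nZ eZ rl [/diagonal_dgA -> zxy] ->]]]]].
 have /choice[h hh] : forall ij : 'I_2 * 'I_2, exists z, Z ij.1 ij.2 = eps z.
  by move=> ij; apply/nilA_eps; exact: nZ.
 have ZE : Z = map_mx eps (\matrix_(i, j) h (i, j)) by apply/matrixP => i j; rewrite !mxE (hh (i, j)).
 have := nu_inj21 (etrans eZ (congr1 (fun W => pgl (1%:M + W)) ZE)); rewrite mxE => ->.
 have [_ _ gen] := nilgenP; have [f fE] := gen l rl.
 have -> : h (o1, o0) = ared x * dg (red f).
  by apply: eps_inj; rewrite -hh zxy fE -eps_dg epsM.
 rewrite fE hL.2 // psi_curveE linearZ /chi linearZ /= rmorph1 mul1r; congr psi.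
 congr (fval (R _) _); apply: aval_inj => p /=.
 by rewrite !rmorph_nat; ring.
apply: hS; apply: (@xgetI _ 1 S (psi_curve d psi (4%:R * ared (lftA (Y o1 o0))) (alpha0 nilgen))).
exists (map_mx eps Y), (lftA (Y o1 o0)), (dgA nilgen), (nilgen); split=> //.
- by move=> i j; rewrite mxE; exact: ared_eps.
- by split; [exact/diagonal_dgA|rewrite mxE].
Qed.
End Characters.

Lemma nuE Y : nu Y = pgl (1%:M + map_mx eps Y). by []. Qed.

#[local] Opaque pgl unip nu pgl_mul pgl_inv.

(** * Supports of equivariant functions, via the Iwasawa decomposition *)

Let Sint := Slat (fun=> 0%N).
Let sg m := Slat_sgp Sp_sgp m.

Lemma SlatM m a b : Slat m a -> Sint b -> Slat m (a * b).
move=> ha hb p; have [x Ox /= ->] := ha p; have /Sp0 Ob := hb p.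
by exists (x * aval b p); [exact: ohM|rewrite mulrA].
Qed.

Lemma Sint1 : Sint 1. by move=> p; apply/Sp0; exact: oh1. Qed.
Lemma int_cover n : fin_supp n -> exists s, covers s Sint (Slat n).
move=> /finite_seqP[r hr]; pose nr (r : seq place) p := if p \in r then n p else 0%N.
suff [s cs] : exists s, covers s Sint (Slat (nr r)).
 exists s; apply: cover_sub cs => // a ha p; have := ha p; rewrite /nr; case: ifPn => // pr.
 suff -> : n p = 0%N by [].
 by apply/eqP; apply: contraNT pr => np; have : [set p | n p != 0%N] p by []; rewrite hr.
elim: r {hr} => [|q r [s cs]]; first by exists [:: 0] => a ha; exists 0; rewrite ?mem_head // subr0.
have [qr|qr] := boolP (q \in r).
 exists s; apply: cover_sub cs => // a ha p; have := ha p; rewrite /nr in_cons.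
 by have [->|] := eqVneq p q => //; rewrite qr.
have [s1 c1] := oh_cover q (n q).
have fin (y : cring M q) : finite_set [set p | ~ cint M p (dfwith (fun q => 0 : cring M q) q y p)].
 apply: (sub_finite_set _ (@finite_set1 _ q)) => p /= np; apply/eqP/negPn/negP => pq.
 by apply: np; rewrite dfwithout 1?eq_sym //; exact: oh0.
suff h : covers [seq Adele (fin y) | y <- s1] (Slat (nr r)) (Slat (nr (q :: r))).
 by eexists; exact: cover_comp cs h.
move=> a ha; have [|y ys hy] := c1 (aval a q).
 by have := ha q; rewrite /nr (negPf qr) => /Sp0.
exists (Adele (fin y)); first by apply/mapP; exists y.
move=> p; rewrite /nr in_cons; have [->|pq] := eqVneq p q.
 by rewrite /= dfwithin.
by rewrite /= dfwithout 1?eq_sym // subr0; exact: ha.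
Qed.

Definition int_gl (Q Q' : 'M[A]_2) := gl2 (Q, Q') /\ forall i j, Sint (Q i j) /\ Sint (Q' i j).
(** Integral entries have finitely many classes modulo a lattice, and integral invertible matrices
    congruent entrywise differ by a congruence subgroup. *)
Lemma int_cosets n : fin_supp n -> exists l : seq G, forall Q Q', int_gl Q Q' ->
 exists2 x, x \in l & csub n (x^-1 * pgl Q)%g.
move=> fn; have [s cs] := int_cover fn.
pose P (f : {ffun 'I_2 * 'I_2 -> 'I_(size s)}) : set G := [set x | exists Q Q',
 [/\ int_gl Q Q', x = pgl Q & forall i j, Slat n (Q i j - nth 0 s (f (i, j)))]].
exists [seq xget 1%g (P f) | f : {ffun 'I_2 * 'I_2 -> 'I_(size s)}] => Q Q' [h hQ].
have /choice[f hf] : forall ij : 'I_2 * 'I_2, exists l : 'I_(size s), Slat n (Q ij.1 ij.2 - nth 0 s l).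
 move=> ij; have [y ys hy] := cs _ (hQ ij.1 ij.2).1.
 by exists (Ordinal (etrans (index_mem _ _) ys : (index y s < size s)%N)); rewrite nth_index.
pose ff' := [ffun ij => f ij]; exists (xget 1%g (P ff')); first exact: map_f (mem_enum _ _).
have [Q1 [Q1' [[h1 hQ1] -> d1]]] : P ff' (xget 1%g (P ff')).
 apply: (@xgetI _ 1%g (P ff') (pgl Q)); exists Q, Q'; split=> // i j.
 by rewrite ffunE; exact: hf (i, j).
have dQ i j : Slat n (Q i j - Q1 i j).
 have -> : Q i j - Q1 i j = (Q i j - nth 0 s (f (i, j))) - (Q1 i j - nth 0 s (f (i, j))) by ring.
 by apply: (sg n).2; [exact: hf (i, j)|have := d1 i j; rewrite ffunE].
have key (R R' R1 : 'M[A]_2) : R' *m R = 1%:M -> R' *m R1 = 1%:M + R' *m (R1 - R).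
 by move=> e; rewrite mulmxBr e addrC subrK.
have lev (R : 'M[A]_2) (S : 'M[A]_2) : (forall i j, Sint (R i j)) -> (forall i j, Slat n (S i j)) ->
  forall i j, congr0 n ((R *m S) i j).
 move=> hR hS i j; apply: Slat_congr0; rewrite mul2E.
 by apply: (sgpD (sg n)); rewrite mulrC; apply: SlatM.
rewrite (pglV h1) -(pglM (gl2C h1) h) (key Q1); last exact: mulmx1C (gl2_1 h1).
apply/congrP; exists (Q1' *m (Q - Q1)), (Q' *m (Q1 - Q)); split=> //.
- rewrite -(key Q1) ?(mulmx1C (gl2_1 h1)) // -(key Q) ?(mulmx1C (gl2_1 h)) //.
 exact: gl2M (gl2C h1) h.
- move=> i j; split; apply: lev => i' j'; try by [case: (hQ1 i' j')|case: (hQ i' j')].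
  by rewrite !mxE.
 by rewrite !mxE -opprB; apply: (sgpN (sg n)).
Qed.

Lemma int_lift (K K' : 'M[Ab]_2) : gl2 (K, K') ->
 (forall i j, int_adele (K i j) /\ int_adele (K' i j)) ->
 exists Q Q', int_gl Q Q' /\ map_mx ared Q = K.
move=> h hK; have lift (R : 'M[Ab]_2) : (forall i j, int_adele (R i j)) ->
  exists2 Q : 'M[A]_2, forall i j, Sint (Q i j) & map_mx ared Q = R.
 move=> hR; have /choice[f hf] : forall ij : 'I_2 * 'I_2, exists a, Sint a /\ ared a = R ij.1 ij.2.
  move=> ij; have [a Sa ra] := ared_lift_lat (fin_supp0 _) ((int_lat _).1 (hR ij.1 ij.2)).
  by exists a.
 exists (\matrix_(i, j) f (i, j)); first by move=> i j; rewrite mxE; have [] := hf (i, j).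
 by apply/matrixP => i j; rewrite !mxE; have [] := hf (i, j).
have [Q SQ rQ] := lift K (fun i j => (hK i j).1); have [Q0 SQ0 rQ0] := lift K' (fun i j => (hK i j).2).
have nN : map_mx ared (Q *m Q0 - 1%:M) = 0.
 by rewrite map_mxB map_mxM map_mx1 rQ rQ0 (gl2_1 h) subrr.
have SM (R S : 'M[A]_2) : (forall i j, Sint (R i j)) -> (forall i j, Sint (S i j)) ->
  forall i j, Sint ((R *m S) i j).
 move=> hR hS i j; rewrite mul2E; apply: (sgpD (sg (fun=> 0%N))); apply: SlatM; [exact: hR|exact: hS|exact: hR|exact: hS].
have S1 i j : Sint ((1%:M : 'M[A]_2) i j).
 by rewrite mxE; case: (i == j); [exact: Sint1|exact: (sg _).1].
have hh : gl2 (Q, Q0 *m (1%:M - (Q *m Q0 - 1%:M))).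
 apply: gl2P; rewrite mulmxA -{1}[Q *m Q0](subrK 1%:M) addrC.
 by have := nil_mx_pred ared_sq0 (N := Q *m Q0 - 1%:M) nN; move/gl2_1.
exists Q, (Q0 *m (1%:M - (Q *m Q0 - 1%:M))); split=> //; split=> // i j; split=> //.
have SB (R S : 'M[A]_2) : (forall i j, Sint (R i j)) -> (forall i j, Sint (S i j)) ->
  forall i j, Sint ((R - S) i j).
 by move=> hR hS i' j'; rewrite mxE [(- S) i' j']mxE; apply: (sg (fun=> 0%N)).2; [exact: hR|exact: hS].
by apply: (SM) => //; apply: (SB) => //; apply: (SB) => //; exact: SM.
Qed.

Definition tlift (d : place -> int) : A := lftA (tid Mb d).
Lemma tlift_inv d : fsupp d -> exists2 b, tlift d * b = 1 & ared b = tid Mb (fun p => - d p).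
move=> fd; have h : ared (tlift d) * tid Mb (fun p => - d p) = 1.
 by rewrite lftAP // -[tid Mb d]mulr1 mulrC tidK.
by have [z tz rz] := unit_lift ared_surj (ared_sq0) h; exists z.
Qed.

Lemma gred_tlift d : fsupp d -> gred (dgl (tlift d)) = dgl (tid Mb d).
move=> fd; have [b tb _] := tlift_inv fd; apply: (etrans (gred_pgl (dgl_pred tb))).
rewrite map_mx_mx2; congr (pgl _); congr mx2; [exact: lftAP|exact: ared0|exact: ared0|exact: ared1].
Qed.

(** The decomposition is made on the reduced group; integral matrices and the torus lift, and the
    discrepancy is a factor [nu Y]. *)
Lemma iwasawaA g : exists Y (u : A) d Q Q', [/\ fsupp d, int_gl Q Q'
 & g = (nu Y * unip u * (dgl (tlift d) * pgl Q))%g].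
have [B [B' [h ->]]] := pgl_ex g; have hb := gl2_map ared h.
have [d [y [c [c' [K [K' [fd hK iK cc eB]]]]]]] := iwasawa hb.
have [Q [Q' [hQ rQ]]] := int_lift hK iK; have [b tb rb] := tlift_inv fd.
have tt : tid Mb d * tid Mb (fun p => - d p) = 1 by rewrite -rb -(lftAP (tid Mb d)) -aredM tb ared1.
have hm : gl2 (mx2 (tid Mb d) y 0 1, mx2 (tid Mb (fun p => - d p)) (- y * tid Mb (fun p => - d p)) 0 1).
 apply: gl2P; rewrite mul_mx2 scalar_mx2 tt; congr mx2; try ring.
 have -> : tid Mb d * (- y * tid Mb (fun p => - d p)) + y * 1 = y * (1 - tid Mb d * tid Mb (fun p => - d p)) by ring.
 by rewrite tt subrr mulr0.
have e1 : gred (pgl B) = pgl (mx2 (tid Mb d) y 0 1 *m K).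
 by rewrite (gred_pgl h) eB (pgl_scale (gl2M hm hK) cc).
have e2 : gred (dgl (tlift d) * pgl Q)%g = pgl (mx2 (tid Mb d) 0 0 1 *m K).
 by rewrite gredM (gred_pgl hQ.1) rQ (gred_tlift fd) (pglM (dgl_pred tt) hK).
have e3 : gred (unip (lftA y) * (dgl (tlift d) * pgl Q))%g = pgl (mx2 (tid Mb d) y 0 1 *m K).
 have eu : gred (unip (lftA y)) = unip y := etrans (gred_unip _) (congr1 (@unip Ab) (lftAP y)).
 rewrite gredM e2 eu unipE.
 apply: (etrans (esym (pglM (unip_pred y) (gl2M (dgl_pred tt) hK)))); congr pgl.
 rewrite mulmxA mul_mx2; congr (_ *m _).
 by apply: mx2P; rewrite !mxE /=; ring.
have [Y eY] := gred_eq (etrans e1 (esym e3)).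
by exists Y, (lftA y), d, Q, Q'; rewrite eY [LHS]mulgA.
Qed.

Lemma dgl_nu (a b : A) (x y z t : Ab) : a * b = 1 ->
 (dgl a * nu (mx2 x y z t) = nu (mx2 x (ared a * y) (z * ared b) t) * dgl a)%g.
move=> ab; have ab' : ared a * ared b = 1 by rewrite -aredM ab ared1.
have e0 : ared (0 : A) = 0 := ared0; have e1 : ared (1 : A) = 1 := ared1.
have <- : map_mx ared (mx2 a 0 0 1) *m mx2 x y z t *m map_mx ared (mx2 b 0 0 1) =
  mx2 x (ared a * y) (z * ared b) t.
 rewrite !map_mx_mx2 e0 e1 !mul_mx2; apply: mx2P; rewrite !mxE /=; try ring.
 have -> : (ared a * x + 0 * z) * ared b + (ared a * y + 0 * t) * 0 = x * (ared a * ared b) by ring.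
 by rewrite ab' mulr1.
exact: (nu_conj _ (dgl_pred ab)).
Qed.

#[local] Opaque dgl.

Section Characters.
Variable C : numFieldType.
Variable psi : k -> C.
Hypothesis hpsi : nontrivial_character psi.
Variables (w : kad Mb -> k) (y0 : kad Mb).
Hypotheses (hw : weil w) (wy0 : w y0 != 0).
Notation chi := (chi psi w).

Definition eqv e (f : G -> C) := forall Y (u : A) g,
 f (nu Y * unip u * g)%g = chi 1 (Y o1 o0) * chi e (ared u) * f g.

Lemma eqv_nu e f Y g : eqv e f -> f (nu Y * g)%g = chi 1 (Y o1 o0) * f g.
move=> h; have := h Y 0 g; have -> : ared (0 : A) = 0 := ared0.
by rewrite unip0 mulg1 (chi0 hpsi hw) mulr1.
Qed.

Lemma eqv_unip e f (u : A) g : eqv e f -> f (unip u * g)%g = chi e (ared u) * f g.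
by move=> h; have := h 0 u g; rewrite nu0 mul1g mxE (chi0 hpsi hw) mul1r. Qed.

Lemma eqv_neq0 e f Y (u : A) g : eqv e f -> f (nu Y * unip u * g)%g != 0 -> f g != 0.
by move=> ->; apply: contraNneq => ->; rewrite mulr0. Qed.

Definition level_inv n (f : G -> C) := forall g x, csub n x -> f (g * x)%g = f g.
Lemma congr_sub n : is_subgroup (@congr_subgroup _ _ _ M n).
by split=> [|x y hx hy]; [exact: congr_subgroup1|apply: congrM => //; exact: congrV]. Qed.

Lemma congr_open n : fin_supp n -> open (@congr_subgroup _ _ _ M n).
move=> fn; rewrite openE => x hx; apply/nbhs_pgl; exists n; split=> // y hy; exact: congrM.
Qed.

Lemma list_level n (l : seq G) : fin_supp n -> exists2 m, fin_supp m & forall f, level_inv n f -> forall x, x \in l ->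
 (forall a y, Slat m a -> f (y * unip a * x)%g = f (y * x)%g) /\
 (forall Y y, (forall i j, lat (fun p => m p) (Y i j)) -> f (y * nu Y * x)%g = f (y * x)%g).
move=> fn; elim: l => [|x l [m fm hm]]; first by exists (fun=> 0%N); first exact: fin_supp0.
have [m1 fm1 hm1] := unip_level C (congr_sub n) (congr_open fn) x.
have [m2 fm2 hm2] := nu_level C (congr_sub n) (congr_open fn) x.
exists (fun p => maxn (m p) (maxn (m1 p) (m2 p))); first by do 2!apply: fin_supp_max => //.
have le p : [/\ m p <= maxn (m p) (maxn (m1 p) (m2 p)), m1 p <= maxn (m p) (maxn (m1 p) (m2 p))
 & m2 p <= maxn (m p) (maxn (m1 p) (m2 p))]%N by split; lia.
move=> f hf y; move=> /predU1P[-> | yl].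
 split=> [a z ha|Y z hY]; [apply: hm1 => // p|apply: hm2 => // i j].
  by have [_ h _] := le p; exact: (Sp_dec h (ha p)).
 by apply: (lat_le _ (hY i j)) => p; have [_ _ h] := le p; rewrite lez_nat.
have [h1 h2] := hm f hf y yl; split=> [a z ha|Y z hY]; [apply: h1 => p|apply: h2 => i j].
 by have [h _ _] := le p; exact: (Sp_dec h (ha p)).
by apply: (lat_le _ (hY i j)) => p; have [h _ _] := le p; rewrite lez_nat.
Qed.

Lemma chi_lat e m (z : Ab) : (forall b, lat m b -> chi e (z * b) = 1) -> forall b, lat m b -> w (dg e * (z * b)) = 0.
move=> h b hb; apply/eqP/negPn/negP => /(chi_neq1 hpsi hw)[a] /negP; apply; apply/eqP.
rewrite mulrCA; apply: h => p /=; rewrite mulrC; apply: hgeMc; first exact: hb.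
by apply/cint_j; exact: vr_const (place_ringP p) a.
Qed.

(** Right invariance at level [m] is compatible with a nonzero value at the torus element of divisor
    [d] only if the characters are trivial on lattices shifted by [d]. The lower nilpotent entry,
    scaled by [- d], bounds [d] above; U, scaled by [d], bounds it below in terms of [e].
    [conductor] turns triviality into these bounds. *)
Lemma supp_bound n (l : seq G) : fin_supp n -> exists m D', [/\ fin_supp m, fsupp D' &
 forall f e, level_inv n f -> eqv e f -> forall x d, x \in l -> fsupp d -> f (dgl (tlift d) * x)%g != 0 ->
  (forall p, D' p <= (m p)%:Z - d p) /\ (e != 0 -> forall p, D' p <= ord p e + d p + (m p)%:Z)].
move=> fn; have [m fm hm] := list_level l fn; have [D' fD' hD'] := conductor hw wy0.
have fm' := (fsupp_fin _).1 fm.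
exists m, D'; split=> // f e rf ef x d xl fd f0; have [h1 h2] := hm f rf x xl.
have [b tb rb] := tlift_inv fd.
have key c (z : Ab) : (forall y, lat (fun p => m p) y -> chi c (z * y) = 1) ->
  lat D' (dg c * (z * tid Mb (fun p => m p))).
 move=> hz; apply: hD' => y hy; rewrite -!mulrA; apply: (chi_lat hz) => p.
 by have := @tid_lat Mb _ _ y fm' hy p; rewrite addr0.
split.
 have /key : forall y, lat (fun p => m p) y -> chi 1 (tid Mb (fun p => - d p) * y) = 1.
  move=> y hy; apply/(mulIf f0); rewrite mul1r.
  have e1 := h2 (mx2 0 0 y 0) (dgl (tlift d)).
  rewrite -{2}e1; last first.
   by move=> i j; rewrite mxE; case: ifP => _; case: ifP => _ //; exact: (lat_sgp _ _).1.
  have e2 := dgl_nu 0 0 y 0 tb; rewrite rb in e2.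
  have e3 := eqv_nu (mx2 0 (ared (tlift d) * 0) (y * tid Mb (fun p => - d p)) 0) (dgl (tlift d) * x)%g ef.
  rewrite mxE /= (mulrC y) in e3; rewrite (mulrC y) in e2.
  apply: (etrans (esym e3)); apply: (congr1 f).
  exact: (etrans (mulgA _ _ _) (congr1 (fun z : G => (z * x)%g) (esym e2))).
 rewrite rmorph1 mul1r => h p; have := h p; rewrite /= !aval_tid //; last exact: fsuppN.
 rewrite -rmorphM -expfzDr ?(unif_neq0 (unifP p)) // => /hge_j.
 by move/vge_ord; rewrite ord_unif addrC; apply; rewrite expfz_neq0 ?(unif_neq0 (unifP p)).
move=> e0; have /key : forall y, lat (fun p => m p) y -> chi e (tid Mb d * y) = 1.
 move=> y hy; apply/(mulIf f0); rewrite mul1r.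
 have [a Sa ra] := ared_lift_lat fm hy.
 have e1 := h1 a (dgl (tlift d)) Sa; have e2 := dgl_unip a tb.
 have e3 := eqv_unip (tlift d * a) (dgl (tlift d) * x)%g ef.
 have e4 : ared (tlift d * a) = tid Mb d * y by rewrite aredM ra; congr (_ * _); exact: lftAP.
 rewrite e4 in e3; apply: (etrans (esym e3)); rewrite -e1; apply: (congr1 f).
 exact: (etrans (mulgA _ _ _) (congr1 (fun z : G => (z * x)%g) (esym e2))).
move=> h p; have := h p; rewrite /= !aval_tid // -!rmorphM.
rewrite -expfzDr ?(unif_neq0 (unifP p)) // => /hge_j/vge_ord.
have u0 n' : unif p ^ n' != 0 by rewrite expfz_neq0 ?(unif_neq0 (unifP p)).
by rewrite ordM // ord_unif addrA; apply; rewrite mulf_neq0.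
Qed.

Lemma int_gl_rep n (l : seq G) f e g : (forall Q Q', int_gl Q Q' -> exists2 x, x \in l & csub n (x^-1 * pgl Q)%g) ->
 level_inv n f -> eqv e f -> f g != 0 -> exists Y (u : A) d x h, [/\ fsupp d, x \in l, csub n h,
  f (dgl (tlift d) * x)%g != 0 & g = (nu Y * unip u * (dgl (tlift d) * x * h))%g].
move=> hl rf ef; have [Y [u [d [Q [Q' [fd hQ ->]]]]]] := iwasawaA g.
move/(eqv_neq0 ef) => f0; have [x xl hx] := hl Q Q' hQ.
have e1 : (dgl (tlift d) * pgl Q)%g = (dgl (tlift d) * x * (x^-1 * pgl Q))%g.
 exact: (etrans (congr1 (fun z : G => (dgl (tlift d) * z)%g) (esym (mulKVg x (pgl Q)))) (mulgA _ _ _)).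
exists Y, u, d, x, (x^-1 * pgl Q)%g; rewrite -e1; split=> //.
by rewrite -(rf _ _ hx) -e1.
Qed.

(** Adding the two bounds of [supp_bound] eliminates [d] and confines [e] to a lattice. *)
Lemma supp_finite n : fin_supp n -> exists r : seq E, forall f e, level_inv n f -> eqv e f -> e != 0 ->
 (exists g, f g != 0) -> e \in r.
move=> fn; have [l hl] := int_cosets fn; have [m [D' [fm fD' hb]]] := supp_bound l fn.
have fm' := (fsupp_fin _).1 fm.
have [r hr] := E_lat_finite Mb (fsuppD (fsuppD fD' fD') (fsuppN (fsuppD fm' fm'))).
exists r => f e rf ef e0 [g f0]; apply: hr; apply/lat_dgE => // p.
have [Y [u [d [x [h [fd xl hh f1 _]]]]]] := int_gl_rep hl rf ef f0.
by have [/(_ p) h1 /(_ e0 p) h2] := hb f e rf ef x d xl fd f1; lia.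
Qed.

(** For fixed nonzero [e] the two bounds leave finitely many torus exponents [d]. *)
Lemma supp_list n e : fin_supp n -> e != 0 -> exists s : seq G, forall f, level_inv n f -> eqv e f ->
 forall g, f g != 0 -> exists Y (u : A) x h, [/\ x \in s, csub n h & g = (nu Y * unip u * (x * h))%g].
move=> fn e0; have [l hl] := int_cosets fn; have [m [D' [fm fD' hb]]] := supp_bound l fn.
have fm' := (fsupp_fin _).1 fm.
pose L p := D' p - (m p)%:Z - ord p e; pose U p := (m p)%:Z - D' p.
have fL : fsupp L by apply: fsuppD (fsuppN (fsupp_ord e0)); apply: fsuppD (fsuppN fm').
have fU : fsupp U by apply: fsuppD fm' (fsuppN fD').
have /finite_seqP[s hs] : finite_set [set (dgl (tlift d) * x)%g | d in [set d | forall p, L p <= d p <= U p] & x in [set` l]].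
 by apply: finite_image2; [exact: finite_between|exact: finite_seq].
exists s => f rf ef g f0.
have [Y [u [d [x [h [fd xl hh f1 ->]]]]]] := int_gl_rep hl rf ef f0.
exists Y, u, (dgl (tlift d) * x)%g, h; split=> //.
suff : [set` s] (dgl (tlift d) * x)%g by [].
rewrite -hs; exists d => [p|]; last by exists x.
by have [/(_ p) h1 /(_ e0 p) h2] := hb f e rf ef x d xl fd f1; rewrite /L /U; apply/andP; split; lia.
Qed.
End Characters.

#[local] Transparent dgl.

Lemma pgl2_axioms (C : numFieldType) (w : kad Mb -> k) (y0 : kad Mb) n : w y0 != 0 -> fin_supp n ->
 @pgl_axioms C G nu (@unip A) rat (@congr_subgroup _ _ _ M n).
move=> wy0 fn; split.
- exact: nuD.
- exact: nu_scalar.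
- exact: nu_conj_unip.
- exact: unipD.
- exact: unip_eps.
- exact: rat_nu.
- exact: rat_unip.
- move=> Q Q' h; have [B [B' [hB rB eQ eQ']]] := rat_lift h; exists (pgl B); first exact: rB.
 by move=> Y; rewrite -eQ -eQ'; exact: nu_conj.
- move=> g /rat_red[B [B' [Q [Q' [hB eg hQ eQ eQ']]]]]; exists Q, Q'; split; first exact: hQ.
 by move=> Y; rewrite eg -eQ -eQ'; exact: nu_conj.
- move=> g; have [m fm hm] := list_level C wy0 [:: g] fn; exists m => // f rf.
 by apply: (hm f rf); rewrite mem_head.
Qed.

Lemma tr_e12 (R : comPzRingType) (W : 'M[R]_2) : \tr (dl01 *m W) = W o1 o0.
rewrite /mxtrace big_ord_recl big_ord1 !mul2E !mxE /= !mulr0n !mulr1n !mul0r !add0r mul1r addr0.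
by congr (W _ _); apply: val_inj.
Qed.

Lemma eta_rat g : rat g -> exists Q Q' : 'M[E]_2, [/\ gl2 (Q, Q'),
 eta g = map_mx dg (Q' *m dl01 *m Q)
 & forall Z, (g * nu Z = nu (map_mx dg Q *m Z *m map_mx dg Q') * g)%g].
move=> /rat_red[B [B' [Q [Q' [hB -> hQ eQ eQ']]]]]; exists Q, Q'; split; first exact: hQ.
 by rewrite (eta_pgl hB) eQ eQ' !map_mxM map_delta_mx.
by move=> Z; rewrite -eQ -eQ'; exact: nu_conj.
Qed.

(** The (2,1) entry is the product of the lower left entries of the matrix and of its inverse, and
    vanishing of one forces that of the other. *)
Lemma eta_borel (Q Q' : 'M[E]_2) : gl2 (Q, Q') ->
 (Q' *m dl01 *m Q) o1 o0 = 0 ->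
 exists2 y, y != 0 & Q' *m dl01 *m Q = mx2 0 y 0 0.
move=> h; have h1 := gl2_1 h; have h2 := gl2_1 (gl2C h).
have e12 : dl01 = mx2 0 1 0 0 :> 'M[E]_2 by apply: mx2P; rewrite !mxE.
move: h1 h2; rewrite e12 [Q]mx2E [Q']mx2E; move: (Q o0 o0) (Q o0 o1) (Q o1 o0) (Q o1 o1) => a b c d.
move: (Q' o0 o0) (Q' o0 o1) (Q' o1 o0) (Q' o1 o1) => a' b' c' d'.
rewrite !mul_mx2 !scalar_mx2 => /mx2_inj[h1 h2 h3 h4] /mx2_inj[k1 k2 k3 k4].
rewrite mxE /= !(mulr0, mul0r, mulr1, add0r, addr0) => /eqP; rewrite mulf_eq0 => cc.
have [c0 c'0] : c = 0 /\ c' = 0.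
 case/orP: cc => /eqP z0.
  have a'0 : a' != 0 by apply: contra_eq_neq h1 => ->; rewrite z0 !mulr0 addr0 eq_sym oner_eq0.
  move: h3; rewrite z0 mulr0 addr0 => /eqP; rewrite mulf_eq0 (negPf a'0) orbF => /eqP.
  by split.
 have a0 : a != 0 by apply: contra_eq_neq k1 => ->; rewrite z0 !mulr0 addr0 eq_sym oner_eq0.
 move: k3; rewrite z0 mulr0 addr0 => /eqP; rewrite mulf_eq0 (negPf a0) orbF => /eqP.
 by split.
exists (a' * d); last by rewrite c0 c'0; congr mx2; ring.
rewrite mulf_neq0 //.
 by apply: contra_eq_neq k1 => ->; rewrite c0 mul0r mulr0 addr0 eq_sym oner_eq0.
by apply: contra_eq_neq k4 => ->; rewrite c'0 mul0r mulr0 addr0 eq_sym oner_eq0.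
Qed.

Lemma red0_gen f : red f = 0 -> exists c, f = c * nilgen.
by have [_ _] := nilgenP; apply. Qed.

(** After division by the (1,1) entry, the bottom row differs from that of a unipotent by rational
    nilpotents. Rationality of both factors is what makes the characters trivial on the element. *)
Lemma St_rat_form g : St g -> rat g -> exists Y a e,
 g = (nu Y * unip (dgA a))%g /\ Y o1 o0 = dg e.
move=> /St_eta stg /ratP[P [P' [hP eg]]].
have hPA := gl2_map (dgA : {rmorphism F -> A}) hP.
have eP : eta (pgl (map_mx dgA P)) = eta g by rewrite eg.
move: eP; rewrite stg (eta_pgl hPA).
have rE Q : map_mx ared (map_mx dgA Q) = map_mx dg (map_mx red Q) :> 'M[Ab]_2.
 by apply/matrixP => i j; rewrite !mxE ared_dgA.
rewrite !rE => e.
have hr := gl2_map (red : {rmorphism F -> E}) hP.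
have {}e : map_mx red P' *m dl01 *m map_mx red P = dl01.
 by apply: dg_mx_inj; rewrite !map_mxM map_delta_mx e.
have {}e : dl01 *m map_mx red P = map_mx red P *m dl01.
 by rewrite -[in RHS]e !mulmxA (gl2_1 hr) mul1mx.
have e12 : dl01 = mx2 0 1 0 0 :> 'M[E]_2 by apply: mx2P; rewrite !mxE.
have hP1 := gl2_1 hr.
move: e hP1; rewrite e12 {1 2 3}[P]mx2E [P']mx2E !map_mx_mx2 !mul_mx2 scalar_mx2.
rewrite !mul0r !mulr0 !mul1r !mulr1 !add0r !addr0 => /mx2_inj[r10 r11 _ _] /mx2_inj[q0 _ q1 q2].
have a0 : red (P o0 o0) != 0.
 by apply: contra_eq_neq q2 => z; rewrite r10 r11 z !mul0r addr0 eq_sym oner_eq0.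
have [b hb] := sF_unit a0.
have rb : red b * red (P o0 o0) = 1 by rewrite -rmorphM mulrC hb rmorph1.
have [y' hy] : exists y', b * P o1 o0 = y' * nilgen.
 by apply: red0_gen; rewrite rmorphM r10 mulr0.
have [z' hz] : exists z', b * P o1 o1 - 1 = z' * nilgen.
 by apply: red0_gen; rewrite rmorphB rmorphM rmorph1 r11 rb subrr.
pose v := b * P o0 o1.
exists (mx2 0 0 (dg (red y')) (dg (red (z' - v * y')))), v, (red y').
split; last by rewrite mxE.
rewrite eg nuE unipE.
rewrite -(pglM (nu_pred _) (unip_pred _)).
have dA : dgA (P o0 o0) * dgA b = 1 by rewrite -rmorphM hb rmorph1.
rewrite -(pgl_scale (gl2M (nu_pred _) (unip_pred _)) dA).
congr pgl; rewrite map_mx_mx2 raddf0 !eps_dg scalar_mx2 add_mx2 mul_mx2 scale_mx2 [P in LHS]mx2E map_mx_mx2.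
have bK x : dgA (P o0 o0) * dgA (b * x) = dgA x by rewrite -rmorphM mulrA hb mul1r.
congr mx2.
- by rewrite !(mulr1, mulr0, addr0).
- by rewrite !(mulr0, addr0, add0r, mul1r, mul0r) /v bK.
- by rewrite !(mulr0, addr0, add0r, mulr1) -hy bK.
- rewrite add0r mulr1 -hy !mulrBl -hz -(mulrA v) -hy.
 rewrite !(rmorphD, rmorphN, rmorphM, rmorph1) /v ?rmorphM.
 transitivity ((dgA (P o0 o0) * dgA b) * dgA (P o1 o1)); last ring.
 by rewrite dA mul1r.
Qed.

Lemma pgl2_st n : st_axioms nu (@unip A) rat (@congr_subgroup _ _ _ M n) (@St _ _ _ X D) eta.
split.
- exact: rat1.
- exact: ratM.
- exact: ratV.
- by rewrite -pgl1 (eta_pgl (gl2_oneP A)) !map_mx1 mul1mx mulmx1.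
- move=> h; have [B [B' [hB ->]]] := pgl_ex h; exists (map_mx ared B), (map_mx ared B').
 by split; [exact: gl2_map|move=> g; exact: etaM].
- move=> h /congrP[Y [Y' [hY cY ->]]]; exists (map_mx ared (1%:M + Y)), (map_mx ared (1%:M + Y')).
 split; first by split; [exact: gl2_map|move=> g; exact: etaM].
 have iS (a : A) i j : congr0 n a -> lat (fun=> 0) (ared ((1%:M : 'M[A]_2) i j + a)).
  move=> ca p; apply/hge0n/ared_int; apply: ohD; first by rewrite mxE; case: eqP => _; [exact: oh1|exact: oh0].
  by have := congr0_int ca p.
 by move=> i j; have [c1 c2] := cY i j; split; rewrite mxE [X in ared X]mxE; exact: iS.
- move=> g /eta_rat[Q [Q' [hQ eQ hZ]]]; exists (Q' *m dl01 *m Q); split=> //.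
  apply/eqP => q0; have : Q *m (Q' *m dl01 *m Q) *m Q' = 0 by rewrite q0 mulmx0 mul0mx.
  rewrite !mulmxA (gl2_1 hQ) mul1mx -mulmxA (gl2_1 hQ) mulmx1.
  by move=> /matrixP/(_ o0 o1); rewrite !mxE => /eqP; rewrite oner_eq0.
 move=> Z; exists (map_mx dg Q *m Z *m map_mx dg Q'); first exact: hZ.
 by rewrite eQ !map_mxM map_delta_mx -!mulmxA mxtrace_mulC -!mulmxA tr_e12.
- by move=> g; exact: St_eta.
- exact: St_rat_form.
- by move=> Y u; exists (nu Y), (unip u); split=> //; [apply/NA_nu; exists Y|exists u].
- move=> g rg e0; have [Q [Q' [hQ eQ _]]] := eta_rat rg.
 have [y y0 yE] : exists2 y, y != 0 & Q' *m dl01 *m Q = mx2 0 y 0 0.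
  apply: (eta_borel hQ); apply: dg_inj; rewrite rmorph0 -e0 eQ.
  by rewrite [RHS]mxE.
 have [c rc] := sred_surj X y^-1.
 have c0 : red c != 0 by rewrite rc invr_eq0.
 have [b cb] := sF_unit c0.
 have hcb : dgA c * dgA b = 1 by rewrite -rmorphM cb rmorph1.
 have rt : rat (dgl (dgA c)).
  apply/ratP; exists (mx2 c 0 0 1), (mx2 b 0 0 1); split; first exact: dgl_pred.
  by rewrite map_mx_mx2 rmorph0 rmorph1.
 exists (g * (dgl (dgA c))^-1)%g, (dgl (dgA c)), c; split; last (by move=> u; exact: dgl_unip hcb); last exact: c0.
 + apply/St_eta; rewrite (pglV (dgl_pred hcb)) (etaM _ (gl2C (dgl_pred hcb))) eQ yE.
  rewrite !map_mx_mx2 ared0 ared1 !ared_dgA !rmorph0 !mul_mx2 rc e12E -rmorphM.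
  by rewrite !(mul0r, mulr0, addr0, add0r, mulr1) mulVf // rmorph1.
 + by apply: ratM; [exact: rg|exact: ratV].
 + exact: esym (mulgKV _ _).
Qed.

(** * Comparison with the function spaces of the statement *)

Section Spaces.
Variables (C : numFieldType) (K : set G).
Hypotheses (sK : is_subgroup K) (oK : open K).
Implicit Types (f : G -> C) (fb : Gb -> C).

Let sT (T : zmodType) : sgp [set: T]. by []. Qed.

Notation linv := (linv rat).
Notation Kinv := (Kinv K).
Notation cusp := (cusp (@unip A)).

Lemma nilA_mean (phi : A -> C) c : meanon setT (phi \o eps) c <-> meanon (@nilA _ _ _ X D) phi c.
apply: (@mean_morph C _ _ setT _ eps) => //.
- by move=> x y _ _; exact: raddfD.
- by move=> x _; exact: ared_eps.
- by move=> y /nilA_eps[x ->]; exists x.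
Qed.

Section Functions.
Variable f : G -> C.
Hypotheses (lf : linv f) (kf : Kinv f).

Lemma unip_principal g (l x : A) : @principal _ _ _ M l -> f (unip (l + x) * g)%g = f (unip x * g)%g.
move=> /principal_dgA[a ->]; apply: etrans (lf (unip x * g)%g (rat_unip a)).
apply: congr1; apply: (etrans _ (esym (mulgA _ _ _))).
by apply: (congr1 (fun h => h * g)%g); exact: unipD.
Qed.

Lemma unip_local g : exists2 m, fin_supp m & forall x a, Slat m a -> f (unip (x + a) * g)%g = f (unip x * g)%g.
have [m fm hm] := unip_level C sK oK g; exists m; first exact: fm.
move=> x a ha; apply: etrans (hm f kf a (unip x) ha).
by apply: congr1; apply: (congr1 (fun h => h * g)%g); exact: unipD.
Qed.

Lemma unip_congr g : exists n, fin_supp n /\ forall x y, congr0 n (y - x) -> f (unip y * g)%g = f (unip x * g)%g.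
have [m fm hm] := unip_local g; have [n fn hn] := congr0_Slat fm; exists n; split; first exact: fn.
move=> x y hy; have := hm x _ (hn _ hy); by rewrite subrKC.
Qed.

Lemma unip_test g : test_fun setT (@principal _ _ _ M) (fun u => f (unip u * g)%g).
apply/test_funP; split=> [l x pl _|x _]; first exact: unip_principal.
have [n [fn hn]] := unip_congr g; exists n; split; first exact: fn.
by move=> y _; exact: hn.
Qed.

Lemma nil_test g : test_fun (@nilA _ _ _ X D) (@nilF _ _ _ X D) (fun u => f (unip u * g)%g).
apply/test_funP; split=> [l x [_ pl] _|x _]; first exact: unip_principal.
have [n [fn hn]] := unip_congr g; exists n; split; first exact: fn.
by move=> y _; exact: hn.
Qed.

Lemma cusp_haar : (forall g, haar_int setT (@principal _ _ _ M) (fun u => f (unip u * g)%g) = 0) <-> cusp f.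
split=> [h g|h g]; last first.
 by have e := haar_A (unip_test g) (h g); exact: e.
have [c hc] := A_mean (unip_test g).
by have := haar_A (unip_test g) hc; rewrite h => ->.
Qed.

Lemma strong_haar : (forall g, haar_int (@nilA _ _ _ X D) (@nilF _ _ _ X D) (fun u => f (unip u * g)%g) = 0) <->
 forall g, meanon setT (fun b => f (nu (md o0 o1 b) * g)%g) 0.
have ext g c : meanon setT ((fun u => f (unip u * g)%g) \o eps) c <-> meanon setT (fun b => f (nu (md o0 o1 b) * g)%g) c.
 have e b : f (unip (eps b) * g)%g = f (nu (md o0 o1 b) * g)%g.
  by apply: congr1; apply: (congr1 (fun h => h * g)%g); exact: unip_eps.
 by have -> : (fun u => f (unip u * g)%g) \o eps = (fun b => f (nu (md o0 o1 b) * g)%g) by apply/funext => b; exact: e.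
split=> [h g|h g]; last exact: haar_nil (nil_test g) ((ext _ _).2 (h g)).
have [c /nilA_mean hc] := nil_mean (nil_test g).
have e0 : c = 0 := etrans (esym (haar_nil (nil_test g) hc)) (h g).
by move: hc; rewrite e0 => hc; exact: (ext g 0).1 hc.
Qed.
End Functions.

Lemma V_aV f : V K f <-> aV (@unip A) rat K f.
split=> [[[lf kf] hf]|[lf kf hf]]; last first.
 by split; [split|exact/cusp_haar].
by split; [move=> x g; exact: lf|exact: kf|exact/cusp_haar].
Qed.

Lemma V1_aV1 f : V1 K f <-> aV1 nu (@unip A) rat K f.
split=> [[/V_aV vf hf]|[vf hf]].
 by split; [exact: vf|have [lf kf _] := vf; exact/strong_haar].
by split; [exact/V_aV|have [lf kf _] := vf; exact/strong_haar].
Qed.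

Section Pullback.
Variable fb : Gb -> C.
Let f : G -> C := fb \o gred.
Hypotheses (lf : linv f) (kf : Kinv f).

Lemma fb_unip g (x : A) : fb (unip (ared x) * gred g)%g = f (unip x * g)%g.
by rewrite /f /= gredM gred_unip. Qed.

Lemma bar_test g : test_fun setT (@principal _ _ _ Mb) (fun u => fb (unip u * gred g)%g).
apply/test_funP; split=> [l x /principal_dg[e ->] _|x _].
 have [a ra] := sred_surj X e.
 have e1 := fb_unip g (dgA a + lftA x); have e2 := fb_unip g (lftA x).
 rewrite aredD ared_dgA ra lftAP in e1; rewrite lftAP in e2.
 apply: (etrans e1); apply: (etrans _ (esym e2)).
 by apply: unip_principal; [exact: lf|apply/principal_dgA; exists a].
have [m fm hm] := unip_local kf g; exists m; split; first exact: fm.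
move=> y _ /congr0_lat hy.
have [a ha ra] := ared_lift_lat fm hy.
have e1 := fb_unip g (lftA x + a); have e2 := fb_unip g (lftA x).
rewrite aredD ra lftAP subrKC in e1; rewrite lftAP in e2.
apply: (etrans e1); apply: (etrans _ (esym e2)); exact: hm.
Qed.

Lemma bar_cusp : (forall gb, haar_int setT (@principal _ _ _ Mb) (fun u => fb (unip u * gb)%g) = 0) <-> cusp f.
have ext g c : meanon setT (fun u => f (unip u * g)%g) c <-> meanon setT (fun u => fb (unip u * gred g)%g) c.
 rewrite -(ared_mean (fun u => fb (unip u * gred g)%g)).
 by have -> : (fun u => fb (unip u * gred g)%g) \o ared = (fun u => f (unip u * g)%g) by apply/funext => u; exact: fb_unip.
have bm := bar_mean (M := Mb) (C := C).
split=> [h g|h gb].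
 have [c hc] := bm _ (bar_test g); apply/ext.
 by have := haar_intE (sT _) bm (bar_test g) hc; rewrite h => ->.
have [g <-] := gred_surj gb.
exact: (haar_intE (sT _) bm (bar_test g)) ((ext _ _).1 (h g)).
Qed.
End Pullback.

(** Invariance under [nu] is invariance under the kernel of reduction, so the function descends
    along any choice of preimages. *)
Lemma Vbar_aVbar f : Vbar K f <-> aVbar nu (@unip A) rat K f.
split=> [[fb [[lfb kfb] hfb] ->]|[[lf kf cf] nf]].
 have lf : linv (fb \o gred) by move=> x g rx /=; rewrite gredM; apply: lfb; exact: rat_gred.
 have kf : Kinv (fb \o gred) by move=> g x Kx /=; rewrite gredM; apply: kfb; exists x.
 split; first by split=> //; exact/bar_cusp.
 by move=> Y g /=; rewrite gredM gred_nu mul1g.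
pose fb (gb : Gb) := f (xget 1%g [set g | gred g = gb]).
have fE : f = fb \o gred.
 apply/funext => g; rewrite /fb /=.
 have e : gred (xget 1%g [set g' | gred g' = gred g]) = gred g by exact: (@xgetI _ 1%g [set g' | gred g' = gred g] g).
 by have [Y ->] := gred_eq e; rewrite nf.
have lf' : linv (fb \o gred) by rewrite -fE.
have kf' : Kinv (fb \o gred) by rewrite -fE.
have cf' : cusp (fb \o gred) by rewrite -fE.
exists fb => //; split; last exact/bar_cusp.
split=> [_ gb /rat_bar_lift[x rx <-]|gb _ [x Kx <-]]; have [g <-] := gred_surj gb.
 by have := lf' x g rx; rewrite /= gredM.
by have := kf' g x Kx; rewrite /= gredM.
Qed.
End Spaces.

Notation St := (@St _ _ _ X D).

(** * Coordinates on differentials and conclusion *)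

Section Forms.
Variables (C : numFieldType) (Om : lmodType E) (d : E -> Om) (psi : k -> C) (alpha0 : F -> Om) (K : set G).
Hypotheses (two : 2%:R != 0 :> k) (hpsi : nontrivial_character psi) (hL : is_Linv_omega alpha0)
 (hn : exists x, red x = 0 /\ alpha0 x <> 0) (sK : is_subgroup K) (oK : open K) (kK : compact K).
Variable R : {linear Om -> functl Mb}.
Hypotheses (hW : forall alpha, weil (fval (R alpha))) (Rinj : forall alpha, R alpha = 0 -> alpha = 0)
 (hres : forall (p : place) (x : cring Mb p) alpha, residue d x alpha = fval (R alpha) (atp x)).
Variable n : place -> nat.
Hypotheses (fn : fin_supp n) (cgK : csub n `<=` K).

Notation omega := (4%:R *: alpha0 nilgen).
Notation w := (fval (R omega)).
Notation cg := (@congr_subgroup _ _ _ M n).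
Notation embG := (embG rat St).
Implicit Types f : G -> C.

Lemma two_E : 2%:R != 0 :> E. by rewrite -(rmorph_nat iota) fmorph_eq0. Qed.
Lemma omega_neq0 : omega != 0.
have [x [rx ax]] := hn; have [a xa] := red0_gen rx; have [rn _ _] := nilgenP.
have e : 4%:R = 2%:R * 2%:R :> E by rewrite -natrM.
rewrite scaler_eq0 e mulf_eq0 (negPf two_E) /=; apply/eqP => z; apply: ax.
by have [_ hZ] := hL; rewrite xa hZ // z scaler0.
Qed.

Definition coord (alpha : Om) : E := xget 0 [set e | alpha = e *: omega].
Lemma weil_omega : exists y0, w y0 != 0.
apply: contrapT => h; have := omega_neq0; rewrite (Rinj (alpha := omega)) ?eqxx //.
by apply: fctl_ext => x /=; apply/eqP; apply: contrapT => /negP xx; apply: h; exists x.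
Qed.

(** Weil differentials are multiples of a single nonzero one and [R] is injective, so [omega]
    generates the differentials. *)
Lemma coordP alpha : alpha = coord alpha *: omega.
have [y0 wy0] := weil_omega; have [e he] := weil_onedim hpsi (hW alpha) (hW omega) wy0.
have ae : alpha = e *: omega.
 apply/subr0_eq/Rinj; rewrite linearB linearZ; apply/subr0_eq; rewrite subr0; apply/eqP; rewrite subr_eq0; apply/eqP.
 by apply: fctl_ext => x; rewrite he.
exact: (@xgetI _ 0 [set e | alpha = e *: omega] e ae).
Qed.

Lemma coord_inj : injective coord.
by move=> a b e; rewrite (coordP a) (coordP b) e. Qed.

Lemma coordZ e : coord (e *: omega) = e.
have := coordP (e *: omega); move/eqP; rewrite -subr_eq0 -scalerBl scaler_eq0 (negPf omega_neq0) orbF subr_eq0.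
by move=> /eqP.
Qed.

Lemma coord_surj e : exists a, coord a = e. by exists (e *: omega); exact: coordZ. Qed.
Lemma coord_eq0 a : (coord a == 0) = (a == 0).
by rewrite -(inj_eq coord_inj) -[in coord 0](scale0r omega) coordZ. Qed.

Notation eqvar := (eqvar nu (@unip A) psi w).

Lemma St_eqvar alpha f : St_equivariant d psi alpha0 alpha f <-> eqvar (coord alpha) f.
have e1 Y u : psi_eta0 d psi alpha0 (nu Y) * psi_curve d psi (ared u) alpha =
  chi psi w 1 (Y o1 o0) * chi psi w (coord alpha) (ared u).
 by rewrite (psi_eta0_nu psi hL hW hres) {1}(coordP alpha) (psi_curve_chi psi alpha0 hW hres).
split=> [h Y u g|h m u g /NA_nu[Y ->]].
 by rewrite -e1; apply: h; apply/NA_nu; exists Y.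
by rewrite e1; exact: h.
Qed.

Lemma compact_list (s : seq G) : exists2 W : set G, compact W & forall x h, x \in s -> K h -> W (x * h)%g.
elim: s => [|x s [W cW hW']]; first by exists set0 => //; exact: compact0.
exists ([set (x * y)%g | y in K] `|` W); first by apply: compactU => //; exact: compact_coset.
by move=> y h; move=> /predU1P[-> Kh|ys Kh]; [left; exists h|right; exact: hW'].
Qed.

(** For nonzero [alpha] compactness of the support modulo the stabilizer is automatic: [supp_list]
    bounds the support of every equivariant function of the given level. Smoothness is witnessed by
    [K] itself. *)
Lemma Stilde_eqvar alpha f : alpha != 0 ->
 Stilde_inv d psi alpha0 K alpha f <-> eqvar (coord alpha) f /\ Kinv K f.
move=> a0; split=> [[[_ /St_eqvar ef _] kf]|[ef kf]]; first by [].
split=> //; split; [by exists K|exact/St_eqvar|].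
have [y0 wy0] := weil_omega; have c0 : coord alpha != 0 by rewrite coord_eq0.
have [s hs] := supp_list hpsi (hW omega) wy0 fn c0; have [W cW hW'] := compact_list s; exists W => // g fg.
have rf : rinv cg f by move=> x y cy; apply: kf; exact: cgK.
have [Y [u [x [h [xs ch ->]]]]] := hs f rf ef g fg.
exists (nu Y * unip u)%g, (x * h)%g; split=> //; last by apply: hW' => //; exact: cgK.
exact: (st_St_nu (pgl2_st n)).
Qed.

Lemma family_fam s phi : Stilde_family d psi alpha0 K s phi <-> fam nu (@unip A) psi w K coord s phi.
split=> -[us s0 hs].
 have a0 a : a \in s -> a != 0 by apply: contraTneq => ->.
 split=> // a as_; first by rewrite coord_eq0 a0.
 by apply/Stilde_eqvar; [exact: a0|exact: hs].
have a0 a : a \in s -> a != 0 by move=> /s0; rewrite coord_eq0.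
split=> //; first by apply/negP => /a0; rewrite eqxx.
by move=> a as_; apply/Stilde_eqvar; [exact: a0|exact: hs].
Qed.

Lemma Vn_aVn f : Vn d psi alpha0 K f <-> aVn nu (@unip A) rat St psi w K coord f.
by split=> -[s [phi [/family_fam hp ->]]]; exists s, phi. Qed.

Lemma supported_eqvar e : e != 0 -> supported nu (@unip A) cg psi w e.
by have [y0 wy0] := weil_omega; exact: (supp_list hpsi (hW omega) wy0 fn). Qed.

Lemma finite_eqvar : exists r : seq E, forall f e, rinv cg f -> eqvar e f -> e != 0 ->
 (exists g, f g != 0) -> e \in r.
by have [y0 wy0] := weil_omega; exact: (supp_finite hpsi (hW omega) wy0 fn). Qed.

Notation V := (V (C := C) K).
Notation Vbar := (Vbar (C := C) K).
Notation Vn := (Vn d psi alpha0 K).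
Notation V1 := (V1 (C := C) K).

Lemma direct_sum_V : direct_sum3 V Vbar Vn V1.
have [y0 wy0] := weil_omega; have ax := pgl2_axioms C wy0 fn; have st := pgl2_st n.
split=> [f|f0 f1 f2 f0' f1' f2' /(Vbar_aVbar sK oK) h0 /Vn_aVn h1 /(V1_aV1 sK oK) h2
  /(Vbar_aVbar sK oK) h0' /Vn_aVn h1' /(V1_aV1 sK oK) h2']; last first.
 exact: (sum_uniq ax hpsi (hW omega) wy0 st cgK two_E coord_inj supported_eqvar).
split=> [/(V_aV sK oK) hf|[f0 [f1 [f2 [/(Vbar_aVbar sK oK) h0 /Vn_aVn h1 /(V1_aV1 sK oK) h2 ->]]]]].
 have [f0 [f1 [f2 [h0 h1 h2 ->]]]] := decomposition ax hpsi (hW omega) wy0 st cgK two_E coord_surj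
  supported_eqvar finite_eqvar hf.
 exists f0, f1, f2; split; [exact/(Vbar_aVbar sK oK)|exact/Vn_aVn|exact/(V1_aV1 sK oK)|by []].
apply/(V_aV sK oK).
have h1V := aVn_V ax hpsi (hW omega) wy0 st cgK supported_eqvar h1.
have one (p q : G -> C) : p + q = (fun g => 1 * p g + q g) by apply/funext => g; rewrite mul1r.
rewrite one; apply: aV_lin; last exact: h2.1.
by rewrite one; apply: aV_lin; [exact: h0.1|exact: h1V].
Qed.

Lemma Vn_uniq s phi phi' :
 Stilde_family d psi alpha0 K s phi -> Stilde_family d psi alpha0 K s phi' ->
 \sum_(alpha <- s) embed (phi alpha) = \sum_(alpha <- s) embed (phi' alpha) ->
 forall alpha, alpha \in s -> phi alpha = phi' alpha.
move=> /family_fam hf /family_fam hf'.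
have [y0 wy0] := weil_omega; have ax := pgl2_axioms C wy0 fn; have st := pgl2_st n.
exact: (fam_uniq ax hpsi (hW omega) wy0 st cgK coord_inj supported_eqvar hf hf').
Qed.

Lemma hecke_preserved (h : (G -> C) -> C) : hecke K h ->
 [/\ forall f, Vbar f -> Vbar (hecke_act h f), forall f, Vn f -> Vn (hecke_act h f)
  & forall f, V1 f -> V1 (hecke_act h f)].
move=> hh; have [s hs] := hecke_act_finite sK oK hh; have hk := hecke_act_inv sK oK hh.
have [y0 wy0] := weil_omega; have ax := pgl2_axioms C wy0 fn; have st := pgl2_st n.
split=> f.
- by move=> /(Vbar_aVbar sK oK) hf; apply/(Vbar_aVbar sK oK); exact: (act_Vbar hs hk hf).
- move=> /Vn_aVn hf; apply/Vn_aVn.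
 exact: (act_Vn ax hpsi (hW omega) wy0 st cgK supported_eqvar hs hk hf).
- by move=> /(V1_aV1 sK oK) hf; apply/(V1_aV1 sK oK); exact: (act_V1 hs hk hf).
Qed.
End Forms.
End SpecialExtension.
End FunctionField.

Theorem corollary6p9 (R : realType) (k : finFieldType) (E : fieldType)
    (iota : {rmorphism k -> E}) (X : special_extension iota) (D : adelic_data X)
    (Om : lmodType E) (d : E -> Om) (psi : k -> R[i]) (alpha0 : sF X -> Om)
    (K : set (PGL2A (aM D))) :
  2%:R != 0 :> k ->
  is_function_field iota ->
  is_kaehler iota d ->
  nontrivial_character psi ->
  is_Linv_omega alpha0 ->
  (exists x, sred x = 0 /\ alpha0 x <> 0) ->
  is_subgroup K -> open K -> compact K ->
  [/\ direct_sum3 (V (C := R[i]) K) (Vbar K) (Vn d psi alpha0 K) (V1 K),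
      (forall s phi phi',
         Stilde_family d psi alpha0 K s phi -> Stilde_family d psi alpha0 K s phi' ->
         \sum_(alpha <- s) embed (phi alpha) = \sum_(alpha <- s) embed (phi' alpha) ->
         forall alpha, alpha \in s -> phi alpha = phi' alpha)
    & forall h, hecke K h ->
        [/\ forall f, Vbar K f -> Vbar K (hecke_act h f),
            forall f, Vn d psi alpha0 K f -> Vn d psi alpha0 K (hecke_act h f)
          & forall f, V1 K f -> V1 K (hecke_act h f)]].
Proof.
move=> two ff hk hpsi hL hn sK oK cK.
have [L [hW Linj hres]] := residue_functional ff (aMbar D) hk hpsi.
(* A principal congruence subgroup inside [K] fixes the one level at which all finiteness statements
   are applied. *)
have [n [fn cgK]] : exists n, fin_supp n /\ forall x, congr_subgroup n x -> K x.
  have /nbhs_pgl[n [fn hn']] : nbhs (1%g : PGL2A (aM D)) K by apply: open_nbhs_nbhs; split=> //; exact: sK.1.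
  by exists n; split=> // x /hn'; rewrite mul1g.
split.
- exact: (direct_sum_V two hpsi hL hn sK oK cK hW Linj hres fn cgK).
- exact: (Vn_uniq two hpsi hL hn sK oK cK hW Linj hres fn cgK).
- exact: (hecke_preserved two hpsi hL hn sK oK cK hW Linj hres fn cgK).
Qed.
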